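(* Let $\Gamma$ be a finite abelian group and $L=\sum_{\gamma\in\Gamma}L_\gamma$ a $\Gamma$-subgraded Lie algebra of compact operators on a complex Banach space. Suppose that for all $\gamma,\delta\in\Gamma$ with either $\gamma+\delta=0$ or $(\gamma,\delta)\in\Gamma^\sharp$, every commutator $[a,b]$ with $a\in L_\gamma$, $b\in L_\delta$ is an Engel element of $L$. Then $L$ is $E$-solvable and triangularizable.
   Context: $\Gamma^\sharp=\{(\alpha,\beta)\in\Gamma\times\Gamma:$ no cyclic subgroup of $\Gamma$ contains both $\alpha$ and $\beta\}$ (empty if $\Gamma$ is cyclic). An operator Lie algebra is a linear subspace $L\subseteq\mathcal{B}(\mathcal{X})$ closed under $[a,b]=ab-ba$, normed by the operator norm; $\operatorname{ad}a:x\mapsto[a,x]$. An element $a\in L$ is an Engel element of $L$ if $\lim_n\|(\operatorname{ad}a)^n\|^{1/n}=0$. A normed Lie algebra $L$ is $E$-solvable if for every closed ideal $I\neq L$ the quotient $L/I$ contains a nonzero closed ideal all of whose elements are Engel elements of it. A set of operators is triangularizable if there is a maximal chain of closed subspaces each invariant under all its operators. $L$ is $\Gamma$-subgraded if $L=\sum_\gamma L_\gamma$ (not necessarily direct) with $[L_\gamma,L_\delta]\subseteq L_{\gamma+\delta}$. *)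

(* Defs.v *)
From Stdlib Require Import Reals List ZArith ClassicalEpsilon.
Open Scope R_scope.
Set Implicit Arguments.

Definition C : Type := (R * R)%type.
Definition C1 : C := (1, 0).
Definition Cadd (a b : C) : C := (fst a + fst b, snd a + snd b).
Definition Cmul (a b : C) : C :=
  (fst a * fst b - snd a * snd b, fst a * snd b + snd a * fst b).
Definition Cmod (a : C) : R := sqrt (fst a ^ 2 + snd a ^ 2).

Record CBanach := {
  car :> Type;
  vadd : car -> car -> car;
  vzero : car;
  vopp : car -> car;
  vscal : C -> car -> car;
  vnorm : car -> R;
  vadd_assoc : forall x y z, vadd x (vadd y z) = vadd (vadd x y) z;
  vadd_comm : forall x y, vadd x y = vadd y x;
  vadd_0 : forall x, vadd x vzero = x;
  vadd_opp : forall x, vadd x (vopp x) = vzero;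
  vscal_1 : forall x, vscal C1 x = x;
  vscal_assoc : forall a b x, vscal a (vscal b x) = vscal (Cmul a b) x;
  vscal_distr_v : forall a x y, vscal a (vadd x y) = vadd (vscal a x) (vscal a y);
  vscal_distr_c : forall a b x, vscal (Cadd a b) x = vadd (vscal a x) (vscal b x);
  vnorm_eq0 : forall x, vnorm x = 0 -> x = vzero;
  vnorm_triangle : forall x y, vnorm (vadd x y) <= vnorm x + vnorm y;
  vnorm_scal : forall a x, vnorm (vscal a x) = Cmod a * vnorm x;
  vcomplete : forall u : nat -> car,
    (forall eps, 0 < eps -> exists N, forall m n, (N <= m)%nat -> (N <= n)%nat ->
        vnorm (vadd (u m) (vopp (u n))) < eps) ->
    exists l, forall eps, 0 < eps -> exists N, forall n, (N <= n)%nat ->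
        vnorm (vadd (u n) (vopp l)) < eps
}.

Section Ops.
Variable X : CBanach.

Definition vconv (u : nat -> X) (l : X) : Prop :=
  forall eps, 0 < eps -> exists N, forall n, (N <= n)%nat ->
    vnorm X (vadd X (u n) (vopp X l)) < eps.

Definition op : Type := X -> X.
Definition oadd (S T : op) : op := fun x => vadd X (S x) (T x).
Definition oopp (S : op) : op := fun x => vopp X (S x).
Definition oscal (c : C) (S : op) : op := fun x => vscal X c (S x).
Definition ozero : op := fun _ => vzero X.
Definition bracket (a b : op) : op := oadd (fun x => a (b x)) (oopp (fun x => b (a x))).
Definition ad (a : op) : op -> op := fun x => bracket a x.

Definition linear (T : op) : Prop :=
  (forall x y, T (vadd X x y) = vadd X (T x) (T y)) /\
  (forall c x, T (vscal X c x) = vscal X c (T x)).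
Definition bounded (T : op) : Prop :=
  exists M, forall x, vnorm X (T x) <= M * vnorm X x.
Definition compact_op (T : op) : Prop :=
  linear T /\ bounded T /\
  forall u : nat -> X, (forall n, vnorm X (u n) <= 1) ->
    exists phi : nat -> nat, (forall n, (phi n < phi (S n))%nat) /\
      exists y, vconv (fun n => T (u (phi n))) y.

Definition opnorm (T : op) : R :=
  epsilon (inhabits 0)
    (is_lub (fun r => exists x, vnorm X x <= 1 /\ r = vnorm X (T x))).

Definition is_glb (E : R -> Prop) (m : R) : Prop :=
  (forall r, E r -> m <= r) /\ (forall b, (forall r, E r -> b <= r) -> b <= m).

Definition qnorm (I : op -> Prop) (T : op) : R :=
  epsilon (inhabits 0)
    (is_glb (fun r => exists y, I y /\ r = opnorm (oadd T y))).

Definition subset (A B : op -> Prop) : Prop := forall a, A a -> B a.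

Definition op_subspace (L : op -> Prop) : Prop :=
  L ozero /\ (forall a b, L a -> L b -> L (oadd a b)) /\
  (forall c a, L a -> L (oscal c a)).

Definition opLieAlg (L : op -> Prop) : Prop :=
  op_subspace L /\ (forall a, L a -> linear a /\ bounded a) /\
  (forall a b, L a -> L b -> L (bracket a b)).

Definition ideal (L I : op -> Prop) : Prop :=
  op_subspace I /\ subset I L /\ (forall a b, L a -> I b -> I (bracket a b)).

Definition opconv (u : nat -> op) (T : op) : Prop :=
  forall eps, 0 < eps -> exists N, forall n, (N <= n)%nat ->
    opnorm (oadd (u n) (oopp T)) < eps.
Definition closed_in (L S : op -> Prop) : Prop :=
  forall (u : nat -> op) T, (forall n, S (u n)) -> L T -> opconv u T -> S T.
Definition closed_ideal (L I : op -> Prop) : Prop := ideal L I /\ closed_in L I.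

(* a is an Engel element of the normed Lie algebra whose elements are
   represented by elements of L, normed by N:
   lim_n ||(ad a)^n||^{1/n} = 0, with ||(ad a)^n|| the operator norm on it,
   written out as: for every eps > 0, eventually ||(ad a)^n|| <= eps^n. *)
Definition Engel_wrt (L : op -> Prop) (N : op -> R) (a : op) : Prop :=
  forall eps, 0 < eps -> exists n0, forall n, (n0 <= n)%nat ->
    forall x, L x -> N (Nat.iter n (ad a) x) <= eps ^ n * N x.

Definition Engel (L : op -> Prop) (a : op) : Prop := L a /\ Engel_wrt L opnorm a.

(* E-solvable: closed ideals of L/I = closed ideals J of L containing I;
   J nonzero in L/I means J strictly contains I. *)
Definition E_solvable (L : op -> Prop) : Prop :=
  forall I, closed_ideal L I -> (exists a, L a /\ ~ I a) ->
    exists J, closed_ideal L J /\ subset I J /\ (exists a, J a /\ ~ I a) /\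
      forall a, J a -> Engel_wrt L (qnorm I) a.

Definition closed_vsubspace (S : X -> Prop) : Prop :=
  S (vzero X) /\ (forall x y, S x -> S y -> S (vadd X x y)) /\
  (forall c x, S x -> S (vscal X c x)) /\
  (forall u l, (forall n, S (u n)) -> vconv u l -> S l).

Definition chain (Ch : (X -> Prop) -> Prop) : Prop :=
  (forall S, Ch S -> closed_vsubspace S) /\
  (forall S1 S2, Ch S1 -> Ch S2 ->
     (forall x, S1 x -> S2 x) \/ (forall x, S2 x -> S1 x)).

Definition maximal_chain (Ch : (X -> Prop) -> Prop) : Prop :=
  chain Ch /\ forall Ch', chain Ch' -> (forall S, Ch S -> Ch' S) ->
    forall S, Ch' S -> Ch S.

Definition triangularizable (L : op -> Prop) : Prop :=
  exists Ch, maximal_chain Ch /\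
    forall S, Ch S -> forall a, L a -> forall x, S x -> S (a x).

End Ops.

Record FinAbGroup := {
  gcar :> Type;
  gadd : gcar -> gcar -> gcar;
  g0 : gcar;
  gopp : gcar -> gcar;
  gadd_assoc : forall x y z, gadd x (gadd y z) = gadd (gadd x y) z;
  gadd_comm : forall x y, gadd x y = gadd y x;
  gadd_0 : forall x, gadd x g0 = x;
  gadd_opp : forall x, gadd x (gopp x) = g0;
  genum : list gcar;
  genum_complete : forall x, In x genum;
  genum_nodup : NoDup genum
}.

Definition gnmul (G : FinAbGroup) (n : nat) (g : G) : G :=
  Nat.iter n (gadd G g) (g0 G).
Definition gzmul (G : FinAbGroup) (z : Z) (g : G) : G :=
  match z with
  | Z0 => g0 G
  | Zpos p => gnmul G (Pos.to_nat p) g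
  | Zneg p => gopp G (gnmul G (Pos.to_nat p) g)
  end.

Definition Gsharp (G : FinAbGroup) (a b : G) : Prop :=
  ~ exists g : G, exists m n : Z, a = gzmul G m g /\ b = gzmul G n g.

Definition osum (X : CBanach) (G : FinAbGroup) (f : G -> op X) : op X :=
  fold_right (fun g acc => oadd (f g) acc) (ozero X) (genum G).

Definition subgraded (X : CBanach) (G : FinAbGroup)
    (L : op X -> Prop) (Lg : G -> op X -> Prop) : Prop :=
  (forall g, op_subspace (Lg g) /\ subset (Lg g) L) /\
  (forall a, L a -> exists f : G -> op X, (forall g, Lg g (f g)) /\ a = @osum X G f) /\
  (forall g d a b, Lg g a -> Lg d b -> Lg (gadd G g d) (bracket a b)).

(* Main.v *)
(** On the gaps of a maximal chain of closed [L]-invariant subspaces [L] acts irreducibly. If this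
action is commutative, then the gaps are one-dimensional, so that the chain is a maximal chain of
closed subspaces; moreover commutators vanish on every gap, whence long words in them are small,
and modulo a closed ideal [I] the closure of [I + [L, L]] consists of Engel elements.

So let [L] be irreducible. In finite dimension, let [w] be homogeneous with [(ad w)^3 = 0] and
[(ad w)^2 L] of minimal dimension; if this is not zero, [u = (ad w)^2 b] lies in [(ad u)^2 L], say
[u = (ad u)^2 f], and the Engel element [[u, f]] has [u] as an eigenvector, a contradiction. Hence
homogeneous [ad]-nilpotent elements are central, and the hypothesis makes [L] commutative.

In infinite dimension, if all elements are quasinilpotent, Shulman and Turovskii's theorem applies.
Otherwise [ad a] is not quasinilpotent for some [a]. Replacing [sum a_g] by convolution with
[g |-> a_g] on [X^G] makes the sum of the [L_g] direct, and the spectral projections of [ad a] yield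
a nonzero finite-rank operator in the closure of some [L_g]. Products of commutators of finite-rank
elements are quasinilpotent by the finite-dimensional case, applied on gaps. A Lie algebra cannot
normalize such a semigroup irreducibly; hence the finite-rank elements are central, and [X] is
finite-dimensional. *)

(* The hypothesis speaks only of pairs of degrees that are opposite or lie in no common cyclic
   subgroup. A cyclic pair e, h is reached through integers i > 0 and j with e + i(h + je) = 0: for
   v, y of degrees e, h and z = (ad v)^j y, the element (ad z)^(i-1) v has the degree opposite to z,
   and commutation is pulled back one bracket at a time by Kleinecke's theorem. The Engel condition
   is used vector by vector, as (ad c)^m x = O(r^m) for every r > 0; in this form it passes to gaps.
   A sum of the L_g need not determine its summands, nor bound them. On X^G each component of a
   convolution operator is bounded by the whole, so a closed graded Lie algebra is available there,
   and a finite-rank element of it has finite-rank homogeneous components. The semigroup of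
   commutators is excluded by an element of minimal rank, followed along an analytic path in the
   group generated by exp L. Riesz projections and Cauchy estimates are obtained from averages over
   2^k-th roots of unity, and compactness arguments from total boundedness. *)
From Stdlib Require Import Reals Lra Lia Psatz.
From Stdlib Require ClassicalEpsilon.
Ltac rring := ring.
Ltac rfield := field.
From HB Require Import structures.
From mathcomp Require Import all_boot all_algebra.
From mathcomp Require Import boolp.
From mathcomp Require classical_sets.
From mathcomp Require Import ring zify.
Ltac cring := ring.
Require Import Defs.
Set Implicit Arguments.
Unset Strict Implicit.
Unset Printing Implicit Defensive.
Import GRing.Theory.
Delimit Scope ring_scope with V.
Delimit Scope nat_scope with N.
Local Open Scope R_scope.
Tactic Notation "via" uconstr(t) := refine (Rle_trans _ _ _ t _).
Tactic Notation "mid" uconstr(e) := refine (Rle_trans _ e _ _ _).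

(** * The scalar field *)

HB.instance Definition _ := gen_eqMixin C.
HB.instance Definition _ := gen_choiceMixin C.

Definition Copp (a : C) : C := (- fst a, - snd a).
Definition Cinv (a : C) : C :=
  (fst a / (fst a ^ 2 + snd a ^ 2), - snd a / (fst a ^ 2 + snd a ^ 2)).

Lemma CaddA : associative Cadd.
Proof. by move=> x y z; rewrite /Cadd /=; congr pair; lra. Qed.
Lemma CaddC : commutative Cadd.
Proof. by move=> x y; congr pair; lra. Qed.
Lemma Cadd0 : left_id (0, 0) Cadd.
Proof. by move=> [a b]; rewrite /Cadd /=; congr pair; lra. Qed.
Lemma CaddN : left_inverse (0, 0) Copp Cadd.
Proof. by move=> x; rewrite /Cadd /=; congr pair; lra. Qed.
HB.instance Definition _ := GRing.isZmodule.Build C CaddA CaddC Cadd0 CaddN.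

Lemma CmulA : associative Cmul.
Proof. by move=> x y z; rewrite /Cmul /=; congr pair; lra. Qed.
Lemma CmulC : commutative Cmul.
Proof. by move=> x y; congr pair; lra. Qed.
Lemma Cmul1 : left_id C1 Cmul.
Proof. by move=> [a b]; rewrite /Cmul /=; congr pair; lra. Qed.
Lemma CmulDl : left_distributive Cmul Cadd.
Proof. by move=> x y z; rewrite /Cmul /Cadd /=; congr pair; lra. Qed.
Lemma C1n0 : C1 != 0%V :> C.
Proof. by apply/eqP => -[]; lra. Qed.
HB.instance Definition _ :=
  GRing.Zmodule_isComNzRing.Build C CmulA CmulC Cmul1 CmulDl C1n0.

Lemma Csq_neq0 (x : C) : x <> 0%V :> C -> fst x ^ 2 + snd x ^ 2 <> 0.
Proof.
case: x => a b h /= e; apply: h.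
have -> : a = 0 by nra.
by have -> : b = 0 by nra.
Qed.
Lemma CmulV (x : C) : x != 0%V -> Cmul (Cinv x) x = C1.
Proof.
move/eqP/Csq_neq0; case: x => a b /= h; rewrite /Cmul /=.
by congr pair; rfield; nra.
Qed.
Lemma CinvV0 : Cinv 0%V = 0%V.
Proof. by rewrite /Cinv /=; congr pair; lra. Qed.
HB.instance Definition _ := GRing.ComNzRing_isField.Build C CmulV CinvV0.

Section Mod.
Variable X : CBanach.
HB.instance Definition _ := gen_eqMixin X.
HB.instance Definition _ := gen_choiceMixin X.
Lemma vadd0l : left_id (vzero X) (@vadd X).
Proof. by move=> x; rewrite vadd_comm vadd_0. Qed.
Lemma vaddNl : left_inverse (vzero X) (@vopp X) (@vadd X).
Proof. by move=> x; rewrite vadd_comm vadd_opp. Qed.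
HB.instance Definition _ :=
  GRing.isZmodule.Build X (@vadd_assoc X) (@vadd_comm X) vadd0l vaddNl.
Lemma vscalA (a b : C) (x : X) : vscal X a (vscal X b x) = vscal X (a * b)%V x.
Proof. exact: vscal_assoc. Qed.
Lemma vscalDr : right_distributive (@vscal X) +%R.
Proof. by exact: vscal_distr_v. Qed.
Lemma vscalDl (v : X) : {morph (@vscal X)^~ v : a b / (a + b)%V}.
Proof. by move=> a b; exact: vscal_distr_c. Qed.
HB.instance Definition _ :=
  GRing.Zmodule_isLmodule.Build C X vscalA (@vscal_1 X) vscalDr vscalDl.
End Mod.

Definition nrm (X : CBanach) (x : X) : R := vnorm X x.
Arguments nrm {X} x%_V : simpl never.

(** * Deciding identities between linear combinations of vectors *)

Inductive vexp := V0 | Vv of nat | Va of vexp & vexp | Vo of vexp | Vs of C & vexp.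
Section Vec.
Variable X : lmodType C.
Fixpoint veval (env : seq X) e : X :=
  match e with
  | V0 => 0 | Vv n => nth 0 env n | Va a b => veval env a + veval env b
  | Vo a => - veval env a | Vs c a => c *: veval env a
  end%V.
Fixpoint vcoef (k : nat) e : C :=
  match e with
  | V0 => 0 | Vv n => if Nat.eqb n k then 1 else 0 | Va a b => vcoef k a + vcoef k b
  | Vo a => - vcoef k a | Vs c a => c * vcoef k a
  end%V.
Fixpoint vbnd (n : nat) e : bool :=
  match e with
  | V0 => true | Vv m => Nat.ltb m n | Va a b => vbnd n a && vbnd n b
  | Vo a => vbnd n a | Vs _ a => vbnd n a
  end.
Lemma vevalE env e : vbnd (size env) e ->
  veval env e = (\sum_(k < size env) vcoef k e *: nth 0 env k)%V.
Proof.
elim: e => [|n|a IHa b IHb|a IHa|c a IHa] /=.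
by rewrite big1 // => i; rewrite scale0r.
case: (PeanoNat.Nat.ltb_spec n (size env)) => // /ltP h.
  rewrite (bigD1 (Ordinal h)) //= PeanoNat.Nat.eqb_refl scale1r big1 ?addr0 // => i.
  case: (PeanoNat.Nat.eqb_spec n i) => e; last by rewrite scale0r.
  by move/eqP => []; apply: val_inj.
case/andP=> /IHa -> /IHb ->; rewrite -big_split; apply: eq_bigr => i.
  by rewrite scalerDl.
move/IHa ->; rewrite -sumrN; apply: eq_bigr => i; by rewrite scaleNr.
move/IHa ->; rewrite scaler_sumr; apply: eq_bigr => i; by rewrite scalerA.
Qed.
(** A recursive conjunction instead of a bounded quantifier, so that [cbn] leaves exactly one scalar
    identity for each atom. *)
Fixpoint vall (n : nat) (a b : vexp) : Prop :=
  if n is m.+1 then vcoef m a = vcoef m b /\ vall m a b else True.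
Lemma vallP n a b : vall n a b -> forall k, (k < n)%N -> vcoef k a = vcoef k b.
Proof.
elim: n => // n IH [e h] k; rewrite ltnS leq_eqVlt => /orP [/eqP -> //|]; exact: IH.
Qed.
Lemma vec_ok env a b : vbnd (size env) a && vbnd (size env) b ->
  vall (size env) a b -> veval env a = veval env b.
Proof.
case/andP => ha hb /vallP h; rewrite !vevalE //; apply: eq_bigr => i.
by rewrite h.
Qed.
End Vec.
(* Rewriting with the generic lemmas of [ssralg] leaves convertible but distinct
   paths to the algebraic structures; the tactics below need them to be syntactically equal. *)
Ltac vc t :=
  lazymatch t with
  | @Algebra.add _ ?a ?b => let a' := vc a in let b' := vc b in constr:((a' + b')%V)
  | @Algebra.opp _ ?a => let a' := vc a in constr:((- a')%V)
  | @Algebra.zero _ => let T := type of t in let T := eval cbn in T in constr:((0%V : T))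
  | @GRing.scale _ _ ?a ?b => let a' := vc a in let b' := vc b in constr:((a' *: b')%V)
  | @GRing.mul _ ?a ?b => let a' := vc a in let b' := vc b in constr:((a' * b')%V)
  | @GRing.exp _ ?a ?n => let a' := vc a in constr:((a' ^+ n)%V)
  | @GRing.natmul _ ?a ?n => let a' := vc a in constr:((a' *+ n)%V)
  | @GRing.one _ => let T := type of t in let T := eval cbn in T in constr:((1%V : T))
  | _ => t
  end.
Ltac vfind x env :=
  lazymatch env with
  | x :: _ => constr:(0%N)
  | _ :: ?e => let n := vfind x e in constr:(S n)
  end.
Ltac vmem x env :=
  lazymatch env with nil => false | x :: _ => true | _ :: ?e => vmem x e end.
Ltac vatoms t env :=
  lazymatch t with
  | @Algebra.add _ ?a ?b => let e := vatoms a env in vatoms b e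
  | @Algebra.opp _ ?a => vatoms a env
  | @Algebra.zero _ => env
  | @GRing.scale _ _ ?c ?a => vatoms a env
  | _ => let b := vmem t env in lazymatch b with true => env | false => constr:(t :: env) end
  end.
Ltac vreify t env :=
  lazymatch t with
  | @Algebra.add _ ?a ?b =>
    let a' := vreify a env in let b' := vreify b env in constr:(Va a' b')
  | @Algebra.opp _ ?a => let a' := vreify a env in constr:(Vo a')
  | @Algebra.zero _ => constr:(V0)
  | @GRing.scale _ _ ?c ?a => let a' := vreify a env in constr:(Vs c a')
  | _ => let n := vfind t env in constr:(Vv n)
  end.
Ltac vecx X :=
  lazymatch goal with
  | |- ?a = ?b =>
    let env0 := constr:(@nil X) in
    let a := vc a in let b := vc b in
    let env1 := vatoms a env0 in let env := vatoms b env1 in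
    let a' := vreify a env in let b' := vreify b env in
    change (@veval X env a' = @veval X env b');
    apply: vec_ok; [reflexivity | cbn [vall vcoef size Nat.eqb]; repeat split; try cring; try reflexivity]
  end.
Ltac vec :=
  intros; lazymatch goal with
  | |- @eq ?T ?a ?b => let X := constr:([the lmodType C of T]) in vecx X
  end.
Ltac bvec := rewrite ?(mulrDl, mulrDr, mulrBl, mulrBr, mulrN, mulNr, mulrA, mul1r, mulr1, mul0r, mulr0, opprD, opprB, opprK); vec.
(** * Norms and limits *)

Definition rc (r : R) : C := (r, 0).
Lemma rcD r s : rc (r + s) = (rc r + rc s)%V.
Proof. congr pair; rewrite /=; lra. Qed.
Lemma rcM r s : rc (r * s) = (rc r * rc s)%V.
Proof. congr pair; rewrite /=; lra. Qed.
Lemma rcN r : rc (- r) = (- rc r)%V.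
Proof. congr pair; rewrite /=; lra. Qed.
Lemma rc1 : rc 1 = 1%V. Proof. by []. Qed.
Lemma rcV r : r <> 0 -> rc (/ r) = (rc r)^-1%V.
Proof.
move=> r0; have n0 : rc r != 0%V by apply/eqP => -[].
by apply: (mulfI n0); rewrite -rcM divff // Rinv_r.
Qed.
Lemma rc_nat n : rc (INR n) = (n%:R)%V.
Proof. by elim: n => // n IH; rewrite S_INR rcD IH mulrS addrC. Qed.
Lemma rcX r n : rc (r ^ n) = (rc r ^+ n)%V.
Proof. by elim: n => // n IH; rewrite exprS -IH -rcM. Qed.

Lemma CmodE (a : C) : Cmod a * Cmod a = fst a ^ 2 + snd a ^ 2.
Proof. by rewrite sqrt_sqrt; nra. Qed.
Lemma Cmod_ge0 a : 0 <= Cmod a. Proof. exact: sqrt_pos. Qed.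
Lemma Cmod_rc r : 0 <= r -> Cmod (rc r) = r.
Proof.
have := CmodE (rc r); have := Cmod_ge0 (rc r); rewrite /=; nra.
Qed.
Lemma CmodM (a b : C) : Cmod (a * b)%V = Cmod a * Cmod b.
Proof.
have := CmodE a; have := CmodE b; have := CmodE (a * b)%V.
have := Cmod_ge0 a; have := Cmod_ge0 b; have := Cmod_ge0 (a * b)%V.
case: a => a1 a2; case: b => b1 b2 /=.
set x := Cmod _; set y := Cmod _; set z := Cmod _ => hx hy hz ex ey ez.
have e : x * x = (z * y) * (z * y).
  nra.
have : (x - z * y) * (x + z * y) = 0 by lra.
case/Rmult_integral; first lra.
by nra.
Qed.
Lemma Cmod0 : Cmod 0%V = 0. Proof. by rewrite Cmod_rc; lra. Qed.
Lemma Cmod1 : Cmod 1%V = 1. Proof. by rewrite Cmod_rc; lra. Qed.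
Lemma Cmod_eq0 (a : C) : Cmod a = 0 -> a = 0%V.
Proof.
move=> h; have := CmodE a; rewrite h; case: a {h} => x y /= h.
by congr pair; nra.
Qed.
Lemma Csqrt (z : C) : exists w : C, (w * w = z)%V.
Proof.
case: z => a b; have := CmodE (a, b); have := Cmod_ge0 (a, b); set r := Cmod _; rewrite /= => r0 er.
have h1 : 0 <= (r + a) / 2 by nra.
have h2 : 0 <= (r - a) / 2 by nra.
have := sqrt_sqrt _ h1; have := sqrt_sqrt _ h2; move: (sqrt _) (sqrt _) => u v u2 v2.
have /Rmult_integral [h|h] : (u * v - b / 2) * (u * v + b / 2) = 0.
- by rewrite (_ : _ * _ = u * u * (v * v) - b / 2 * (b / 2)); [nra|rring].
- by exists (u, v); congr pair; rewrite /=; lra.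
by exists (u, - v); congr pair; rewrite /=; lra.
Qed.
Lemma Cmod_gt0 (a : C) : a <> 0%V -> 0 < Cmod a.
Proof.
move=> a0; case: (Cmod_ge0 a) => // h; by case: a0; apply: Cmod_eq0.
Qed.
Lemma CmodN (a : C) : Cmod (- a)%V = Cmod a.
Proof. by rewrite /Cmod /=; congr sqrt; nra. Qed.
Lemma CmodX (a : C) n : Cmod (a ^+ n)%V = Cmod a ^ n.
Proof. by elim: n => [|n IH]; rewrite ?Cmod1 // exprS CmodM IH. Qed.
Lemma CmodV (a : C) : a <> 0%V -> Cmod (a^-1)%V = / Cmod a.
Proof.
move=> a0; have h := Cmod_gt0 a0.
apply: (Rmult_eq_reg_l (Cmod a)); last lra.
by rewrite -CmodM divff ?Cmod1; [rewrite Rinv_r; lra|apply/eqP].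
Qed.

Ltac vstep :=
  match goal with
  | H : context [@nrm ?X ?x] |- _ =>
    let x' := vc x in tryif constr_eq x x' then fail else change (@nrm X x) with (@nrm X x') in H
  | |- context [@nrm ?X ?x] =>
    let x' := vc x in tryif constr_eq x x' then fail else change (@nrm X x) with (@nrm X x')
  | H : context [Cmod ?x] |- _ =>
    let x' := vc x in tryif constr_eq x x' then fail else change (Cmod x) with (Cmod x') in H
  | |- context [Cmod ?x] =>
    let x' := vc x in tryif constr_eq x x' then fail else change (Cmod x) with (Cmod x')
  end.
Ltac vlra := intros; repeat vstep; Lra.lra.

Section Norm.
Variable X : CBanach.
Implicit Types x y z : X.

Lemma nrmZ a x : nrm (a *: x) = Cmod a * nrm x.
Proof. exact: vnorm_scal. Qed.
Lemma nrm0 : nrm (0 : X) = 0.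
Proof. by rewrite -(scale0r (0%V : X)) nrmZ Cmod0; nra. Qed.
Lemma nrmD x y : nrm (x + y) <= nrm x + nrm y.
Proof. exact: vnorm_triangle. Qed.
Lemma nrmN x : nrm (- x) = nrm x.
Proof. by rewrite -scaleN1r nrmZ CmodN Cmod1; nra. Qed.
Lemma nrm_ge0 x : 0 <= nrm x.
Proof. have := nrmD x (- x)%V; rewrite addrN nrm0 nrmN; lra. Qed.
Lemma nrm_eq0 x : nrm x = 0 -> x = 0%V.
Proof. exact: vnorm_eq0. Qed.
Lemma nrm_gt0 x : x <> 0%V -> 0 < nrm x.
Proof. by move=> x0; case: (nrm_ge0 x) => // h; case: x0; apply: nrm_eq0. Qed.
Lemma nrmB x y : nrm (x - y) <= nrm x + nrm y.
Proof. by have := nrmD x (- y)%V; rewrite nrmN. Qed.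
Lemma nrmC x y : nrm (x - y) = nrm (y - x).
Proof. by rewrite -opprB nrmN. Qed.
Lemma nrm_tri x y z : nrm (x - z) <= nrm (x - y) + nrm (y - z).
Proof. by have := nrmD (x - y)%V (y - z)%V; rewrite addrA subrK. Qed.
Lemma nrm_le x y : nrm x <= nrm y + nrm (x - y).
Proof. by have := nrmD y (x - y)%V; rewrite addrC subrK. Qed.
Lemma nrm_small x : (forall e, 0 < e -> nrm x <= e) -> x = 0%V.
Proof.
move=> h; apply: nrm_eq0; have := nrm_ge0 x.
have := h (nrm x / 2); nra.
Qed.

Definition cvg (u : nat -> X) (l : X) : Prop :=
  forall e, 0 < e -> exists N, forall n, (N <= n)%N -> nrm (u n - l) < e.

Lemma cvgE u l : cvg u l <-> vconv X u l.
Proof.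
by split=> h e /h [N hN]; exists N => n hn; apply: hN; apply/leP.
Qed.
Lemma cvg_cst l : cvg (fun=> l) l.
Proof. by exists 0%N; rewrite subrr nrm0. Qed.
Lemma cvgD u v l m : cvg u l -> cvg v m -> cvg (fun n => (u n + v n)%V) (l + m)%V.
Proof.
move=> hu hv e e0; have e2 : 0 < e / 2 by lra.
have [N1 h1] := hu _ e2; have [N2 h2] := hv _ e2.
exists (maxn N1 N2) => n; rewrite geq_max => /andP [n1 n2].
have := h1 n n1; have := h2 n n2; have := nrmD (u n - l)%V (v n - m)%V.
by rewrite addrACA -opprD; vlra.
Qed.
Lemma cvgN u l : cvg u l -> cvg (fun n => (- u n)%V) (- l)%V.
Proof.
by move=> hu e e0; have [N h] := hu e e0; exists N => n /h; rewrite -opprD nrmN.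
Qed.
Lemma cvgB u v l m : cvg u l -> cvg v m -> cvg (fun n => (u n - v n)%V) (l - m)%V.
Proof. by move=> hu hv; apply: cvgD => //; apply: cvgN. Qed.
Lemma cvg_lip (Y : CBanach) (f : X -> Y) M u l :
  (forall x y, nrm (f x - f y) <= M * nrm (x - y)) -> cvg u l ->
  forall e, 0 < e -> exists N, forall n, (N <= n)%N -> nrm (f (u n) - f l) < e.
Proof.
move=> hf hu e e0; have M0 : 0 < Rabs M + 1 by have := Rabs_pos M; lra.
have h0 : 0 < e / (Rabs M + 1) by apply: Rdiv_lt_0_compat.
have [N h] := hu _ h0; exists N => n /h {}h.
apply: Rle_lt_trans (hf _ _) _.
apply: (Rle_lt_trans _ ((Rabs M + 1) * nrm (u n - l)%V)).
  apply: Rmult_le_compat_r; first exact: nrm_ge0.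
  by have := Rle_abs M; nra.
have -> : e = (Rabs M + 1) * (e / (Rabs M + 1)) by rfield; nra.
exact: Rmult_lt_compat_l.
Qed.
Lemma cvgZ a u l : cvg u l -> cvg (fun n => (a *: u n)%V) (a *: l)%V.
Proof.
apply: (@cvg_lip X (fun x => (a *: x)%V) (Cmod a)) => x y.
by rewrite -scalerBr nrmZ; apply: Rle_refl.
Qed.
Lemma cvg_le u l M : cvg u l -> (exists N, forall n, (N <= n)%N -> nrm (u n) <= M) ->
  nrm l <= M.
Proof.
move=> hu [N1 h1]; apply: Rnot_lt_le => hM.
have [N h] := hu (nrm l - M) ltac:(lra).
have := h (maxn N N1) (leq_maxl _ _); have := h1 (maxn N N1) (leq_maxr _ _).
by have := nrm_le l (u (maxn N N1)); rewrite nrmC; nra.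
Qed.
Lemma cvg_uniq u l m : cvg u l -> cvg u m -> l = m.
Proof.
move=> h1 h2; apply: subr0_eq.
have h := cvgB h1 h2; apply: nrm_small => e e0.
by apply: cvg_le h _; exists 0%N => n; rewrite subrr nrm0; lra.
Qed.
Lemma cvg_eq u v l : u =1 v -> cvg u l -> cvg v l.
Proof. by move=> /funext ->. Qed.
Lemma cvg_dom u l (r : nat -> R) : (forall n, nrm (u n - l) <= r n) ->
  (forall e, 0 < e -> exists N, forall n, (N <= n)%N -> r n < e) -> cvg u l.
Proof.
move=> h hr e /hr [N hN]; exists N => n /hN; have := h n; vlra.
Qed.

Definition cauchy (u : nat -> X) : Prop :=
  forall e, 0 < e -> exists N, forall m n, (N <= m)%N -> (N <= n)%N ->
    nrm (u m - u n) < e.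
Lemma cauchy_cvg u : cauchy u -> exists l, cvg u l.
Proof.
move=> h; have [e e0|l hl] := @vcomplete X u.
  by have [N hN] := h e e0; exists N => m n /leP hm /leP; apply: hN.
by exists l; apply/cvgE.
Qed.
Lemma cvg_cauchy u l : cvg u l -> cauchy u.
Proof.
move=> h e e0; have [N hN] := h (e / 2) ltac:(nra); exists N => m n /hN h1 /hN.
by have := nrm_tri (u m) l (u n); have := nrmC l (u n); nra.
Qed.
End Norm.
#[global] Hint Resolve Rle_refl : core.

Ltac pos1 :=
  lazymatch goal with
  | |- 0 <= nrm _ => exact: nrm_ge0
  | |- 0 <= Cmod _ => exact: Cmod_ge0
  | |- 0 <= Rabs _ => exact: Rabs_pos
  | |- 0 <= INR _ => exact: pos_INR
  | |- 0 < exp _ => exact: exp_pos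
  | |- 0 < _ ^ _ => first [assumption | apply: pow_lt; pos1]
  | |- 0 <= _ ^ _ => first [assumption | apply: pow_le; pos1]
  | |- 0 < / _ => first [assumption | apply: Rinv_0_lt_compat; pos1]
  | |- 0 < _ * _ => first [assumption | apply: Rmult_lt_0_compat; pos1 | nra]
  | |- 0 < _ / _ => first [assumption | apply: Rmult_lt_0_compat; pos1]
  | |- 0 <= _ * _ => first [assumption | apply: Rmult_le_pos; pos1 | nra]
  | |- 0 <= _ / _ => first [assumption | apply: Rmult_le_pos; pos1]
  | |- 0 < _ + _ => first [lra | apply: Rplus_lt_0_compat; pos1 | apply: Rplus_lt_le_0_compat; pos1 | nra]
  | |- 0 <= _ + _ => first [lra | apply: Rplus_le_le_0_compat; pos1 | nra]
  | |- 0 <= / _ => left; pos1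
  | |- 0 <= exp _ => left; pos1
  | |- _ => first [assumption | lra | nra | done]
  end.
Ltac pos := solve [intros; pos1].
Ltac mono1 :=
  first [assumption | lra |
  lazymatch goal with
  | |- ?a * _ <= ?a * _ => apply: Rmult_le_compat_l; [pos|mono1]
  | |- _ * ?a <= _ * ?a => apply: Rmult_le_compat_r; [pos|mono1]
  | |- _ * _ <= _ * _ => apply: Rmult_le_compat; [pos|pos|mono1|mono1]
  | |- _ ^ ?n <= _ ^ ?n => apply: pow_incr; split; [pos|mono1]
  | |- _ + _ <= _ + _ => apply: Rplus_le_compat; mono1
  end | by auto | by left; auto].
Ltac mono := solve [intros; mono1].

Fixpoint rsum (f : nat -> R) n : R := if n is m.+1 then rsum f m + f m else 0.
Lemma rsum_le f g n : (forall i, (i < n)%N -> f i <= g i) -> rsum f n <= rsum g n.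
Proof.
elim: n => /=; first nra.
mono.
Qed.
Lemma rsum_ge0 f n : (forall i, 0 <= f i) -> 0 <= rsum f n.
Proof. by move=> h; elim: n => /=; pos. Qed.
Lemma rsum_mono f m n : (forall i, 0 <= f i) -> (m <= n)%N -> rsum f m <= rsum f n.
Proof.
move=> h /subnKC <-; elim: (n - m)%N => [|k IH]; first by rewrite addn0.
by rewrite addnS /=; have := h (m + k)%N; nra.
Qed.
Lemma rsumZ c f n : rsum (fun i => c * f i) n = c * rsum f n.
Proof. by elim: n => [|n IH] /=; lra. Qed.
Lemma rsum_cst c n : rsum (fun=> c) n = INR n * c.
Proof. by elim: n => [|n IH]; [rewrite /=; nra|rewrite S_INR [LHS]/=; lra]. Qed.
Lemma rsumD f g n : rsum (fun i => f i + g i) n = rsum f n + rsum g n.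
Proof. by elim: n => [|n IH] /=; lra. Qed.
Lemma rsum_cut f p n : (p <= n)%N ->
  rsum (fun i => if (i < p)%N then 0 else f i) n = rsum f n - rsum f p.
Proof.
move=> /subnKC <-; elim: (n - p)%N => [|k IH]; last first.
  by rewrite addnS /= ltnNge leq_addr /=; lra.
have h q : (q <= p)%N -> rsum (fun i => if (i < p)%N then 0 else f i) q = 0.
  by elim: q => // q IH hq /=; rewrite IH ?hq ?(ltnW hq) //; lra.
by rewrite addn0 h //; lra.
Qed.
Lemma nrm_sum (X : CBanach) (u : nat -> X) n :
  nrm (\sum_(i < n) u i) <= rsum (fun i => nrm (u i)) n.
Proof.
elim: n => [|n IH]; first by rewrite big_ord0 nrm0.
rewrite big_ord_recr; via (nrmD _ _).
exact: Rplus_le_compat_r.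
Qed.
(** * The Banach algebra of bounded operators *)

Record BL (X : CBanach) := BLmk { bf :> X -> X; bfP : linear bf /\ bounded bf }.
Lemma BLext (X : CBanach) (S T : BL X) : (forall x, S x = T x) -> S = T.
Proof.
case: S => f hf; case: T => g hg /= /funext e; subst.
by congr BLmk.
Qed.

Section BL.
Variable X : CBanach.
Implicit Types S T : BL X.

Lemma blD T x y : T (x + y)%V = (T x + T y)%V.
Proof. by have [[h _] _] := bfP T; apply: h. Qed.
Lemma blZ T a x : T (a *: x)%V = (a *: T x)%V.
Proof. by have [[_ h] _] := bfP T; apply: h. Qed.
Lemma bl0 T : T 0%V = 0%V.
Proof. by have := blZ T 0%V 0%V; rewrite !scale0r. Qed.
Lemma blN T x : T (- x)%V = (- T x)%V.
Proof. by have := blZ T (-1)%V x; rewrite !scaleN1r. Qed.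
Lemma blB T x y : T (x - y)%V = (T x - T y)%V.
Proof. by rewrite blD blN. Qed.
Lemma bl_sum T I (r : seq I) (P : pred I) (F : I -> X) :
  T (\sum_(i <- r | P i) F i)%V = (\sum_(i <- r | P i) T (F i))%V.
Proof. by elim/big_rec2: _ => [|i y1 y2 _ <-]; [exact: bl0|rewrite blD]. Qed.

Lemma opnorm_lub (T : op X) : linear T -> bounded T ->
  is_lub (fun r => exists x, vnorm X x <= 1 /\ r = vnorm X (T x)) (opnorm T).
Proof.
move=> hl [M hM]; apply: ClassicalEpsilon.epsilon_spec.
have [||m hm] := completeness (fun r => exists x, vnorm X x <= 1 /\ r = vnorm X (T x)).
exists (Rabs M) => r [x [x1 ->]]; via (hM x).
  have := nrm_ge0 => x0.
  mid (Rabs M * vnorm X x).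
    by apply: Rmult_le_compat_r => //; apply: Rle_abs.
  by have := Rabs_pos M; nra.
exists (vnorm X (T (vzero X))), (vzero X).
  by have := nrm0; rewrite /nrm => ->; lra.
by exists m.
Qed.
Lemma opnorm_ge0 (T : op X) : linear T -> bounded T -> 0 <= opnorm T.
Proof.
move=> hl hb; have [h _] := opnorm_lub hl hb.
mid (vnorm X (T (vzero X))); first exact: nrm_ge0.
apply: h; exists (vzero X).
by have := nrm0; rewrite /nrm => ->; lra.
Qed.
Lemma opnorm_le (T : op X) x : linear T -> bounded T ->
  nrm (T x) <= opnorm T * nrm x.
Proof.
move=> hl hb; have [h _] := opnorm_lub hl hb.
have [x0|x0] := EM (x = 0%V).
  have -> : T x = 0%V.
    by case: hl => _ /(_ 0%V x); rewrite x0 -[vscal _ _ _]/(0 *: 0)%V scale0r => ->;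
    exact: scale0r.
  by rewrite x0 !nrm0; lra.
have n0 := nrm_gt0 x0.
have hc : Cmod (rc (/ nrm x)) = / nrm x by apply: Cmod_rc; pos.
have : nrm (T (rc (/ nrm x) *: x)%V) <= opnorm T.
  apply: h; exists (rc (/ nrm x) *: x)%V; split=> //.
  by rewrite -/(nrm _) nrmZ hc Rinv_l; lra.
have -> : T (rc (/ nrm x) *: x)%V = (rc (/ nrm x) *: T x)%V by case: hl => _ ->.
rewrite nrmZ hc => h1; apply: (Rmult_le_reg_l (/ nrm x)); first pos.
via h1; right; rfield; lra.
Qed.
Lemma opnorm_bound (T : op X) M : linear T -> bounded T ->
  (forall x, nrm x <= 1 -> nrm (T x) <= M) -> opnorm T <= M.
Proof.
by move=> hl hb h; have [_ h1] := opnorm_lub hl hb; apply: h1 => r [x [x1 ->]]; mono.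
Qed.

Lemma bladdP S T : linear (oadd S T) /\ bounded (oadd S T).
Proof.
split.
  split=> [x y|c x]; rewrite /oadd.
    have := blD; have := blD => -> ->; exact: addrACA.
  have := blZ; have := blZ => -> ->; exact: esym (scalerDr _ _ _).
have [[_ [M hM]] [_ [N hN]]] := (bfP S, bfP T); exists (M + N) => x.
via (@nrmD X (S x) (T x)).
by have := hM x; have := hN x; rewrite /nrm; lra.
Qed.
Lemma bloppP T : linear (oopp T) /\ bounded (oopp T).
Proof.
split.
  split=> [x y|c x]; rewrite /oopp.
    have := blD => ->; exact: opprD.
  have := blZ => ->; exact: esym (scalerN _ _).
have [_ [M hM]] := bfP T; exists M => x.
by apply: Rle_trans (hM x); right; apply: nrmN.
Qed.
Lemma blscalP c T : linear (oscal c T) /\ bounded (oscal c T).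
Proof.
split.
  split=> [x y|d x]; rewrite /oscal.
    have := blD => ->; exact: scalerDr.
  have -> := blZ.
  by rewrite -![vscal _ _ _]/(_ *: _)%V !scalerA mulrC.
have [_ [M hM]] := bfP T; exists (Cmod c * M) => x.
via (Req_le _ _ (nrmZ c (T x))); rewrite Rmult_assoc.
mono.
Qed.
Lemma blzeroP : linear (ozero X) /\ bounded (ozero X).
Proof.
split.
  split=> [x y|d x]; first by rewrite vadd_0.
  exact: esym (scaler0 _ _).
exists 0 => x; have := nrm0; rewrite /nrm => ->; lra.
Qed.
Lemma blidP : linear (fun x : X => x) /\ bounded (fun x : X => x).
Proof. by split; [|exists 1 => x; lra]. Qed.
Lemma blcompP S T : linear (fun x => S (T x)) /\ bounded (fun x => S (T x)).
Proof.
split.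
  split=> [x y|d x].
    by have -> := blD; have -> := blD.
  by have -> := blZ; have -> := blZ.
exists (opnorm S * opnorm T) => x; case: (bfP S) => h1 h2; case: (bfP T) => h3 h4.
via (opnorm_le (T x) h1 h2); rewrite Rmult_assoc.
apply: Rmult_le_compat_l; first exact: opnorm_ge0.
exact: opnorm_le.
Qed.
Definition bladd S T := BLmk (bladdP S T).
Definition blopp T := BLmk (bloppP T).
Definition blscal c T := BLmk (blscalP c T).
Definition blzero := BLmk blzeroP.
Definition blid := BLmk blidP.
Definition blcomp S T := BLmk (blcompP S T).
Definition blnorm T := opnorm T.

Lemma blnorm_le T x : nrm (T x) <= blnorm T * nrm x.
Proof. by have [] := bfP T; apply: opnorm_le. Qed.
Lemma blnorm_ge0 T : 0 <= blnorm T.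
Proof. by have [] := bfP T; apply: opnorm_ge0. Qed.
Lemma blnorm_bound1 T M : (forall x, nrm x <= 1 -> nrm (T x) <= M) -> blnorm T <= M.
Proof. by have [] := bfP T; apply: opnorm_bound. Qed.
Lemma blnorm_bound T M : 0 <= M -> (forall x, nrm (T x) <= M * nrm x) -> blnorm T <= M.
Proof.
by move=> M0 h; apply: blnorm_bound1 => x x1; via (h x); nra.
Qed.

Lemma blnorm_eq0 T : blnorm T = 0 -> T = blzero.
Proof.
move=> h; apply: BLext => x; apply: nrm_eq0.
by have := blnorm_le T x; have := nrm_ge0 (T x); nra.
Qed.
Lemma blnorm_triangle S T : blnorm (bladd S T) <= blnorm S + blnorm T.
Proof.
apply: blnorm_bound; first by have := blnorm_ge0 S; have := blnorm_ge0 T; lra.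
move=> x; have := nrmD (S x) (T x); have := blnorm_le S x; have := blnorm_le T x.
by rewrite -[bladd S T x]/(S x + T x)%V; lra.
Qed.
Lemma blnorm_scal a T : blnorm (blscal a T) = Cmod a * blnorm T.
Proof.
have le c S : blnorm (blscal c S) <= Cmod c * blnorm S.
  apply: blnorm_bound; first by apply: Rmult_le_pos; [pos|exact: blnorm_ge0].
  move=> x; rewrite nrmZ Rmult_assoc.
  by apply: Rmult_le_compat_l; [pos|exact: blnorm_le].
apply: Rle_antisym => //.
have [->|a0] := EM (a = 0%V); first by rewrite Cmod0; have := blnorm_ge0 (blscal 0%V T); lra.
have := le (a^-1)%V (blscal a T); rewrite CmodV //.
have -> : blscal (a^-1)%V (blscal a T) = T.
  apply: BLext => x; rewrite -[LHS]/(a^-1 *: (a *: T x))%V scalerA mulVf ?scale1r //.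
  exact/eqP.
have h := Cmod_gt0 a0 => h1; apply: (Rmult_le_reg_l (/ Cmod a)).
  pos.
by rewrite -Rmult_assoc Rinv_l; lra.
Qed.

Lemma bl_complete (u : nat -> BL X) :
  (forall eps, 0 < eps -> exists N, forall m n, (N <= m)%coq_nat -> (N <= n)%coq_nat ->
      blnorm (bladd (u m) (blopp (u n))) < eps) ->
  exists l, forall eps, 0 < eps -> exists N, forall n, (N <= n)%coq_nat ->
      blnorm (bladd (u n) (blopp l)) < eps.
Proof.
move=> hu.
have hx x : exists l, cvg (fun n => u n x) l.
  apply: cauchy_cvg => e e0.
  have h0 : 0 < e / (nrm x + 1) by apply: Rdiv_lt_0_compat; have := nrm_ge0 x; lra.
  have [N hN] := hu _ h0; exists N => m n /leP hm /leP hn.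
  apply: Rle_lt_trans (blnorm_le (bladd (u m) (blopp (u n))) x) _.
  have := hN m n hm hn; have := (pos).
  set _ => d0 d1; have x0 := nrm_ge0 x.
  have -> : e = e / (nrm x + 1) * (nrm x + 1) by rfield; lra.
  nra.
pose f x := sval (cid (hx x)); have hf x : cvg (fun n => u n x) (f x) := svalP (cid (hx x)).
have hlin : linear f.
  split=> [x y|c x].
    apply: (cvg_uniq (hf _)); apply: cvg_eq (cvgD (hf x) (hf y)) => n; exact: esym (blD _ _ _).
  apply: (cvg_uniq (hf _)); apply: cvg_eq (cvgZ c (hf x)) => n; exact: esym (blZ _ _ _).
have est e N : 0 < e -> (forall m n, (N <= m)%N -> (N <= n)%N ->
    blnorm (bladd (u m) (blopp (u n))) < e) ->
    forall n x, (N <= n)%N -> nrm (u n x - f x) <= e * nrm x.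
  move=> e0 hN n x hn.
  apply: (cvg_le (cvgB (cvg_cst (u n x)) (hf x))); exists N => m hm.
  via (blnorm_le (bladd (u n) (blopp (u m))) x).
  mono.
have hbd : bounded f.
  have [N hN] := hu 1 ltac:(lra).
  have {}hN m n : (N <= m)%N -> (N <= n)%N -> blnorm (bladd (u m) (blopp (u n))) < 1.
    by move=> /leP hm /leP; mono.
  exists (blnorm (u N) + 1) => x; have := est 1 N ltac:(lra) hN N x (leqnn _).
  rewrite -/(nrm (f x)) -/(nrm x); have := blnorm_le (u N) x.
  by have := nrm_le (f x) (u N x); rewrite nrmC; lra.
exists (BLmk (conj hlin hbd)) => e e0; have [N hN] := hu (e / 2) ltac:(lra).
have {}hN m n : (N <= m)%N -> (N <= n)%N -> blnorm (bladd (u m) (blopp (u n))) < e / 2.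
  by move=> /leP hm /leP; mono.
exists N => n /leP hn; apply: (Rle_lt_trans _ (e / 2)); last lra.
apply: blnorm_bound; first lra.
by move=> x; apply: (est (e / 2) N ltac:(lra) hN).
Qed.
End BL.

(** The operators form a [CBanach] again, so that everything shown for vectors applies to operators,
    and [ad a] becomes an element of [BL (BB X)]. *)
Definition BB (X : CBanach) : CBanach.
refine (@Build_CBanach (BL X) (@bladd X) (blzero X) (@blopp X) (@blscal X) (@blnorm X)
  _ _ _ _ _ _ _ _ (@blnorm_eq0 X) (@blnorm_triangle X) (@blnorm_scal X) (@bl_complete X)).
- by move=> R S T; apply: BLext => x; apply: addrA.
- by move=> S T; apply: BLext => x; apply: addrC.
- by move=> S; apply: BLext => x; apply: addr0.
- by move=> S; apply: BLext => x; apply: addrN.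
- by move=> S; apply: BLext => x; apply: scale1r.
- by move=> a b S; apply: BLext => x; apply: scalerA.
- by move=> a S T; apply: BLext => x; apply: scalerDr.
- by move=> a b S; apply: BLext => x; apply: scalerDl.
Defined.
Canonical BB.
HB.instance Definition _ X := GRing.Lmodule.copy (BL X) (car (BB X)).

Section Ring.
Variable X : CBanach.
Lemma blcompA : associative (@blcomp X). Proof. by move=> R S T; apply: BLext. Qed.
Lemma bl1l : left_id (blid X) (@blcomp X). Proof. by move=> T; apply: BLext. Qed.
Lemma bl1r : right_id (blid X) (@blcomp X). Proof. by move=> T; apply: BLext. Qed.
Lemma blDl : left_distributive (@blcomp X) +%R. Proof. by move=> R S T; apply: BLext. Qed.
Lemma blDr : right_distributive (@blcomp X) +%R.
Proof. by move=> R S T; apply: BLext => x; apply: (blD R). Qed.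
HB.instance Definition _ := GRing.Zmodule_isPzRing.Build (BL X) blcompA bl1l bl1r blDl blDr.
End Ring.

Notation Id := (1%V : BL _).
Section Ops.
Variable X : CBanach.
Implicit Types S T : BL X.
Lemma blDE S T x : (S + T)%V x = (S x + T x)%V. Proof. by []. Qed.
Lemma blNE T x : (- T)%V x = (- T x)%V. Proof. by []. Qed.
Lemma blBE S T x : (S - T)%V x = (S x - T x)%V. Proof. by []. Qed.
Lemma blZE a T x : (a *: T)%V x = (a *: T x)%V. Proof. by []. Qed.
Lemma bl0E x : (0 : BL X)%V x = 0%V. Proof. by []. Qed.
Lemma bl1E x : (1 : BL X)%V x = x. Proof. by []. Qed.
Lemma blME S T x : (S * T)%V x = S (T x). Proof. by []. Qed.
Lemma bl_sumE I (r : seq I) (P : pred I) (F : I -> BL X) x :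
  (\sum_(i <- r | P i) F i)%V x = (\sum_(i <- r | P i) F i x)%V.
Proof. by elim/big_rec2: _ => [|i y1 y2 _ <-]. Qed.
Definition blE := (blDE, blNE, blZE, bl0E, bl1E, blME).
Lemma scalerAl a S T : (a *: (S * T) = (a *: S) * T)%V. Proof. exact: BLext. Qed.
Lemma scalerAr a S T : (a *: (S * T) = S * (a *: T))%V.
Proof. by apply: BLext => x; rewrite !blE blZ. Qed.
Lemma bnle T x : nrm (T x) <= nrm T * nrm x. Proof. exact: blnorm_le. Qed.
Lemma bnM S T : nrm (S * T) <= nrm S * nrm T.
Proof.
apply: blnorm_bound; first pos.
move=> x; via (bnle S (T x)); rewrite Rmult_assoc.
by apply: Rmult_le_compat_l; [pos|exact: bnle].
Qed.
Lemma bn1 : nrm (1 : BL X) <= 1.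
Proof. by apply: blnorm_bound1. Qed.
Lemma bnX T n : nrm (T ^+ n) <= nrm T ^ n.
Proof.
elim: n => [|n IH]; first exact: bn1.
rewrite exprS; via (bnM _ _).
by apply: Rmult_le_compat_l; pos.
Qed.
Lemma bnM_le S T s t : nrm S <= s -> nrm T <= t -> nrm (S * T) <= s * t.
Proof. by move=> hS hT; via (bnM _ _); mono. Qed.
Lemma bnle_le T x s t : nrm T <= s -> nrm x <= t -> nrm (T x) <= s * t.
Proof. by move=> hT hx; via (bnle _ _); mono. Qed.
Ltac mono ::= solve [intros; first [mono1 | apply: bnM_le; mono1 | apply: bnle_le; mono1]].
Lemma bn_bound T M : 0 <= M -> (forall x, nrm (T x) <= M * nrm x) -> nrm T <= M.
Proof. exact: blnorm_bound. Qed.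
Lemma bn_bound1 T M : (forall x, nrm x <= 1 -> nrm (T x) <= M) -> nrm T <= M.
Proof. exact: blnorm_bound1. Qed.
Lemma bn_wit T q : q < nrm T -> exists x, nrm x <= 1 /\ q < nrm (T x).
Proof.
apply: contrapT => hn; have : nrm T <= q; last lra.
apply: bn_bound1 => x x1; apply: Rnot_lt_le => hq; apply: hn; by exists x.
Qed.
Lemma bn_cvg (u : nat -> BL X) T x : cvg u T -> cvg (fun n => u n x) (T x).
Proof.
move=> h; apply: cvg_dom (fun n => bnle (u n - T)%V x) _ => e e0.
have h0 : 0 < e / (nrm x + 1) by apply: Rdiv_lt_0_compat; have := nrm_ge0 x; lra.
have [N hN] := h _ h0; exists N => n /hN.
have := nrm_ge0; set d := (u n - T)%V => d0 d1; have x0 := nrm_ge0 x.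
have -> : e = e / (nrm x + 1) * (nrm x + 1) by rfield; lra.
nra.
Qed.
End Ops.
(** * Series, power series and exponentials *)

Section Series.
Variable X : CBanach.
Implicit Types u v : nat -> X.

Definition summ u : Prop := exists M, forall n, rsum (fun i => nrm (u i)) n <= M.

Lemma rsum_tail (f : nat -> R) : (forall i, 0 <= f i) ->
  (exists M, forall n, rsum f n <= M) ->
  forall e, 0 < e -> exists N, forall m n, (N <= m)%N -> (N <= n)%N ->
    rsum f m - rsum f n < e.
Proof.
move=> f0 [M hM] e e0.
have [||s [s1 s2]] := completeness (fun r => exists n, r = rsum f n).
by exists M => r [n ->].
by exists (rsum f 0), 0%N.
have [N hN] : exists N, s - e < rsum f N.
  apply: contrapT => h; have : s <= s - e; last lra.
  by apply: s2 => r [n ->]; apply: Rnot_lt_le => hn; apply: h; exists n.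
exists N => m n hm hn; have := rsum_mono f0 hn.
have : rsum f m <= s by apply: s1; exists m.
lra.
Qed.

Lemma nrm_sumB u m n : (m <= n)%N ->
  nrm (\sum_(i < n) u i - \sum_(i < m) u i) <=
  rsum (fun i => nrm (u i)) n - rsum (fun i => nrm (u i)) m.
Proof.
move=> /subnKC <-; elim: (n - m)%N => [|k IH]; first by rewrite addn0 subrr nrm0; lra.
rewrite addnS big_ord_recr addrAC.
via (nrmD _ _); via (Rplus_le_compat_r _ _ _ IH).
by rewrite /=; nra.
Qed.

Lemma summ_cvg u : summ u -> exists l, cvg (fun n => \sum_(i < n) u i)%V l.
Proof.
move=> hu; apply: cauchy_cvg => e e0.
have [N hN] := rsum_tail (fun i => nrm_ge0 (u i)) hu e0.
exists N => m n hm hn; case: (leqP m n) => [h|/ltnW h].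
  by rewrite nrmC; apply: Rle_lt_trans (nrm_sumB _ h) _; mono.
by apply: Rle_lt_trans (nrm_sumB _ h) _; mono.
Qed.

Definition ser u : X :=
  ClassicalEpsilon.epsilon (inhabits 0%V) (cvg (fun n => \sum_(i < n) u i)%V).
Lemma serP u : summ u -> cvg (fun n => \sum_(i < n) u i)%V (ser u).
Proof. by move=> /summ_cvg; apply: ClassicalEpsilon.epsilon_spec. Qed.
Lemma ser_uniq u l : cvg (fun n => \sum_(i < n) u i)%V l -> ser u = l.
Proof.
move=> h; have h' : cvg (fun n => \sum_(i < n) u i)%V (ser u).
  by apply: ClassicalEpsilon.epsilon_spec; exists l.
exact: cvg_uniq h.
Qed.
Lemma ser_le u M : (forall n, rsum (fun i => nrm (u i)) n <= M) -> nrm (ser u) <= M.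
Proof.
move=> h; apply: (cvg_le (serP (ex_intro _ M h))); exists 0%N => n _.
exact: Rle_trans (nrm_sum _ _) (h n).
Qed.
Lemma summ_le u (f : nat -> R) : (forall i, nrm (u i) <= f i) ->
  (exists M, forall n, rsum f n <= M) -> summ u.
Proof.
move=> h [M hM]; exists M => n; apply: Rle_trans (hM n); exact: rsum_le.
Qed.
Lemma summZ a u : summ u -> summ (fun i => a *: u i)%V.
Proof.
move=> [M hM]; exists (Cmod a * M) => n.
mid (Cmod a * rsum (fun i => nrm (u i)) n).
  by rewrite -rsumZ; apply: rsum_le => i; rewrite nrmZ.
mono.
Qed.
Lemma serZ a u : summ u -> ser (fun i => a *: u i)%V = (a *: ser u)%V.
Proof.
move=> h; apply: ser_uniq; apply: cvg_eq (cvgZ a (serP h)) => n.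
by rewrite scaler_sumr.
Qed.
Lemma ser_recl u : summ u -> summ (fun i => u i.+1) /\ ser u = (u 0%N + ser (fun i => u i.+1))%V.
Proof.
move=> [M hM].
have h : summ (fun i => u i.+1).
  exists M => n; apply: Rle_trans (hM n.+1).
  elim: n => [|n IH]; first by rewrite /=; pos.
  by rewrite [rsum _ n.+1]/= [rsum _ n.+2]/=; mono.
split=> //; apply: ser_uniq => e e0.
have [N hN] := serP h e0; exists N.+1 => -[//|n] hn.
by have := hN n hn; rewrite big_ord_recl opprD addrACA subrr add0r.
Qed.
End Series.

Lemma bl_ser (X Y : CBanach) (T : X -> Y) u M :
  (forall x y, T (x + y)%V = (T x + T y)%V) -> (forall x, nrm (T x) <= M * nrm x) ->
  summ u -> summ (fun i => T (u i)) /\ ser (fun i => T (u i)) = T (ser u).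
Proof.
move=> hD hM hu; have T0 : T 0%V = 0%V.
  by apply: (addrI (T 0%V)); rewrite -hD !addr0.
have TN x : T (- x)%V = (- T x)%V by apply/eqP; rewrite -addr_eq0 -hD addNr T0.
have M0 := Rabs_pos M; have MM := Rle_abs M.
have {}hM x : nrm (T x) <= Rabs M * nrm x.
  by via (hM x); mono.
split.
  case: (hu) => B hB; exists (Rabs M * B) => n.
  mid (Rabs M * rsum (fun i => nrm (u i)) n).
    by rewrite -rsumZ; apply: rsum_le => i _.
  mono.
apply: ser_uniq => e e0.
have [|N hN] := @cvg_lip X Y T (Rabs M) _ _ _ (serP hu) e e0.
  by move=> x y; rewrite -TN -hD.
have hs n : (\sum_(i < n) T (u i) = T (\sum_(i < n) u i))%V.
  by elim: n => [|n IH]; rewrite ?big_ord0 // !big_ord_recr hD -IH.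
by exists N => n /hN; rewrite hs.
Qed.

Section Cauchy.
Variable X : CBanach.
Implicit Types u v : nat -> BL X.
Definition conv u v n : BL X := (\sum_(i < n.+1) u i * v (n - i)%N)%V.

(** Both sides run over the triangle of index pairs with sum below [n], by diagonals and by rows. *)
Lemma conv_sum u v n :
  (\sum_(k < n) conv u v k = \sum_(i < n) u i * \sum_(j < n - i) v j)%V.
Proof.
elim: n => [|n IH]; first by rewrite !big_ord0.
rewrite big_ord_recr IH /=.
have -> : (\sum_(i < n) u i * \sum_(j < n - i) v j =
  \sum_(i < n.+1) u i * \sum_(j < n - i) v j)%V.
  by rewrite big_ord_recr /= subnn big_ord0 mulr0 addr0.
rewrite -big_split; apply: eq_bigr => i.
have hi : (i <= n)%N by rewrite -ltnS.
by rewrite subSn // big_ord_recr mulrDr.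
Qed.

Lemma conv_ser u v : summ u -> summ v ->
  summ (conv u v) /\ ser (conv u v) = (ser u * ser v)%V.
Proof.
move=> hu hv; case: (hu) => A hA; case: (hv) => B hB.
have A0 : 0 <= A by have := hA 0%N.
have B0 : 0 <= B by have := hB 0%N.
have u0 i : 0 <= nrm (u i) := nrm_ge0 _.
have v0 i : 0 <= nrm (v i) := nrm_ge0 _.
have cs : summ (conv u v).
  exists (A * B) => n.
  have : rsum (fun k => nrm (conv u v k)) n <=
    rsum (fun i => nrm (u i) * rsum (fun j => nrm (v j)) (n - i)) n.
    elim: n => [|n IH]; first by rewrite /=; lra.
    rewrite [X in X <= _]/=.
    have h : nrm (conv u v n) <= rsum (fun i => nrm (u i) * nrm (v (n - i)%N)) n.+1.
      rewrite /conv; via (nrm_sum (fun i => (u i * v (n - i)%N)%V) _).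
      by apply: rsum_le => i _; apply: bnM.
    have e : rsum (fun i => nrm (u i) * rsum (fun j => nrm (v j)) (n.+1 - i)) n.+1 =
      rsum (fun i => nrm (u i) * rsum (fun j => nrm (v j)) (n - i)) n.+1 +
      rsum (fun i => nrm (u i) * nrm (v (n - i)%N)) n.+1.
      have ek k : (k <= n.+1)%N -> rsum (fun i => nrm (u i) * rsum (fun j => nrm (v j)) (n.+1 - i)) k =
        rsum (fun i => nrm (u i) * rsum (fun j => nrm (v j)) (n - i)) k +
        rsum (fun i => nrm (u i) * nrm (v (n - i)%N)) k.
        elim: k => [|k IHk] hk /=; first lra.
        by rewrite (IHk (ltnW hk)) subSn //=; lra.
      exact: ek.
    rewrite e; apply: Rplus_le_compat h.
    rewrite [X in _ <= X]/= subnn [X in _ * X]/= Rmult_0_r Rplus_0_r.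
    exact: IH.
  move=> h0; apply: (Rle_trans _ _ _ h0) => {h0}.
  mid (rsum (fun i => nrm (u i) * B) n).
    by apply: rsum_le => i _; mono.
  rewrite (_ : rsum _ n = B * rsum (fun i => nrm (u i)) n); last first.
    by elim: n => [|n IH] /=; [lra|rewrite IH; lra].
  by rewrite Rmult_comm; mono.
split=> //; apply: ser_uniq.
set su := fun n => (\sum_(i < n) u i)%V; set sv := fun n => (\sum_(i < n) v i)%V.
have hsu : cvg su (ser u) := serP hu.
have hsv : cvg sv (ser v) := serP hv.
move=> e e0.
have e1 : 0 < e / (4 * (A + B + 1)) by apply: Rdiv_lt_0_compat; lra.
have [N1 h1] := hsu _ e1; have [N2 h2] := hsv _ e1.
have [N3 h3] := rsum_tail u0 hu e1; have [N4 h4] := rsum_tail v0 hv e1.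
set d := e / (4 * (A + B + 1)) in e1 h1 h2 h3 h4.
have ed : d * (4 * (A + B + 1)) = e by rewrite /d; rfield; lra.
pose N := (N1 + N2 + N3 + N4)%N.
exists (N + N)%N => n hn; rewrite conv_sum.
have hn1 : (N <= n)%N by lia.
have bsu : nrm (su n) <= A by apply: Rle_trans (nrm_sum _ _) (hA n).
have bv : nrm (ser v) <= B by apply: ser_le.
have -> : (\sum_(i < n) u i * \sum_(j < n - i) v j - ser u * ser v =
  (su n - ser u) * ser v + su n * (sv n - ser v) - \sum_(i < n) u i * (sv n - sv (n - i)%N))%V.
  rewrite (_ : \sum_(i < n) u i * (sv n - sv (n - i)%N) = su n * sv n -
    \sum_(i < n) u i * \sum_(j < n - i) v j)%V.
    by bvec.
  rewrite /su mulr_suml -sumrB; apply: eq_bigr => i _; exact: mulrBr.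
have t1 : nrm ((su n - ser u) * ser v)%V <= d * B.
  apply: bnM_le => //.
  by left; apply: h1; lia.
have t2 : nrm (su n * (sv n - ser v))%V <= A * d.
  apply: bnM_le => //.
  by left; apply: h2; lia.
(* The missing part of the square is split at the row [n - N]: before it the tail of [v] is below
   [d], after it the tail of [u] is. *)
pose g i := if (i < n - N)%N then 0 else nrm (u i).
have t3 : nrm (\sum_(i < n) u i * (sv n - sv (n - i)%N))%V <= d * A + B * d.
  via (nrm_sum (fun i => u i * (sv n - sv (n - i)%N))%V n).
  mid (rsum (fun i => d * nrm (u i)) n + rsum (fun i => B * g i) n).
    rewrite -rsumD; apply: rsum_le => i hi; via (bnM _ _).
    have hb : nrm (sv n - sv (n - i)%N)%V <= rsum (fun i => nrm (v i)) n - rsum (fun i => nrm (v i)) (n - i).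
      by apply: nrm_sumB; lia.
    have ui := u0 i; rewrite /g; case: ifP => hi2.
      have := h4 n (n - i)%N ltac:(lia) ltac:(lia) => h4'.
      pos.
    have q0 := @rsum_ge0 _ (n - i)%N v0; have hBn := hB n.
    pos.
  rewrite !rsumZ; have hAn := hA n.
  have -> : rsum g n = rsum (fun i => nrm (u i)) n - rsum (fun i => nrm (u i)) (n - N).
    exact/rsum_cut/leq_subr.
  have := h3 n (n - N)%N ltac:(lia) ltac:(lia); nra.
apply: Rle_lt_trans (nrmB _ _) _; apply: Rle_lt_trans (Rplus_le_compat_r _ _ _ (nrmD _ _)) _.
nra.
Qed.
End Cauchy.

Section Entire.
Variable X : CBanach.
(** An entire function is represented by its coefficients; products and identity theorems then need
    no derivative. *)
Definition ent (phi : nat -> X) : Prop :=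
  forall r, 0 <= r -> exists M, forall n, rsum (fun i => r ^ i * nrm (phi i)) n <= M.
Definition pser (phi : nat -> X) (t : C) : X := ser (fun i => t ^+ i *: phi i)%V.
Lemma ent_summ phi t : ent phi -> summ (fun i => t ^+ i *: phi i)%V.
Proof.
move=> h; apply: summ_le (h _ (Cmod_ge0 t)) => i; rewrite nrmZ CmodX; lra.
Qed.
Lemma pser0 phi : pser phi 0%V = phi 0%N.
Proof.
apply: ser_uniq; exists 1%N => -[//|n].
rewrite big_ord_recl scale1r big1 ?addr0 ?subrr ?nrm0 // => i.
by rewrite exprS mul0r scale0r.
Qed.
End Entire.

Lemma ent_mul (X : CBanach) (phi psi : nat -> BL X) : ent phi -> ent psi ->
  ent (conv phi psi) /\ forall t, pser (conv phi psi) t = (pser phi t * pser psi t)%V.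
Proof.
move=> h1 h2.
have e t i : (t ^+ i *: conv phi psi i = conv (fun i => t ^+ i *: phi i) (fun i => t ^+ i *: psi i) i)%V.
  rewrite scaler_sumr; apply: eq_bigr => j.
  by rewrite -scalerAl -scalerAr scalerA -exprD subnKC // -ltnS.
split=> [r r0|t].
  have [[M hM] _] := conv_ser (ent_summ (rc r) h1) (ent_summ (rc r) h2).
  exists M => n; apply: Rle_trans (hM n); apply: rsum_le; right.
  by rewrite -e nrmZ CmodX Cmod_rc.
have [_ <-] := conv_ser (ent_summ t h1) (ent_summ t h2).
by congr ser; apply/funext.
Qed.

Section Exp.
Variable X : CBanach.
Implicit Types a b : BL X.
Definition ec (a : BL X) i : BL X := ((i`!%:R : C)^-1 *: a ^+ i)%V.
Definition bexp a : BL X := ser (ec a).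

Lemma factE n : Factorial.fact n = (n`!)%N.
Proof. by elim: n => // n IH; rewrite factS -IH. Qed.
Lemma fact_gt0R n : 0 < INR (n`!).
Proof. by apply: lt_0_INR; apply/ltP; apply: fact_gt0. Qed.
Lemma Cmod_factV n : Cmod (n`!%:R^-1)%V = / INR (n`!).
Proof.
have h := fact_gt0R n; rewrite -rc_nat -rcV ?Cmod_rc //; last lra.
pos.
Qed.
Lemma expsum_le r n : 0 <= r -> rsum (fun i => / INR (i`!) * r ^ i) n <= exp r.
Proof.
move=> r0; have e f m : rsum f m.+1 = sum_f_R0 f m.
  by elim: m => [|m IH]; [rewrite /=; lra|rewrite tech5 -IH].
have pos i : 0 <= / INR (i`!) * r ^ i.
  apply: Rmult_le_pos; last pos.
  by left; apply: Rinv_0_lt_compat; apply: fact_gt0R.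
mid (rsum (fun i => / INR (i`!) * r ^ i) n.+1).
  exact: rsum_mono.
rewrite e; apply: sum_incr; last exact: pos.
rewrite /exp; case: exist_exp => l hl e0 /hl [N hN]; exists N => n' /hN.
by rewrite (_ : (fun i => _) = fun i => / INR (i`!) * r ^ i) //; apply/funext => i; rewrite factE.
Qed.
Lemma nrm_ec a i : nrm (ec a i) <= / INR (i`!) * nrm a ^ i.
Proof.
rewrite nrmZ Cmod_factV; apply: Rmult_le_compat_l; last exact: bnX.
by left; apply: Rinv_0_lt_compat; apply: fact_gt0R.
Qed.
Lemma ec_ent a : ent (ec a).
Proof.
move=> r; exists (exp (r * nrm a)) => n.
have h0 : 0 <= r * nrm a by pos.
apply: Rle_trans (expsum_le n h0); apply: rsum_le => i _.
rewrite Rpow_mult_distr -Rmult_assoc (Rmult_comm (/ _)) Rmult_assoc.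
by apply: Rmult_le_compat_l; [pos|exact: nrm_ec].
Qed.
Lemma ec_summ a : summ (ec a).
Proof.
apply: summ_le (nrm_ec a) _; exists (exp (nrm a)) => n; apply: expsum_le; pos.
Qed.
Lemma ecZ t a i : ec (t *: a)%V i = (t ^+ i *: ec a i)%V.
Proof.
rewrite /ec; have -> : ((t *: a) ^+ i = t ^+ i *: a ^+ i)%V.
  elim: i => [|i IH]; first by rewrite scale1r.
  by rewrite !exprS IH -scalerAl -scalerAr scalerA.
by rewrite !scalerA mulrC.
Qed.
Lemma bexpZ t a : bexp (t *: a)%V = pser (ec a) t.
Proof. by congr ser; apply/funext => i; rewrite ecZ. Qed.
Lemma nrm_bexp a : nrm (bexp a) <= exp (nrm a).
Proof.
apply: ser_le => n; apply: Rle_trans (expsum_le n (nrm_ge0 a)); apply: rsum_le => i _.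
exact: nrm_ec.
Qed.
Lemma ec0 a : ec a 0 = 1%V.
Proof. by rewrite /ec invr1 scale1r. Qed.
Lemma bexp0 : bexp 0%V = 1%V.
Proof.
by have := bexpZ 0%V 0%V; rewrite scale0r pser0 ec0.
Qed.

Lemma natC_neq0 n : (0 < n)%N -> ((n%:R : C) != 0)%V.
Proof. by move=> /ltP /lt_0_INR n0; apply/eqP; rewrite -rc_nat => -[]; lra. Qed.
Lemma binC n i : (i <= n)%N ->
  ((n`!%:R : C)^-1 * 'C(n, i)%:R = (i`!%:R)^-1 * ((n - i)`!%:R)^-1)%V.
Proof.
move=> hi; have e := bin_fact hi.
have h1 := natC_neq0 (fact_gt0 n); have h2 := natC_neq0 (fact_gt0 i).
have h3 := natC_neq0 (fact_gt0 (n - i)).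
have e' : (n`!%:R = 'C(n, i)%:R * (i`!%:R * (n - i)`!%:R) :> C)%V by rewrite -e !natrM.
apply: (mulfI h1); rewrite mulrA divff // mul1r e' -!mulrA.
by rewrite [(_ ((_)^-1 * _))%V]mulrCA mulVKf // divff // mulr1.
Qed.

Lemma bexpD a b : GRing.comm a b -> bexp (a + b)%V = (bexp a * bexp b)%V.
Proof.
move=> hab; have [_ <-] := conv_ser (ec_summ a) (ec_summ b).
congr ser; apply/funext => n; rewrite /ec addrC exprDn_comm //.
rewrite scaler_sumr; apply: eq_bigr => i _.
have hi : (i <= n)%N by rewrite -ltnS.
rewrite -scalerAl -scalerAr scalerA -binC // -scalerA scaler_nat.
by congr (_ (_ *+ _))%V; apply/commr_sym/commrX/commr_sym/commrX.
Qed.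
Lemma bexpNr a : (bexp a * bexp (- a))%V = 1%V.
Proof. by rewrite -bexpD ?subrr ?bexp0 //; apply: commrN. Qed.
Lemma bexpNl a : (bexp (- a) * bexp a)%V = 1%V.
Proof. by have := bexpNr (- a)%V; rewrite opprK. Qed.
Lemma bexpMn a n : bexp (a *+ n)%V = (bexp a ^+ n)%V.
Proof.
elim: n => [|n IH]; first by rewrite bexp0.
rewrite mulrS exprS bexpD ?IH //; exact: commrMn.
Qed.
End Exp.
(** * Total boundedness and compact operators *)

Lemma archi_inv e : 0 < e -> exists N, forall n, (N <= n)%N -> / INR n.+1 < e.
Proof.
move=> e0; have [N hN] := archimed_cor1 e e0; exists N => n hn.
case: hN => h1 h2; apply: Rle_lt_trans h1; apply: Rinv_le_contravar.
  exact: lt_0_INR.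
by apply: le_INR; lia.
Qed.
Lemma inv_pos n : 0 < / INR n.+1.
Proof. by apply: Rinv_0_lt_compat; apply: lt_0_INR; lia. Qed.
Lemma incr_ge (phi : nat -> nat) : (forall n, (phi n < phi n.+1)%N) -> forall n, (n <= phi n)%N.
Proof. by move=> h; elim=> // n IH; apply: leq_ltn_trans (h n). Qed.
Lemma incr_lt (phi : nat -> nat) : (forall n, (phi n < phi n.+1)%N) ->
  forall m n, (m < n)%N -> (phi m < phi n)%N.
Proof.
move=> h m n /subnKC <-; elim: (n - m.+1)%N => [|k IH]; first by rewrite addn0.
by rewrite addnS; apply: ltn_trans (h _).
Qed.
Lemma dep_choice (T : Type) (P : T -> Prop) (Q : nat -> T -> T -> Prop) x0 : P x0 ->
  (forall n x, P x -> exists y, P y /\ Q n x y) ->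
  exists f : nat -> T, f 0%N = x0 /\ forall n, P (f n) /\ Q n (f n) (f n.+1).
Proof.
move=> p0 h.
have h' n x : exists y, P x -> P y /\ Q n x y.
  have [/h|] := EM (P x); first by move=> /(_ n) [y hy]; exists y.
  by exists x.
pose g n x := sval (cid (h' n x)); have hg n x : P x -> P (g n x) /\ Q n x (g n x).
  exact: svalP (cid (h' n x)).
pose fix f n := if n is m.+1 then g m (f m) else x0.
have pf n : P (f n) by elim: n => //= n IH; apply: (hg n _ IH).1.
by exists f; do 2 (split=> //); apply: (hg n _ (pf n)).2.
Qed.

Section TB.
Variable X : CBanach.
Implicit Types S A B : X -> Prop.

Definition tb S : Prop := forall e, 0 < e -> exists l : seq X,
  forall x, S x -> exists2 y, y \in l & nrm (x - y) < e.

(** Replaces the choice of a finite subcover. The [good] sets form an ideal; a totally bounded set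
    outside the ideal is cut into ever smaller pieces outside it, and the centres of these converge
    by completeness. The point [y] need not lie in [S]. *)
Lemma tb_cluster S (good : (X -> Prop) -> Prop) : tb S ->
  (forall A B, (forall x, A x -> B x) -> good B -> good A) ->
  (forall A B, good A -> good B -> good (fun x => A x \/ B x)) ->
  good (fun=> False) -> ~ good S ->
  exists y, forall r, 0 < r -> ~ good (fun x => S x /\ nrm (x - y) < r).
Proof.
move=> hS mono un good0 nS.
pose P (p : (X -> Prop) * X) := (forall x, p.1 x -> S x) /\ ~ good p.1.
pose Q n (p q : (X -> Prop) * X) :=
  forall x, q.1 x <-> p.1 x /\ nrm (x - q.2)%V < / INR n.+1.
have [|n p [pS pg]|f [f0 hf]] := @dep_choice _ P Q (S, 0%V).
pos.
have [l hl] := hS _ (inv_pos n).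
  have [c hc] : exists c, ~ good (fun x => p.1 x /\ nrm (x - c)%V < / INR n.+1).
    apply: contrapT => h; apply: pg.
    have {}h c : good (fun x => p.1 x /\ nrm (x - c)%V < / INR n.+1).
      by apply: contrapT => hc; apply: h; exists c.
    apply: (mono _ (fun x => exists2 c, c \in l & p.1 x /\ nrm (x - c)%V < / INR n.+1)).
      by move=> x px; have [y hy] := hl x (pS x px); exists y.
    elim: l {hl} => [|c l IH]; first by apply: mono good0 => x [].
    apply: mono (un _ _ (h c) IH) => x [c' ]; rewrite in_cons => /orP [/eqP -> hx|]; first mono.
    by right; exists c'.
  exists ((fun x => p.1 x /\ nrm (x - c)%V < / INR n.+1), c); split => //.
  by split=> //= x []; mono.
have sub n m x : (f (n + m)%N).1 x -> (f n).1 x.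
  elim: m => [|m IH]; first by rewrite addn0.
  by rewrite addnS => /(hf (n + m)%N).2 [/IH].
have ne n : exists x, (f n).1 x.
  apply: contrapT => h; apply: (hf n).1.2; apply: mono good0 => x hx; apply: h; by exists x.
pose p n := sval (cid (ne n)); have hp n : (f n).1 (p n) := svalP (cid (ne n)).
have pc n m : (n < m)%N -> nrm (p m - (f n.+1).2)%V < / INR n.+1.
  move=> h; have : (f n.+1).1 (p m) by apply: (sub _ (m - n.+1)%N); rewrite subnKC.
  by move/(hf n).2 => [].
have [y hy] : exists y, cvg p y.
  apply: cauchy_cvg => e e0; have [N hN] := archi_inv (e := e / 2) ltac:(lra).
  exists N.+1 => m n hm hn; have h := hN N (leqnn _).
  have := pc N m hm; have := pc N n hn; have := nrm_tri (p m) (f N.+1).2 (p n).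
  by have := nrmC (f N.+1).2 (p n); lra.
exists y => r r0; have [N hN] := archi_inv (e := r / 3) ltac:(lra).
have h3 := hN N (leqnn _).
have hyc : nrm (y - (f N.+1).2)%V <= r / 3.
  apply: (cvg_le (cvgB hy (cvg_cst _))); exists N.+1 => m hm; have := pc N m hm; lra.
move=> hg; apply: (hf N.+1).1.2; apply: mono hg => x hx; split; first exact: (hf N.+1).1.1.
have [] := (proj1 ((hf N).2 x) hx).
by have := nrm_tri x (f N.+1).2 y; have := nrmC (f N.+1).2 y; lra.
Qed.

Lemma tb_subseq S (u : nat -> X) : tb S -> (forall n, S (u n)) ->
  exists phi : nat -> nat, (forall n, (phi n < phi n.+1)%N) /\ exists l, cvg (u \o phi) l.
Proof.
move=> hS hu; pose good A := exists N, forall n, (N <= n)%N -> ~ A (u n).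
have [||||y hy] := @tb_cluster S good hS.
by move=> A B h [N hN]; exists N => n /hN hB /h.
move=> A B [N hN] [M hM]; exists (maxn N M) => n; rewrite geq_max => /andP [/hN h1 /hM h2].
  by case.
by exists 0%N => n _.
by case=> N; apply.
have h n k : exists m, (k < m)%N /\ nrm (u m - y)%V < / INR n.+1.
  apply: contrapT => h; apply: (hy _ (inv_pos n)); exists k.+1 => m hm [_ h1].
  by apply: h; exists m.
have [//|n x _|phi [_ hphi]] := @dep_choice nat (fun=> True)
    (fun n x m => (x < m)%N /\ nrm (u m - y)%V < / INR n.+1) 0%N.
  by have [m hm] := h n x; exists m.
exists (fun n => phi n.+1); split=> [n|]; first by case: (hphi n.+1).2.
exists y => e /archi_inv [N hN]; exists N => n /hN.
by have := (hphi n).2.2; rewrite /=; lra.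
Qed.

Lemma tb_sep S (u : nat -> X) e : tb S -> (forall n, S (u n)) -> 0 < e ->
  exists m n, (m < n)%N /\ nrm (u n - u m) < e.
Proof.
move=> hS hu e0; have [phi [hp [l hl]]] := tb_subseq hS hu.
have [N hN] := cvg_cauchy hl e0; exists (phi N), (phi N.+1).
by have := hN N.+1 N (leqnSn _) (leqnn _).
Qed.
(** Without a finite net an [e]-separated sequence can be chosen greedily; the state of the choice
    carries the list of all earlier points. *)
Lemma tb_of_sep S : (forall (u : nat -> X) e, (forall n, S (u n)) -> 0 < e ->
  exists m n, (m < n)%N /\ nrm (u n - u m) < e) -> tb S.
Proof.
move=> h e e0; apply: contrapT => hn.
have hl (l : seq X) : exists x, S x /\ forall y, y \in l -> e <= nrm (x - y).
  apply: contrapT => hx; apply: hn; exists l => x Sx; apply: contrapT => hy; apply: hx.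
  by exists x; split=> // y yl; apply: Rnot_lt_le => h1; apply: hy; exists y.
have [|n p hp|f [_ hf]] := @dep_choice (seq X * X) (fun p => S p.2)
    (fun n p q => q.1 = p.2 :: p.1 /\ forall y, y \in q.1 -> e <= nrm (q.2 - y)%V)
    ([::], sval (cid (hl [::]))).
by case: (svalP (cid (hl [::]))).
by have [x []] := hl (p.2 :: p.1); exists (p.2 :: p.1, x).
have mem m n : (m < n)%N -> (f m).2 \in (f n).1.
  elim: n => // n IH; rewrite ltnS (hf n).2.1 in_cons leq_eqVlt => /orP [/eqP ->|/IH ->].
    by rewrite eqxx.
  by rewrite orbT.
have [m [n [hmn]]] := h (fun n => (f n).2) e (fun n => (hf n).1) e0.
case: n hmn => // n hmn; have := (hf n).2.2 _ (mem _ _ hmn); lra.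
Qed.

Lemma tb_mono S A : (forall x, A x -> S x) -> tb S -> tb A.
Proof. by move=> h hS e /hS [l hl]; exists l => x /h /hl. Qed.
Lemma tb_approx S : (forall e, 0 < e -> exists A, tb A /\
  forall x, S x -> exists y, A y /\ nrm (x - y) < e) -> tb S.
Proof.
move=> h e e0; have [A [hA hx]] := h (e / 2) ltac:(lra).
have [l hl] := hA (e / 2) ltac:(lra); exists l => x /hx [y [/hl [z hz] hy]].
by exists z => //; have := nrm_tri x y z; lra.
Qed.
(** A net of half the radius has its centres moved into [S]. *)
Lemma tb_net S : tb S -> forall e, 0 < e -> exists l : seq X,
  (forall y, y \in l -> S y) /\
  forall x, S x -> exists2 y, y \in l & nrm (x - y) < e.
Proof.
move=> hS e e0; have [l hl] := hS (e / 2) ltac:(lra).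
have [l' [h1 h2]] : exists l' : seq X, (forall y, y \in l' -> S y) /\
   forall c, c \in l -> forall x, S x -> nrm (x - c)%V < e / 2 ->
     exists2 y, y \in l' & nrm (x - y)%V < e.
  elim: l {hl} => [|c l [l' [h1 h2]]]; first by exists [::].
  have [[x0 []]|hn] := EM (exists x, S x /\ nrm (x - c)%V < e / 2).
    exists (x0 :: l'); split=> [y|d].
      by rewrite in_cons => /orP [/eqP ->|/h1].
    rewrite in_cons => /orP [/eqP ->|dl] x Sx hx.
      exists x0; first by rewrite mem_head.
      by have := nrm_tri x c x0; have := nrmC c x0; lra.
    by have [y yl hy] := h2 d dl x Sx hx; exists y => //; rewrite in_cons yl orbT.
  exists l'; split=> // in_cons /orP [/eqP ->|] x Sx hx.
    by case: hn; exists x.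
  exact: h2.
by exists l'; split=> // x Sx; have [c cl hc] := hl x Sx; exact: (h2 c cl x Sx hc).
Qed.
Lemma tb_or A B : tb A -> tb B -> tb (fun x => A x \/ B x).
Proof.
move=> hA hB e e0; have [l hl] := hA e e0; have [m hm] := hB e e0.
exists (l ++ m) => x [/hl|/hm] [y yl hy]; exists y => //; by rewrite mem_cat yl ?orbT.
Qed.
Lemma tb1 x : tb (fun y => y = x).
Proof.
by exists [:: x] => y ->; exists x; rewrite ?mem_head // subrr nrm0.
Qed.
Lemma tb_add A B : tb A -> tb B -> tb (fun z => exists x y, A x /\ B y /\ z = (x + y)%V).
Proof.
move=> hA hB e e0; have [l hl] := hA (e / 2) ltac:(lra); have [m hm] := hB (e / 2) ltac:(lra).
exists [seq (x + y)%V | x <- l, y <- m] => z [x [y [/hl [x' xl hx] [/hm [y' ym hy] ->]]]].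
exists (x' + y')%V; first exact: allpairs_f.
have -> : (x + y - (x' + y') = (x - x') + (y - y'))%V by vec.
by have := nrmD (x - x')%V (y - y')%V; lra.
Qed.
Lemma tb_bounded S : tb S -> exists M, 0 <= M /\ forall x, S x -> nrm x <= M.
Proof.
move=> /(_ 1 ltac:(lra)) [l hl].
have [M [M0 hM]] : exists M, 0 <= M /\ forall y, y \in l -> nrm y <= M.
  elim: l {hl} => [|c l [M [M0 hM]]]; first by exists 0.
  exists (M + nrm c); have c0 := nrm_ge0 c; split; first lra.
  by move=> in_cons /orP [/eqP ->|/hM]; lra.
exists (M + 1); split; first lra.
by move=> x /hl [y /hM h]; have := nrm_le x y; lra.
Qed.
End TB.

Lemma tb_lip (X Y : CBanach) (f : X -> Y) M (S : X -> Prop) :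
  (forall x y, nrm (f x - f y) <= M * nrm (x - y)) -> tb S ->
  tb (fun z => exists x, S x /\ z = f x).
Proof.
move=> hf hS e e0; have M0 : 0 < Rabs M + 1 by have := Rabs_pos M; lra.
have [l hl] := hS (e / (Rabs M + 1)) ltac:(pos).
exists [seq f x | x <- l] => z [x [/hl [y yl hy] ->]]; exists (f y); first exact: map_f.
apply: Rle_lt_trans (hf _ _) _.
apply: (Rle_lt_trans _ ((Rabs M + 1) * nrm (x - y)%V)).
  by apply: Rmult_le_compat_r; [pos|have := Rle_abs M; lra].
have -> : e = (Rabs M + 1) * (e / (Rabs M + 1)) by rfield; lra.
exact: Rmult_lt_compat_l.
Qed.

Section Cpt.
Variable X : CBanach.
Implicit Types a b T : BL X.
Definition cpt T : Prop := tb (fun y => exists x, nrm x <= 1 /\ y = T x).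

Lemma blip T x y : nrm (T x - T y) <= nrm T * nrm (x - y).
Proof. by rewrite -blB; apply: bnle. Qed.
Lemma nrm_unscale (x : X) M : 0 < M -> nrm x <= M -> nrm (rc (/ M) *: x) <= 1.
Proof.
move=> M0; have h := Rinv_0_lt_compat _ M0; rewrite nrmZ Cmod_rc; last lra.
have -> : 1 = / M * M by rewrite Rinv_l; lra.
mono.
Qed.
Lemma scaleKrc M (x : X) : M <> 0 -> (rc M *: (rc (/ M) *: x) = x)%V.
Proof. by move=> M0; rewrite scalerA -rcM Rinv_r // scale1r. Qed.
Lemma cpt_ball T M : cpt T -> tb (fun y => exists x, nrm x <= M /\ y = T x).
Proof.
move=> hT; pose N := Rabs M + 1; have N0 : 0 < N by have := Rabs_pos M; rewrite /N; lra.
have h : tb (fun z => exists y, (exists x, nrm x <= 1 /\ y = T x) /\ z = (rc N *: y)%V).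
  apply: tb_lip hT => x y; rewrite -scalerBr nrmZ; exact: Rle_refl.
apply: tb_mono h => y [x []]; exists (T (rc (/ N) *: x)%V); split.
  exists (rc (/ N) *: x)%V; split=> //; apply: nrm_unscale => //.
  by have := Rle_abs M; rewrite /N; lra.
by rewrite -blZ scaleKrc //; lra.
Qed.
Lemma cpt0 : cpt 0%V.
Proof. by apply: tb_mono (@tb1 X 0%V) => y [x []]. Qed.
Lemma cptD S T : cpt S -> cpt T -> cpt (S + T)%V.
Proof.
move=> hS hT; apply: tb_mono (tb_add hS hT) => y [x []]; exists (S x), (T x).
by split; [exists x|split; [exists x|]].
Qed.
Lemma cptMl S T : cpt T -> cpt (S * T)%V.
Proof.
move=> hT; apply: tb_mono (tb_lip (blip S) hT) => y [x []]; exists (T x).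
by split=> //; exists x.
Qed.
Lemma cptMr S T : cpt S -> cpt (S * T)%V.
Proof.
move=> hS; apply: tb_mono (cpt_ball (nrm T) hS) => y [x []]; exists (T x).
split=> //; via (bnle _ _); have := nrm_ge0 T; nra.
Qed.
Lemma cptZ c T : cpt T -> cpt (c *: T)%V.
Proof. by move=> hT; rewrite -[T]mul1r scalerAl; apply: cptMl. Qed.
Lemma cptN T : cpt T -> cpt (- T)%V.
Proof. by rewrite -scaleN1r; apply: cptZ. Qed.
Lemma cptB S T : cpt S -> cpt T -> cpt (S - T)%V.
Proof. by move=> hS hT; apply/cptD/cptN. Qed.
Lemma cpt_approx T : (forall e, 0 < e -> exists S, cpt S /\ nrm (T - S) < e) -> cpt T.
Proof.
move=> h; apply: tb_approx => e /h [S []].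
exists (fun y => exists x, nrm x <= 1 /\ y = S x); split=> // y [x [hx ->]].
exists (S x); split; first by exists x.
rewrite -blBE; apply: Rle_lt_trans (bnle _ _) _; have := nrm_ge0 (T - S)%V; nra.
Qed.
Lemma cpt_lim (u : nat -> BL X) T : (forall n, cpt (u n)) -> cvg u T -> cpt T.
Proof.
move=> hu hT; apply: cpt_approx => e /hT [N /(_ N (leqnn _))]; rewrite nrmC.
by exists (u N).
Qed.

(** Vala's theorem. Compactness of [b] reduces the unit ball to finitely many vectors [y], and
    compactness of [a] makes [a (T n y)] converge along a common subsequence for all of them. *)
Lemma vala a b M : cpt a -> cpt b ->
  tb (fun S => exists T : BL X, nrm T <= M /\ S = (a * T * b)%V).
Proof.
move=> ha hb; apply: tb_of_sep => u e hu e0.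
have [T hT] : exists T : nat -> BL X, forall n, nrm (T n) <= M /\ u n = (a * T n * b)%V.
  by exists (fun n => sval (cid (hu n))) => n; apply: (svalP (cid (hu n))).
have M0 : 0 <= M by have := (hT 0%N).1; have := nrm_ge0 (T 0%N); lra.
(* With radius [e / k] each of the two replacements of [b x] by [y] costs at most [e / 4], as does
   the Cauchy condition at [y]. *)
pose k := 4 * (nrm a * M + 1); have a0 := nrm_ge0.
have aM : 0 <= nrm a * M by pos.
have k0 : 0 < k by rewrite /k; lra.
have [l hl] := hb (e / k) ltac:(pos).
have [phi [hp hc]] : exists phi : nat -> nat, (forall n, (phi n < phi n.+1)%N) /\
    forall y, y \in l -> cauchy (fun n => a (T (phi n) y)).
  elim: l {hl} => [|y l [phi [hp hc]]]; first by exists id.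
  have [|psi [hpsi [z hz]]] := @tb_subseq X _ (fun n => a (T (phi n) y)) (cpt_ball (M * nrm y) ha).
    move=> n; exists (T (phi n) y); split=> //; via (bnle _ _).
    by apply: Rmult_le_compat_r; [pos|case: (hT (phi n))].
  exists (phi \o psi); split=> lra; first by apply: (incr_lt hp).
  rewrite in_cons => /orP [/eqP ->|/hc h e1 e10]; first exact: cvg_cauchy hz.
  have [N hN] := h e1 e10; exists N => m n hm hn.
  by apply: hN; [apply: leq_trans hm _|apply: leq_trans hn _]; apply: incr_ge.
have [N hN] : exists N, forall y, y \in l -> forall m n, (N <= m)%N -> (N <= n)%N ->
    nrm (a (T (phi m) y) - a (T (phi n) y))%V < e / 4.
  elim: l hc {hl} => [|y l IH] hc; first by exists 0%N.
  have [|N hN] := IH; first by move=> z zl; apply: hc; rewrite in_cons zl orbT.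
  have [N' hN'] := hc y (mem_head _ _) (e / 4) ltac:(lra).
  exists (N + N')%N => z; rewrite in_cons => /orP [/eqP ->|zl] m n hm hn; first by apply: hN'; lia.
  by apply: (hN z zl); lia.
exists (phi N), (phi N.+1); split=> //.
apply: (Rle_lt_trans _ (3 / 4 * e)); last lra.
apply: bn_bound1 => x hx; have [|y yl hy] := hl (b x); first by exists x.
have [hm em] := hT (phi N); have [hn en] := hT (phi N.+1).
rewrite em en blBE !blME.
have d (S : BL X) : nrm S <= M -> nrm (a (S (b x)) - a (S y))%V <= e / 4.
  move=> hS; rewrite -!blB; via (bnle _ _).
  mid (nrm a * (M * nrm (b x - y)%V)).
    apply: Rmult_le_compat_l => //; via (bnle _ _).
    mono; pos.
  rewrite -Rmult_assoc; mid (nrm a * M * (e / k)).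
    mono.
  have -> : e / 4 = (nrm a * M + 1) * (e / k) by rewrite /k; rfield; lra.
  mono.
have := d _ hm; have := d _ hn; have := hN y yl N.+1 N (leqnSn _) (leqnn _).
have := nrm_tri (a (T (phi N.+1) (b x))) (a (T (phi N.+1) y)) (a (T (phi N) (b x))).
have := nrm_tri (a (T (phi N.+1) y)) (a (T (phi N) y)) (a (T (phi N) (b x))).
by rewrite (nrmC (a (T (phi N) y))); lra.
Qed.
End Cpt.
(** * Neumann series, scalars as a Banach space, quotients *)

Lemma geo_le q n : 0 <= q -> q < 1 -> rsum (fun i => q ^ i) n <= / (1 - q).
Proof.
move=> q0 q1; have -> : rsum (fun i => q ^ i) n = (1 - q ^ n) / (1 - q).
  elim: n => [|n IH]; first by rewrite /=; lra.
  by rewrite [LHS]/= IH [q ^ n.+1]/=; rfield; lra.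
have h1 := pow_le q n; have h2 : 0 < / (1 - q) by pos.
nra.
Qed.
Lemma pow_small q e : 0 <= q -> q < 1 -> 0 < e -> exists N, forall n, (N <= n)%N -> q ^ n < e.
Proof.
move=> q0 q1 e0; have [|N hN] := pow_lt_1_zero q _ e e0; first by rewrite Rabs_pos_eq.
exists N => n /leP hn; have := hN n hn; rewrite Rabs_pos_eq; pos.
Qed.

Lemma inv_comm (A : pzRingType) (s a u : A) :
  (s * a = 1)%V -> (a * s = 1)%V -> (u * a = a * u)%V -> (u * s = s * u)%V.
Proof.
move=> h1 h2 h; rewrite -[LHS]mul1r -h1 -!mulrA; congr (_ _)%V.
by rewrite mulrA -h -mulrA h2 mulr1.
Qed.

Section Neumann.
Variable X : CBanach.
Implicit Types S T : BL X.
Lemma neumann T : nrm T < 1 -> exists S : BL X,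
  (S * (1 - T) = 1)%V /\ ((1 - T) * S = 1)%V /\ nrm S <= / (1 - nrm T) /\
  cvg (fun n => \sum_(i < n) T ^+ i)%V S.
Proof.
move=> h; have T0 := nrm_ge0 T.
have hb n : rsum (fun i => nrm (T ^+ i)%V) n <= / (1 - nrm T).
  apply: Rle_trans (geo_le n T0 h); apply: rsum_le => i _; exact: bnX.
have hs : @summ (BB X) (fun i => T ^+ i)%V by exists (/ (1 - nrm T)).
pose S := @ser (BB X) (fun i => T ^+ i)%V; exists S.
have [_ e] := ser_recl hs.
have [_ e1] := @bl_ser (BB X) (BB X) (fun U => (T * U)%V) _ (nrm T) (mulrDr T) (bnM T) hs.
have hr (U : BL X) : nrm (U * T)%V <= nrm T * nrm U by rewrite Rmult_comm; apply: bnM.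
have [_ e2] := @bl_ser (BB X) (BB X) (fun U => (U * T)%V) _ (nrm T)
  (fun x y => mulrDl x y T) hr hs.
have f1 : S = (1 + T * S)%V.
  rewrite {1}/S e -e1; congr (_ + ser _)%V; apply/funext; exact: exprS.
have f2 : S = (1 + S * T)%V.
  rewrite {1}/S e -e2; congr (_ + ser _)%V; apply/funext; exact: exprSr.
split; first by rewrite mulrBr mulr1 {1}f2 addrK.
split; first by rewrite mulrBl mul1r {1}f1 addrK.
by split; [exact: ser_le|exact: serP].
Qed.
End Neumann.

Lemma Cmod_tri (a b : C) : Cmod (a + b)%V <= Cmod a + Cmod b.
Proof.
have := CmodE a; have := CmodE b; have := CmodE (a + b)%V.
have := Cmod_ge0 a; have := Cmod_ge0 b; have := Cmod_ge0 (a + b)%V.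
case: a => a1 a2; case: b => b1 b2 /=.
set x := Cmod _; set y := Cmod _; set z := Cmod _ => hx hy hz ex ey ez.
pose p := a1 * b1 + a2 * b2; pose d := a1 * b2 - a2 * b1.
have e : p * p + d * d = (z * y) * (z * y).
  rewrite (_ : z * y * (z * y) = (z * z) * (y * y)); last by rring.
  by rewrite ez ey /p /d; rring.
have hzy : 0 <= z * y by pos.
have hp : p <= z * y by pos.
rewrite /p in hp; nra.
Qed.
Lemma fst_le (a : C) : Rabs (fst a) <= Cmod a.
Proof.
have h := CmodE a; have h0 := Cmod_ge0 a.
by apply: Rabs_le; nra.
Qed.
Lemma snd_le (a : C) : Rabs (snd a) <= Cmod a.
Proof.
have h := CmodE a; have h0 := Cmod_ge0 a.
by apply: Rabs_le; nra.
Qed.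
Lemma Cmod_le (a : C) : Cmod a <= Rabs (fst a) + Rabs (snd a).
Proof.
have h := CmodE a.
have h1 := Rabs_pos (fst a); have h2 := Rabs_pos (snd a).
have e1 : Rabs (fst a) * Rabs (fst a) = fst a ^ 2 by rewrite -Rabs_mult Rabs_pos_eq; nra.
have e2 : Rabs (snd a) * Rabs (snd a) = snd a ^ 2 by rewrite -Rabs_mult Rabs_pos_eq; nra.
apply: Rnot_lt_le; nra.
Qed.

Definition CC : CBanach.
refine (@Build_CBanach C (fun a b => (a + b)%V) 0%V (fun a => (- a)%V) (fun a b => (a * b)%V) Cmod
  _ _ _ _ _ _ _ _ _ _ _ _).
- exact: addrA.
- exact: addrC.
- exact: addr0.
- exact: addrN.
- exact: mul1r.
- exact: mulrA.
- exact: mulrDr.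
- move=> a b c; exact: mulrDl.
- exact: Cmod_eq0.
- exact: Cmod_tri.
- exact: CmodM.
move=> u hu.
have [x hx] : exists l, Un_cv (fun n => fst (u n)) l.
  have [|l hl] := R_complete (fun n => fst (u n)); last by exists l.
  move=> e /hu [N hN]; exists N => n m hn hm; apply: Rle_lt_trans (hN n m hn hm).
  exact: (fst_le (u n - u m)%V).
have [y hy] : exists l, Un_cv (fun n => snd (u n)) l.
  have [|l hl] := R_complete (fun n => snd (u n)); last by exists l.
  move=> e /hu [N hN]; exists N => n m hn hm; apply: Rle_lt_trans (hN n m hn hm).
  exact: (snd_le (u n - u m)%V).
exists (x, y) => e e0; have [N hN] := hx (e / 2) ltac:(lra); have [M hM] := hy (e / 2) ltac:(lra).
exists (N + M)%coq_nat => n hn; apply: Rle_lt_trans (Cmod_le _) _.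
have := hN n ltac:(lia); have := hM n ltac:(lia); rewrite /Rdist /=.
rewrite -[fst _ + - _]/(fst (u n) - x) -[snd _ + - _]/(snd (u n) - y); lra.
Defined.

Lemma nat_floor x N : 0 <= x -> x < INR N -> exists k, (k < N)%N /\ INR k <= x < INR k + 1.
Proof.
move=> x0; elim: N => [|N IH]; first by rewrite /=; lra.
rewrite S_INR; have [h1|] := Rlt_le_dec x (INR N).
  by have [k []] := IH h1; exists k; mono.
by exists N.
Qed.
Lemma tb_CC M : @tb CC (fun z => Cmod z <= M).
Proof.
move=> e e0; pose d := e / 2; have d0 : 0 < d by rewrite /d; lra.
have [|M0] := Rlt_le_dec M 0.
  by exists [::] => x; have := Cmod_ge0 x; lra.
have [N hN] : exists N, (M + M) / d < INR N.
  have := archimed ((M + M) / d) => -[h _]; exists (Z.to_nat (up ((M + M) / d))).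
  rewrite INR_IZR_INZ Znat.Z2Nat.id //; apply: le_IZR; apply: Rlt_le.
  apply: Rle_lt_trans h; pos.
have net t : Rabs t <= M -> exists k, (k < N)%N /\ Rabs (t - (INR k * d - M)) < d.
  move=> ht; have ht' : - M <= t <= M by move: ht; rewrite /Rabs; case: Rcase_abs; lra.
  have [||k []] := @nat_floor ((t + M) / d) N.
  pos.
  apply: Rle_lt_trans hN; apply: Rmult_le_compat_r; last lra.
    pos.
  exists k; split=> //.
  have e1 : t + M = (t + M) / d * d by rfield; lra.
  have h1 : INR k * d <= (t + M) / d * d by mono.
  have h2 : (t + M) / d * d < (INR k + 1) * d by apply: Rmult_lt_compat_r; lra.
  by apply: Rabs_def1; lra.
exists [seq ((INR p * d - M, INR q * d - M) : CC) | p <- iota 0 N, q <- iota 0 N] => x hx.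
have [p [hp h1]] := net (fst x) (Rle_trans _ _ _ (fst_le x) hx).
have [q [hq h2]] := net (snd x) (Rle_trans _ _ _ (snd_le x) hx).
exists (INR p * d - M, INR q * d - M).
  by apply: (@allpairs_f _ _ _ (fun p q => (INR p * d - M, INR q * d - M) : CC)); rewrite mem_iota.
apply: Rle_lt_trans (Cmod_le _) _.
by rewrite /= -/(Rminus _ _) -/(Rminus (snd x) _); rewrite /d in h1 h2 *; lra.
Qed.

(** * Closed subspaces and their quotients *)

Section Sub.
Variable X : CBanach.
Implicit Types (x y : X) (V : X -> Prop).
Definition lsub V : Prop :=
  V 0%V /\ (forall x y, V x -> V y -> V (x + y)%V) /\ (forall c x, V x -> V (c *: x)%V).
Definition csub V : Prop := lsub V /\ (forall u l, (forall n, V (u n)) -> cvg u l -> V l).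
Lemma lsub0 V : lsub V -> V 0%V. Proof. by case. Qed.
Lemma lsubD V x y : lsub V -> V x -> V y -> V (x + y)%V. Proof. by case=> _ []; mono. Qed.
Lemma lsubZ V c x : lsub V -> V x -> V (c *: x)%V. Proof. by case=> _ []; mono. Qed.
Lemma lsubN V x : lsub V -> V x -> V (- x)%V. Proof. by rewrite -scaleN1r; apply: lsubZ. Qed.
Lemma lsubB V x y : lsub V -> V x -> V y -> V (x - y)%V.
Proof. by move=> h hx hy; apply: lsubD => //; apply: lsubN. Qed.
Lemma lsub_sum V I (r : seq I) (P : pred I) (F : I -> X) : lsub V ->
  (forall i, P i -> V (F i)) -> V (\sum_(i <- r | P i) F i)%V.
Proof.
by move=> hV h; elim/big_ind: _ => //; [exact: lsub0|move=> x y; exact: lsubD].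
Qed.
Lemma csub_cvg V u l : csub V -> (forall n, V (u n)) -> cvg u l -> V l.
Proof. by case=> _ h; apply: h. Qed.
Definition cl V : X -> Prop := fun x => forall e, 0 < e -> exists y, V y /\ nrm (x - y) < e.
Lemma cl_incl V x : V x -> cl V x.
Proof. by exists x; rewrite subrr nrm0. Qed.
Lemma cl_seq V x : cl V x -> exists u, (forall n, V (u n)) /\ cvg u x.
Proof.
move=> h; have hn n := h _ (inv_pos n).
exists (fun n => sval (cid (hn n))); split=> [n|]; first by case: (cid (hn n)) => y [].
apply: (@cvg_dom _ _ _ (fun n => / INR n.+1)) => [n|e /archi_inv //].
by case: (cid (hn n)) => y [] /=; rewrite nrmC; left.
Qed.
Lemma cl_sub V W : csub W -> (forall x, V x -> W x) -> forall x, cl V x -> W x.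
Proof. by move=> hW h x /cl_seq [u [hu hx]]; apply: (csub_cvg hW _ hx); mono. Qed.
Lemma cvg_cl V u l : (forall n, cl V (u n)) -> cvg u l -> cl V l.
Proof.
move=> hu hl e e0; have [N hN] := hl (e / 2) ltac:(lra).
have [y []] := hu N (e / 2) ltac:(lra); exists y; split=> //.
by have := hN N (leqnn _); rewrite nrmC; have := nrm_tri l (u N) y; lra.
Qed.
Lemma cl_csub V : lsub V -> csub (cl V).
Proof.
split; last exact: cvg_cl.
split; first by apply: cl_incl; exact: lsub0.
split=> [x y hx hy e e0|c x hx e e0].
  have [x' []] := hx (e / 2) ltac:(lra); have [y' []] := hy (e / 2) ltac:(lra).
  exists (x' + y')%V; split; first exact: lsubD.
  by rewrite opprD addrACA; have := nrmD (x - x')%V (y - y')%V; vlra.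
have c1 : 0 < Cmod c + 1 by have := Cmod_ge0 c; lra.
have [x' []] := hx (e / (Cmod c + 1)) ltac:(pos).
exists (c *: x')%V; split; first exact: lsubZ.
rewrite -scalerBr nrmZ.
apply: (Rle_lt_trans _ ((Cmod c + 1) * nrm (x - x')%V)).
  mono; pos.
have -> : e = (Cmod c + 1) * (e / (Cmod c + 1)) by rfield; lra.
by apply: Rmult_lt_compat_l.
Qed.
Lemma csub0 : csub (fun x => x = 0%V).
Proof.
split; first by split=> //; split=> [x y -> ->|c x ->]; rewrite ?addr0 ?scaler0.
by move=> u l hu hl; apply: (cvg_uniq hl); apply: cvg_eq (cvg_cst _).
Qed.
Lemma csubT : csub (fun x => True). Proof. by []. Qed.
Lemma csub_cap (I : Type) (F : I -> X -> Prop) : (forall i, csub (F i)) ->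
  csub (fun x => forall i, F i x).
Proof.
move=> h; split.
  split=> [i|]; first exact: lsub0 (proj1 (h i)).
  by split=> [x y hx hy i|c x hx i]; [apply: lsubD (proj1 (h i)) _ _|apply: lsubZ (proj1 (h i)) _].
by move=> u l hu hl i; apply: (csub_cvg (h i) _ hl).
Qed.
End Sub.
Lemma csub_pre (X Y : CBanach) (f : X -> Y) M (V : Y -> Prop) :
  (forall x y, f (x + y)%V = (f x + f y)%V) -> (forall c x, f (c *: x)%V = (c *: f x)%V) ->
  (forall x, nrm (f x) <= M * nrm x) -> csub V -> csub (fun x => V (f x)).
Proof.
move=> fD fZ fM [hV hc]; split.
  split; first by rewrite -(scale0r 0%V) fZ scale0r; exact: lsub0.
  by split=> [x hy|c hx]; rewrite ?fD ?fZ; [exact: lsubD|exact: lsubZ].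
move=> u l hu hl; apply: (hc (fun n => f (u n))) => // e e0.
apply: (@cvg_lip X Y f M _ _ _ hl e e0) => x y.
by rewrite -(scaleN1r (f y)) -fZ -fD scaleN1r.
Qed.
Lemma csub_preB (X : CBanach) (T : BL X) V : csub V -> csub (fun x => V (T x)).
Proof. by apply: csub_pre (blD T) (blZ T) (bnle T). Qed.

Lemma glb_ex (E : R -> Prop) : (exists r, E r) -> (forall r, E r -> 0 <= r) ->
  exists m, is_glb E m.
Proof.
move=> [r hr] h0; have [||m [h1 h2]] := completeness (fun r => E (- r)).
exists 0 => x /h0; lra.
by exists (- r); rewrite Ropp_involutive.
exists (- m); split=> [x hx|b hb].
  by have := h1 (- x); rewrite Ropp_involutive => /(_ hx); lra.
by have := h2 (- b); have h : is_upper_bound (fun r => E (- r)) (- b) by [move=> x /hb; lra];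
   move=> /(_ h); lra.
Qed.

(** The quotient [hi / lo]. It covers closed subspaces (with [lo] zero), quotients, and gaps of
    chains at once. *)
Record spair (X : CBanach) := SPair {
  hi : X -> Prop; lo : X -> Prop; hiP : csub hi; loP : csub lo;
  lohi : forall x, lo x -> hi x }.

Section Quot.
Variables (X : CBanach) (p : spair X).
Local Notation hi := (hi p).
Local Notation lo := (lo p).
Definition qT := {A : X -> Prop | exists2 z, hi z & A = fun w => lo (w - z)%V}.
Definition qcl (z : X) : X -> Prop := fun w => lo (w - z)%V.
Definition hi0 : hi 0%V := lsub0 (proj1 (hiP p)).
(** Classes are sets of vectors, so equal classes are Leibniz equal. Outside [hi] the class of [0]
    is a default value, which makes the projection total but linear on [hi] only. *)
Definition qpi (x : X) : qT :=
  if pselect (hi x) is left h then exist _ (qcl x) (ex_intro2 _ _ x h erefl)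
  else exist _ (qcl 0%V) (ex_intro2 _ _ 0%V hi0 erefl).
Lemma qpi_ex q : exists x, hi x /\ qpi x = q.
Proof.
case: q => A [z hz e]; subst; exists z; rewrite /qpi.
by case: pselect => h; rewrite (Prop_irrelevance hz).
Qed.
Lemma qT_eq (a b : qT) : sval a = sval b -> a = b.
Proof. by apply: eq_sig_hprop. Qed.
Lemma qpiV x : hi x -> sval (qpi x) = qcl x.
Proof. by rewrite /qpi; case: pselect. Qed.
Let hlo := proj1 (loP p).
Let hhi := proj1 (hiP p).
Lemma qpiE x y : hi x -> hi y -> (qpi x = qpi y <-> lo (x - y)%V).
Proof.
split=> [/(congr1 sval)|h].
  rewrite !qpiV // => /(congr1 (fun A => A x)); rewrite /qcl subrr => <-; exact: lsub0.
apply: qT_eq; rewrite !qpiV //; apply/funext => w; apply/propext; rewrite /qcl; split=> hw.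
  by rewrite (_ : w - y = (w - x) + (x - y))%V; [apply: lsubD|vec].
by rewrite (_ : w - x = (w - y) - (x - y))%V; [apply: lsubB|vec].
Qed.
Definition qrep q := sval (cid (qpi_ex q)).
Lemma qrepP q : hi (qrep q) /\ qpi (qrep q) = q.
Proof. exact: (svalP (cid (qpi_ex q))). Qed.
Definition qadd a b := qpi (qrep a + qrep b)%V.
Definition qopp a := qpi (- qrep a)%V.
Definition qscal c a := qpi (c *: qrep a)%V.
Definition qnrm q :=
  ClassicalEpsilon.epsilon (inhabits 0) (is_glb (fun r => exists w, hi w /\ qpi w = q /\ r = nrm w)).
Lemma qpiD x y : hi x -> hi y -> qadd (qpi x) (qpi y) = qpi (x + y)%V.
Proof.
move=> hx hy; have [h1 h2] := qrepP (qpi x); have [h3 h4] := qrepP (qpi y).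
apply/qpiE; try exact: lsubD.
rewrite opprD addrACA; apply: lsubD => //; exact/qpiE.
Qed.
Lemma qpiN x : hi x -> qopp (qpi x) = qpi (- x)%V.
Proof.
move=> hx; have [h1 h2] := qrepP (qpi x); apply/qpiE; try exact: lsubN.
by rewrite -opprD; apply: lsubN => //; exact/qpiE.
Qed.
Lemma qpiZ c x : hi x -> qscal c (qpi x) = qpi (c *: x)%V.
Proof.
move=> hx; have [h1 h2] := qrepP (qpi x); apply/qpiE; try exact: lsubZ.
by rewrite -scalerBr; apply: lsubZ => //; exact/qpiE.
Qed.
Lemma qnrmP q : is_glb (fun r => exists w, hi w /\ qpi w = q /\ r = nrm w) (qnrm q).
Proof.
apply: ClassicalEpsilon.epsilon_spec; apply: glb_ex => [|r [w [_ [_ ->]]]]; last pos.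
by have [x []] := qpi_ex q; exists (nrm x), x.
Qed.
Lemma qnrm_le w : hi w -> qnrm (qpi w) <= nrm w.
Proof. by move=> hw; have [h _] := qnrmP (qpi w); apply: h; exists w. Qed.
Lemma qnrm_ge0 q : 0 <= qnrm q.
Proof. by have [_ h] := qnrmP q; apply: h => r [w [_ [_ ->]]]; pos. Qed.
Lemma qnrm_wit q e : 0 < e -> exists w, hi w /\ qpi w = q /\ nrm w < qnrm q + e.
Proof.
apply: contrapT => hn; have [_ h] := qnrmP q.
have : qnrm q + e <= qnrm q; last lra.
apply: h => r [w [h1 [h2 ->]]]; apply: Rnot_lt_le => h3; apply: hn; by exists w.
Qed.
Lemma qnrm_tri a b : qnrm (qadd a b) <= qnrm a + qnrm b.
Proof.
apply: le_epsilon => e e0; have e2 : 0 < e / 2 by lra.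
have [x [hx [<- ex]]] := qnrm_wit a e2; have [y [hy [<- ey]]] := qnrm_wit b e2.
rewrite qpiD //; via (qnrm_le (lsubD hhi hx hy)).
by have := nrmD x y; lra.
Qed.
Lemma qnrm_scal_le c a : qnrm (qscal c a) <= Cmod c * qnrm a.
Proof.
apply: le_epsilon => e e0; have c0 := Cmod_ge0 c.
have [|x [hx [<- ex]]] := @qnrm_wit a (e / (Cmod c + 1)); first pos.
rewrite qpiZ //; via (qnrm_le (lsubZ _ hhi hx)); rewrite nrmZ.
mid (Cmod c * (qnrm (qpi x) + e / (Cmod c + 1))).
  mono.
rewrite Rmult_plus_distr_l; apply: Rplus_le_compat_l.
rewrite {2}(_ : e = (Cmod c + 1) * (e / (Cmod c + 1))); last by rfield; lra.
apply: Rmult_le_compat_r; last lra.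
pos.
Qed.
Lemma qnrm_scal c a : qnrm (qscal c a) = Cmod c * qnrm a.
Proof.
apply: Rle_antisym; first exact: qnrm_scal_le.
have [->|/eqP c0] := EM (c = 0%V).
  by rewrite Cmod0 Rmult_0_l; apply: qnrm_ge0.
have cp : 0 < Cmod c by apply: Cmod_gt0; apply/eqP.
have := qnrm_scal_le (c^-1)%V (qscal c a).
have -> : qscal (c^-1)%V (qscal c a) = a.
  have [x [hx <-]] := qpi_ex a; rewrite !qpiZ //; last exact: lsubZ.
  by rewrite scalerA mulVf // scale1r.
rewrite CmodV; last exact/eqP.
move=> h; have h2 : Cmod c * qnrm a <= Cmod c * (/ Cmod c * qnrm (qscal c a)).
  mono.
by via h2; rewrite -Rmult_assoc Rinv_r; lra.
Qed.
Lemma qnrm_eq0 a : qnrm a = 0 -> a = qpi 0%V.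
Proof.
move=> h; have [x [hx ex]] := qpi_ex a; rewrite -ex; apply/qpiE => //; first exact: hi0.
rewrite subr0; have wit n : exists w, lo w /\ nrm (w - x)%V <= / INR n.+1.
  have [w [hw [ew nw]]] := qnrm_wit a (inv_pos n); exists (x - w)%V; split.
    by apply/qpiE => //; rewrite ew.
  rewrite (_ : x - w - x = - w)%V; last by vec.
  by rewrite nrmN; lra.
apply: (csub_cvg (loP p) (fun n => proj1 (svalP (cid (wit n))))).
apply: (@cvg_dom _ _ _ (fun n => / INR n.+1)) => [n|e /archi_inv //].
by case: (svalP (cid (wit n))).
Qed.
Lemma qaddA a b c : qadd a (qadd b c) = qadd (qadd a b) c.
Proof.
have [x [hx <-]] := qpi_ex a; have [y [hy <-]] := qpi_ex b; have [z [hz <-]] := qpi_ex c.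
by rewrite !qpiD ?addrA //; apply: lsubD.
Qed.
Lemma qaddC a b : qadd a b = qadd b a. Proof. by rewrite /qadd addrC. Qed.
Lemma qadd0 a : qadd a (qpi 0%V) = a.
Proof. by have [x [hx <-]] := qpi_ex a; rewrite qpiD ?addr0 //; apply: hi0. Qed.
Lemma qaddN a : qadd a (qopp a) = qpi 0%V.
Proof. by have [x [hx <-]] := qpi_ex a; rewrite qpiN // qpiD ?addrN //; apply: lsubN. Qed.
Lemma qscal1 a : qscal 1%V a = a.
Proof. by have [x [hx <-]] := qpi_ex a; rewrite qpiZ // scale1r. Qed.
Lemma qscalA c d a : qscal c (qscal d a) = qscal (c * d)%V a.
Proof. by have [x [hx <-]] := qpi_ex a; rewrite !qpiZ ?scalerA //; apply: lsubZ. Qed.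
Lemma qscalDr c a b : qscal c (qadd a b) = qadd (qscal c a) (qscal c b).
Proof.
have [x [hx <-]] := qpi_ex a; have [y [hy <-]] := qpi_ex b.
rewrite qpiD // !qpiZ //; last exact: lsubD.
by rewrite qpiD ?scalerDr //; apply: lsubZ.
Qed.
Lemma qscalDl c d a : qscal (c + d)%V a = qadd (qscal c a) (qscal d a).
Proof.
by have [x [hx <-]] := qpi_ex a; rewrite !qpiZ // qpiD ?scalerDl //; apply: lsubZ.
Qed.
Let qd a b := qnrm (qadd a (qopp b)).
Lemma qd_tri a b c : qd a c <= qd a b + qd b c.
Proof.
apply: Rle_trans (qnrm_tri _ _); right.
by rewrite -qaddA (qaddA (qopp b)) (qaddC (qopp b)) qaddN (qaddC (qpi _)) qadd0.
Qed.
Lemma qd_pi x y : hi x -> hi y -> qd (qpi x) (qpi y) <= nrm (x - y).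
Proof.
move=> h1 h2; rewrite /qd qpiN // qpiD //; last exact: lsubN.
by apply: qnrm_le; apply: lsubB.
Qed.
(** Along a fast subsequence the increments lift to vectors with geometrically decreasing norms;
    their series converges in [X], and its sum projects to the limit. *)
Lemma q_complete (u : nat -> qT) :
  (forall eps, 0 < eps -> exists N, forall m n, (N <= m)%coq_nat -> (N <= n)%coq_nat ->
      qnrm (qadd (u m) (qopp (u n))) < eps) ->
  exists l, forall eps, 0 < eps -> exists N, forall n, (N <= n)%coq_nat ->
      qnrm (qadd (u n) (qopp l)) < eps.
Proof.
move=> hu; have h2 k : 0 < (1 / 2) ^ k by pos.
have /choice [M hM] k : exists M, forall m n, (M <= m)%coq_nat -> (M <= n)%coq_nat -> qd (u m) (u n) < (1 / 2) ^ k.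
  by have [M hM] := hu _ (h2 k); exists M.
(* Summing the thresholds makes [N k] and [N k.+1] both at least [M k]. *)
pose N k := (\sum_(i < k.+1) M i)%N.
have NM k : (M k <= N k)%N by rewrite /N big_ord_recr /= leq_addl.
have NS k : (M k <= N k.+1)%N by apply: leq_trans (NM k) _; rewrite /N [X in (_ <= X)%N]big_ord_recr leq_addr.
pose v k := u (N k).
have hv k : qd (v k.+1) (v k) < (1 / 2) ^ k by apply: hM; apply/leP.
have /choice [d hd] k : exists d, hi d /\ qpi d = qadd (v k.+1) (qopp (v k)) /\ nrm d <= (1 / 2) ^ k.
  have [|w [h3 [h4 h5]]] := @qnrm_wit (qadd (v k.+1) (qopp (v k))) ((1 / 2) ^ k - qd (v k.+1) (v k)).
    by have := hv k; lra.
  by exists w; rewrite /qd in h5; do 2 (split=> //); lra.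
have [x0 [hx0 e0]] := qpi_ex (v 0%N).
have [|s hs] := @summ_cvg X d.
  apply: (@summ_le _ _ (fun k => (1 / 2) ^ k)) => [k|]; first by case: (hd k) => _ [].
  by exists (/ (1 - 1 / 2)) => n; apply: geo_le; lra.
pose w n := (x0 + \sum_(i < n) d i)%V.
have hw n : hi (w n) by apply: lsubD => //; apply: lsub_sum => // i _; case: (hd i).
have ew n : qpi (w n) = v n.
  elim: n => [|n IH]; first by rewrite /w big_ord0 addr0.
  have [h3 [h4 _]] := hd n.
  rewrite /w big_ord_recr /= addrA -qpiD //; last exact: hw.
  by rewrite -/(w n) IH h4 qaddC -qaddA (qaddC (qopp _)) qaddN qadd0.
have hl : cvg w (x0 + s)%V by apply: cvgD => //; apply: cvg_cst.
have hil : hi (x0 + s)%V by apply: (csub_cvg (hiP p) hw hl).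
exists (qpi (x0 + s)%V) => e e1.
have [N1 h1] := hl (e / 2) ltac:(lra).
have [N2 hN2] : exists N2, forall n, (N2 <= n)%N -> (1 / 2) ^ n < e / 2 by apply: pow_small; lra.
pose k := (N1 + N2)%N; exists (N k) => n hn.
apply: Rle_lt_trans (qd_tri _ (v k) _) _.
have : qd (u n) (v k) < (1 / 2) ^ k by apply: hM; [apply: Nat.le_trans hn; exact/leP|exact/leP].
have := hN2 k ltac:(rewrite /k; lia); have := h1 k ltac:(rewrite /k; lia).
have := qd_pi (hw k) hil; rewrite ew; vlra.
Qed.
Definition qsp : CBanach :=
  @Build_CBanach qT qadd (qpi 0%V) qopp qscal qnrm qaddA qaddC qadd0 qaddN qscal1 qscalA qscalDr
    qscalDl qnrm_eq0 qnrm_tri qnrm_scal q_complete.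
Definition pi (x : X) : qsp := qpi x.
Implicit Types x y z : X.
Lemma pi_ex (q : qsp) : exists x, hi x /\ pi x = q. Proof. exact: qpi_ex. Qed.
Lemma piD x y : hi x -> hi y -> pi (x + y)%V = (pi x + pi y)%V.
Proof. by move=> h1 h2; rewrite /pi -qpiD. Qed.
Lemma piZ c x : hi x -> pi (c *: x)%V = (c *: pi x)%V.
Proof. by move=> h1; rewrite /pi -qpiZ. Qed.
Lemma piN x : hi x -> pi (- x)%V = (- pi x)%V.
Proof. by move=> h1; rewrite /pi -qpiN. Qed.
Lemma piB x y : hi x -> hi y -> pi (x - y)%V = (pi x - pi y)%V.
Proof. by move=> h1 h2; rewrite piD ?piN //; apply: lsubN. Qed.
Lemma pi0 : pi 0%V = 0%V. Proof. by []. Qed.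
Lemma pi_eq0 x : hi x -> (pi x = 0%V <-> lo x).
Proof. by move=> h1; rewrite -[X in _ = X]pi0 qpiE ?subr0 //; apply: hi0. Qed.
Lemma pi_le x : hi x -> nrm (pi x) <= nrm x. Proof. exact: qnrm_le. Qed.
Lemma pi_wit (q : qsp) e : 0 < e -> exists x, hi x /\ pi x = q /\ nrm x < nrm q + e.
Proof. exact: qnrm_wit. Qed.
Lemma pi_cvg (u : nat -> X) l : (forall n, hi (u n)) -> cvg u l -> cvg (fun n => pi (u n)) (pi l).
Proof.
move=> hu hl; have hil := csub_cvg (hiP p) hu hl.
move=> e /hl [N hN]; exists N => n /hN; rewrite -piB //.
by apply: Rle_lt_trans; apply: pi_le; apply: lsubB.
Qed.

Definition stab (T : BL X) : Prop := (forall x, hi x -> hi (T x)) /\ (forall x, lo x -> lo (T x)).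
Definition indf (T : BL X) (q : qsp) : qsp := pi (T (qrep q)).
Lemma indfE T x : stab T -> hi x -> indf T (pi x) = pi (T x).
Proof.
move=> [h1 h2] hx; have [h3 h4] := qrepP (pi x).
apply/qpiE; try mono.
by rewrite -blB; apply: h2; apply/qpiE.
Qed.
Lemma indP T : stab T -> linear (indf T) /\ bounded (indf T).
Proof.
move=> hT; have h1 := hT.1; split.
  split=> [a b|c a].
    have [x [hx <-]] := pi_ex a; have [y [hy <-]] := pi_ex b.
    rewrite -[vadd _ _ _]/(pi x + pi y)%V -piD // !indfE //; last exact: lsubD.
    by rewrite blD piD; auto.
  have [x [hx <-]] := pi_ex a.
  rewrite -[vscal _ _ _]/(c *: pi x)%V -piZ // !indfE //; last exact: lsubZ.
  by rewrite blZ piZ; auto.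
exists (nrm T) => a; apply: le_epsilon => e e0.
have T0 := nrm_ge0 T.
have [|x [hx [<- ex]]] := @pi_wit a (e / (nrm T + 1)); first pos.
rewrite indfE //; via (pi_le (h1 _ hx)); via (bnle T x).
mid (nrm T * (nrm (pi x) + e / (nrm T + 1))).
  mono.
rewrite Rmult_plus_distr_l; apply: Rplus_le_compat_l.
rewrite {2}(_ : e = (nrm T + 1) * (e / (nrm T + 1))); last by rfield; lra.
apply: Rmult_le_compat_r; last lra.
pos.
Qed.
(** Zero is the default for operators that do not preserve the pair. *)
Definition ind (T : BL X) : BL qsp :=
  if pselect (stab T) is left h then BLmk (indP h) else 0%V.
Lemma indE T x : stab T -> hi x -> ind T (pi x) = pi (T x).
Proof. rewrite /ind; case: pselect => // h; apply: indfE. Qed.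
Lemma nrm_ind T : nrm (ind T) <= nrm T.
Proof.
rewrite /ind; case: pselect => [h|]; last by rewrite nrm0; pos.
have T0 := nrm_ge0 T; apply: bn_bound => // a.
apply: le_epsilon => e e0.
have [|x [hx [<- ex]]] := @pi_wit a (e / (nrm T + 1)); first pos.
have -> : BLmk (indP h) (pi x) = pi (T x) by exact: indfE.
via (pi_le (h.1 _ hx)); via (bnle T x).
mid (nrm T * (nrm (pi x) + e / (nrm T + 1))).
  mono.
rewrite Rmult_plus_distr_l; apply: Rplus_le_compat_l.
rewrite {2}(_ : e = (nrm T + 1) * (e / (nrm T + 1))); last by rfield; lra.
apply: Rmult_le_compat_r; last lra.
pos.
Qed.
Lemma stabD S T : stab S -> stab T -> stab (S + T)%V.
Proof.
by move=> [h1 h2] []; split=> x hx; apply: lsubD; auto.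
Qed.
Lemma stabZ c T : stab T -> stab (c *: T)%V.
Proof. by move=> []; split=> x hx; apply: lsubZ; auto. Qed.
Lemma stabM S T : stab S -> stab T -> stab (S * T)%V.
Proof. by move=> [h1 h2] []; split=> x; rewrite blME; auto. Qed.
Lemma stab1 : stab 1%V. Proof. by []. Qed.
Lemma stab0 : stab 0%V. Proof. by split=> x _; apply: lsub0. Qed.
Lemma stabN T : stab T -> stab (- T)%V. Proof. by rewrite -scaleN1r; apply: stabZ. Qed.
Lemma stabB S T : stab S -> stab T -> stab (S - T)%V.
Proof. by move=> h1 h2; apply: stabD => //; apply: stabN. Qed.
Lemma stabX T n : stab T -> stab (T ^+ n)%V.
Proof. by move=> h; elim: n => [|n IH]; [|rewrite exprS; apply: stabM]. Qed.
Lemma ind_ext (S : BL qsp) T : stab T -> (forall x, hi x -> S (pi x) = pi (T x)) -> ind T = S.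
Proof.
move=> hT h; apply: BLext => q; have [x [hx <-]] := pi_ex q; by rewrite indE // h.
Qed.
Lemma indD S T : stab S -> stab T -> ind (S + T)%V = (ind S + ind T)%V.
Proof.
move=> h1 h2; apply: ind_ext => [|x hx]; first exact: stabD.
by rewrite !blE !indE // piD //; [apply: h1.1|apply: h2.1].
Qed.
Lemma indM S T : stab S -> stab T -> ind (S * T)%V = (ind S * ind T)%V.
Proof.
move=> h1 h2; apply: ind_ext => [|x hx]; first exact: stabM.
by rewrite !blE !indE //; apply: h2.1.
Qed.
Lemma indZ c T : stab T -> ind (c *: T)%V = (c *: ind T)%V.
Proof.
move=> h1; apply: ind_ext => [|x hx]; first exact: stabZ.
by rewrite !blE !indE // piZ //; apply: h1.1.
Qed.
Lemma indN T : stab T -> ind (- T)%V = (- ind T)%V.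
Proof. by move=> h; rewrite -scaleN1r indZ // scaleN1r. Qed.
Lemma indB S T : stab S -> stab T -> ind (S - T)%V = (ind S - ind T)%V.
Proof. by move=> h1 h2; rewrite indD ?indN //; apply: stabN. Qed.
Lemma ind1 : ind 1%V = 1%V. Proof. by apply: ind_ext. Qed.
Lemma indX T n : stab T -> ind (T ^+ n)%V = (ind T ^+ n)%V.
Proof.
move=> h; elim: n => [|n IH]; first by rewrite ind1.
by rewrite !exprS indM ?IH //; apply: stabX.
Qed.
Lemma cpt_ind T : cpt T -> cpt (ind T).
Proof.
rewrite /ind; case: pselect => [h hT|_ _]; last exact: cpt0.
(* A class of norm at most [1] lifts to a vector of norm below [2]. The net lies in the image of
   [hi], where [pi] is additive. *)
move=> e e0; have [l [hl1 hl2]] := tb_net (tb_mono (A := fun y => exists x, hi x /\ nrm x <= 2 /\ y = T x)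
  (fun y hy => let: ex_intro x (conj _ (conj h1 h2)) := hy in ex_intro _ x (conj h1 h2)) (cpt_ball 2 hT)) e0.
exists [seq pi y | y <- l] => q [a [ha ->]].
have [|x [hx [ex nx]]] := @pi_wit a 1; first lra.
have [|y yl hy] := hl2 (T x); first by exists x; do 2 (split=> //); lra.
exists (pi y); first exact: map_f.
have [z [hz [_ ez]]] := hl1 y yl.
rewrite -ex -[BLmk _ _]/(indf T (pi x)) indfE // -piB; last 2 first.
exact: h.1.
by rewrite ez; apply: h.1.
by apply: Rle_lt_trans hy; apply: pi_le; rewrite ez; apply: lsubB => //; apply: h.1.
Qed.
(* Closed subspaces of the quotient correspond to closed subspaces between [lo] and [hi]. *)
Definition lift (S : qsp -> Prop) x : Prop := hi x /\ S (pi x).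
Lemma lift_csub S : csub S -> csub (lift S).
Proof.
move=> hS; have hS1 := hS.1; split.
  split; first by split; [exact: hi0|rewrite pi0; exact: lsub0].
  split=> [x y [h1 h2] []|c x []].
    by split; [exact: lsubD|rewrite piD //; exact: lsubD].
  by split; [exact: lsubZ|rewrite piZ //; exact: lsubZ].
move=> u l hu hl; have hu1 n := (hu n).1; split; first exact: (csub_cvg (hiP p) hu1 hl).
exact: (csub_cvg hS (fun n => (hu n).2) (pi_cvg hu1 hl)).
Qed.
Lemma lift_lo S : csub S -> forall x, lo x -> lift S x.
Proof.
move=> [hS _] x hx; have h1 := lohi hx; split=> //.
by rewrite (proj2 (pi_eq0 h1) hx); exact: lsub0.
Qed.
End Quot.
(** * Riesz theory of compact operators *)

Lemma cptP (X : CBanach) (T : BL X) (u : nat -> X) M : cpt T -> (forall n, nrm (u n) <= M) ->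
  exists phi : nat -> nat, (forall n, (phi n < phi n.+1)%N) /\
    exists l, cvg (fun n => T (u (phi n))) l.
Proof.
move=> hT hu; have [n|phi []] := tb_subseq (u := fun n => T (u n)) (cpt_ball M hT).
  by exists (u n).
by exists phi.
Qed.
Lemma bl_cvg (X : CBanach) (T : BL X) (u : nat -> X) l : cvg u l -> cvg (fun n => T (u n)) (T l).
Proof. by apply: cvg_lip => x y; rewrite -blB; apply: bnle. Qed.

Lemma riesz (X : CBanach) (V W : X -> Prop) w : csub V -> lsub W -> (forall x, V x -> W x) ->
  W w -> ~ V w -> exists y, W y /\ nrm y <= 1 /\ forall v, V v -> / 2 <= nrm (y - v).
Proof.
move=> hV hW hVW ww wv.
have [||d [d1 d2]] := @glb_ex (fun r => exists v, V v /\ r = nrm (w - v)%V).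
- by exists (nrm (w - 0)%V), 0%V; split=> //; apply: lsub0 hV.1.
- by move=> r [v [_ ->]]; apply: nrm_ge0.
have d0 : 0 < d.
  apply: Rnot_le_lt => d0; apply: wv; apply: (cl_sub hV (fun x h => h)) => e e0.
  apply: contrapT => hn; have : e <= d; last lra.
  apply: d2 => r [v [hv ->]]; apply: Rnot_lt_le => h; apply: hn; by exists v.
have [v [hv nv]] : exists v, V v /\ nrm (w - v)%V < 2 * d.
  apply: contrapT => hn; have : 2 * d <= d; last lra.
  apply: d2 => r [v [hv ->]]; apply: Rnot_lt_le => h; apply: hn; by exists v.
set rho := nrm (w - v)%V in nv.
have r0 : 0 < rho by have := d1 rho (ex_intro _ v (conj hv erefl)); lra.
exists (rc (/ rho) *: (w - v))%V; split.
  by apply: lsubZ => //; apply: lsubB => //; apply: hVW.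
split; first by apply: nrm_unscale => //; rewrite /rho; lra.
move=> y hy; have e : (rc (/ rho) *: (w - v) - y = rc (/ rho) *: (w - (v + rc rho *: y)))%V.
  have e1 : y = (rc (/ rho) *: (rc rho *: y))%V.
    by rewrite scalerA -rcM Rinv_l ?rc1 ?scale1r //; lra.
  by rewrite {1}e1 -scalerBr opprD addrA.
have i0 : 0 < / rho by pos.
rewrite e nrmZ Cmod_rc; last lra.
have h : d <= nrm (w - (v + rc rho *: y))%V.
  apply: d1; exists (v + rc rho *: y)%V; split=> //.
  by apply: lsubD hV.1 _ _ => //; apply: lsubZ hV.1 _.
mid (/ rho * d); last pos.
have -> : / 2 = / rho * (rho / 2) by rfield; lra.
by apply: Rmult_le_compat_l; lra.
Qed.

Section Fred.
Variable X : CBanach.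
Implicit Types T R K S : BL X.
Lemma img_csub T (V : X -> Prop) M : csub V -> (forall v, V v -> nrm v <= M * nrm (T v)) ->
  csub (fun y => exists v, V v /\ y = T v).
Proof.
move=> hV hM; have hV1 := hV.1; split.
  split; first by exists 0%V; rewrite bl0; split=> //; exact: lsub0.
  split=> [x y [v [hv ->]] [w [hw ->]]|c x [v [hv ->]]].
    by exists (v + w)%V; rewrite blD; split=> //; exact: lsubD.
  by exists (c *: v)%V; rewrite blZ; split=> //; exact: lsubZ.
move=> u l /choice [v hv] hl.
have [|y hy] := @cauchy_cvg X v.
  move=> e e0; have M1 : 0 < Rabs M + 1 by have := Rabs_pos M; lra.
  have [N hN] := cvg_cauchy hl (Rdiv_lt_0_compat _ _ e0 M1).
  exists N => m n hm hn; apply: Rle_lt_trans (hM _ _) _.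
    by apply: lsubB => //; [case: (hv m)|case: (hv n)].
  have := hN m n hm hn; have [_ ->] := hv m; have [_ ->] := hv n; rewrite -blB.
  set d := nrm _ => hd; have d0 : 0 <= d := nrm_ge0 _.
  apply: (Rle_lt_trans _ ((Rabs M + 1) * d)).
    by apply: Rmult_le_compat_r; have := Rle_abs M; lra.
  have -> : e = (Rabs M + 1) * (e / (Rabs M + 1)) by rfield; lra.
  nra.
exists y; split; first by apply: (csub_cvg hV _ hy) => n; case: (hv n).
by apply: (cvg_uniq hl); apply: cvg_eq (bl_cvg T hy) => n; case: (hv n).
Qed.

(** The Fredholm alternative for an operator that commutes with an inverse of it modulo a compact
    and a small operator. The generality is meant for [z - ad a], which is not a compact
    perturbation of a scalar; there [R] is the quotient in a polynomial division. *)
Lemma fred T R K S (c : C) (V : X -> Prop) : csub V -> c <> 0%V ->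
  (forall v, V v -> V (T v)) -> (forall v, V v -> V (R v)) ->
  (K + S = c *: Id - T * R)%V -> (T * R = R * T)%V -> nrm S <= Cmod c / 8 -> cpt K ->
  (forall v, V v -> T v = 0%V -> v = 0%V) ->
  (exists M, forall v, V v -> nrm v <= M * nrm (T v)) /\
  (forall v, V v -> exists w, V w /\ T w = v).
Proof.
move=> hV c0 hT hR e comm nS hK inj; have hV1 := hV.1.
have cp := Cmod_gt0 c0; have c0' : c != 0%V by apply/eqP.
have eK v : K v = (c *: v - S v - R (T v))%V.
  have h : (K + S)%V v = (c *: Id - T * R)%V v by rewrite e.
  rewrite comm !blE in h.
  by rewrite -(addrK (S v) (K v)) h; vec.
have bb : exists M, forall v, V v -> nrm v <= M * nrm (T v).
  apply: contrapT => hn.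
  have /choice [x hx] n : exists x, V x /\ nrm x = 1 /\ nrm (T x) <= / INR n.+1.
    have [v [hv nv]] : exists v, V v /\ INR n.+1 * nrm (T v) < nrm v.
      apply: contrapT => h; apply: hn; exists (INR n.+1) => v hv.
      by apply: Rnot_lt_le => h1; apply: h; exists v.
    have n0 : 0 < INR n.+1 by apply: lt_0_INR; lia.
    have v0 : 0 < nrm v by apply: Rle_lt_trans nv; pos.
    have i0 := Rinv_0_lt_compat _ v0.
    exists (rc (/ nrm v) *: v)%V; split; first exact: lsubZ.
    rewrite blZ !nrmZ Cmod_rc; last lra.
    split; first by rewrite Rinv_l; lra.
    apply: (Rmult_le_reg_l (INR n.+1)) => //; rewrite Rinv_r; last lra.
    apply: (Rmult_le_reg_l (nrm v)) => //.
    rewrite (_ : nrm v * (INR n.+1 * (/ nrm v * nrm (T v))) = INR n.+1 * nrm (T v)); last by rfield; lra.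
    lra.
  have [|phi [hphi [y hy]]] := cptP (u := x) (M := 1) hK; first by move=> n; have [] := hx n; lra.
  have [|N [hN _]] := @neumann X (c^-1 *: S)%V.
    rewrite nrmZ CmodV //; apply: (Rle_lt_trans _ (/ Cmod c * (Cmod c / 8))).
      mono.
    by rewrite (_ : / Cmod c * (Cmod c / 8) = / 8); [lra|rfield; lra].
  have hT0 : cvg (fun n => T (x (phi n))) 0%V.
    apply: (@cvg_dom _ _ _ (fun n => / INR n.+1)) => [n|ee /archi_inv //].
    rewrite subr0; have [_ [_ h]] := hx (phi n); via h.
    apply: Rinv_le_contravar; first by apply: lt_0_INR; lia.
    by apply: le_INR; have := incr_ge hphi n; lia.
  have hz : cvg (fun n => x (phi n)) (N (c^-1 *: (y + R 0)))%V.
    apply: cvg_eq (bl_cvg N (cvgZ (c^-1)%V (cvgD hy (bl_cvg R hT0)))) => n.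
    rewrite eK (_ : _ *: _ = (1 - c^-1 *: S) (x (phi n)))%V.
      by rewrite -blME hN.
    by rewrite subrK scalerBr scalerA mulVf // scale1r.
  set z := N _ in hz; have Vz : V z by apply: (csub_cvg hV _ hz) => n; case: (hx (phi n)).
  have z0 : z = 0%V by apply: inj (cvg_uniq (bl_cvg T hz) hT0).
  have [M hM] := hz 1 ltac:(lra); have := hM M (leqnn _).
  by rewrite z0 subr0; have [] := hx (phi M); lra.
split=> //; have [M hM] := bb.
move=> v0 hv0; apply: contrapT => hn.
(* If [T] is not onto, the ranges of its powers decrease strictly. Riesz vectors in them have
   [K]-images that are [Cmod c / 4] apart: [Cmod c / 2] from the Riesz property, less two errors of
   [Cmod c / 8] from [S]. *)
pose fix W k := if k is k'.+1 then fun y => exists v, W k' v /\ y = T v else V.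
have WV k x : W k x -> V x.
  by elim: k x => // k IH x [v [/IH hv ->]]; mono.
have Wc k : csub (W k).
  by elim: k => // k IH; apply: (img_csub (M := M)) => // v /WV; mono.
have WR k x : W k x -> W k (R x).
  elim: k x => [|k IH] x; first exact: hR.
  move=> [v [/IH hv ->]]; exists (R v).
  by have := congr1 (fun U : BL X => U v) comm.
have Wd k x : W k.+1 x -> W k x.
  by elim: k x => [|k IH] x [v [hv ->]]; [apply: hT|exists v; mono].
have Wdd k l x : (k <= l)%N -> W l x -> W k x.
  by move=> /subnKC <-; elim: (l - k)%N => [|j IH]; rewrite ?addn0 // addnS => /Wd.
have hz k : exists z, W k z /\ ~ W k.+1 z.
  elim: k => [|k [z [h1 h2]]].
    by exists v0; split=> // -[w [hw ew]]; apply: hn; exists w.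
  exists (T z); split; first by exists z.
  move=> [w [hw ew]]; apply: h2; rewrite (_ : z = w) //.
  apply: subr0_eq; apply: inj.
    by apply: lsubB => //; [exact: WV h1|exact: (WV k.+1 _ hw)].
  by rewrite blB ew subrr.
have /choice [y hy] k : exists y, W k y /\ nrm y <= 1 /\ forall v, W k.+1 v -> / 2 <= nrm (y - v).
  by have [z []] := hz k; apply: (riesz (w := z)) => //; [exact: (Wc k).1|mono].
have [||k [l [kl]]] := @tb_sep X _ (fun n => K (y n)) (Cmod c / 4) hK; last 1 first.
rewrite nrmC.
  have [h1 [h2 h3]] := hy k; have [h4 [h5 h6]] := hy l.
  have Wl := (Wc k.+1).1.
  pose b := (R (T (y k)) + (c *: y l - R (T (y l))))%V.
  have Wb : W k.+1 b.
    have h7 : W k.+1 (y l) by apply: Wdd h4.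
    have h8 : W k.+1 (T (y l)) by apply: Wd; exists (y l).
    apply: lsubD => //; first by apply: WR; exists (y k).
    by apply: lsubB => //; [apply: lsubZ|mono].
  have -> : (K (y k) - K (y l) = c *: (y k - c^-1 *: b) - (S (y k) - S (y l)))%V.
    by rewrite !eK scalerBr scalerA mulfV // /b; vec.
  have hb : Cmod c / 2 <= nrm (c *: (y k - c^-1 *: b))%V.
    by rewrite nrmZ; apply: Rmult_le_compat_l; [lra|apply: h3; apply: lsubZ].
  have hs x : nrm x <= 1 -> nrm (S x) <= Cmod c / 8.
    by move=> hx; via (bnle _ _); have := nrm_ge0 S; nra.
  have := hs _ h2; have := hs _ h5; have := nrmB (S (y k)) (S (y l)).
  have := nrm_tri (c *: (y k - c^-1 *: b))%V (S (y k) - S (y l))%V 0%V; rewrite !subr0; vlra.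
by move=> n; exists (y n); have [_ []] := hy n.
- lra.
Qed.

Lemma bl_inv T M : (forall v, nrm v <= M * nrm (T v)) -> (forall v, exists w, T w = v) ->
  exists S, (S * T = 1)%V /\ (T * S = 1)%V.
Proof.
move=> hM /choice [f hf].
have inj x y : T x = T y -> x = y.
  move=> h; apply: subr0_eq; apply: nrm_eq0.
  have := hM (x - y)%V; rewrite blB h subrr nrm0; have := nrm_ge0 (x - y)%V; vlra.
have hl : linear f /\ bounded f.
  split; last by exists M => x; have := hM (f x); rewrite hf.
  split=> [x y|c x]; apply: inj; rewrite hf; first by have := blD T (f x) (f y); rewrite !hf.
  by have := blZ T c (f x); rewrite hf.
exists (BLmk hl); split; apply: BLext => x; last exact: hf.
by apply: inj; rewrite hf.
Qed.
Lemma fredholm K (z : C) : cpt K -> z <> 0%V -> (forall v, K v = (z *: v)%V -> v = 0%V) ->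
  exists S, (S * (z *: Id - K) = 1)%V /\ ((z *: Id - K) * S = 1)%V.
Proof.
move=> hK z0 inj.
have [|||||||||[M hM] hs] := @fred (z *: Id - K)%V 1%V K 0%V z (fun=> True).
- exact: csubT.
- exact: z0.
- by [].
- by [].
- by rewrite mulr1 addr0 opprB addrC subrK.
- by rewrite mulr1 mul1r.
- by rewrite nrm0; have := Cmod_ge0 z; lra.
- exact: hK.
- move=> v _ h; apply: inj; apply/esym/subr0_eq.
  by move: h; rewrite !blE.
apply: (bl_inv (M := M)) => v; first exact: hM.
by have [w [_ hw]] := hs v I; exists w.
Qed.

(** The kernels of the products of the [K - la m] increase strictly, since the eigenvalues are
    distinct. Riesz vectors in them have [K]-images at distance at least [s / 2], against
    compactness. *)
Lemma cpt_eig_seq K (la : nat -> C) (e : nat -> X) s : cpt K -> 0 < s ->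
  (forall n, s <= Cmod (la n) /\ e n <> 0%V /\ K (e n) = (la n *: e n)%V) ->
  (forall m n, (m < n)%N -> la m <> la n) -> False.
Proof.
move=> hK s0 he hd.
pose P := fix P n : BL X := if n is m.+1 then ((K - la m *: Id) * P m)%V else 1%V.
have Pc n : (P n * K = K * P n)%V.
  elim: n => [|n IH] /=; first by rewrite mulr1 mul1r.
  rewrite -mulrA IH !mulrA; congr (_ * _)%V.
  by rewrite mulrBl mulrBr -scalerAl -scalerAr mul1r mulr1.
have Pe n m : exists a : C, P n (e m) = (a *: e m)%V /\ ((forall i, (i < n)%N -> la i <> la m) -> a <> 0%V).
  elim: n => [|n [a [h1 h2]]].
    by exists 1%V; rewrite /= scale1r; split=> // _; apply/eqP; rewrite oner_eq0.
  exists ((la m - la n) * a)%V; split.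
    rewrite -[P n.+1 _]/(((K - la n *: Id) * P n)%V (e m)) blME h1 blBE blZ blZE bl1E; have [_ [_ ->]] := he m.
    by rewrite !scalerA -scalerBl; congr (_ *: _)%V; cring.
  move=> h; apply/eqP; rewrite mulf_eq0 negb_or; apply/andP; split.
    by rewrite subr_eq0 eq_sym; apply/eqP; apply: h.
  by apply/eqP; apply: h2 => i hi; apply: h; apply: ltn_trans hi _.
pose E n x := P n x = 0%V.
have Ec n : csub (E n) by apply: csub_preB (@csub0 X).
have PS n x : P n.+1 x = (K (P n x) - la n *: P n x)%V by [].
have Ed n x : E n x -> E n.+1 x by rewrite /E PS => ->; rewrite bl0 scaler0 subr0.
have Edd k l x : (k <= l)%N -> E k x -> E l x.
  by move=> /subnKC <-; elim: (l - k)%N => [|j IH]; rewrite ?addn0 // addnS => /IH /Ed.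
have EK n x : E n x -> E n (K x) by rewrite /E -blME Pc blME => ->; rewrite bl0.
have El n x : E n.+1 x -> E n (K x - la n *: x)%V.
  by rewrite /E PS blB blZ -(blME (P n)) Pc blME.
have /choice [y hy] n : exists y, E n.+1 y /\ nrm y <= 1 /\ forall v, E n v -> / 2 <= nrm (y - v).
  apply: (riesz (w := e n)) => //; [exact: (Ec n.+1).1|exact: Ed|..].
    have [a [h _]] := Pe n n; rewrite /E PS h blZ; have [_ [_ ->]] := he n.
    by rewrite !scalerA mulrC subrr.
  have [a [h1 h2]] := Pe n n; rewrite /E h1 => h3.
  have [|a0] := EM (a = 0%V); first by apply: h2 => i; apply: hd.
  have [_ [h4 _]] := he n; apply: h4; rewrite -[e n]scale1r -(mulVf (introN eqP a0)).
  by rewrite -scalerA h3 scaler0.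
have [||k [l [kl]]] := @tb_sep X _ (fun n => K (y n)) (s / 2) hK; last 1 first.
- apply/Rle_not_lt; have [h1 [h2 h3]] := hy k; have [h4 [h5 h6]] := hy l.
  have [h7 _] := he l; have l0 : la l <> 0%V by move=> h; move: h7; rewrite h Cmod0; lra.
  pose b := (K (y k) - (K (y l) - la l *: y l))%V.
  have Eb : E l b.
    by apply: lsubB (Ec l).1 _ _; [apply: EK; apply: Edd h1|apply: El].
  have -> : (K (y l) - K (y k) = la l *: (y l - (la l)^-1 *: b))%V.
    by rewrite scalerBr scalerA mulfV ?scale1r /b; [vec|apply/eqP].
  rewrite nrmZ; have := h6 ((la l)^-1 *: b)%V (lsubZ _ (Ec l).1 Eb); nra.
- by move=> n; exists (y n); have [_ [h _]] := hy n.
- lra.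
Qed.

(** The intervals from [a n] to [b n] are disjoint. If each contained the modulus of an eigenvalue,
    there would be infinitely many eigenvalues of modulus at least [s1]. *)
Lemma cpt_gap K s1 s2 : cpt K -> 0 < s1 -> s1 < s2 -> exists t1 t2, s1 < t1 /\ t1 < t2 /\ t2 < s2 /\
  forall (z : C) x, t1 <= Cmod z -> Cmod z <= t2 -> K x = (z *: x)%V -> x = 0%V.
Proof.
move=> hK s0 s12; apply: contrapT => hn.
pose a n := s1 + (s2 - s1) * / INR (n + n).+3; pose b n := s1 + (s2 - s1) * / INR (n + n).+2.
have pos n : 0 < INR n.+1 by apply: lt_0_INR; lia.
have lt m n : (m < n)%N -> (s2 - s1) * / INR n.+1 < (s2 - s1) * / INR m.+1.
  move=> h; apply: Rmult_lt_compat_l; first lra.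
  by apply: Rinv_0_lt_contravar => //; apply: lt_INR; lia.
have /choice [la hla] n : exists z : C, (a n <= Cmod z /\ Cmod z <= b n) /\ exists x, K x = (z *: x)%V /\ x <> 0%V.
  apply: contrapT => h; apply: hn; exists (a n), (b n).
  have h1 := lt (n + n).+1 (n + n).+2 (leqnn _); have h2 : b n < s2.
    have := lt 0%N (n + n).+1 (ltn0Sn _); rewrite /b Rinv_1; lra.
  split; first by rewrite /a; have := Rinv_0_lt_compat _ (pos (n + n).+2); nra.
  split; first by rewrite /a /b; lra.
  split=> // z x z1 z2 ex; apply: contrapT => x0; apply: h; exists z; split=> //; by exists x.
have /choice [e he] n := (hla n).2.
apply: (@cpt_eig_seq K la e s1) => // [n|m n mn h].
  have [[h1 _] _] := hla n; split; last by have [h2 h3] := he n.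
  by apply: Rle_trans h1; rewrite /a; have := Rinv_0_lt_compat _ (pos (n + n).+2); nra.
have [[h1 _] _] := hla m; have [[_ h2] _] := hla n; rewrite h in h1.
have := lt (m + m).+2 (n + n).+1 ltac:(lia); rewrite /a /b in h1 h2; lra.
Qed.

(** A Neumann series extends the inverse, with a bound, to a disc around each point, and the closed
    annulus is totally bounded. *)
Lemma unif_inv (B : BL X) t1 t2 :
  (forall z : C, t1 <= Cmod z -> Cmod z <= t2 ->
     exists S, (S * (z *: Id - B) = 1)%V /\ ((z *: Id - B) * S = 1)%V) ->
  exists M, forall z : C, t1 <= Cmod z -> Cmod z <= t2 ->
     exists S, (S * (z *: Id - B) = 1)%V /\ ((z *: Id - B) * S = 1)%V /\ nrm S <= M.
Proof.
move=> hB; pose A (z : CC) := t1 <= Cmod z <= t2.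
pose good (D : CC -> Prop) := exists M, forall z, D z -> A z ->
  exists S, (S * (z *: Id - B) = 1)%V /\ ((z *: Id - B) * S = 1)%V /\ nrm S <= M.
suff [M hM] : good A by exists M => z h1 h2; apply: hM.
apply: contrapT => hn.
have [||||y hy] := @tb_cluster CC A good _ _ _ _ hn.
by apply: tb_mono (tb_CC t2) => z [].
move=> D D' h [M hM]; exists M; mono.
move=> D D' [M hM] [M' hM']; exists (Rmax M M') => z [h|h] Az.
    have [S [h1 [h2 h3]]] := hM z h Az; exists S; do 2 (split=> //).
    by via h3; apply: Rmax_l.
  have [S [h1 [h2 h3]]] := hM' z h Az; exists S; do 2 (split=> //).
  by via h3; apply: Rmax_r.
by exists 0.
have near r : 0 < r -> exists z : C, A z /\ Cmod (z - y)%V < r.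
  move=> r0; apply: contrapT => h; apply: (hy r r0); exists 0 => z [Az hz].
  by case: h; exists z.
have Ay : A y.
  split; apply: Rnot_lt_le => h.
    have [z [[] h3]] := near (t1 - Cmod y) ltac:(lra).
    by have := Cmod_tri (z - y)%V y; rewrite subrK; lra.
  have [z [[] h3]] := near (Cmod y - t2) ltac:(lra).
  have := Cmod_tri z (y - z)%V; rewrite addrC subrK -(opprB z y).
  by have -> : Cmod (- (z - y))%V = Cmod (z - y)%V by [exact: CmodN]; lra.
have [S [e1 e2]] := hB y Ay.1 Ay.2; have S0 := nrm_ge0 S.
have r0 : 0 < / (2 * (nrm S + 1)) by pos.
apply: (hy _ r0); exists (2 * nrm S) => z [Az hz].
have hz' : Cmod (y - z)%V < / (2 * (nrm S + 1)).
  by have := @nrmC CC z y; rewrite /nrm /= => <-.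
have hT : nrm ((y - z) *: S)%V <= / 2.
  rewrite nrmZ.
  mid (/ (2 * (nrm S + 1)) * (nrm S + 1)).
    mono.
  by rewrite (_ : / (2 * (nrm S + 1)) * (nrm S + 1) = / 2); [lra|rfield; lra].
have [|N [n1 [n2 [n3 _]]]] := @neumann X ((y - z) *: S)%V; first lra.
have n4 : nrm N <= 2.
  via n3; rewrite -[X in _ <= X]Rinv_inv; apply: Rinv_le_contravar; lra.
have eA : (z *: Id - B = (1 - (y - z) *: S) * (y *: Id - B))%V.
  by rewrite mulrBl mul1r -scalerAl e1; vec.
have eB : (z *: Id - B = (y *: Id - B) * (1 - (y - z) *: S))%V.
  by rewrite mulrBr mulr1 -scalerAr e2; vec.
have eNS : (N * S = S * N)%V.
  by apply: esym; apply: (inv_comm n1 n2); rewrite mulrBl mulrBr mul1r mulr1 -scalerAl -scalerAr.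
exists (S * N)%V; split; first by rewrite eA -mulrA (mulrA N) n1 mul1r.
split; first by rewrite eB -mulrA -eNS (mulrA _ N) n2 mul1r.
by via (bnM _ _); rewrite Rmult_comm; mono.
Qed.
End Fred.

Lemma blZX (X : CBanach) (c : C) (T : BL X) n : ((c *: T) ^+ n = c ^+ n *: T ^+ n)%V.
Proof.
elim: n => [|n IH]; first by rewrite scale1r.
by rewrite !exprS IH -scalerAl -scalerAr scalerA.
Qed.
(** * Spectral projections *)

Lemma Cmod_rcR r : Cmod (rc r) = Rabs r.
Proof.
have [h|h] := Rle_lt_dec 0 r; first by rewrite Cmod_rc // Rabs_pos_eq.
rewrite -[in LHS](Ropp_involutive r) rcN CmodN Cmod_rc; last lra.
by rewrite Rabs_left.
Qed.
Lemma half2 : (rc (/ 2) * (1 + 1) = 1)%V.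
Proof. by rewrite -rcD -rcM; congr rc; lra. Qed.
Lemma bcvgM (X : CBanach) (u v : nat -> BL X) a b : cvg u a -> cvg v b ->
  cvg (fun n => u n * v n)%V (a * b)%V.
Proof.
move=> hu hv e e0; have a0 := nrm_ge0 a; have b0 := nrm_ge0 b.
have d0 : 0 < Rmin 1 (e / (nrm a + nrm b + 2)).
  by apply: Rmin_pos; pos.
set d := Rmin _ _ in d0; have d1 : d <= 1 := Rmin_l _ _.
have d2 : d * (nrm a + nrm b + 2) <= e.
  mid (e / (nrm a + nrm b + 2) * (nrm a + nrm b + 2)).
    by apply: Rmult_le_compat_r; [lra|exact: Rmin_r].
  by right; rfield; lra.
have [N hN] := hu _ d0; have [M hM] := hv _ d0; exists (N + M)%N => n hn.
have h1 := hN n ltac:(lia); have h2 := hM n ltac:(lia).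
have -> : (u n * v n - a * b = (u n - a) * (v n - b) + (u n - a) * b + a * (v n - b))%V by bvec.
have h3 := bnM (u n - a)%V (v n - b)%V; have h4 := bnM (u n - a)%V b.
have h5 := bnM a (v n - b)%V.
have h6 := nrmD ((u n - a) * (v n - b) + (u n - a) * b)%V (a * (v n - b))%V.
have h7 := nrmD ((u n - a) * (v n - b))%V ((u n - a) * b)%V.
apply: Rle_lt_trans h6 _; apply: Rle_lt_trans (Rplus_le_compat _ _ _ _ h7 h5) _.
apply: Rle_lt_trans (Rplus_le_compat_r _ _ _ (Rplus_le_compat _ _ _ _ h3 h4)) _.
have n2 := nrm_ge0 (v n - b)%V.
set x := (u n - a)%V in h1 *; set y := (v n - b)%V in h2 n2 *.
nra.
Qed.
Lemma bcvgMl (X : CBanach) (a b : BL X) (u : nat -> BL X) : cvg u b ->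
  cvg (fun n => a * u n)%V (a * b)%V.
Proof. apply: bcvgM; apply: cvg_cst. Qed.
Lemma bcvgMr (X : CBanach) (a b : BL X) (u : nat -> BL X) : cvg u b ->
  cvg (fun n => u n * a)%V (b * a)%V.
Proof. by move=> h; apply: bcvgM => //; apply: cvg_cst. Qed.

Section Circle.
Variables (X : CBanach) (B : BL X) (t1 t2 M : R).
Hypotheses (t1p : 0 < t1) (t12 : t1 < t2).
Hypothesis hB : forall z : C, t1 <= Cmod z -> Cmod z <= t2 ->
  exists S, (S * (z *: (1 : BL X) - B) = 1)%V /\ ((z *: (1 : BL X) - B) * S = 1)%V /\ nrm S <= M.
Let K := t2 * M.
Let T (th : R) : BL X := (rc (/ th) *: B)%V.

Lemma circ0 th (z : C) : t1 <= th <= t2 -> Cmod z = 1 ->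
  exists S : BL X, (S * (1 - z *: T th) = 1)%V /\ ((1 - z *: T th) * S = 1)%V /\ nrm S <= K.
Proof.
move=> [h1 h2] hz; have z0 : z <> 0%V by move=> e; move: hz; rewrite e Cmod0; lra.
have m : Cmod (rc th * z^-1)%V = th by rewrite CmodM CmodV // hz Cmod_rc; lra.
have [||S [e1 []]] := hB (z := (rc th * z^-1)%V); rewrite ?m //.
have zi : z != 0%V by apply/eqP.
have rr : (rc th * rc (/ th) = 1)%V by rewrite -rcM Rinv_r //; lra.
have e : (1 - z *: T th = (z * rc (/ th)) *: ((rc th * z^-1) *: Id - B))%V.
  have e0 : (z * rc (/ th) * (rc th * z^-1) = 1)%V.
    by rewrite (mulrC (rc th)) mulrACA mulfV // mul1r mulrC.
  by rewrite scalerBr !scalerA e0 scale1r.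
have e' : (rc th * z^-1 * (z * rc (/ th)) = 1)%V by rewrite -mulrA (mulrA z^-1)%V mulVf // mul1r.
exists ((rc th * z^-1) *: S)%V; rewrite e; split.
  by rewrite -scalerAl -scalerAr scalerA e' scale1r.
split; first by rewrite -scalerAl -scalerAr scalerA mulrC e' scale1r.
rewrite nrmZ; apply: Rmult_le_compat; pos.
Qed.
Definition cinv0 th z : BL X := ClassicalEpsilon.epsilon (inhabits 0%V) (fun S : BL X =>
  (S * (1 - z *: T th) = 1)%V /\ ((1 - z *: T th) * S = 1)%V /\ nrm S <= K).
Definition csq z : C := sval (cid (Csqrt z)).
Lemma csqP z : (csq z * csq z = z)%V. Proof. exact: (svalP (cid (Csqrt z))). Qed.
Lemma csq1 z : Cmod z = 1 -> Cmod (csq z) = 1.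
Proof. by rewrite -{1}(csqP z) CmodM; have := Cmod_ge0 (csq z); nra. Qed.
Lemma csqN1 z : Cmod z = 1 -> Cmod (- csq z)%V = 1.
Proof. by rewrite CmodN; apply: csq1. Qed.
(** An inverse of [1 - z T^(2^j)], found from 2/(1 - a^2) = 1/(1 - a) + 1/(1 + a). At [z = 1] it is
    the average of the inverses of [1 - w T] over the 2^j-th roots of unity [w], a discrete form of
    the contour integral for the Riesz projection; being an average, it keeps the bound [K]. *)
Fixpoint cinv j th z : BL X :=
  if j is i.+1 then (rc (/ 2) *: (cinv i th (csq z) + cinv i th (- csq z)))%V else cinv0 th z.

Lemma dbl (a p q : BL X) : (p * (1 - a) = 1)%V -> ((1 - a) * p = 1)%V ->
  (q * (1 + a) = 1)%V -> ((1 + a) * q = 1)%V ->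
  ((rc (/ 2) *: (p + q)) * (1 - a * a) = 1)%V /\ ((1 - a * a) * (rc (/ 2) *: (p + q)) = 1)%V /\
  (a * (rc (/ 2) *: (p + q)) = rc (/ 2) *: (p - q))%V.
Proof.
move=> p1 p2 q1 q2.
have f1 : (1 - a * a = (1 - a) * (1 + a))%V by rewrite mulrBl mul1r mulrDr mulr1; vec.
have f2 : (1 - a * a = (1 + a) * (1 - a))%V by rewrite mulrDl mul1r mulrBr mulr1; vec.
have h : (rc (/ 2) *: ((1 + a) + (1 - a)) = 1)%V.
  rewrite (_ : (1 + a + (1 - a) = (1 + 1 : C) *: Id)%V); last by vec.
  by rewrite scalerA half2 scale1r.
have ap : (a * p = p - 1)%V by rewrite -p2 mulrBl mul1r; vec.
have aq : (a * q = 1 - q)%V by rewrite -q2 mulrDl mul1r; vec.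
split.
  rewrite -scalerAl mulrDl {1}f1 f2 !mulrA p1 q1 !mul1r //.
split.
  rewrite -scalerAr mulrDr {1}f2 f1 -!mulrA p2 q2 !mulr1 //.
by rewrite -scalerAr mulrDr ap aq; vec.
Qed.

Lemma cinvP j th z : t1 <= th <= t2 -> Cmod z = 1 ->
  (cinv j th z * (1 - z *: T th ^+ (2 ^ j)) = 1)%V /\
  ((1 - z *: T th ^+ (2 ^ j)) * cinv j th z = 1)%V /\ nrm (cinv j th z) <= K /\
  forall m, (m <= 2 ^ j)%N -> nrm (T th ^+ m * cinv j th z)%V <= K + 1.
Proof.
move=> hth.
elim: j z => [|j IH] z hz.
  have [h1 [h2 h3]] : (cinv 0 th z * (1 - z *: T th) = 1)%V /\
      ((1 - z *: T th) * cinv 0 th z = 1)%V /\ nrm (cinv 0 th z) <= K.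
    exact: (ClassicalEpsilon.epsilon_spec _ _ (circ0 hth hz)).
  do 2 (split=> //); split=> // -[|[|//]].
    by rewrite mul1r; lra.
  rewrite expr1.
  have e : (z *: (T th * cinv 0 th z) = cinv 0 th z - 1)%V.
    by have := h2; rewrite mulrBl mul1r -scalerAl => <-; vec.
  have : nrm (z *: (T th * cinv 0 th z))%V <= K + 1.
    by rewrite e; via (nrmB _ _); exact: Rplus_le_compat (bn1 X).
  by rewrite nrmZ hz; lra.
have [p1 [p2 [p3 p4]]] := IH _ (csq1 hz); have [q1 [q2 [q3 q4]]] := IH _ (csqN1 hz).
pose a := (csq z *: T th ^+ (2 ^ j))%V.
have ea : ((- csq z) *: T th ^+ (2 ^ j) = - a)%V by rewrite scaleNr.
rewrite ea opprK in q1 q2.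
have [d1 [d2 d3]] := dbl p1 p2 q1 q2.
have eaa : (a * a = z *: T th ^+ (2 ^ j.+1))%V.
  by rewrite -scalerAl -scalerAr scalerA csqP -exprD addnn -mul2n -expnS.
rewrite eaa in d1 d2; split => //.
split => //.
have hlf : Cmod (rc (/ 2)) = / 2 by rewrite Cmod_rc; lra.
split.
  rewrite -[cinv j.+1 th z]/(rc (/ 2) *: (cinv j th (csq z) + cinv j th (- csq z)))%V nrmZ hlf.
  have := nrmD (cinv j th (csq z)) (cinv j th (- csq z)); vlra.
move=> m hm; have [h|h] := leqP m (2 ^ j).
  rewrite -[cinv j.+1 th z]/(rc (/ 2) *: (cinv j th (csq z) + cinv j th (- csq z)))%V.
  rewrite -(scalerAr (rc (/ 2))) mulrDr nrmZ hlf; have := p4 m h; have := q4 m h.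
  have := nrmD (T th ^+ m * cinv j th (csq z))%V (T th ^+ m * cinv j th (- csq z))%V; vlra.
(* Beyond [2^j] one factor [T^(2^j)] is absorbed by the third identity of [dbl], which leaves an
   exponent covered by the induction hypothesis. *)
have -> : m = ((m - 2 ^ j) + 2 ^ j)%N by lia.
have h' : (m - 2 ^ j <= 2 ^ j)%N by move: hm; rewrite expnS; lia.
have := p4 _ h'; have := q4 _ h'; set (m - 2 ^ j)%N.
have e : (csq z *: (T th ^+ (n + 2 ^ j) * cinv j.+1 th z) =
    rc (/ 2) *: (T th ^+ n * cinv j th (csq z) - T th ^+ n * cinv j th (- csq z)))%V.
  have -> : (csq z *: (T th ^+ (n + 2 ^ j) * cinv j.+1 th z) = T th ^+ n * (a * cinv j.+1 th z))%V.
    by rewrite exprD -!scalerAl -!scalerAr mulrA.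
  by rewrite d3 -scalerAr mulrBr.
have := nrmB (T th ^+ n * cinv j th (csq z))%V (T th ^+ n * cinv j th (- csq z))%V.
have := congr1 (@nrm (BB X)) e; rewrite !nrmZ hlf csq1; vlra.
Qed.

Lemma cinv_comm j th z (W : BL X) : t1 <= th <= t2 -> Cmod z = 1 -> (W * B = B * W)%V ->
  (W * cinv j th z = cinv j th z * W)%V.
Proof.
move=> hth hz hW; have [h1 [h2 _]] := cinvP j hth hz.
apply: (inv_comm h1 h2).
have h : (W * T th ^+ (2 ^ j) = T th ^+ (2 ^ j) * W)%V.
  rewrite blZX -scalerAl -scalerAr; congr (_ _)%V.
  exact/commrX.
by rewrite mulrBl mulrBr mul1r mulr1 -scalerAl -scalerAr h.
Qed.

Let L := K * K * nrm B / (t1 * t1).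
(** For [j = 0] this is the resolvent identity, and averaging preserves the constant. That it does
    not depend on [j] is what the limit needs. *)
Lemma cinv_diff j th th' z : t1 <= th <= t2 -> t1 <= th' <= t2 -> Cmod z = 1 ->
  nrm (cinv j th z - cinv j th' z)%V <= L * Rabs (th - th').
Proof.
move=> hth hth'; have hlf : Cmod (rc (/ 2)) = / 2 by rewrite Cmod_rc; lra.
elim: j z => [|j IH] z hz.
  have [h1 [h2 [h3 _]]] := cinvP 0 hth hz; have [g1 [g2 [g3 _]]] := cinvP 0 hth' hz.
  set p := cinv 0 th z; set q := cinv 0 th' z.
  have -> : (p - q = p * (z *: (T th - T th')) * q)%V.
    have -> : (z *: (T th - T th') = (1 - z *: T th') - (1 - z *: T th))%V by vec.
    by rewrite mulrBr mulrBl h1 -mulrA g2 mulr1 mul1r.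
  have hT : nrm (T th - T th')%V <= Rabs (th - th') / (t1 * t1) * nrm B.
    rewrite -scalerBl nrmZ -rcN -rcD Cmod_rcR; apply: Rmult_le_compat_r; first pos.
    have -> : / th + - / th' = (th' - th) / (th * th') by rfield; lra.
    rewrite Rabs_mult Rabs_minus_sym; apply: Rmult_le_compat_l; first pos.
    rewrite Rabs_pos_eq; last pos.
    by apply: Rinv_le_contravar; nra.
  via (bnM _ _); via (Rmult_le_compat_r _ _ _ (nrm_ge0 q) (bnM _ _)).
  rewrite nrmZ hz.
  mid (K * (Rabs (th - th') / (t1 * t1) * nrm B) * K).
    apply: Rmult_le_compat => //; first pos.
      pos.
    mono.
  by rewrite /L; lra.
have h1 := IH _ (csq1 hz); have h2 := IH _ (csqN1 hz).
rewrite /= -scalerBr nrmZ hlf opprD addrACA.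
have := nrmD (cinv j th (csq z) - cinv j th' (csq z))%V (cinv j th (- csq z) - cinv j th' (- csq z))%V.
vlra.
Qed.

Let U j th := cinv j th 1%V.
Let i1 : Cmod 1%V = 1 := Cmod1.
Lemma circ_K : 0 <= K.
Proof.
have h : t1 <= t1 <= t2 by lra.
have [_ [_ [h3 _]]] := cinvP 0 h i1; exact: Rle_trans (nrm_ge0 _) h3.
Qed.
Lemma circ_U j th : t1 <= th <= t2 -> (1 - U j th = - (T th ^+ (2 ^ j) * U j th))%V.
Proof.
move=> hth; have [_ [h _]] := cinvP j hth i1.
have e : (U j th - T th ^+ (2 ^ j) * U j th = 1)%V by rewrite -h scale1r mulrBl mul1r.
by rewrite -{1}e; vec.
Qed.
Lemma circ_Uc j th (W : BL X) : t1 <= th <= t2 -> (W * B = B * W)%V -> (W * U j th = U j th * W)%V.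
Proof. by move=> hth; apply: cinv_comm. Qed.
Lemma circ_UB j th n : t1 <= th <= t2 -> (U j th * B ^+ n = B ^+ n * U j th)%V.
Proof. by move=> hth; rewrite -circ_Uc //; apply/commr_sym/commrX. Qed.
Lemma circ_UT j th th' n : t1 <= th <= t2 -> (U j th * T th' ^+ n = T th' ^+ n * U j th)%V.
Proof. by move=> hth; rewrite blZX -scalerAl -scalerAr circ_UB. Qed.
Lemma circ_UU i j th th' : t1 <= th <= t2 -> t1 <= th' <= t2 ->
  (U i th * U j th' = U j th' * U i th)%V.
Proof.
move=> h h'; apply: circ_Uc; have := circ_UB i 1 h; pos.
Qed.
(** The second factor contains [T th' ^+ (2 ^ j)]. Handing [m] of these powers to [U i th] rescales
    them by [(th / th') ^ m], and the two remaining products are bounded by [K + 1]. *)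
Lemma circ_cross i j th th' : t1 <= th -> th <= th' -> th' <= t2 ->
  nrm (U i th * (1 - U j th'))%V <= (K + 1) * (K + 1) * (th / th') ^ (2 ^ minn i j).
Proof.
move=> h1 h2 h3; have h : t1 <= th <= t2 by lra.
have h' : t1 <= th' <= t2 by lra.
have [_ [_ [_ a1]]] := cinvP i h i1; have [_ [_ [_ a2]]] := cinvP j h' i1.
set m := (2 ^ minn i j)%N.
have m1 : (m <= 2 ^ i)%N by apply: leq_pexp2l => //; apply: geq_minl.
have m2 : (m <= 2 ^ j)%N by apply: leq_pexp2l => //; apply: geq_minr.
have e : (T th' ^+ m = rc ((th / th') ^ m) *: T th ^+ m)%V.
  rewrite rcX -blZX; congr (_ ^+ _)%V; rewrite scalerA -rcM; congr (rc _ *: _)%V.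
  by rfield; lra.
have -> : (U i th * (1 - U j th') =
   - (rc ((th / th') ^ m) *: ((T th ^+ m * U i th) * (T th' ^+ (2 ^ j - m) * U j th'))))%V.
  rewrite circ_U // -{1}(subnKC m2) exprD e mulrN.
  by rewrite -!scalerAl -scalerAr; rewrite !mulrA circ_UT.
rewrite nrmN nrmZ Cmod_rc; last first.
  pos.
rewrite Rmult_comm; apply: Rmult_le_compat_r.
  pos.
apply: bnM_le.
  mono.
by apply: a2; exact: leq_subr.
Qed.
Lemma pow_small2 q e : 0 <= q -> q < 1 -> 0 < e ->
  exists N, forall i j, (N <= i)%N -> (N <= j)%N -> q ^ (2 ^ minn i j) < e.
Proof.
move=> q0 q1 e0; have [N hN] := pow_small q0 q1 e0; exists N => i j hi hj; apply: hN.
apply: (leq_trans (n := minn i j)); first by rewrite leq_min hi.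
by apply: ltnW; apply: ltn_expl.
Qed.
(** At equal radii [circ_cross] gives no decay. The second radius is increased by a small [d], and
    the Lipschitz bound pays for the change. *)
Lemma circ_small th e : t1 <= th < t2 -> 0 < e -> exists N, forall i j, (N <= i)%N -> (N <= j)%N ->
  nrm (U i th * (1 - U j th))%V < e.
Proof.
move=> hth e0; have K0 := circ_K.
have L0 : 0 <= L.
  rewrite /L.
  pos.
have KL : 0 <= K * L by pos.
have d0 : 0 < Rmin (t2 - th) (e / (2 * (K * L + 1))).
  by apply: Rmin_pos; pos.
set d := Rmin _ _ in d0; have d1 : d <= t2 - th := Rmin_l _ _.
have d2 : K * (L * d) <= e / 2.
  mid ((K * L + 1) * (e / (2 * (K * L + 1)))); last by right; rfield; lra.
  rewrite -Rmult_assoc; apply: Rmult_le_compat; [lra|lra|lra|exact: Rmin_r].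
have q0 : 0 <= th / (th + d) by pos.
have q1 : th / (th + d) < 1.
  apply: (Rmult_lt_reg_r (th + d)); first lra.
  by rewrite (_ : th / (th + d) * (th + d) = th); [lra|rfield; lra].
have k1 : 0 < (K + 1) * (K + 1) by nra.
have [N hN] := pow_small2 q0 q1 (Rdiv_lt_0_compat _ _ e0 (Rmult_lt_0_compat 2 _ ltac:(lra) k1)).
exists N => i j hi hj.
have h : t1 <= th <= t2 by lra.
have h' : t1 <= th + d <= t2 by lra.
have -> : (U i th * (1 - U j th) = U i th * (1 - U j (th + d)) + U i th * (U j (th + d) - U j th))%V by bvec.
apply: Rle_lt_trans (nrmD _ _) _.
have := @circ_cross i j th (th + d).
have p1 : (K + 1) * (K + 1) * (th / (th + d)) ^ (2 ^ minn i j) < e / 2.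
  have -> : e / 2 = (K + 1) * (K + 1) * (e / (2 * ((K + 1) * (K + 1)))) by rfield; lra.
  by apply: Rmult_lt_compat_l; mono.
have [_ [_ [h3 _]]] := cinvP i h i1.
have h4 := @cinv_diff j (th + d) th 1%V h' h i1.
have h5 : nrm (U i th * (U j (th + d) - U j th))%V <= e / 2.
  apply: Rle_trans d2; apply: bnM_le => //.
  by via h4; rewrite (_ : th + d - th = d) ?Rabs_pos_eq; lra.
lra.
Qed.
Lemma circ_lim th : t1 <= th < t2 -> exists E, cvg (fun j => U j th) E.
Proof.
move=> hth; have h : t1 <= th <= t2 by lra.
apply: cauchy_cvg => e e0; have [N hN] := circ_small hth (Rdiv_lt_0_compat _ _ e0 Rlt_0_2).
exists N => m n hm hn.
have -> : (U m th - U n th = U m th * (1 - U n th) - U n th * (1 - U m th))%V.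
  by rewrite !mulrBr !mulr1 (circ_UU m n h h); vec.
apply: Rle_lt_trans (nrmB _ _) _; have := hN m n hm hn; have := hN n m hn hm; lra.
Qed.
Definition cE th : BL X := ClassicalEpsilon.epsilon (inhabits 0%V) (cvg (fun j => U j th)).
Lemma cEP th : t1 <= th < t2 -> cvg (fun j => U j th) (cE th).
Proof. by move=> hth; apply: ClassicalEpsilon.epsilon_spec; apply: circ_lim. Qed.
Lemma cE_idem th : t1 <= th < t2 -> (cE th * (1 - cE th) = 0)%V.
Proof.
move=> hth; have hE := cEP hth.
have h1 : cvg (fun j => U j th * (1 - U j th))%V (cE th * (1 - cE th))%V.
  by apply: bcvgM => //; apply: cvgB => //; apply: cvg_cst.
apply: (cvg_uniq h1) => e e0; have [N hN] := circ_small hth e0.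
by exists N => n; rewrite subr0; mono.
Qed.
Lemma cE_comm th (W : BL X) : t1 <= th < t2 -> (W * B = B * W)%V -> (W * cE th = cE th * W)%V.
Proof.
move=> hth hW; have hE := cEP hth; apply: (cvg_uniq (bcvgMl W hE)).
by apply: cvg_eq (bcvgMr W hE) => j; rewrite circ_Uc //; lra.
Qed.
Lemma cE_mono th th' : t1 <= th -> th < th' -> th' < t2 -> (cE th * (1 - cE th') = 0)%V.
Proof.
move=> h1 h2 h3; have hE := @cEP th ltac:(lra).
have hE' := @cEP th' ltac:(lra).
have h : cvg (fun j => U j th * (1 - U j th'))%V (cE th * (1 - cE th'))%V.
  by apply: bcvgM => //; apply: cvgB => //; apply: cvg_cst.
have K0 := circ_K; have k1 : 0 < (K + 1) * (K + 1) by nra.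
have q0 : 0 <= th / th' by pos.
have q1 : th / th' < 1.
  apply: (Rmult_lt_reg_r th'); first lra.
  by rewrite (_ : th / th' * th' = th); [lra|rfield; lra].
apply: (cvg_uniq h) => e e0; have [N hN] := pow_small2 q0 q1 (Rdiv_lt_0_compat _ _ e0 k1).
exists N => n hn; rewrite subr0; apply: Rle_lt_trans (@circ_cross n n th th' _ _ _) _; try lra.
have -> : e = (K + 1) * (K + 1) * (e / ((K + 1) * (K + 1))) by rfield; lra.
by apply: Rmult_lt_compat_l; mono.
Qed.
Lemma cE_diff th th' : t1 <= th < t2 -> t1 <= th' < t2 -> nrm (cE th - cE th')%V <= L * Rabs (th - th').
Proof.
move=> h h'; apply: (cvg_le (cvgB (cEP h) (cEP h'))); exists 0%N => n _.
by apply: cinv_diff; pos.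
Qed.
(** By [cE_mono] the difference is idempotent, and an idempotent of norm below [1] is zero. *)
Lemma cE_eq1 th th' : t1 <= th -> th < th' -> th' < t2 -> L * (th' - th) < 1 -> cE th = cE th'.
Proof.
move=> h1 h2 h3 h4; have h : t1 <= th < t2 by lra.
have h' : t1 <= th' < t2 by lra.
pose D := (cE th' - cE th)%V.
have m0 := cE_mono h1 h2 h3.
have eE : (cE th * cE th' = cE th)%V.
  by move: m0; rewrite mulrBr mulr1 => /subr0_eq.
have BE th0 : t1 <= th0 < t2 -> (cE th0 * B = B * cE th0)%V by move=> h0; rewrite cE_comm.
have eE' : (cE th' * cE th = cE th)%V by rewrite cE_comm // BE.
have id th0 : t1 <= th0 < t2 -> (cE th0 * cE th0 = cE th0)%V.
  by move=> /cE_idem; rewrite mulrBr mulr1 => /subr0_eq.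
have DD : (D * D = D)%V by rewrite /D mulrBr !mulrBl eE eE' !id //; vec.
have nD : nrm D < 1.
  by apply: Rle_lt_trans (cE_diff h' h) _; rewrite Rabs_pos_eq; lra.
have : nrm D <= nrm D * nrm D by rewrite -{1}DD; apply: bnM.
have := nrm_ge0 D => D0 D1; have /nrm_eq0 : nrm D = 0 by nra.
by move=> /eqP; rewrite subr_eq0 => /eqP.
Qed.
Lemma cE_eq s : t1 < s -> s < t2 -> cE t1 = cE s.
Proof.
move=> h1 h2; have [n hn] := INR_unbounded (Rabs L * (s - t1)).
have n0 : 0 < INR n by apply: Rle_lt_trans hn; pos.
pose d := (s - t1) / INR n.
have d0 : 0 < d by apply: Rdiv_lt_0_compat; lra.
have Ld : L * d < 1.
  apply: (Rle_lt_trans _ (Rabs L * d)); first by apply: Rmult_le_compat_r; [lra|exact: Rle_abs].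
  apply: (Rmult_lt_reg_r (INR n)) => //.
  by rewrite (_ : Rabs L * ((s - t1) / INR n) * INR n = Rabs L * (s - t1)); [lra|rfield; lra].
have es : t1 + INR n * d = s by rewrite /d; rfield; lra.
suff h k : (k <= n)%N -> cE t1 = cE (t1 + INR k * d) by rewrite (h n) // es.
elim: k => [|k IH] hk; first by rewrite Rmult_0_l Rplus_0_r.
have kn : INR k.+1 <= INR n by apply: le_INR; lia.
have k0 := pos_INR k; rewrite S_INR in kn *; rewrite IH; last lia.
by apply: cE_eq1; nra.
Qed.

Lemma circle_aux s : t1 < s -> s < t2 -> exists (E G : BL X) (D : R),
  (E * E = E)%V /\ (1 - E = B * G)%V /\ (G * E = 0)%V /\
  (forall W, (W * B = B * W)%V -> (W * E = E * W)%V /\ (W * G = G * W)%V) /\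
  (forall m, nrm (B ^+ m * E)%V <= D * t1 ^ m) /\
  (forall m, nrm (G ^+ m * (1 - E))%V <= D * / s ^ m).
Proof.
move=> h1 h2; have hs : t1 <= s < t2 by lra.
have hs' : t1 <= s <= t2 by lra.
have ht : t1 <= t1 < t2 by lra.
have ht' : t1 <= t1 <= t2 by lra.
pose E := cE s; have hE := cEP hs; have K0 := circ_K.
have EE : (E * E = E)%V.
  by have := cE_idem hs; rewrite mulrBr mulr1 => /subr0_eq.
have [N hN] := hE (/ 2) ltac:(lra); pose j := N.+1.
have hj : nrm (E - U j s)%V < / 2 by rewrite nrmC; mono.
pose Dj := (U j s - E)%V.
have nDj : nrm Dj < 1 by rewrite nrmC; vlra.
have [N1 [n1 [n2 _]]] := neumann nDj.
have Ec (W : BL X) : (W * B = B * W)%V -> (W * E = E * W)%V by apply: cE_comm.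
have Uc (W : BL X) : (W * B = B * W)%V -> (W * U j s = U j s * W)%V by apply: circ_Uc.
have Nc (W : BL X) : (W * B = B * W)%V -> (W * N1 = N1 * W)%V.
  move=> hW; apply: (inv_comm n1 n2).
  by rewrite mulrBl mulrBr mul1r mulr1 mulrBl mulrBr Ec // Uc.
have p1 : ((1 - E) * (1 - E) = 1 - E)%V by rewrite mulrBl mul1r mulrBr mulr1 EE subrr subr0.
have e1 : (1 - E = N1 * ((1 - U j s) * (1 - E)))%V.
  have : ((1 - Dj) * (1 - E) = (1 - U j s) * (1 - E))%V.
    have -> : ((1 - Dj) * (1 - E) = (1 - U j s) * (1 - E) + E * (1 - E))%V by bvec.
    by have -> : (E * (1 - E) = 0)%V by [rewrite mulrBr mulr1 EE subrr]; rewrite addr0.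
  by move=> <-; rewrite mulrA n1 mul1r.
have [k ek] : exists k, (2 ^ j = k.+1)%N by exists (2 ^ j).-1; rewrite prednK // expn_gt0.
(* Since [U j s] is near [E], the operator [1 - U j s] is inverted by [N1] on the range of [1 - E].
   It equals [- T s ^+ k.+1 * U j s]; splitting off one factor [B] leaves [G]. *)
pose G := (- rc (/ s) *: (N1 * (T s ^+ k * (U j s * (1 - E)))))%V.
have Tc (W : BL X) n : (W * B = B * W)%V -> (W * T s ^+ n = T s ^+ n * W)%V.
  by move=> hW; rewrite blZX -scalerAl -scalerAr; congr (_ _)%V; apply/commrX.
have Gc (W : BL X) : (W * B = B * W)%V -> (W * G = G * W)%V.
  move=> hW; have e : (W * (1 - E) = (1 - E) * W)%V by rewrite mulrBl mulrBr mul1r mulr1 Ec.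
  have cm (P Q : BL X) : (W * P = P * W)%V -> (W * Q = Q * W)%V -> (W * (P * Q) = (P * Q) * W)%V.
    by move=> hP hQ; rewrite mulrA hP -mulrA hQ mulrA.
  have hH := cm _ _ (Nc W hW) (cm _ _ (Tc W k hW) (cm _ _ (Uc W hW) e)).
  by rewrite -(scalerAr (- rc (/ s))%V W) -(scalerAl (- rc (/ s))%V _ W) hH.
have BG : (1 - E = B * G)%V.
  rewrite Gc // {1}e1 circ_U // ek exprSr -scalerAl mulNr mulrN scaleNr.
  rewrite -!mulrA; have hBU : (B * U j s = U j s * B)%V by mono.
  have hBE : (B * (1 - E) = (1 - E) * B)%V by rewrite mulrBl mulrBr mul1r mulr1 Ec.
  rewrite -hBE (mulrA (U j s)) -hBU -!mulrA -!scalerAl -!scalerAr.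
  by [].
have GE : (G * E = 0)%V.
  have z : ((1 - E) * E = 0)%V by rewrite mulrBl mul1r EE subrr.
  by rewrite -scalerAl -!mulrA z !mulr0 scaler0.
have bE m : nrm (B ^+ m * E)%V <= (K + 1) * t1 ^ m.
  (* The projection does not depend on the radius, so the smallest one may be used for the rate. *)
  have <- : cE t1 = E by apply: cE_eq.
  apply: (cvg_le (bcvgMl (B ^+ m)%V (cEP ht))); exists m => n hn.
  have [_ [_ [_ a]]] := cinvP n ht' i1.
  have hm : (m <= 2 ^ n)%N by apply: leq_trans hn _; apply: ltnW; apply: ltn_expl.
  have := a m hm; rewrite blZX -scalerAl nrmZ -rcX Cmod_rc; last first.
    pos.
  rewrite pow_inv => h; have tm := pow_lt t1 m.
  apply: (Rmult_le_reg_l (/ t1 ^ m)); first pos.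
  by rewrite (Rmult_comm (K + 1)) -Rmult_assoc Rinv_l ?Rmult_1_l; pos.
have low m (Z : BL X) : nrm ((1 - E) * Z)%V <= (K + 1) * / s ^ m * nrm (B ^+ m * ((1 - E) * Z))%V.
  pose Y := ((1 - E) * Z)%V.
  have cv : cvg (fun n => (1 - U n s) * Y)%V Y.
    have h0 : cvg (fun n => (1 - U n s) * Y)%V ((1 - E) * Y)%V.
      by apply: bcvgMr; apply: cvgB hE; apply: cvg_cst.
    by move: h0; rewrite mulrA p1.
  apply: (cvg_le cv); exists m => n hn.
  have [_ [_ [_ a]]] := cinvP n hs' i1.
  have hm : (m <= 2 ^ n)%N by apply: leq_trans hn _; apply: ltnW; apply: ltn_expl.
  rewrite circ_U // -{1}(subnK hm) exprD mulNr nrmN.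
  have -> : (T s ^+ (2 ^ n - m) * T s ^+ m * U n s * Y =
     rc (/ s ^ m) *: ((T s ^+ (2 ^ n - m) * U n s) * (B ^+ m * Y)))%V.
    rewrite -(mulrA _ (T s ^+ m)%V) -circ_UT // {2}/T blZX -rcX pow_inv.
    by rewrite -!scalerAr -!scalerAl !mulrA.
  have sm : 0 < / s ^ m by pos.
  rewrite nrmZ Cmod_rc; last lra.
  rewrite (Rmult_comm (K + 1)) Rmult_assoc; apply: Rmult_le_compat_l; first lra.
  apply: bnM_le => //.
  by apply: a; exact: leq_subr.
pose D := (K + 1) * (nrm (1 - E)%V + 1).
have n1E := nrm_ge0 (1 - E)%V.
exists E, G, D; do 3 (split=> //); split; first mono.
split=> m.
  via (bE m); apply: Rmult_le_compat_r; first pos.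
  by rewrite /D; nra.
have cEG : ((1 - E) * G ^+ m = G ^+ m * (1 - E))%V.
  have : (E * B = B * E)%V by rewrite -Ec.
  move=> /Gc h; have : GRing.comm E (G ^+ m)%V by exact: commrX.
  by rewrite /GRing.comm mulrBl mulrBr mul1r mulr1 => ->.
have e2 : (B ^+ m * ((1 - E) * G ^+ m) = 1 - E)%V.
  have hBG : (B * G = G * B)%V by mono.
  rewrite cEG mulrA -exprMn_comm // -BG.
  by elim: m {cEG} => [|m IH]; rewrite ?mul1r // exprS -mulrA IH.
have := low m (G ^+ m)%V; rewrite e2 cEG.
have sm : 0 < / s ^ m by pos.
rewrite /D.
nra.
Qed.
End Circle.

(* The spectral projections [E], [1 - E] of [B] inside and outside a circle in its resolvent set;
   [G] inverts [B] on the range of [1 - E]. *)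
Lemma circle (X : CBanach) (B : BL X) t1 s t2 : 0 < t1 -> t1 < s -> s < t2 ->
  (forall z : C, t1 <= Cmod z -> Cmod z <= t2 ->
     exists S, (S * (z *: Id - B) = 1)%V /\ ((z *: Id - B) * S = 1)%V) ->
  exists (E G : BL X) (D : R),
  (E * E = E)%V /\ (1 - E = B * G)%V /\ (G * E = 0)%V /\
  (forall W, (W * B = B * W)%V -> (W * E = E * W)%V /\ (W * G = G * W)%V) /\
  (forall m, nrm (B ^+ m * E)%V <= D * t1 ^ m) /\
  (forall m, nrm (G ^+ m * (1 - E))%V <= D * / s ^ m).
Proof.
move=> h0 h1 h2 /unif_inv [M hM]; apply: (@circle_aux X B t1 t2 M h0 _ hM s h1 h2); lra.
Qed.
(** * Quasinilpotent operators *)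

Definition qn (X : CBanach) (T : BL X) : Prop :=
  forall e, 0 < e -> exists N, forall n, (N <= n)%N -> nrm (T ^+ n)%V <= e ^ n.

Lemma pow_dom C t e : 0 <= t -> t < e -> exists N, forall n, (N <= n)%N -> C * t ^ n <= e ^ n.
Proof.
move=> t0 te; have q0 : 0 <= t / e by pos.
have q1 : t / e < 1.
  by apply: (Rmult_lt_reg_r e); [lra|rewrite (_ : t / e * e = t); [lra|rfield; lra]].
have C1 : 0 < Rabs C + 1 by have := Rabs_pos C; lra.
have [N hN] := pow_small q0 q1 (Rinv_0_lt_compat _ C1); exists N => n h.
have en : 0 < e ^ n by pos.
have -> : t ^ n = (t / e) ^ n * e ^ n by rewrite -Rpow_mult_distr; congr (_ ^ _); rfield; lra.
have qn0 : 0 <= (t / e) ^ n by pos.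
rewrite -Rmult_assoc -[X in _ <= X]Rmult_1_l; apply: Rmult_le_compat_r; first lra.
mid ((Rabs C + 1) * (t / e) ^ n).
  by apply: Rmult_le_compat_r; have := Rle_abs C; lra.
mid ((Rabs C + 1) * / (Rabs C + 1)); last by rewrite Rinv_r; lra.
mono.
Qed.

Section QN.
Variable X : CBanach.
Implicit Types S T : BL X.
Lemma qn_of_bound T : (forall e, 0 < e -> exists D, forall n, nrm (T ^+ n)%V <= D * e ^ n) -> qn T.
Proof.
move=> h e e0; have [D hD] := h (e / 2) ltac:(lra).
have [N hN] := @pow_dom D (e / 2) e ltac:(lra) ltac:(lra).
by exists N => n /hN; apply: Rle_trans.
Qed.
Lemma fin_bound (f : nat -> R) e N : 0 < e -> exists D, 0 <= D /\ forall n, (n < N)%N -> f n <= D * e ^ n.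
Proof.
move=> e0; elim: N => [|N [D [D0 hD]]]; first by exists 0; split; pos.
have eN := pow_lt e N.
have g0 : 0 <= Rabs (f N) / e ^ N by pos.
exists (D + Rabs (f N) / e ^ N); split=> [|n]; first lra.
rewrite ltnS leq_eqVlt Rmult_plus_distr_r => /orP [/eqP ->|/hD h].
  have -> : Rabs (f N) / e ^ N * e ^ N = Rabs (f N) by rfield; lra.
  have := Rle_abs (f N); pos.
have := pow_lt e n; have := Rmult_le_pos _ (e ^ n) g0; lra.
Qed.
Lemma qn_bound T : qn T -> forall e, 0 < e -> exists D, 0 <= D /\ forall n, nrm (T ^+ n)%V <= D * e ^ n.
Proof.
move=> h e e0; have [N hN] := h e e0; have [D [D0 hD]] := fin_bound (fun n => nrm (T ^+ n)%V) N e0.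
exists (1 + D); split=> [|n]; first lra.
have en := pow_lt e n; have := Rmult_le_pos D (e ^ n).
by have [/hN|/hD] := leqP N n; lra.
Qed.
(** Division of the exponent by [m]; the remainders contribute only the constant. *)
Lemma pow_bound T e m : 0 < e -> (0 < m)%N -> nrm (T ^+ m)%V <= e ^ m ->
  exists D, forall n, nrm (T ^+ n)%V <= D * e ^ n.
Proof.
move=> e0 m0 hm; have [D [D0 hD]] := fin_bound (fun n => nrm (T ^+ n)%V) m e0; exists D => n.
rewrite (divn_eq n m); move: (n %/ m)%N (n %% m)%N (ltn_pmod n m0) => q r hr.
elim: q => [|q IH]; first by rewrite mul0n add0n; exact: hD.
rewrite mulSn -addnA exprD; via (bnM _ _).
mid (e ^ m * (D * e ^ (q * m + r))).
  mono.
by rewrite (pow_add e m); right; rring.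
Qed.
Lemma qn_comm S T : (S * T = T * S)%V -> qn S -> qn (S * T)%V.
Proof.
move=> c h; apply: qn_of_bound => e e0; have T0 := nrm_ge0 T.
have [D []] := qn_bound h (Rdiv_lt_0_compat e (nrm T + 1) e0 ltac:(lra)).
exists D => n; rewrite exprMn_comm //; via (bnM _ _).
have h1 := bnX T n; have h2 : nrm T ^ n <= (nrm T + 1) ^ n by mono.
mid (D * (e / (nrm T + 1)) ^ n * (nrm T + 1) ^ n).
  mono.
by right; rewrite Rmult_assoc -Rpow_mult_distr; congr (_ * _ ^ _); rfield; lra.
Qed.
Lemma qnZ c T : qn T -> qn (c *: T)%V.
Proof.
move=> h; rewrite -[T]mulr1 scalerAr; apply: qn_comm => //.
by rewrite -scalerAr -scalerAl mulr1 mul1r.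
Qed.
Lemma qn0 : qn (0 : BL X)%V.
Proof.
exists 1%N => -[//|n]; rewrite exprS mul0r nrm0; pos.
Qed.
Lemma bl_powZ T x (c : C) n : T x = (c *: x)%V -> (T ^+ n)%V x = (c ^+ n *: x)%V.
Proof.
move=> h; elim: n => [|n IH]; first by rewrite scale1r.
by rewrite exprS blME IH blZ h scalerA -exprSr.
Qed.
Lemma qn_eig T x (c : C) : qn T -> T x = (c *: x)%V -> x <> 0%V -> c = 0%V.
Proof.
move=> h hx x0; apply: contrapT => c0; have cp := Cmod_gt0 c0; have xp := nrm_gt0 x0.
have [N hN] := h (Cmod c / 2) ltac:(lra); have := hN N.+1 (leqnSn _).
have := bnle (T ^+ N.+1)%V x; rewrite (bl_powZ _ hx) nrmZ CmodX => h1 h2.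
have h3 : Cmod c ^ N.+1 <= (Cmod c / 2) ^ N.+1 by nra.
have h4 : (Cmod c / 2) ^ N.+1 < Cmod c ^ N.+1.
  rewrite Rpow_mult_distr -[X in _ < X]Rmult_1_r; apply: Rmult_lt_compat_l; first pos.
  by have [] := pow_lt_1_compat (/ 2) N.+1 ltac:(lra) ltac:(lia).
lra.
Qed.
Lemma bcvgX (u : nat -> BL X) T n : cvg u T -> cvg (fun i => u i ^+ n)%V (T ^+ n)%V.
Proof.
move=> h; elim: n => [|n IH]; first by apply: (cvg_cst _).
rewrite exprS; apply: cvg_eq (bcvgM h IH) => i; by rewrite exprS.
Qed.

(* Away from the moduli of its eigenvalues a compact operator has circular spectral projections. *)
Lemma cpt_circle T t1 s t2 : cpt T -> 0 < t1 -> t1 < s -> s < t2 ->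
  (forall (z : C) x, t1 <= Cmod z -> Cmod z <= t2 -> T x = (z *: x)%V -> x = 0%V) ->
  exists (E G : BL X) (D : R), 0 < D /\
  (E * E = E)%V /\ (1 - E = T * G)%V /\ (G * E = 0)%V /\
  (forall W, (W * T = T * W)%V -> (W * E = E * W)%V /\ (W * G = G * W)%V) /\
  (forall m, nrm (T ^+ m * E)%V <= D * t1 ^ m) /\
  (forall m x, nrm ((1 - E)%V x) <= D * / s ^ m * nrm ((T ^+ m * (1 - E))%V x)).
Proof.
move=> hT h0 h1 h2 inj.
have [|E [G [D [p1 [p2 [p3 [p4 [p5 p6]]]]]]]] := @circle X T t1 s t2 h0 h1 h2.
  move=> z hz1 hz2; apply: fredholm => //; first by move=> z0; move: hz1; rewrite z0 Cmod0; lra.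
  by move=> v; apply: inj.
exists E, G, (Rabs D + 1).
have Dp : 0 < Rabs D + 1 by have := Rabs_pos D; lra.
have DD : D <= Rabs D + 1 by have := Rle_abs D; lra.
do 5 (split=> //); split=> m.
  by apply: Rle_trans; mono.
move=> x; have [_ cG] := p4 T erefl; have [cE _] := p4 T erefl.
have p1' : ((1 - E) * (1 - E) = 1 - E)%V by rewrite mulrBl mul1r mulrBr mulr1 p1 subrr subr0.
have e : ((1 - E) = (G ^+ m * (1 - E)) * (T ^+ m * (1 - E)))%V.
  have cP : ((1 - E) * T ^+ m = T ^+ m * (1 - E))%V.
    have : GRing.comm (1 - E)%V (T ^+ m)%V.
      by apply: commrX; rewrite /GRing.comm mulrBl mulrBr mul1r mulr1 cE.
    by [].
  rewrite mulrA -(mulrA (G ^+ m)%V) cP -!mulrA p1' !mulrA -exprMn_comm //.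
  rewrite -cG -p2; elim: m {cP} => [|m IH]; rewrite ?mul1r // exprS -mulrA -IH //.
rewrite {1}e blME; apply: bnle_le => //.
via (p6 m); apply: Rmult_le_compat_r => //.
by pos.
Qed.

Lemma cpt_qn T : cpt T -> (forall (z : C) x, T x = (z *: x)%V -> z <> 0%V -> x = 0%V) -> qn T.
Proof.
move=> hT inj; apply: qn_of_bound => e e0; have T0 := nrm_ge0 T.
(* The outer radius exceeds [nrm T]. On the range of [1 - E] the operator would expand faster than
   its norm allows, so this range is zero. *)
have [|||E [G [D [D0 [p1 [p2 [p3 [p4 [p5 p6]]]]]]]]] := @cpt_circle T e (nrm T + e + 1) (nrm T + e + 2) hT e0.
- lra.
- lra.
- by move=> z x h1 h2 hx; apply: (inj z) => // z0; move: h1; rewrite z0 Cmod0; lra.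
exists D => n; suff E1 : E = 1%V by have := p5 n; rewrite E1 mulr1.
apply: BLext => x; rewrite bl1E; apply/esym/subr0_eq.
apply: nrm_small => d d0; pose q := nrm T / (nrm T + e + 1).
have q0 : 0 <= q by apply: Rmult_le_pos; pos.
have q1 : q < 1.
  apply: (Rmult_lt_reg_r (nrm T + e + 1)); first lra.
  by rewrite (_ : q * (nrm T + e + 1) = nrm T); [lra|rewrite /q; rfield; lra].
pose M := D * nrm ((1 - E)%V x); have M0 : 0 <= M by apply: Rmult_le_pos; pos.
have [N hN] := pow_small q0 q1 (Rdiv_lt_0_compat d (M + 1) d0 ltac:(lra)).
have := hN N (leqnn _) => hq; have := p6 N x; rewrite blBE bl1E => h.
via h; rewrite blME.
have h3 : nrm ((T ^+ N)%V ((1 - E)%V x)) <= nrm T ^ N * nrm ((1 - E)%V x).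
  apply: bnle_le => //; exact: bnX.
have sp : 0 < (nrm T + e + 1) ^ N by pos.
have si := Rinv_0_lt_compat _ sp.
mid (D * / (nrm T + e + 1) ^ N * (nrm T ^ N * nrm ((1 - E)%V x))).
  mono.
have -> : D * / (nrm T + e + 1) ^ N * (nrm T ^ N * nrm ((1 - E)%V x)) = M * q ^ N.
  by rewrite /M /q Rpow_mult_distr pow_inv; rring.
have qN : 0 <= q ^ N by pos.
mid ((M + 1) * q ^ N); first nra.
mid ((M + 1) * (d / (M + 1))); last by right; rfield; lra.
by apply: Rmult_le_compat_l; lra.
Qed.

(* A circular spectral projection of the limit keeps the spectral radii of nearby operators away from [0]. *)
Lemma qn_lim (u : nat -> BL X) T : cpt T -> cvg u T ->
  (forall e, 0 < e -> exists N, forall n, (N <= n)%N ->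
     exists D, forall m, nrm (u n ^+ m)%V <= D * e ^ m) -> qn T.
Proof.
move=> hT hu hr; apply: qn_of_bound => e e0.
have [t1 [t2 [h1 [h2 [h3 inj]]]]] := @cpt_gap X T (e / 2) e hT ltac:(lra) ltac:(lra).
have t1p : 0 < t1 by lra.
pose s := (t1 + t2) / 2; have ts : t1 < s by rewrite /s; lra.
have st : s < t2 by rewrite /s; lra.
have [E [G [D [D0 [p1 [p2 [p3 [p4 [p5 p6]]]]]]]]] := cpt_circle hT t1p ts st inj.
have [E1|hE] := EM (E = 1%V).
  exists D => n; have := p5 n; rewrite E1 => h; via h.
mono.
have [x0 hx0] : exists x, (1 - E)%V x <> 0%V.
  apply: contrapT => h; apply: hE; apply: BLext => x; apply: contrapT => hx; apply: h; exists x.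
  by rewrite blBE => /subr0_eq; mono.
pose P := (1 - E)%V.
have PP : (P * P = P)%V by rewrite mulrBl mul1r mulrBr mulr1 p1 subrr subr0.
have EP : (E * P = 0)%V by rewrite mulrBr mulr1 p1 subrr.
pose x := P x0; have Px : P x = x by rewrite -blME PP.
have Ex : E x = 0%V by rewrite -blME EP.
have xp : 0 < nrm x by apply: nrm_gt0.
have q0 : 0 <= t1 / s by pos.
have q1 : t1 / s < 1.
  by apply: (Rmult_lt_reg_r s); [lra|rewrite (_ : t1 / s * s = t1); [lra|rfield; lra]].
have D4 : 0 < / (4 * (D * D)) by pos.
have [m0 hm0] := pow_small q0 q1 D4; pose m := m0.+1.
have hm := hm0 m (leqnSn _).
have sm : 0 < s ^ m by pos.
(* [T ^+ m] expands the range of [P] at least by the factor [be], and has norm at most [be / 4] on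
   the range of [E]; [m] was chosen for this. *)
pose be := s ^ m / D; have be0 : 0 < be by apply: Rdiv_lt_0_compat.
have al : D * t1 ^ m <= be / 4.
  have -> : t1 ^ m = (t1 / s) ^ m * s ^ m by rewrite -Rpow_mult_distr; congr (_ ^ _); rfield; lra.
  have -> : be / 4 = D * (/ (4 * (D * D)) * s ^ m) by rewrite /be; rfield; lra.
  mono.
have P0 := nrm_ge0 P; have E0 := nrm_ge0 E.
pose ep := be / (8 * (nrm P + nrm E + 1)); have ep0 : 0 < ep by apply: Rdiv_lt_0_compat; lra.
have epE : ep * (8 * (nrm P + nrm E + 1)) = be by rewrite /ep; rfield; lra.
pose e' := Rmin 1 (be / 4); have e'0 : 0 < e' by apply: Rmin_pos; lra.
have e'm : e' ^ m <= be / 4.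
  mid e'; last exact: Rmin_r.
  rewrite /=; have : e' ^ m0 <= 1.
    by rewrite -(pow1 m0); apply: pow_incr; split; [lra|exact: Rmin_l].
  nra.
have [N1 hN1] := hr e' e'0; have [N2 hN2] := bcvgX m hu ep0.
pose (N1 + N2)%N; have [Cn hC] := hN1 n ltac:(rewrite /n; lia).
have hS := hN2 n ltac:(rewrite /n; lia); set S := (u n ^+ m)%V.
have lowP y : be * nrm (P y) <= nrm ((T ^+ m)%V (P y)).
  have := p6 m => h.
  have : s ^ m / D * nrm (P y) <= s ^ m / D * (D / s ^ m * nrm ((T ^+ m)%V (P y))).
    mono.
  rewrite (_ : s ^ m / D * (D / s ^ m * nrm ((T ^+ m)%V (P y))) = nrm ((T ^+ m)%V (P y))) //.
  by rfield; lra.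
have [cE _] := p4 (T ^+ m)%V (commr_sym (commrX m (erefl (T * T)%V))).
have cP : (P * T ^+ m = T ^+ m * P)%V by rewrite mulrBl mulrBr mul1r mulr1 cE.
(* The cone where the [P]-part dominates is mapped into itself by every operator close to [T ^+ m],
   and the [P]-part grows by [be / 2]. The iterates of [x] then contradict the small rate assumed
   for the powers of [u n]. *)
have cone y : nrm (E y) <= nrm (P y) ->
    be / 2 * nrm (P y) <= nrm (P (S y)) /\ nrm (E (S y)) <= nrm (P (S y)).
  move=> hy; set a := nrm (P y) in hy; have a0 : 0 <= a := nrm_ge0 _.
  have y2 : nrm y <= 2 * a.
    have -> : y = (P y + E y)%V by rewrite subrK.
    by have := nrmD (P y) (E y); rewrite -/a; lra.
  have dS : nrm ((S - T ^+ m)%V y) <= ep * (2 * a).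
    apply: bnle_le => //.
    mono.
  have bP : nrm (P ((S - T ^+ m)%V y)) <= nrm P * (ep * (2 * a)).
    by apply: bnle_le.
  have bE : nrm (E ((S - T ^+ m)%V y)) <= nrm E * (ep * (2 * a)).
    by apply: bnle_le.
  have e1 : P (S y) = ((T ^+ m)%V (P y) + P ((S - T ^+ m)%V y))%V.
    have -> : (T ^+ m)%V (P y) = P ((T ^+ m)%V y) by rewrite -!blME cP.
    by rewrite -blD addrC subrK.
  have e2 : E (S y) = ((T ^+ m * E)%V (E y) + E ((S - T ^+ m)%V y))%V.
    by rewrite blB -!blME -mulrA p1 -cE addrC subrK.
  have b1 := lowP y; rewrite -/a in b1.
  have b2 : nrm ((T ^+ m * E)%V (E y)) <= be / 4 * a.
    apply: bnle_le => //.
    by apply: Rle_trans.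
  have pe : nrm P * (ep * (2 * a)) <= be / 4 * a.
    by rewrite -epE; have : 0 <= ep * a; nra.
  have ee : nrm E * (ep * (2 * a)) <= be / 4 * a.
    have : 0 <= ep * a; nra.
  have lb : be / 2 * a <= nrm (P (S y)).
    have e3 : (T ^+ m)%V (P y) = (P (S y) - P ((S - T ^+ m)%V y))%V by rewrite e1 addrK.
    have ba : 0 <= be * a by pos.
    by have := nrmB (P (S y)) (P ((S - T ^+ m)%V y)); rewrite -e3; lra.
  split=> //; rewrite e2.
  by via (nrmD _ _); lra.
have it k : (be / 2) ^ k * nrm x <= nrm (P ((S ^+ k)%V x)) /\
    nrm (E ((S ^+ k)%V x)) <= nrm (P ((S ^+ k)%V x)).
  elim: k => [|k [IH1 IH2]]; first by rewrite Px Ex nrm0; lra.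
  have [c1 c2] := cone _ IH2; rewrite exprS; split=> //.
  apply: Rle_trans c1; rewrite Rmult_assoc; mono.
have hk k : (be / 2) ^ k <= nrm P * Cn * (be / 4) ^ k.
  have [h _] := it k; apply: (Rmult_le_reg_r (nrm x)) => //.
  via h; via (bnle _ _); rewrite !Rmult_assoc.
  apply: Rmult_le_compat_l => //; via (bnle _ _).
  rewrite -Rmult_assoc; apply: Rmult_le_compat_r; first lra.
  rewrite -exprM; via (hC _).
  have C0 : 0 <= Cn.
    have := hC 0%N; rewrite Rmult_1_r; apply: Rle_trans; pos.
  apply: Rmult_le_compat_l => //; rewrite (_ : e' ^ (m * k)%N = (e' ^ m) ^ k); last exact: pow_mult.
  apply: pow_incr; split=> //.
  pos.
have [k hk2] := @pow_dom (nrm P * Cn + 1) (be / 4) (be / 2) ltac:(lra) ltac:(lra).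
have := hk2 k (leqnn _); have := hk k; have : 0 < (be / 4) ^ k by pos.
lra.
Qed.
End QN.
Lemma qn_ind (X : CBanach) (p : spair X) (T : BL X) : stab p T -> qn T -> qn (ind p T).
Proof.
move=> hs h e /h [N hN]; exists N => n /hN; apply: Rle_trans.
by rewrite -indX //; apply: nrm_ind.
Qed.
(** * Finite-dimensional subspaces *)

Section Span.
Variable X : CBanach.
Implicit Types (x y v : X) (l vs : seq X) (V W : X -> Prop) (T : BL X).
Fixpoint span l x : Prop :=
  if l is v :: l' then exists a y, span l' y /\ x = (a *: v + y)%V else x = 0%V.
Lemma span_lsub l : lsub (span l).
Proof.
elim: l => [|v l [h0 [hD hZ]]]; first by case: (@csub0 X).
split; first by exists 0%V, 0%V; rewrite scale0r addr0.
split=> [x y [a [x' [hx ->]]] [b [y' [hy ->]]]|c x [a [x' [hx ->]]]].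
  by exists (a + b)%V, (x' + y')%V; split; [mono|vec].
by exists (c * a)%V, (c *: x')%V; split; [mono|vec].
Qed.
Lemma span_in l x : x \in l -> span l x.
Proof.
elim: l => // v l IH; rewrite in_cons => /orP [/eqP ->|/IH h].
  by exists 1%V, 0%V; split; [exact: lsub0 (span_lsub l)|rewrite scale1r addr0].
by exists 0%V, x; rewrite scale0r add0r.
Qed.
Lemma span_min l V : lsub V -> (forall x, x \in l -> V x) -> forall x, span l x -> V x.
Proof.
move=> hV; elim: l => [|v l IH] h x; first by move=> ->; apply: lsub0.
move=> [a [y [/IH hy ->]]]; apply: lsubD => //; first by apply: lsubZ => //; apply/h/mem_head.
by apply: hy => z zl; apply: h; rewrite in_cons zl orbT.
Qed.
Lemma span_sub l l' : (forall x, x \in l -> x \in l') ->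
  forall x, span l x -> span l' x.
Proof. by move=> h; apply: span_min (span_lsub l') _ => x /h; apply: span_in. Qed.

Lemma csub_dist W v : csub W -> ~ W v -> exists d, 0 < d /\ forall w, W w -> d <= nrm (v - w).
Proof.
move=> hW hv; apply: contrapT => hn; apply: hv; apply: (cl_sub hW (fun x h => h)) => e e0.
apply: contrapT => h; apply: hn; exists e; split=> // w ww; apply: Rnot_lt_le => h1.
by apply: h; exists w.
Qed.
Lemma dist_coef W v d a y : lsub W -> (forall w, W w -> d <= nrm (v - w)) -> W y ->
  d * Cmod a <= nrm (a *: v + y)%V.
Proof.
move=> hW hd hy; have [->|a0] := EM (a = 0%V).
  by rewrite Cmod0 Rmult_0_r; pos.
have ap := Cmod_gt0 a0.
have -> : (a *: v + y = a *: (v - (- a^-1) *: y))%V.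
  by rewrite scalerBr scalerA mulrN mulfV ?scaleN1r ?opprK; apply/eqP.
rewrite nrmZ Rmult_comm; apply: Rmult_le_compat_l; first lra.
by apply: hd; apply: lsubZ.
Qed.
Lemma span_csub l : csub (span l).
Proof.
elim: l => [|v l hl]; first exact: csub0.
have [hv|hv] := EM (span l v).
  have e x : span (v :: l) x <-> span l x.
    split=> [[a [y [hy ->]]]|]; first by apply: lsubD hl.1 _ _ => //; apply: lsubZ hl.1 _.
    by exists 0%V, x; rewrite scale0r add0r.
  by rewrite (_ : span _ = span l) //; apply/funext => x; apply/propext.
have [d [d0 hd]] := csub_dist hl hv.
split; first exact: span_lsub.
move=> u x /choice [a /choice [y hy]] hx.
have co (b : C) z : span l z -> d * Cmod b <= nrm (b *: v + z)%V by apply: dist_coef hl.1 hd.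
have [|a0 ha] := @cauchy_cvg CC a.
  move=> e e0; have [N hN] := cvg_cauchy hx (Rmult_lt_0_compat _ _ d0 e0).
  exists N => m n hm hn; apply: (Rmult_lt_reg_l d) => //; apply: Rle_lt_trans (hN m n hm hn).
  have [h1 e1] := hy m; have [h2 e2] := hy n; rewrite e1 e2.
  via (co (a m - a n)%V (y m - y n)%V _); first exact: lsubB hl.1 _ _.
  by right; congr nrm; vec.
have hy0 : cvg y (x - a0 *: v)%V.
  have h : cvg (fun n => u n - a n *: v)%V (x - a0 *: v)%V.
    apply: cvgB => // e e0; apply: (@cvg_lip CC X (fun b => b *: v)%V (nrm v) _ _ _ ha e e0) => b c.
    by rewrite -scalerBl nrmZ Rmult_comm; apply: Rle_refl.
  by apply: cvg_eq h => n; have [_ ->] := hy n; vec.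
exists a0, (x - a0 *: v)%V; split; last by vec.
by apply: (csub_cvg hl _ hy0) => n; case: (hy n).
Qed.
Lemma tb_line v M : tb (fun x => exists a : C, Cmod a <= M /\ x = (a *: v)%V).
Proof.
apply: (@tb_lip CC X (fun a => a *: v)%V (nrm v)); last exact: tb_CC.
by move=> a b; rewrite -scalerBl nrmZ Rmult_comm; apply: Rle_refl.
Qed.
Lemma tb_span l M : tb (fun x => span l x /\ nrm x <= M).
Proof.
elim: l M => [|v l IH] M; first by apply: tb_mono (@tb1 X 0%V) => x [].
have [hv|hv] := EM (span l v).
  apply: tb_mono (IH M) => x [[a [y [hy ->]]] hM]; split=> //.
  by apply: lsubD (span_lsub l) _ _ => //; apply: lsubZ (span_lsub l) _.
have [d [d0 hd]] := csub_dist (span_csub l) hv.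
apply: tb_mono (tb_add (tb_line v (M / d)) (IH (M + M / d * nrm v))) => x [[a [y [hy ->]]] hM].
have ha : Cmod a <= M / d.
  apply: (Rmult_le_reg_l d) => //; rewrite (_ : d * (M / d) = M); last by rfield; lra.
  by apply: Rle_trans hM; apply: dist_coef (span_lsub l) hd hy.
exists (a *: v)%V, y; split; first by exists a.
do 2 (split=> //).
have -> : y = ((a *: v + y) - a *: v)%V by vec.
via (nrmB _ _); rewrite nrmZ.
by mono.
Qed.

Definition fd V : Prop := exists l, forall x, V x -> span l x.
Lemma bt_fd V : lsub V -> tb (fun x => V x /\ nrm x <= 1) -> exists l, forall x, V x <-> span l x.
Proof.
move=> hV /tb_net /(_ (/ 3) ltac:(lra)) [l [h1 h2]].
have hl x : span l x -> V x by apply: span_min => // y /h1 [].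
exists l; split; last mono.
move=> Vx; apply: contrapT => hx.
have [y [Vy [y1 hy]]] := riesz (span_csub l) hV hl Vx hx.
have [z zl hz] := h2 y (conj Vy y1); have := hy z (span_in zl); lra.
Qed.

Fixpoint indep l : Prop := if l is v :: l' then indep l' /\ ~ span l' v else True.
Lemma exchange (A B : seq X) x : span (A ++ B) x -> ~ span A x ->
  exists B1 b B2, B = B1 ++ b :: B2 /\ span (x :: A ++ B1 ++ B2) b.
Proof.
elim: B x => [|b B IH] x; first by rewrite cats0.
move=> hx hA.
have [c [y [hy ex]]] : exists c y, span (A ++ B) y /\ x = (c *: b + y)%V.
  have h : span (b :: A ++ B) x.
    by apply: (span_sub _ hx) => z; rewrite !(mem_cat, in_cons) orbCA.
  pos.
have [c0|] := EM (c = 0%V).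
  have hx' : span (A ++ B) x by rewrite ex c0 scale0r add0r.
  have [B1 [b' [B2 [-> hb]]]] := IH x hx' hA; exists (b :: B1), b', B2; split=> //.
  apply: (span_sub _ hb) => z; rewrite !(mem_cat, in_cons).
  by case/orP => [->//|/orP [->|/orP [->|->]]]; rewrite ?orbT.
exists [::], b, B; split=> //.
have -> : b = (c^-1 *: (x - y))%V.
  by rewrite ex addrK scalerA mulVf ?scale1r; apply/eqP.
apply: lsubZ (span_lsub _) _; apply: lsubB (span_lsub _) _ _.
  by apply: span_in; apply: mem_head.
by apply: (span_sub _ hy) => z; rewrite in_cons orbC => ->.
Qed.
Lemma steinitz l vs : indep vs -> (forall v, v \in vs -> span l v) ->
  exists l', (size l' + size vs)%N = size l /\ forall x, span l x -> span (vs ++ l') x.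
Proof.
elim: vs => [|v vs IH]; first by exists l; rewrite addn0.
move=> [h1 h2] h3.
have [|l' [e hl]] := IH h1; first by move=> w hw; apply: h3; rewrite in_cons hw orbT.
have [B1 [b [B2 [eB hb]]]] := exchange (hl _ (h3 v (mem_head _ _))) h2.
exists (B1 ++ B2); split; first by rewrite -e eB !size_cat /=; lia.
move=> x /hl hx; apply: (span_min (span_lsub (v :: vs ++ B1 ++ B2)) _ hx).
move=> y; rewrite eB !mem_cat in_cons => hy.
have [/eqP ->|hyb] := boolP (y == b) => //.
apply: span_in; rewrite in_cons !mem_cat.
by move: hy; rewrite (negbTE hyb) /=; case/orP => [->|/orP [->|->]]; rewrite ?orbT.
Qed.
(** An upper bound on the dimension; minimality arguments work with such bounds and never need the
    dimension itself. *)
Definition dle V n : Prop := forall vs, indep vs -> (forall v, v \in vs -> V v) -> (size vs <= n)%N.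
Lemma span_dle l : dle (span l) (size l).
Proof. by move=> vs h1 h2; have [l' [<- _]] := steinitz h1 h2; apply: leq_addl. Qed.
Lemma fd_dle V : fd V -> exists n, dle V n.
Proof. by move=> [l h]; exists (size l) => vs h1 h2; apply: span_dle => // v /h2 /h. Qed.
Lemma dle_mono V W n : (forall x, W x -> V x) -> dle V n -> dle W n.
Proof. by move=> h hV vs; mono. Qed.
Lemma dle_span V n : lsub V -> dle V n -> exists l, (size l <= n)%N /\ forall x, V x <-> span l x.
Proof.
move=> hV hn.
have [l [h1 [h2 h3]]] : exists l, indep l /\ (forall v, v \in l -> V v) /\
    forall x, V x -> span l x.
  apply: contrapT => h.
  have hk k : exists l, size l = k /\ indep l /\ (forall v, v \in l -> V v).
    elim: k => [|k [l [e [h1 h2]]]]; first by exists [::].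
    have [x []] : exists x, V x /\ ~ span l x.
      apply: contrapT => h3; apply: h; exists l; split=> //; split=> // x Vx.
      by apply: contrapT => h4; apply: h3; exists x.
    exists (x :: l); split; first by rewrite /= e.
    by split=> // in_cons /orP [/eqP ->|/h2].
  have [l [e [h1 h2]]] := hk n.+1; have := hn l h1 h2; by rewrite e ltnn.
exists l; split; first mono.
by split=> [/h3|] //; apply: span_min.
Qed.
Lemma dle_fd V n : lsub V -> dle V n -> fd V.
Proof. by move=> hV /(dle_span hV) [l [_ h]]; exists l => x /h. Qed.
Lemma dle_strict V W n v : lsub W -> (forall x, W x -> V x) -> V v -> ~ W v -> dle V n.+1 -> dle W n.
Proof.
move=> hW h Vv Wv hn vs h1 h2; have := hn (v :: vs); apply.
  by split=> // hv; apply: Wv; apply: (span_min hW h2).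
by move=> in_cons /orP [/eqP ->|/h2 /h].
Qed.
Lemma dle0 V x : dle V 0 -> V x -> x = 0%V.
Proof.
move=> h Vx; apply: contrapT => x0; have := h [:: x]; rewrite ltn0 => h1.
have : false => //.
apply: h1 => //.
by move=> y; rewrite inE => /eqP ->.
Qed.
Lemma fd_csub V : lsub V -> fd V -> csub V.
Proof.
move=> hV /fd_dle [n /(dle_span hV) [l [_ h]]].
have -> : V = span l by apply/funext => x; apply/propext.
exact: span_csub.
Qed.
Lemma fd_tb V M : fd V -> tb (fun x => V x /\ nrm x <= M).
Proof. by move=> [l h]; apply: tb_mono (tb_span l M) => x [/h]. Qed.
End Span.

Section Img.
Variables X Y : CBanach.
Variable f : X -> Y.
Hypotheses (fD : forall x y, f (x + y)%V = (f x + f y)%V) (fZ : forall c x, f (c *: x)%V = (c *: f x)%V).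
Lemma span_map l x : span l x -> span (map f l) (f x).
Proof.
elim: l x => [|v l IH] x; first by move=> ->; rewrite -(scale0r (0 : X)%V) fZ scale0r.
by move=> [a [y [/IH hy ->]]]; exists a, (f y); rewrite fD fZ.
Qed.
Lemma img_lsub V : lsub V -> lsub (fun y => exists x, V x /\ y = f x).
Proof.
split.
  exists 0%V; split; first exact: lsub0.
  by rewrite -(scale0r (0 : X)%V) fZ scale0r.
split=> [x y [v [hv ->]] [w [hw ->]]|c x [v [hv ->]]].
  by exists (v + w)%V; split; [apply: lsubD|].
by exists (c *: v)%V; split; [apply: lsubZ|].
Qed.
(** Preimages of an independent family of images stay independent after adjoining the kernel
    vector. *)
Lemma dle_ker V n x : V x -> x <> 0%V -> f x = 0%V -> dle V n.+1 ->
  dle (fun y => exists x, V x /\ y = f x) n.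
Proof.
move=> Vx x0 fx hn vs h1 h2.
have [us [e [hu iu]]] : exists us, map f us = vs /\ (forall v, v \in us -> V v) /\
    indep (us ++ [:: x]).
  elim: vs h1 h2 => [|v vs IH]; first by exists [::].
  move=> [i1 i2] h2; have [|us [e [hu iu]]] := IH i1; first by move=> w hw; apply: h2; rewrite in_cons hw orbT.
  have [u [hu' ev]] := h2 v (mem_head _ _).
  exists (u :: us); split; first by rewrite /= e ev.
  split; first by move=> in_cons /orP [/eqP ->|/hu].
  split=> // /span_map; rewrite map_cat e /= fx -ev => h.
  apply: i2; apply: (span_min (span_lsub vs) _ h) => z; rewrite mem_cat inE => /orP [/span_in //|/eqP ->].
  exact: lsub0 (span_lsub vs).
have := hn (us ++ [:: x]) iu; rewrite size_cat addn1 -e size_map; apply.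
by move=> w; rewrite mem_cat inE => /orP [/hu|/eqP ->].
Qed.
End Img.

Section FdOps.
Variable X : CBanach.
Implicit Types (S T : BL X) (V : X -> Prop).
Lemma surj_inj V T x : lsub V -> fd V -> (forall v, V v -> V (T v)) -> (forall v, V v -> exists w, V w /\ T w = v) ->
  V x -> T x = 0%V -> x = 0%V.
Proof.
move=> hV /fd_dle [n hn] hT hs Vx Tx; apply: contrapT => x0.
elim: n hn => [|n IH] hn; first by apply: x0; exact: dle0 Vx.
apply: IH; apply: dle_mono (dle_ker (blD T) (blZ T) Vx x0 Tx hn) => v /hs [w []].
by exists w.
Qed.
(* Without eigenvalue [T] would be quasinilpotent and bounded below on [V]. *)
Lemma fd_eig V T x0 : lsub V -> fd V -> (forall v, V v -> V (T v)) -> V x0 -> x0 <> 0%V ->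
  exists x (c : C), V x /\ x <> 0%V /\ T x = (c *: x)%V.
Proof.
move=> hV fV hT Vx0 x00; apply: contrapT => hn.
have cV := fd_csub hV fV.
pose p := SPair cV (@csub0 X) (fun x (h : x = 0%V) => eq_ind_r V (lsub0 hV) h).
have st : stab p T by split=> [x hx|x /= ->]; [exact: hT|rewrite bl0].
have pin x : V x -> pi p x = 0%V -> x = 0%V by move=> hx /pi_eq0; apply.
pose Q := qsp p; pose K : BL Q := ind p T.
have tbQ : @cpt Q 1%V.
  have h1 := tb_net (fd_tb 2 fV); move=> e /h1 [l [hl1 hl2]].
  exists [seq pi p y | y <- l] => q [a [ha ->]]; rewrite bl1E.
  have [|x [hx [ex nx]]] := @pi_wit X p a 1; first lra.
  have [|y yl hy] := hl2 x; first by split=> //; via (Rlt_le _ _ nx); apply: Rplus_le_compat_r; exact: ha.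
  exists (pi p y); first exact: map_f.
  have [Vy _] := hl1 y yl; rewrite -ex -piB //.
  by apply: Rle_lt_trans hy; apply: pi_le; apply: lsubB.
have cK : cpt K by rewrite -[K]mul1r; apply: cptMr.
have hq : qn K.
  apply: cpt_qn => // z q hqz z0; have [x [hx ex]] := pi_ex q.
  apply: contrapT => q0; apply: hn; exists x, z; split=> //.
  split; first by move=> x1; apply: q0; rewrite -ex x1 pi0.
  move: hqz; rewrite -ex indE // -piZ // => h.
  apply: subr0_eq; apply: pin.
    by apply: lsubB => //; [apply: hT|apply: lsubZ].
  rewrite piB ?h ?subrr //; [exact: hT|exact: lsubZ].
have inj q : True -> K q = 0%V -> q = 0%V.
  move=> _; have [x [hx ex]] := pi_ex q; rewrite -ex indE // => h.
  have Tx := pin _ (hT _ hx) h.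
  have [->|x1] := EM (x = 0%V); first exact: pi0.
  by case: hn; exists x, 0%V; rewrite scale0r.
(* The identity of [Q] is itself compact, so [0] serves as the inverse of [K] modulo compact
   operators. *)
have [|||||||||[M hM] _] := @fred Q K 0%V 1%V 0%V 1%V (fun=> True).
- exact: csubT.
- exact/eqP/oner_neq0.
- by [].
- by [].
- by rewrite mulr0 scale1r subr0 addr0.
- by rewrite mulr0 mul0r.
- by rewrite nrm0 Cmod1; lra.
- exact: tbQ.
- exact: inj.
pose M1 := Rabs M + 1; have M1p : 0 < M1 by have := Rabs_pos M; rewrite /M1; lra.
have low n q : nrm q <= M1 ^ n * nrm ((K ^+ n)%V q).
  elim: n => [|n IH]; first by rewrite expr0 bl1E /=; lra.
  via IH; rewrite exprS blME [M1 ^ n.+1]/= (Rmult_comm M1) Rmult_assoc.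
  apply: Rmult_le_compat_l; first pos.
  via (hM _ I); apply: Rmult_le_compat_r; first pos.
  by have := Rle_abs M; rewrite /M1; lra.
have [N hN] := hq (/ (2 * M1)) ltac:(pos).
have h1 := hN N.+1 (leqnSn _); have h2 := low N.+1 (pi p x0).
have q0 : 0 < nrm (pi p x0) by apply: nrm_gt0 => /(pin _ Vx0).
have h3 := bnle (K ^+ N.+1)%V (pi p x0).
have h4 : M1 ^ N.+1 * (/ (2 * M1)) ^ N.+1 = (/ 2) ^ N.+1.
  by rewrite -Rpow_mult_distr; congr (_ ^ _); rfield; lra.
have [_ h5] := pow_lt_1_compat (/ 2) N.+1 ltac:(lra) ltac:(lia).
have Mp : 0 < M1 ^ N.+1 by pos.
have h6 : nrm ((K ^+ N.+1)%V (pi p x0)) <= (/ (2 * M1)) ^ N.+1 * nrm (pi p x0).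
  by via h3; mono.
have h7 : M1 ^ N.+1 * nrm ((K ^+ N.+1)%V (pi p x0)) <= (/ 2) ^ N.+1 * nrm (pi p x0).
  pos.
apply: (Rlt_irrefl (nrm (pi p x0))); apply: Rle_lt_trans h2 _; apply: Rle_lt_trans h7 _.
by rewrite -[X in _ < X]Rmult_1_l; apply: Rmult_lt_compat_r.
Qed.

Fixpoint rprod (a : BL X) (rs : seq C) : BL X :=
  if rs is r :: rs' then (rprod a rs' * (a - r *: (1 : BL X)))%V else 1%V.
(* The roots of the annihilating polynomial are found one eigenvector at a time. *)
Lemma annih V T : lsub V -> fd V -> (forall v, V v -> V (T v)) -> exists rs,
  (forall r, r \in rs -> exists x, V x /\ x <> 0%V /\ T x = (r *: x)%V) /\
  forall v, V v -> rprod T rs v = 0%V.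
Proof.
move=> hV /fd_dle [n hn]; elim: n V hV hn => [|n IH] V hV hn hT.
  by exists [::]; split=> // v /(dle0 hn) ->; rewrite bl0.
have [[x0 [Vx0 x00]]|hz] := EM (exists x, V x /\ x <> 0%V); last first.
  exists [::]; split=> // v Vv; have [->|v0] := EM (v = 0%V); first by rewrite bl0.
  by case: hz; exists v.
have [x [r [Vx [x1 Tx]]]] := fd_eig hV (dle_fd hV hn) hT Vx0 x00.
pose S : BL X := (T - r *: Id)%V.
have Sx : S x = 0%V by rewrite /S blBE blZE bl1E Tx subrr.
have SV v : V v -> V (S v) by move=> hv; apply: lsubB => //; [apply: hT|apply: lsubZ].
have TS v : T (S v) = S (T v) by rewrite /S !blBE !blZE !bl1E blB blZ.
have [|rs [h1 h2]] := IH _ (img_lsub (blD S) (blZ S) hV) (dle_ker (blD S) (blZ S) Vx x1 Sx hn).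
  by move=> _ [v [Vv ->]]; exists (T v); split; [apply: hT|rewrite TS].
exists (r :: rs); split=> [r'|v Vv].
  rewrite in_cons => /orP [/eqP ->|/h1 [_ [[v [Vv ->]] h]]]; first by exists x.
  by exists (S v); split=> //; apply: SV.
by rewrite [rprod _ _]/= blME; apply: h2; exists v.
Qed.

Definition frk T : Prop := fd (fun y => exists x, y = T x).
Lemma range_lsub T : lsub (fun y => exists x, y = T x).
Proof.
split; first by exists 0%V; rewrite bl0.
split=> [x y [v ->] [w ->]|c x [v ->]]; first by exists (v + w)%V; rewrite blD.
by exists (c *: v)%V; rewrite blZ.
Qed.
Lemma frkP T l : (forall x, span l (T x)) -> frk T.
Proof. by exists l => y [x ->]. Qed.
Lemma frkE T : frk T -> exists l, forall x, span l (T x).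
Proof. by move=> [l h]; exists l => x; apply: h; exists x. Qed.
Lemma frkD S T : frk S -> frk T -> frk (S + T)%V.
Proof.
move=> /frkE [l hl] /frkE [m hm]; apply: (@frkP _ (l ++ m)) => x.
apply: lsubD (span_lsub _) _ _.
  by apply: span_sub (hl x) => y; rewrite mem_cat => ->.
by apply: span_sub (hm x) => y; rewrite mem_cat => ->; rewrite orbT.
Qed.
Lemma frkZ c T : frk T -> frk (c *: T)%V.
Proof. by move=> /frkE [l hl]; apply: (@frkP _ l) => x; apply: lsubZ (span_lsub _) _. Qed.
Lemma frkN T : frk T -> frk (- T)%V. Proof. by rewrite -scaleN1r; apply: frkZ. Qed.
Lemma frkB S T : frk S -> frk T -> frk (S - T)%V.
Proof. by move=> hS hT; apply: frkD => //; apply: frkN. Qed.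
Lemma frkMl S T : frk T -> frk (S * T)%V.
Proof.
move=> /frkE [l hl]; apply: (@frkP _ (map S l)) => x.
exact: (span_map (blD S) (blZ S) (hl x)).
Qed.
Lemma frkMr S T : frk S -> frk (S * T)%V.
Proof. by move=> /frkE [l hl]; apply: (@frkP _ l) => x; rewrite blME. Qed.
Lemma frk0 : frk 0%V. Proof. by apply: (@frkP _ [::]). Qed.
Lemma frk_cpt T : frk T -> cpt T.
Proof.
move=> /(fd_tb (nrm T)); apply: tb_mono => y [x [hx ->]]; split; first by exists x.
by via (bnle _ _); have := nrm_ge0 T; nra.
Qed.
Lemma cpt_idem_frk P : cpt P -> (P * P = P)%V -> frk P.
Proof.
move=> hP PP; have [|l hl] := bt_fd (range_lsub P).
  apply: tb_mono hP => y [[x ->] hx]; exists (P x).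
  by rewrite -blME PP.
by exists l => y /hl.
Qed.
End FdOps.
(** * The adjoint operator of a compact operator *)

Lemma nrm_signX (X Y : CBanach) (T : BL X) (f : BL X -> Y) i : (forall y, f (- y)%V = (- f y)%V) ->
  nrm (f ((-1) ^+ i * T)%V) = nrm (f T).
Proof.
move=> hf; elim: i => [|i IH]; first by rewrite mul1r.
by rewrite exprS -mulrA mulN1r hf nrmN.
Qed.
Lemma sq_diff (X : CBanach) (B : BL X) (z : C) :
  ((z *: Id - B) * (z *: Id + B) = (z * z) *: Id - B * B)%V.
Proof. by rewrite mulrBl !mulrDr -!scalerAl -!scalerAr !mulr1 !mul1r; vec. Qed.
Lemma corner_dec (X : CBanach) (P v : BL X) : ((1 - P) * v * (1 - P) = 0)%V ->
  v = (P * v + (v * P - P * v * P))%V.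
Proof.
by rewrite mulrBl mulrBr !mulr1 mulrBl mul1r => h; rewrite -[LHS]subr0 -h; vec.
Qed.
Section Adm.
Variable X : CBanach.
Implicit Types (a b x : BL X).
Notation BX := (BB X).
Lemma LmP a : linear (X := BX) (fun x : BL X => a * x)%V /\ bounded (X := BX) (fun x : BL X => a * x)%V.
Proof.
split; last by exists (nrm a); apply: bnM.
by split=> [|c x]; [exact: mulrDr|exact: esym (scalerAr _ _ _)].
Qed.
Lemma RmP a : linear (X := BX) (fun x : BL X => x * a)%V /\ bounded (X := BX) (fun x : BL X => x * a)%V.
Proof.
split; last by exists (nrm a) => x; rewrite Rmult_comm; apply: bnM.
by split=> [x y|c x]; [exact: mulrDl|exact: esym (scalerAl _ _ _)].
Qed.
Definition Lm a : BL BX := BLmk (LmP a).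
Definition Rm a : BL BX := BLmk (RmP a).
Definition adm a : BL BX := (Lm a - Rm a)%V.
Lemma LmE a x : Lm a x = (a * x)%V. Proof. by []. Qed.
Lemma RmE a x : Rm a x = (x * a)%V. Proof. by []. Qed.
Lemma admE a x : adm a x = (a * x - x * a)%V. Proof. by []. Qed.
Lemma LmM a b : Lm (a * b)%V = (Lm a * Lm b)%V.
Proof. by apply: BLext => x; rewrite blME !LmE mulrA. Qed.
Lemma RmM a b : Rm (a * b)%V = (Rm b * Rm a)%V.
Proof. by apply: BLext => x; rewrite !RmE mulrA. Qed.
Lemma LRm a b : (Lm a * Rm b = Rm b * Lm a)%V.
Proof. by apply: BLext => x; rewrite !blME !LmE mulrA. Qed.
Lemma LmX a n : (Lm a ^+ n = Lm (a ^+ n))%V.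
Proof.
elim: n => [|n IH]; first by apply: BLext => x; rewrite LmE mul1r.
by rewrite !exprS IH LmM.
Qed.
Lemma RmX a n : (Rm a ^+ n = Rm (a ^+ n))%V.
Proof.
elim: n => [|n IH]; first by apply: BLext => x; rewrite RmE mulr1.
by rewrite exprS IH exprSr RmM.
Qed.
Lemma nrm_Lm a : nrm (Lm a) <= nrm a.
Proof. by apply: bn_bound; [pos|move=> x; apply: bnM]. Qed.
Lemma nrm_Rm a : nrm (Rm a) <= nrm a.
Proof. by apply: bn_bound; [pos|move=> x; rewrite Rmult_comm; apply: bnM]. Qed.
Lemma cpt_LR a b : cpt a -> cpt b -> cpt (Lm a * Rm b)%V.
Proof.
move=> ha hb; apply: tb_mono (vala 1 ha hb) => y [x [hx ->]]; exists x.
by rewrite blME LmE mulrA.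
Qed.
Lemma bsum_bound (f : nat -> BL X) n M t r : 0 <= M ->
  (forall i, (i <= n)%N -> nrm (f i) <= M * (t ^ i * r ^ (n - i))) ->
  0 <= t -> 0 <= r ->
  nrm (\sum_(i < n.+1) f i *+ 'C(n, i))%V <= M * (t + r) ^ n.
Proof.
move=> M0 hf t0 r0; via (nrm_sum (fun i => f i *+ 'C(n, i))%V n.+1).
have -> : M * (t + r) ^ n = rsum (fun i => M * (INR 'C(n, i) * (t ^ i * r ^ (n - i)))) n.+1.
  rewrite rsumZ; congr (_ _); rewrite Rplus_comm.
  have : rc ((r + t) ^ n) = rc (rsum (fun i => INR 'C(n, i) * (t ^ i * r ^ (n - i))) n.+1).
    rewrite rcX rcD exprDn.
    have h m (g : nat -> R) : rc (rsum g m) = (\sum_(i < m) rc (g i))%V.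
      by elim: m => [|m IH]; rewrite ?big_ord0 // big_ord_recr rcD IH.
    rewrite h; apply: eq_bigr => i.
    by rewrite !rcM !rcX rc_nat -mulr_natl (mulrC (_ ^+ (n - i))%V).
  by move=> [].
apply: rsum_le => i hi; rewrite -scaler_nat nrmZ -rc_nat Cmod_rc; last pos.
rewrite -Rmult_assoc (Rmult_comm M) Rmult_assoc; apply: Rmult_le_compat_l; first pos.
exact: hf.
Qed.
Lemma exprB_sum (A : pzRingType) (u v : A) n : (u * v = v * u)%V ->
  ((u - v) ^+ n = \sum_(i < n.+1) (u ^+ (n - i) * (- v) ^+ i) *+ 'C(n, i))%V.
Proof. by move=> h; apply: exprDn_comm; rewrite /GRing.comm mulrN mulNr h. Qed.
Lemma ad_pow a x n : ((adm a ^+ n)%V x = \sum_(i < n.+1) ((-1) ^+ i * (a ^+ (n - i) * x * a ^+ i)) *+ 'C(n, i))%V.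
Proof.
rewrite exprB_sum; last exact: LRm.
rewrite bl_sumE; apply: eq_bigr => i.
have e (T : BL BX) m : (T *+ m)%V x = (T x *+ m)%V.
  by elim: m => [|m IH]; rewrite // !mulrS -IH.
rewrite e; rewrite -[(- Rm a)%V]mulN1r exprMn_comm; last first.
  by rewrite /GRing.comm mulN1r mulrN1.
rewrite LmX RmX blME LmE blME.
have sg (y : BL X) : ((-1) ^+ i : BL BX)%V y = ((-1) ^+ i * y)%V.
  elim: (i : nat) => [|j IH]; first by rewrite mul1r.
  by rewrite !exprS blME IH mulN1r mulNr.
have c : (a ^+ (n - i) * (-1) ^+ i = (-1) ^+ i * a ^+ (n - i))%V.
  by apply: commrX; rewrite /GRing.comm mulN1r mulrN1.
by rewrite sg !mulrA c.
Qed.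
(** In the binomial expansion of the power of [L_a - R_a] both the left and the right powers of [a]
    are cut by [E], so the rate is twice that of [a] on the range of [E]. *)
Lemma ad_corner a E x D t n : 0 <= D -> 0 <= t -> (E * x * E = x)%V ->
  (forall m, nrm (a ^+ m * E)%V <= D * t ^ m) -> (a * E = E * a)%V ->
  nrm ((adm a ^+ n)%V x) <= D * D * nrm x * (t + t) ^ n.
Proof.
move=> D0 t0 hx hE cE; rewrite ad_pow; apply: (@bsum_bound (fun i => (-1) ^+ i * (a ^+ (n - i) * x * a ^+ i))%V) => //.
  pos.
move=> i hi; rewrite (@nrm_signX X (BB X) (a ^+ (n - i) * x * a ^+ i)%V (fun y => y)) //.
have -> : (a ^+ (n - i) * x * a ^+ i = (a ^+ (n - i) * E) * x * (a ^+ i * E))%V.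
  have c : (a ^+ i * E = E * a ^+ i)%V by have : GRing.comm E (a ^+ i)%V by [apply: commrX].
  by rewrite c -{1}hx !mulrA.
via (bnM _ _); mid (D * t ^ (n - i) * nrm x * (D * t ^ i)).
  apply: Rmult_le_compat; try pos.
  by apply: bnM_le.
lra.
Qed.
Lemma adm_comm a E n x : (a * E = E * a)%V ->
  ((adm a ^+ n)%V (E * x) = E * (adm a ^+ n)%V x)%V /\ ((adm a ^+ n)%V (x * E) = (adm a ^+ n)%V x * E)%V.
Proof.
move=> c; elim: n => [|n [IH1 IH2]] //.
rewrite !exprS !blME IH1 IH2 !admE mulrBr mulrBl !mulrA c.
by rewrite -!mulrA c.
Qed.
End Adm.

(** * Quasinilpotence of [ad a] on spaces without finite-rank operators *)

Section T8.
Variables (X : CBanach) (a : BL X) (V : BL X -> Prop).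
Hypotheses (ca : cpt a) (cV : csub V) (adV : forall v, V v -> V (a * v - v * a)%V)
  (nV : forall v, V v -> frk v -> v = 0%V).
Notation A := (adm a).
Let sq (c : C) : BL (BB X) := (A * A - (c * c) *: (1 : BL (BB X)))%V.

(* [p(A)] modulo compact operators, for [p = z^N prod (z^2 - r^2)]. *)
Fixpoint Qr (rs : seq C) : BL X := if rs is r :: rs' then ((a * a - (r * r) *: (1 : BL X)) * Qr rs')%V else 1%V.
Fixpoint pA N (rs : seq C) : BL (BB X) := if rs is r :: rs' then (sq r * pA N rs')%V else (A ^+ N)%V.
Fixpoint pz N (z : C) (rs : seq C) : C := if rs is r :: rs' then ((z * z - r * r) * pz N z rs')%V else (z ^+ N)%V.
Lemma Qr_comm rs : (a * Qr rs = Qr rs * a)%V.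
Proof.
elim: rs => [|r rs IH]; first by rewrite mulr1 mul1r.
rewrite -!(mulrA _ _ a) -IH !mulrA; congr (_ _)%V.
by rewrite mulrBr mulrBl -scalerAl -scalerAr mulr1 mul1r mulrA.
Qed.
(** Since [L_a R_a] is compact by [vala], a polynomial without constant term in [L_a - R_a] is,
    modulo compact operators, the sum of its values at [L_a] and [- R_a]. The factors are even, so
    that one sign [sg] relates the value at [- R_a] to that at [R_a]. *)
Lemma pA_mod N rs : exists (K : BL (BB X)) (sg : C), cpt K /\ Cmod sg = 1 /\
  pA N.+1 rs = (K + (Lm (Qr rs * a ^+ N.+1) + sg *: Rm (Qr rs * a ^+ N.+1)))%V.
Proof.
elim: rs => [|r rs [K [sg [hK [hs IH]]]]].
  rewrite /pA mul1r; elim: N => [|N [K [sg [hK [hs IH]]]]].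
    exists 0%V, (-1)%V; split; first exact: cpt0.
    split; first by rewrite CmodN Cmod1.
    by rewrite add0r scaleN1r.
  exists (A * K - Rm a * Lm (a ^+ N.+1) + sg *: (Lm a * Rm (a ^+ N.+1)))%V, (- sg)%V.
  have cN : cpt (a ^+ N.+1)%V by rewrite exprSr; apply: cptMl.
  split; first by apply: cptD; [apply: cptB; [exact: cptMl|rewrite -LRm; exact: cpt_LR]|apply: cptZ; exact: cpt_LR].
  split; first by rewrite CmodN.
  rewrite exprS IH mulrDr (mulrDr A) -scalerAr !mulrBl -LmM -RmM -exprS -exprSr; vec.
set x := (Qr rs * a ^+ N.+1)%V.
have cx : cpt x by rewrite /x exprSr mulrA; apply: cptMl.
have xc : (a * x = x * a)%V by rewrite mulrA Qr_comm -!mulrA -exprSr.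
pose y := ((a * a - (r * r) *: Id) * x)%V.
have ey : (Qr (r :: rs) * a ^+ N.+1 = y)%V by rewrite -mulrA.
rewrite ey.
have ey2 : y = (x * (a * a) - (r * r) *: x)%V.
  by rewrite /y mulrBl -scalerAl mul1r mulrA -xc -mulrA -xc mulrA.
have ey1 : y = (a * a * x - (r * r) *: x)%V by rewrite /y mulrBl -scalerAl mul1r.
have LmB u v : Lm (u - v)%V = (Lm u - Lm v)%V by apply: BLext => w; rewrite LmE mulrBl.
have RmB u v : Rm (u - v)%V = (Rm u - Rm v)%V by apply: BLext => w; rewrite RmE mulrBr.
have LmZ c u : Lm (c *: u)%V = (c *: Lm u)%V by apply: BLext => w; rewrite LmE -scalerAl.
have RmZ c u : Rm (c *: u)%V = (c *: Rm u)%V by apply: BLext => w; rewrite RmE -scalerAr.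
pose L := Lm a; pose R1 := Rm a.
have eL : Lm y = (L * L * Lm x - (r * r) *: Lm x)%V by rewrite ey1 LmB LmZ !LmM.
have eR : Rm y = (R1 * R1 * Rm x - (r * r) *: Rm x)%V by rewrite ey2 RmB RmZ !RmM.
have AA : (A * A = L * L - (L * R1) *+ 2 + R1 * R1)%V.
  have cLR : (R1 * L = L * R1)%V by rewrite LRm.
  by rewrite /adm -/L -/R1 mulrBl !mulrBr cLR mulr2n; vec.
exists (sq r * K + (R1 * R1 * Lm x - (L * R1 * Lm x) *+ 2) + sg *: (L * L * Rm x - (L * R1 * Rm x) *+ 2))%V, sg.
have c1 : cpt (R1 * Lm x)%V by rewrite -LRm; exact: cpt_LR.
have c2 : cpt (L * Rm x)%V by exact: cpt_LR.
have c3 : cpt (L * R1)%V by exact: cpt_LR.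
split.
  apply: cptD; first apply: cptD; first exact: cptMl.
    apply: cptB; first by rewrite -mulrA; apply: cptMl.
    by apply: cptD; apply: cptMr.
  apply: cptZ; apply: cptB; first by rewrite -mulrA; apply: cptMl.
  by apply: cptD; apply: cptMr.
split=> //.
have sqE U : (sq r * U = L * L * U - (L * R1 * U) *+ 2 + R1 * R1 * U - (r * r) *: U)%V.
  by rewrite /sq AA mulrBl mulrDl mulrBl mulrnAl -scalerAl mul1r.
have -> : pA N.+1 (r :: rs) = (sq r * K + sq r * Lm x + sg *: (sq r * Rm x))%V.
  by rewrite [LHS]/= IH addrA mulrDr mulrDr -scalerAr.
by rewrite (sqE (Lm x)) (sqE (Rm x)) eL eR; vec.
Qed.

Let polyA (U : BL (BB X)) : Prop := (A * U = U * A)%V /\ forall v, V v -> V (U v).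
Lemma polyA1 c : polyA (c *: Id)%V.
Proof.
split; first by rewrite -scalerAl -scalerAr mulr1 mul1r.
by move=> v hv; apply: (lsubZ c cV.1 hv).
Qed.
Lemma polyAD S T : polyA S -> polyA T -> polyA (S + T)%V.
Proof.
move=> [h1 h2] [h3 h4]; split; first by rewrite mulrDr h1 h3 mulrDl.
by move=> v hv; apply: (lsubD cV.1); auto.
Qed.
Lemma polyAM S T : polyA S -> polyA T -> polyA (S * T)%V.
Proof.
move=> [h1 h2] [h3 h4]; split; first by rewrite mulrA h1 -mulrA h3 mulrA.
by move=> v; rewrite blME; auto.
Qed.
Lemma polyAZ c S : polyA S -> polyA (c *: S)%V.
Proof. by move=> h; rewrite -[S]mul1r scalerAl; apply: polyAM => //; apply: polyA1. Qed.
Lemma polyAB S T : polyA S -> polyA T -> polyA (S - T)%V.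
Proof. by move=> h1 h2; apply: polyAD => //; rewrite -scaleN1r; apply: polyAZ. Qed.
Lemma polyA_pA N rs : polyA (pA N rs).
Proof.
have h0 : polyA (A ^+ N)%V.
  elim: N => [|N IH]; first by rewrite expr0 -[1%V]scale1r; apply: polyA1.
  by rewrite exprS; apply: polyAM.
elim: rs => [//|r rs IH] /=; apply: polyAM => //.
apply: polyAB; last exact: polyA1.
apply: polyAM; pos.
Qed.
(** Polynomial division by [z - A]. The quotient is a polynomial in [A], so it preserves [V] and
    commutes with [A], as [fred] requires. *)
Lemma pA_div N z rs : exists U, polyA U /\
  (pz N z rs *: Id - pA N rs = (z *: Id - A) * U)%V.
Proof.
elim: rs => [|r rs [U [hU IH]]] /=.
  elim: N => [|N [U [hU IH]]].
    exists 0%V; split; first by rewrite -(scale0r Id)%V; apply: polyA1.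
    by rewrite scale1r subrr mulr0.
  exists (z ^+ N *: Id + A * U)%V; split.
    by apply: polyAD; [apply: polyA1|apply: polyAM => //].
  have h1 : ((z *: Id - A) * (A * U) = A * (z ^+ N *: Id - A ^+ N))%V.
    by rewrite IH !mulrA mulrBl [in RHS]mulrBr -scalerAl -scalerAr mulr1 mul1r.
  have h2 : (A * (z ^+ N *: Id - A ^+ N) = z ^+ N *: A - A ^+ N.+1)%V.
    by rewrite mulrBr -scalerAr mulr1 -exprS.
  rewrite [RHS]mulrDr h1 h2 -scalerAr mulr1 (exprS z); vec.
exists ((z * z - r * r) *: U + (z *: Id + A) * pA N rs)%V; split.
  apply: polyAD; first exact: polyAZ.
  apply: polyAM; last exact: polyA_pA.
  by apply: polyAD; [exact: polyA1|].
have f : ((z *: Id - A) * (z *: Id + A) = (z * z) *: Id - A * A)%V.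
  exact: sq_diff.
rewrite mulrDr mulrA f -scalerAr.
have -> : ((z *: Id - A) * U = pz N z rs *: Id - pA N rs)%V by pos.
by rewrite !mulrBl -!scalerAl !mul1r; vec.
Qed.

(** The constant [k] is independent of [N], which is fixed only afterwards. *)
Lemma pz_lower z rs s : 0 < s -> (forall r, r \in rs -> (z * z <> r * r)%V) ->
  exists k, 0 < k /\ forall N, s <= Cmod z -> k * s ^ N <= Cmod (pz N z rs).
Proof.
move=> s0; elim: rs => [|r rs IH] h.
  exists 1; split; first lra.
  by move=> N; rewrite CmodX Rmult_1_l; mono.
have [|k [k0 hk]] := IH; first by move=> r' hr'; apply: h; rewrite in_cons hr' orbT.
have d0 : 0 < Cmod (z * z - r * r)%V.
  apply: Cmod_gt0 => /subr0_eq; apply: h; exact: mem_head.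
exists (Cmod (z * z - r * r)%V * k); split; first pos.
move=> N hz; rewrite CmodM Rmult_assoc; apply: Rmult_le_compat_l; first lra.
exact: hk.
Qed.

Lemma Qr_kill (P : BL X) rs : (forall x, rprod a rs (P x) = 0%V) -> (a * P = P * a)%V -> (Qr rs * P = 0)%V.
Proof.
have e : exists U, (Qr rs = U * rprod a rs)%V.
  have rc rs' : (a * rprod a rs' = rprod a rs' * a)%V.
    elim: rs' => [|r rs' IH]; first by rewrite mulr1 mul1r.
    rewrite mulrA IH -!mulrA.
    by rewrite mulrBr mulrBl -scalerAl -scalerAr mulr1 mul1r.
  elim: rs => [|r rs [U IH]] /=; first by exists 1%V; rewrite mul1r.
  exists ((a + r *: Id) * U)%V.
  have -> : (a * a - (r * r) *: Id = (a + r *: Id) * (a - r *: Id))%V.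
    by rewrite mulrDl !mulrBr -!scalerAl -!scalerAr !mulr1 !mul1r; vec.
  have Qc : ((a - r *: Id) * Qr rs = Qr rs * (a - r *: Id))%V.
    by rewrite mulrBr mulrBl -scalerAl -scalerAr mulr1 mul1r Qr_comm.
  by rewrite -mulrA Qc IH !mulrA.
move=> h cP; have [U ->] := e; apply: BLext => x.
by rewrite !blME h bl0.
Qed.

(** Let [E] be the spectral projection of [a] inside a small circle. Then [v - E v E] has finite
    rank, so cutting to the corner is injective on [V], and on the corner [ad a] is small. This
    excludes large eigenvalues on [V]; Fredholm theory then gives a resolvent and a spectral
    projection on [V], which the same injectivity shows to be [1]. *)
Lemma t8 e : 0 < e -> exists D, forall m v, V v -> nrm ((A ^+ m)%V v) <= D * e ^ m * nrm v.
Proof.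
move=> e0.
have [u1 [u2 [hu1 [hu12 [hu2 gu]]]]] := @cpt_gap X a (e / 2) e ca ltac:(lra) ltac:(lra).
(* The corner has rate [t1 + t1], below [e / 4] and hence below [u1]. *)
have [t1 [t2 [ht1 [ht12 [ht2 gt]]]]] := @cpt_gap X a (e / 16) (e / 8) ca ltac:(lra) ltac:(lra).
have t1p : 0 < t1 by lra.
have ts : t1 < (t1 + t2) / 2 by lra.
have st : (t1 + t2) / 2 < t2 by lra.
have [E [G [D [D0 [p1 [p2 [p3 [p4 [p5 p6]]]]]]]]] := cpt_circle ca t1p ts st gt.
have [cE _] := p4 a erefl.
pose P : BL X := (1 - E)%V.
have PP : (P * P = P)%V by rewrite /P mulrBl mul1r mulrBr mulr1 p1 subrr subr0.
have cP : (a * P = P * a)%V by rewrite /P mulrBr mulrBl mulr1 mul1r cE.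
have fP : frk P by apply: cpt_idem_frk => //; rewrite /P p2; apply: cptMr.
have [|rs [hr1 hr2]] := @annih X _ a (range_lsub P) fP.
  by move=> y [x ->]; exists (a x); rewrite -!blME cP.
have QP : (Qr rs * P = 0)%V by apply: Qr_kill => // x; apply: hr2; exists x.
have QE : (Qr rs = Qr rs * E)%V.
  have : (Qr rs = Qr rs * (E + P))%V by rewrite /P addrC subrK mulr1.
  by rewrite mulrDr QP addr0.
have corner v : V v -> (E * v * E = 0)%V -> v = 0%V.
  move=> Vv h; apply: nV => //.
  have -> : v = (P * v + (v * P - P * v * P))%V.
    have : ((1 - P) * v * (1 - P) = 0)%V by rewrite /P opprB addrC subrK.
    exact: corner_dec.
  apply: frkD; first exact: frkMr.
  by apply: frkB; [apply: frkMl|rewrite -mulrA; apply: frkMr].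
have cornerN n x : nrm ((A ^+ n)%V (E * x * E)%V) <= D * D * nrm (E * x * E)%V * (t1 + t1) ^ n.
  apply: (@ad_corner X a E) => //; [lra|lra|].
  by rewrite !mulrA p1 -!mulrA p1.
have t4 : t1 + t1 < u1 by lra.
have small v z : V v -> u1 <= Cmod z -> (z *: Id - A)%V v = 0%V -> v = 0%V.
  move=> Vv hz; rewrite blBE blZE bl1E => /eqP; rewrite subr_eq0 eq_sym => /eqP hv.
  apply: corner => //; pose x : BL X := (E * v * E)%V.
  have hx n : (A ^+ n)%V x = (z ^+ n *: x)%V.
    have [h1 _] := @adm_comm X a E n (v * E)%V cE; have [_ h2] := @adm_comm X a E n v cE.
    by rewrite /x -!mulrA h1 h2 (bl_powZ n hv) -scalerAl -scalerAr mulrA.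
  apply: contrapT => x0; have xp : 0 < nrm x by exact: (@nrm_gt0 (BB X)).
  have [N hN] := @pow_dom (D * D + 1) (t1 + t1) u1 ltac:(lra) t4.
  have := hN N (leqnn _); have := cornerN N v; rewrite -/x hx nrmZ CmodX => h1 h2.
  have h3 : u1 ^ N <= Cmod z ^ N by mono.
  have tp : 0 < (t1 + t1) ^ N by pos.
  have h4 : Cmod z ^ N <= D * D * (t1 + t1) ^ N by pos.
  nra.
have zinv z : u1 <= Cmod z -> Cmod z <= u2 ->
    (exists M, forall v, V v -> nrm v <= M * nrm ((z *: Id - A)%V v)) /\
    (forall v, V v -> exists w, V w /\ (z *: Id - A)%V w = v).
  move=> hz1 hz2.
  have [|k [k0 hk]] := @pz_lower z rs u1 ltac:(lra).
    move=> r /hr1 [x [_ [x0 hx]]] hzr; apply: x0.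
    apply: (gu r x) => //; have : Cmod (z * z)%V = Cmod (r * r)%V by rewrite hzr.
    by rewrite !CmodM; have := Cmod_ge0 r; pos.
    have : Cmod (z * z)%V = Cmod (r * r)%V by rewrite hzr.
    by rewrite !CmodM; pos.
  have Q0 := nrm_ge0 (Qr rs).
  (* The left and right multiplications by [Qr rs * a ^+ N] together have norm at most
     [2 * nrm (Qr rs) * D * t1 ^ N]; for this [N] that is at most an eighth of the value
     [pz N z rs], whose modulus is at least [k * u1 ^ N]. *)
  have [N0 hN] := @pow_dom (16 * (nrm (Qr rs) * D) / k) t1 u1 ltac:(lra) ltac:(lra).
  have [K [sg [hK [hs epA]]]] := pA_mod N0 rs; pose N := N0.+1.
  have [U [[U1 U2] eU]] := pA_div N z rs.
  have lz := hk N hz1.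
  have c0 : pz N z rs <> 0%V.
    move=> h; move: lz; rewrite h Cmod0; have : 0 < k * u1 ^ N by [pos]; lra.
  apply: (@fred (BB X) (z *: Id - A)%V U K
     (Lm (Qr rs * a ^+ N) + sg *: Rm (Qr rs * a ^+ N))%V (pz N z rs) V cV c0).
  - by move=> v hv; apply: (lsubB cV.1); [apply: (lsubZ z cV.1 hv)|apply: adV].
  - exact: U2.
  - by rewrite -eU opprB [X in _ = X]addrC subrK /N epA.
  - by rewrite mulrBl mulrBr -scalerAl -scalerAr mulr1 mul1r U1.
  - have nx : nrm (Qr rs * a ^+ N)%V <= nrm (Qr rs) * (D * t1 ^ N).
      rewrite {1}QE -mulrA.
      have -> : (E * a ^+ N = a ^+ N * E)%V by apply: commrX; rewrite /GRing.comm cE.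
      apply: bnM_le => //.
    via (nrmD _ _); rewrite nrmZ hs Rmult_1_l.
    have h1 := Rle_trans _ _ _ (nrm_Lm _) nx; have h2 := Rle_trans _ _ _ (nrm_Rm _) nx.
    mid (nrm (Qr rs) * (D * t1 ^ N) + nrm (Qr rs) * (D * t1 ^ N)).
      exact: Rplus_le_compat h1 h2.
    have := hN N (leqnSn _) => h3.
    have : 16 * (nrm (Qr rs) * D) * t1 ^ N <= k * u1 ^ N.
      have -> : 16 * (nrm (Qr rs) * D) * t1 ^ N = k * (16 * (nrm (Qr rs) * D) / k * t1 ^ N) by rfield; lra.
      pos.
    lra.
  - exact: hK.
  - by move=> v hv; apply: small.
(* [V] is turned into a Banach space as its quotient by zero; the projection is isometric on [V]. *)
pose p := @SPair (BB X) V _ cV (@csub0 (BB X)) (fun x (h : x = 0%V) => eq_ind_r V (lsub0 cV.1) h).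
have stA : stab p A by split=> [x hx|x ->]; [exact: adV|exact: (bl0 A)].
have nrm_pi (v : BB X) : V v -> nrm (pi p v) = nrm v.
  move=> hv; apply: Rle_antisym; first exact: pi_le.
  apply: le_epsilon => d d0; have [w [hw [ew nw]]] := pi_wit (pi p v) d0.
  have : (w - v)%V = 0%V by apply/(@pi_eq0 _ p); [apply: lsubB cV.1 hw hv|rewrite piB // ew subrr].
  by move=> /subr0_eq ew'; move: nw; rewrite ew'; apply: Rlt_le.
pose B := ind p A.
have sz z : stab p (z *: Id - A)%V by apply: stabB => //; apply: stabZ; apply: stab1.
have ez z : (z *: (1 : BL (qsp p)) - B = ind p (z *: Id - A))%V.
  by rewrite indB //; [rewrite indZ ?ind1 //; exact: stab1|apply: stabZ; exact: stab1].
have [|EB [GB [DB [q1 [q2 [q3 [q4 [q5 q6]]]]]]]] := @circle (qsp p) B u1 ((u1 + u2) / 2) u2 ltac:(lra) ltac:(lra) ltac:(lra).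
  move=> z hz1 hz2; have [[M hM] hs] := zinv z hz1 hz2; rewrite ez.
  apply: (@bl_inv _ _ M) => q; have [v [hv <-]] := pi_ex q.
    rewrite indE // !nrm_pi //; first exact: hM.
    exact: (sz z).1.
  by have [w [hw ew]] := hs v hv; exists (pi p w); rewrite indE // ew.
(* An element [w] of the complementary range equals [A ^+ N] of some [v] of size [/ r ^ N]. Its
   corner is at most a multiple of [((t1 + t1) / r) ^ N] for every [N], so the corner and with it
   [w] vanish. *)
have E1 : EB = 1%V.
  apply: BLext => q; rewrite bl1E; apply/eqP; rewrite eq_sym -subr_eq0 -{1}[q]bl1E -blBE; apply/eqP.
  have [w [hw ew]] := pi_ex ((1 - EB)%V q); rewrite -ew.
  suff -> : w = 0%V by exact: pi0.
  apply: corner => //; apply: (@nrm_small (BB X)) => d d0.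
  pose r := (u1 + u2) / 2; have rp : 0 < r by rewrite /r; lra.
  have E0 := nrm_ge0 E; have q0 := nrm_ge0 q.
  pose C := D * D * (nrm E * (Rabs DB * nrm q) * nrm E).
  have [N hN] := @pow_dom (C / d) (t1 + t1) r ltac:(lra) ltac:(rewrite /r; lra).
  have [v [hv ev]] := pi_ex ((GB ^+ N * (1 - EB))%V q).
  have rN : 0 < r ^ N by pos.
  have iN : 0 < / r ^ N by pos.
  have nv : nrm v <= Rabs DB * / r ^ N * nrm q.
    rewrite -(nrm_pi v hv) ev; apply: bnle_le => //.
    via (q6 N); apply: Rmult_le_compat_r; [pos|exact: Rle_abs].
  have ewv : w = (A ^+ N)%V v.
    have e1 : pi p w = pi p ((A ^+ N)%V v).
      rewrite -indE //; last exact: stabX.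
      rewrite indX // ev -blME ew; congr ((_ : BL (qsp p)) q).
      have [_ cG] := q4 B erefl.
      have p1' : ((1 - EB) * (1 - EB) = 1 - EB)%V by rewrite mulrBl mul1r mulrBr mulr1 q1 subrr subr0.
      rewrite mulrA -exprMn_comm //.
      by rewrite -q2; elim: (N) => [|m IH]; rewrite ?expr0 ?mul1r // exprS -mulrA -IH.
    have h : (w - (A ^+ N)%V v)%V = 0%V.
      have hA : V ((A ^+ N)%V v) by exact: (stabX N stA).1.
      apply/(@pi_eq0 _ p); first by apply: lsubB cV.1 hw hA.
      by rewrite piB // e1 subrr.
    by apply/eqP; rewrite -subr_eq0 h.
  have h1 : (E * w * E = (A ^+ N)%V (E * v * E))%V.
    have [h1 _] := @adm_comm X a E N (v * E)%V cE; have [_ h2] := @adm_comm X a E N v cE.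
    by rewrite -!mulrA h1 h2 -ewv mulrA.
  rewrite h1; via (cornerN N v).
  have nE : nrm (E * v * E)%V <= nrm E * (Rabs DB * / r ^ N * nrm q) * nrm E.
    apply: bnM_le => //.
    by apply: bnM_le.
  have tp : 0 < (t1 + t1) ^ N by pos.
  mid (D * D * (nrm E * (Rabs DB * / r ^ N * nrm q) * nrm E) * (t1 + t1) ^ N).
    mono.
  have -> : D * D * (nrm E * (Rabs DB * / r ^ N * nrm q) * nrm E) * (t1 + t1) ^ N =
    d * (C / d * (t1 + t1) ^ N) * / r ^ N by rewrite /C; rfield; split; [lra|exact: Rgt_not_eq].
  have h2 := hN N (leqnn _).
  mid (d * r ^ N * / r ^ N); last by rewrite Rmult_assoc Rinv_r; lra.
  mono.
exists (Rabs DB) => m v hv.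
have hA : V ((A ^+ m)%V v) by exact: (stabX m stA).1.
rewrite -(nrm_pi _ hA) -(nrm_pi _ hv) -indE //; last exact: stabX.
rewrite indX // -/B; apply: bnle_le => //.
have := q5 m; rewrite E1 mulr1 => h; via h.
have um : 0 <= u1 ^ m by pos.
mid (Rabs DB * u1 ^ m); first by apply: Rmult_le_compat_r => //; exact: Rle_abs.
by apply: Rmult_le_compat_l; [exact: Rabs_pos|apply: pow_incr; lra].
Qed.
End T8.

(* [x] is a generalized null vector of [ad a]. *)
Definition adq (X : CBanach) (a x : BL X) : Prop :=
  forall e, 0 < e -> exists D, forall m, nrm ((adm a ^+ m)%V x) <= D * e ^ m.

Section P6.
Variable X : CBanach.
Implicit Types (a x : BL X).
(** [P] is the spectral projection outside a circle of radius [s], and [a] has rate [t1 < s] inside.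
    On the off-diagonal blocks [P x E] and [E x P] a growth of [ad a] at a rate [d] with
    [d + t1 < s] forces the block to be zero. *)
Lemma p6 a : cpt a -> ~ qn a -> exists P : BL X, P <> 0%V /\ cpt P /\ (P * P = P)%V /\
  forall x, adq a x -> (P * x = x * P)%V.
Proof.
move=> ca hq; have [e [e0 he]] : exists e, 0 < e /\ ~ exists D, forall n, nrm (a ^+ n)%V <= D * e ^ n.
  apply: contrapT => h; apply: hq; apply: qn_of_bound => e e0; apply: contrapT => h1; apply: h; by exists e.
have [t1 [t2 [ht1 [ht12 [ht2 gt]]]]] := @cpt_gap X a (e / 2) e ca ltac:(lra) ltac:(lra).
have t1p : 0 < t1 by lra.
pose s := (t1 + t2) / 2.
have ts : t1 < s by rewrite /s; lra.
have st : s < t2 by rewrite /s; lra.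
have [E [G [D [D0 [p1 [p2 [p3 [p4 [p5 p6]]]]]]]]] := cpt_circle ca t1p ts st gt.
have [cE _] := p4 a erefl.
pose P : BL X := (1 - E)%V.
have PP : (P * P = P)%V by rewrite mulrBl mul1r mulrBr mulr1 p1 subrr subr0.
have cP : (a * P = P * a)%V by rewrite mulrBr mulrBl mulr1 mul1r cE.
exists P; split.
  move=> h; apply: he; exists D => n.
  have E1 : E = 1%V by apply/esym/subr0_eq.
  have := p5 n; rewrite E1 => h1; via h1.
  mono.
split; first by rewrite /P p2; apply: cptMr.
split=> // x hx.
have [_ cG] := p4 a erefl; have [cPG _] := p4 G (esym cG).
have cGP : (G * P = P * G)%V by rewrite mulrBr mulrBl mulr1 mul1r cPG.
have GaP m : (a ^+ m * (G ^+ m * P) = P)%V.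
  rewrite mulrA -exprMn_comm // -p2.
  by elim: m => [|m IH]; rewrite ?mul1r // exprS -mulrA IH.
have GPa m : (G ^+ m * P * a ^+ m = P)%V.
  have h1 : (P * a ^+ m = a ^+ m * P)%V by apply: commrX.
  rewrite -mulrA h1 mulrA -exprMn_comm // -cG -p2.
  by elim: m {h1} => [|m IH]; rewrite ?mul1r // exprS -mulrA IH.
have gm m : nrm (G ^+ m * P)%V <= D / s ^ m * nrm P.
  have sm : 0 < / s ^ m by pos.
  apply: bn_bound => [|y]; first pos.
  have cGm : (P * G ^+ m = G ^+ m * P)%V by apply: commrX.
  have e1 : (G ^+ m * P)%V y = P ((G ^+ m * P)%V y) by rewrite -blME mulrA cGm -mulrA PP.
  rewrite e1; via (p6 m _); rewrite -blME -mulrA (mulrA P) cGm -(mulrA _ P) PP GaP.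
  by rewrite (Rmult_assoc _ (nrm P)); apply: Rmult_le_compat_l; [nra|exact: bnle].
pose d := (s - t1) / 2; have d0 : 0 < d by rewrite /d; lra.
have ds : d + t1 < s by rewrite /d; lra.
have cRA : (Rm a * adm a = adm a * Rm a)%V by rewrite mulrBr mulrBl LRm.
have cLA : (Lm a * adm a = adm a * Lm a)%V by rewrite mulrBr mulrBl LRm.
have natE (Y : CBanach) (T : BL Y) m y : (T *+ m)%V y = (T y *+ m)%V.
  by elim: m => [|m IH]; rewrite // !mulrS -IH.
have fin (c : BL X) K : 0 <= K -> (forall m, nrm c <= K / s ^ m * (d + t1) ^ m) -> c = 0%V.
  move=> K0 h; apply: (@nrm_small (BB X)) => ee ee0.
  have [N hN] := @pow_dom (K / ee) (d + t1) s ltac:(lra) ds.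
  have sN : 0 < s ^ N by pos.
  via (h N).
  have -> : K / s ^ N * (d + t1) ^ N = ee * (K / ee * (d + t1) ^ N) * / s ^ N by rfield; nra.
  mid (ee * s ^ N * / s ^ N); last by rewrite Rmult_assoc Rinv_r; lra.
mono.
have key1 (c : BL X) K : 0 <= K -> (forall m, nrm ((adm a ^+ m)%V c) <= K * d ^ m) ->
    (P * c = c)%V -> (c * E = c)%V -> c = 0%V.
  move=> K0 hK hP hE; apply: (fin c (D * nrm P * (K * D))).
    pos.
  move=> m; have eP : c = (G ^+ m * P * (a ^+ m * c))%V by rewrite mulrA GPa.
  rewrite {1}eP; via (bnM _ _).
  have -> : D * nrm P * (K * D) / s ^ m * (d + t1) ^ m = D / s ^ m * nrm P * (K * D * (d + t1) ^ m) by nra.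
  apply: Rmult_le_compat; try pos.
  (* From [L_a = R_a + ad a]. Since [c E = c], the powers of [a] on the right grow only like
     [t1]. *)
  have -> : (a ^+ m * c = \sum_(i < m.+1) ((adm a ^+ i)%V c * a ^+ (m - i)) *+ 'C(m, i))%V.
    rewrite -LmE -LmX (_ : Lm a = Rm a + adm a)%V; last by rewrite addrC subrK.
    rewrite exprDn_comm // bl_sumE; apply: eq_bigr => i.
    by rewrite natE RmX.
  apply: (@bsum_bound X (fun i => (adm a ^+ i)%V c * a ^+ (m - i))%V); try nra.
  move=> i hi; have [_ h2] := adm_comm i c cE; rewrite hE in h2.
  rewrite h2 -mulrA (_ : E * a ^+ (m - i) = a ^+ (m - i) * E)%V; last by apply: commrX.
  via (bnM _ _).
  have -> : K * D * (d ^ i * t1 ^ (m - i)) = (K * d ^ i) * (D * t1 ^ (m - i)) by lra.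
  mono.
have key2 (c : BL X) K : 0 <= K -> (forall m, nrm ((adm a ^+ m)%V c) <= K * d ^ m) ->
    (c * P = c)%V -> (E * c = c)%V -> c = 0%V.
  move=> K0 hK hP hE; apply: (fin c (D * nrm P * (K * D))).
    pos.
  move=> m; have eP : c = ((c * a ^+ m) * (G ^+ m * P))%V by rewrite -mulrA GaP.
  rewrite {1}eP [X in _ <= X]Rmult_comm; via (bnM _ _).
  have -> : (d + t1) ^ m * (D * nrm P * (K * D) / s ^ m) = K * D * (d + t1) ^ m * (D / s ^ m * nrm P) by nra.
  apply: Rmult_le_compat; try pos.
  have -> : (c * a ^+ m = \sum_(i < m.+1) (a ^+ (m - i) * ((- adm a) ^+ i)%V c) *+ 'C(m, i))%V.
    rewrite -RmE -RmX (_ : Rm a = Lm a - adm a)%V; last by rewrite opprB addrC subrK.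
    rewrite exprB_sum // bl_sumE; apply: eq_bigr => i.
    by rewrite natE LmX.
  apply: (@bsum_bound X (fun i => a ^+ (m - i) * ((- adm a) ^+ i)%V c)%V); try nra.
  move=> i hi; have [h2 _] := adm_comm i c cE; rewrite hE in h2.
  have h3 : ((- adm a) ^+ i)%V c = (E * ((- adm a) ^+ i)%V c)%V.
    rewrite -[(- adm a)%V]mulN1r exprMn_comm; last by rewrite /GRing.comm mulN1r mulrN1.
    have sg (y : BL X) : ((-1) ^+ i : BL (BB X))%V y = ((-1) ^+ i *: y)%V.
      elim: (i : nat) => [|j IH]; first by rewrite scale1r.
      by rewrite !exprS blME IH mulN1r scaleNr.
    by rewrite blME sg {1}h2 scalerAr.
  rewrite h3 mulrA.
  via (bnM _ _).
  have -> : K * D * (d ^ i * t1 ^ (m - i)) = (D * t1 ^ (m - i)) * (K * d ^ i) by nra.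
  apply: Rmult_le_compat; try pos.
  rewrite -[(- adm a)%V]mulN1r exprMn_comm; last by rewrite /GRing.comm mulN1r mulrN1.
  by rewrite (@nrm_signX (BB X) (BB X) (adm a ^+ i)%V (fun U => U c)).
have [Dx hDx] := hx d d0.
have Dx0 : 0 <= Dx.
  by have := hDx 0%N; rewrite Rmult_1_r; apply: Rle_trans; pos.
have bnd (S T : BL X) m : (a * S = S * a)%V -> (a * T = T * a)%V ->
    nrm ((adm a ^+ m)%V (S * x * T)%V) <= nrm S * Dx * nrm T * d ^ m.
  move=> hS hT; have [_ h2] := adm_comm m (S * x)%V hT; have [h1 _] := adm_comm m x hS.
  rewrite h2 h1; via (bnM _ _).
  have -> : nrm S * Dx * nrm T * d ^ m = nrm S * (Dx * d ^ m) * nrm T by nra.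
  apply: Rmult_le_compat_r; first pos.
  by apply: bnM_le.
have z1 : (P * x * E = 0)%V.
  apply: (key1 _ (nrm P * Dx * nrm E)).
  pos.
  mono.
  by rewrite !mulrA PP.
  by rewrite -mulrA p1.
have z2 : (E * x * P = 0)%V.
  apply: (key2 _ (nrm E * Dx * nrm P)).
  pos.
  mono.
  by rewrite -mulrA PP.
  by rewrite !mulrA p1.
have PE : (P + E = 1)%V by rewrite subrK.
have -> : (P * x = P * x * P)%V by rewrite -{1}[(P * x)%V]mulr1 -PE mulrDr z1 addr0.
by rewrite -[RHS]mul1r -PE (mulrDl P E) !mulrA z2 addr0.
Qed.
End P6.
(** * Maximal chains of invariant subspaces and norms of words *)

Section Words.
Variable X : CBanach.
Implicit Types (M : seq (BL X)) (w : BL X) (Y Z W : X -> Prop).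
Fixpoint word M n w : Prop :=
  if n is m.+1 then exists a w', a \in M /\ word M m w' /\ w = (a * w')%V else w = 1%V.
Lemma word_cat M m n u v : word M m u -> word M n v -> word M (m + n)%N (u * v)%V.
Proof.
elim: m u => [|m IH] u; first by move=> ->; rewrite mul1r.
move=> [a [w' [h1 [h2 ->]]]]; exists a, (w' * v)%V; rewrite mulrA; do 2 (split=> //).
exact: IH.
Qed.
Lemma word_split M m n w : word M (m + n)%N w -> exists u v, word M m u /\ word M n v /\ w = (u * v)%V.
Proof.
elim: m w => [|m IH] w; first by exists 1%V, w; rewrite mul1r.
move=> [a [w' [h1 [/IH [u [v [h2 [h3 ->]]]] ->]]]].
by exists (a * u)%V, v; split; [exists a, u|rewrite mulrA].
Qed.
Lemma word1 M a : a \in M -> word M 1 a.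
Proof. by exists a, 1%V; rewrite mulr1. Qed.
Lemma word_last M n w : word M n.+1 w -> exists w' a, word M n w' /\ a \in M /\ w = (w' * a)%V.
Proof.
rewrite -addn1 => /word_split [u [v [h1 [[a [v' [h2 [h3 ->]]]] ->]]]].
by exists u, a; rewrite (h3 : v' = 1%V) mulr1.
Qed.
Lemma word_bound M : exists B, 1 <= B /\ (forall a, a \in M -> nrm a <= B) /\
  forall n w, word M n w -> nrm w <= B ^ n.
Proof.
have [B [B1 hB]] : exists B, 1 <= B /\ forall a, a \in M -> nrm a <= B.
  elim: M => [|a M [B [B1 hB]]]; first by exists 1; split; pos.
  exists (B + nrm a); have := nrm_ge0 a; split; first lra.
  by move=> in_cons /orP [/eqP ->|/hB]; lra.
exists B; do 2 (split=> //); elim=> [|n IH] w /=; first by move=> ->; exact: bn1.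
move=> [a [w' [/hB h1 [/IH h2 ->]]]]; via (bnM _ _).
by mono.
Qed.
Definition pres M Z := forall a, a \in M -> forall x, Z x -> Z (a x).
Lemma word_pres M Z n w x : pres M Z -> word M n w -> Z x -> Z (w x).
Proof.
move=> h; elim: n w x => [|n IH] w x; first by move=> ->.
by move=> [a [w' [h1 [h2 ->]]]]; rewrite blME; mono.
Qed.

(* The norm of [w] as a map from [Z] to the quotient by [Y] is at least [q]. *)
Definition NN Z Y w q := exists x, Z x /\ nrm x <= 1 /\ forall y, Y y -> q <= nrm (w x - y).
(** By submultiplicativity this says that the joint spectral radius of [M] on the quotient of [Z] by
    [Y] is at least [1]. *)
Definition RR M Z Y := forall n q, q < 1 -> exists w, word M n.+1 w /\ NN Z Y w q.
Definition small M Z Y n q := forall w, word M n w -> forall x, Z x -> nrm x <= 1 ->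
  exists y, Y y /\ nrm (w x - y)%V <= q.

Section Fixed.
Variables (M : seq (BL X)).

Lemma small_scale Z Y n q r w x : lsub Z -> lsub Y -> 0 <= r -> small M Z Y n q -> word M n w ->
  Z x -> nrm x <= r -> exists y, Y y /\ nrm (w x - y)%V <= r * q.
Proof.
move=> hZ hY r0 hs hw hx xr; have [r1|r1] := EM (r = 0).
  have : x = 0%V by apply: nrm_eq0; have := nrm_ge0 x; lra.
  by move=> ->; exists 0%V; rewrite bl0 subr0 nrm0 r1; split; [exact: lsub0|lra].
have [||y []] := hs w hw (rc (/ r) *: x)%V.
exact: lsubZ.
apply: nrm_unscale; lra.
exists (rc r *: y)%V; split; first exact: lsubZ.
have -> : (w x - rc r *: y = rc r *: (w (rc (/ r) *: x) - y))%V.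
  by rewrite blZ scalerBr scaleKrc.
by rewrite nrmZ Cmod_rc; mono.
Qed.
Lemma small_pow Z Y n q k : csub Z -> csub Y -> (forall x, Y x -> Z x) -> pres M Z -> pres M Y ->
  0 <= q -> small M Z Y n q -> small M Z Y (n * k)%N (q ^ k).
Proof.
move=> [hZ _] [hY _] hYZ pZ pY q0 hs; elim: k => [|k IH].
  rewrite muln0 => w ->; exists 0%V; split; first exact: lsub0.
  by rewrite subr0.
rewrite mulnS => w /word_split [u [v [hu [hv ->]]]] x hx x1.
have [y [hy1 hy2]] := IH v hv x hx x1.
have hz : Z (v x - y)%V by apply: lsubB => //; [apply: word_pres hv hx|mono].
have [y' []] := small_scale hZ hY (pow_le _ k q0) hs hu hz hy2.
exists (u y + y')%V; split; first by apply: lsubD => //; apply: word_pres hu hy1.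
rewrite (_ : u (v x) - (u y + y') = u (v x - y) - y')%V; last by rewrite blB; vec.
by rewrite [q ^ k.+1]/= Rmult_comm.
Qed.
Lemma notRR Z Y : ~ RR M Z Y -> exists n q, 0 < q < 1 /\ small M Z Y n.+1 q.
Proof.
move=> h; apply: contrapT => hn; apply: h => n q; apply: contrapT => h; apply: hn.
have m1 := Rmax_l q (/ 2); have m2 := Rmax_r q (/ 2).
have m3 : Rmax q (/ 2) < 1 by apply: Rmax_lub_lt; lra.
exists n, (Rmax q (/ 2)); split; first lra.
move=> w hw x hx x1; apply: contrapT => h1; apply: h; exists w; split=> //.
exists x; split=> //; split=> // y hy; apply: Rnot_lt_le => h2; apply: h1; exists y; split=> //; lra.
Qed.
(** If all words of one length had norm at most some [q < 1], the words of a multiple of that length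
    would fall below [c]. *)
Lemma RRa Z Y c : csub Z -> csub Y -> (forall x, Y x -> Z x) -> pres M Z -> pres M Y -> 0 < c ->
  (forall n, exists w, word M n.+1 w /\ NN Z Y w c) -> RR M Z Y.
Proof.
move=> hZ hY hYZ pZ pY c0 h; apply: contrapT => /notRR [n [q [[q0 q1] hs]]].
have [k hk] := pow_small (Rlt_le _ _ q0) q1 c0; have := hk k.+1 (leqnSn _).
have [w [hw [x [hx [x1 hx2]]]]] := h (n.+1 * k.+1).-1.
have hw' : word M (n.+1 * k.+1) w by pos.
have [y [hy1 hy2]] := small_pow hZ hY hYZ pZ pY (Rlt_le _ _ q0) hs hw' hx x1.
by have := hx2 y hy1; lra.
Qed.
(** The joint spectral radius of a block-triangular family is that of one of its diagonal blocks. If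
    both blocks contract by [/ 2] on words of length [L], then after [m] such words the part in [Z]
    is at most [(/ 2) ^ m] and the part in [W] at most a multiple of [m * (/ 2) ^ m]. *)
Lemma RRd Z W Y : csub Z -> csub W -> csub Y -> (forall x, Y x -> W x) -> (forall x, W x -> Z x) ->
  pres M Z -> pres M W -> pres M Y -> RR M Z Y -> ~ RR M W Y -> RR M Z W.
Proof.
move=> hZ hW hY hYW hWZ pZ pW pY hR /notRR [n1 [q1 [hq1 s1]]]; apply: contrapT.
move=> /notRR [n2 [q2 [hq2 s2]]].
have [k1 hk1] := pow_small (Rlt_le _ _ hq1.1) hq1.2 (Rinv_0_lt_compat 2 ltac:(lra)).
have [k2 hk2] := pow_small (Rlt_le _ _ hq2.1) hq2.2 (Rinv_0_lt_compat 2 ltac:(lra)).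
pose k := (k1 + k2).+1; pose L := (n1.+1 * (n2.+1 * k))%N.
have sW : small M W Y L (/ 2).
  move=> w hw x hx x1; have [y [h1 h2]] := small_pow hW hY hYW pW pY (Rlt_le _ _ hq1.1) s1 hw hx x1.
  exists y; split=> //; via h2; left; apply: hk1.
  by lia.
have sZ : small M Z W L (/ 2).
  have eL : L = (n2.+1 * (n1.+1 * k))%N by rewrite mulnCA.
  rewrite eL => w hw x hx x1.
  have [y [h1 h2]] := small_pow hZ hW hWZ pZ pW (Rlt_le _ _ hq2.1) s2 hw hx x1.
  exists y; split=> //; via h2; left; apply: hk2.
  by lia.
have [B [B1 [_ hB]]] := word_bound M; pose B' := B ^ L.
have B0 : 0 <= B' by apply: pow_le; lra.
have hp m : 0 < (/ 2) ^ m by pos.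
have key m w x : word M (L * m)%N w -> Z x -> nrm x <= 1 -> exists y u v, Y y /\ W u /\ Z v /\
    w x = (y + u + v)%V /\ nrm v <= (/ 2) ^ m /\ nrm u <= 2 * INR m * (B' + 1) * (/ 2) ^ m.
  move=> hw hx x1; elim: m w hw => [|m IH] w.
    rewrite muln0 => ->; exists 0%V, 0%V, x; rewrite !add0r nrm0 /=.
    split; first exact: lsub0 hY.1.
    split; first exact: lsub0 hW.1.
    by do 2 (split=> //); lra.
  rewrite mulnS => /word_split [w1 [w2 [h1 [/IH [y [u [v [Yy [Wu [Zv [e [nv nu]]]]]]]] ->]]]].
  have [y' []] := small_scale hW.1 hY.1 (Rle_trans _ _ _ (nrm_ge0 u) nu) sW h1 Wu nu.
  have [u' []] := small_scale hZ.1 hW.1 (Rlt_le _ _ (hp m)) sZ h1 Zv nv.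
  exists (w1 y + y')%V, ((w1 u - y') + u')%V, (w1 v - u')%V.
  have Ww1 z : W z -> W (w1 z) by move=> hz; apply: word_pres h1 hz.
  split; first by apply: lsubD hY.1 _ _ => //; apply: word_pres h1 Yy.
  split; first by apply: lsubD hW.1 _ _ => //; apply: lsubB hW.1 _ _; mono.
  split; first by apply: lsubB hZ.1 _ _; [apply: word_pres h1 Zv|mono].
  split; first by rewrite blME e !blD; vec.
  split; first by rewrite /= Rmult_comm.
  have b1 : nrm (w1 v) <= B' * (/ 2) ^ m.
    by apply: bnle_le => //; exact: hB.
  have b2 : nrm u' <= B' * (/ 2) ^ m + (/ 2) ^ m / 2.
    by have := nrm_le u' (w1 v); rewrite nrmC; lra.
  via (nrmD _ _); rewrite S_INR [(/ 2) ^ m.+1]/=.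
  have := hp m.
  lra.
have [m hm] : exists m, 2 * INR m * (B' + 1) * (/ 2) ^ m + (/ 2) ^ m < / 2 /\ (0 < m)%N.
  have h4 j : INR j <= 4 * (4 / 3) ^ j.
    elim: j => [|j IHj]; first by rewrite /=; lra.
    have : 1 <= (4 / 3) ^ j by apply: pow_R1_Rle; lra.
    by rewrite S_INR [_ j.+1]/=; lra.
  have [m2 hm2] := @pow_dom (16 * (B' + 1) + 16) (2 / 3) (3 / 4) ltac:(lra) ltac:(lra).
  have [m3 hm3] := pow_small (q := 3 / 4) ltac:(lra) ltac:(lra) (Rinv_0_lt_compat 4 ltac:(lra)).
  pose j := (m2 + m3).+1; exists j; split=> //.
  have a1 := hm2 j ltac:(rewrite /j; lia); have a2 := hm3 j ltac:(rewrite /j; lia).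
  have e : (4 / 3) ^ j * (/ 2) ^ j = (2 / 3) ^ j by rewrite -Rpow_mult_distr; congr (_ ^ _); lra.
  have a3 : INR j * (/ 2) ^ j <= 4 * (2 / 3) ^ j.
    by rewrite -e -Rmult_assoc; mono.
  have a4 : (/ 2) ^ j <= (2 / 3) ^ j by mono.
  nra.
have [w [hw [x [hx [x1 hx2]]]]] := hR (L * m).-1 (/ 2) ltac:(lra).
have hw' : word M (L * m) w by rewrite prednK // in hw; rewrite muln_gt0 hm.2.
have [y [u [v [Yy [Wu [Zv [e []]]]]]]] := key m w x hw' hx x1.
have := hx2 y Yy; rewrite e (_ : y + u + v - y = u + v)%V; last by vec.
by have := nrmD u v; lra.
Qed.

Hypothesis cM : forall a, a \in M -> cpt a.
Lemma tb_letters r : tb (fun y => exists a x, a \in M /\ nrm x <= r /\ y = a x).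
Proof.
elim: M cM => [|a l IH] hc; first by apply: tb_mono (@tb1 X 0%V) => y [a [x []]].
have h1 : tb (fun y => exists x, nrm x <= r /\ y = a x) by apply: cpt_ball; apply: hc; exact: mem_head.
have h2 := IH (fun b hb => hc b (mem_behead (s := a :: l) hb)).
apply: tb_mono (tb_or h1 h2) => y [b [x [hb []]]].
by move: hb; rewrite in_cons => /orP [/eqP ->|]; [left; exists x|right; exists b, x].
Qed.
Variable F : (X -> Prop) -> Prop.
Hypotheses (Fc : forall S, F S -> csub S) (Fp : forall S, F S -> pres M S)
  (Ft : forall S1 S2, F S1 -> F S2 -> (forall x, S1 x -> S2 x) \/ (forall x, S2 x -> S1 x))
  (Fn : exists S, F S).
Definition Fcap x := forall S, F S -> S x.
Definition Fcup := cl (fun x => exists S, F S /\ S x).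
Lemma Fcap_csub : csub Fcap.
Proof.
have := @csub_cap X {S | F S} (fun S => sval S) (fun S => Fc (svalP S)).
have -> : (fun x => forall i : {S | F S}, sval i x) = Fcap => //.
apply/funext => x; apply/propext; split=> [h S hS|h []]; first exact: (h (exist _ S hS)).
exact: h.
Qed.
Lemma Fcup_csub : csub Fcup.
Proof.
apply: cl_csub; split.
  by have [S hS] := Fn; exists S; split=> //; apply: lsub0 (Fc hS).1.
split=> [x y [S [hS Sx]] [S' [hS' Sy]]|c x [S [hS Sx]]]; last first.
  by exists S; split=> //; exact: (lsubZ c (Fc hS).1 Sx).
have [] := Ft hS hS'.
  by exists S'; split=> //; apply: lsubD (Fc hS').1 _ _; mono.
by exists S; split=> //; apply: lsubD (Fc hS).1 _ _; mono.
Qed.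
Lemma Fcap_pres : pres M Fcap.
Proof. by move=> a ha x hx S hS; apply: (Fp hS ha); apply: hx. Qed.
Lemma cl_pres (V : X -> Prop) (a : BL X) : (forall x, V x -> V (a x)) -> forall x, cl V x -> cl V (a x).
Proof.
move=> h x /cl_seq [u [hu hl]]; apply: (@cvg_cl X V (fun n => a (u n))); last exact: bl_cvg.
by move=> n; apply: cl_incl; mono.
Qed.
Lemma Fcup_pres : pres M Fcup.
Proof. by move=> a ha; apply: cl_pres => x [S [hS Sx]]; exists S; split=> //; apply: (Fp hS ha). Qed.

(** The letter applied first sends the unit ball to a totally bounded set. Its values on vectors
    from smaller and smaller members that remain large cluster at a vector [y] of the intersection,
    on which words of the given length remain large. *)
Lemma RRb : (forall S, F S -> RR M S (fun x => x = 0%V)) -> RR M Fcap (fun x => x = 0%V).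
Proof.
move=> hR; have [B [B1 [hB1 hB]]] := word_bound M.
have p0 : pres M (fun x => x = 0%V) by move=> a _ x ->; exact: bl0.
apply: (@RRa _ _ (/ (4 * (B + 1)))) => //; [exact: Fcap_csub|exact: csub0| | exact: Fcap_pres| |].
by move=> x -> S hS; apply: lsub0 (Fc hS).1.
pos.
move=> n.
pose S y := exists a x, a \in M /\ nrm x <= 1 /\ y = (a : BL X) x.
pose good (A : X -> Prop) := exists Z, F Z /\ forall x a w, Z x -> nrm x <= 1 -> a \in M ->
  word M n.+1 w -> A (a x) -> nrm (w (a x)) < / 2.
have [||||y hy] := @tb_cluster X S good (tb_letters 1).
move=> A A' h [Z []]; exists Z; mono.
move=> A A' [Z [hZ hg]] [Z' [hZ' hg']]; have [h|] := Ft hZ hZ'.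
    exists Z; split=> // x a w h1 h2 h3 h4 []; first mono.
    mono.
  exists Z'; split=> // x a w h1 h2 h3 h4 []; last mono.
  mono.
by have [Z hZ] := Fn; exists Z.
move=> [Z [hZ hg]]; have [w [hw [x [hx [x1 hx2]]]]] := hR Z hZ n.+1 (/ 2) ltac:(lra).
  have [w' [a [h1 [h2 e]]]] := word_last hw.
  have := hg x a w' hx x1 h2 h1 (ex_intro _ a (ex_intro _ x (conj h2 (conj x1 erefl)))).
  by have := hx2 0%V erefl; rewrite subr0 e blME; lra.
have near r Z : 0 < r -> F Z -> exists x a w, Z x /\ nrm x <= 1 /\ a \in M /\ word M n.+1 w /\
    nrm (a x - y) < r /\ / 2 <= nrm (w (a x)).
  move=> r0 hZ; apply: contrapT => hn; apply: (hy r r0); exists Z; split=> // x a w h1 h2 h3 h4 [_ h5].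
  by apply: Rnot_le_lt => h6; apply: hn; exists x, a, w.
have yF : Fcap y.
  move=> Z hZ; apply: (cl_sub (Fc hZ) (fun x h => h)) => e e0.
  have [x [a [w [h1 [h2 [h3 [h4 []]]]]]]] := near e Z e0 hZ.
  by exists (a x); rewrite nrmC; split=> //; apply: (Fp hZ h3).
have Bn : 0 < B ^ n.+1 by pos.
have [Z hZ] := Fn.
have [|x [a [w [h1 [h2 [h3 [h4 [h5 h6]]]]]]]] := near (Rmin 1 (/ (4 * B ^ n.+1))) Z _ hZ.
  by apply: Rmin_pos; pos.
have r1 := Rmin_l 1 (/ (4 * B ^ n.+1)); have r2 := Rmin_r 1 (/ (4 * B ^ n.+1)).
have ny : nrm y <= B + 1.
  have := nrm_le y (a x); rewrite nrmC; have := bnle a x; have := hB1 a h3; have := nrm_ge0 x.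
  nra.
have wy : / 4 <= nrm (w y).
  have h7 : nrm (w (a x) - w y)%V <= / 4.
    rewrite -blB; via (bnle _ _).
    mid (B ^ n.+1 / (4 * B ^ n.+1)).
      by apply: Rmult_le_compat; try pos; [mono|exact: Rle_trans (Rlt_le _ _ h5) r2].
    by right; rfield; lra.
  by have := nrm_le (w (a x)) (w y); lra.
exists w; split=> //; exists (rc (/ (B + 1)) *: y)%V.
split; first by apply: lsubZ Fcap_csub.1 _.
split; first by apply: nrm_unscale; lra.
move=> _ ->; rewrite subr0 blZ nrmZ Cmod_rc; last pos.
have -> : / (4 * (B + 1)) = / (B + 1) * / 4 by rfield; lra.
by mono.
Qed.

(** Dual to [RRb]: the letter applied last is compact, so the values of words cluster at a vector
    [v] that is at distance at least [/ 2] from every member of the chain. *)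
Lemma RRc Z : csub Z -> pres M Z -> (forall S, F S -> forall x, S x -> Z x) ->
  (forall S, F S -> RR M Z S) -> RR M Z Fcup.
Proof.
move=> hZ pZ FZ hR; have [B [B1 [hB1 hB]]] := word_bound M.
apply: (@RRa _ _ (/ 4)) => //; [exact: Fcup_csub| |exact: Fcup_pres|lra|].
  by apply: cl_sub => // x [S [hS Sx]]; apply: FZ hS _ Sx.
move=> n; pose S y := exists a x, a \in M /\ nrm x <= B ^ n /\ y = (a : BL X) x.
pose good (A : X -> Prop) := exists Y, F Y /\ forall x a w, Z x -> nrm x <= 1 -> a \in M ->
  word M n w -> A (a (w x)) -> exists y, Y y /\ nrm (a (w x) - y) < / 2.
have [||||v hv] := @tb_cluster X S good (tb_letters (B ^ n)).
- by move=> A A' h [Y [hY hg]]; exists Y; split=> // x a w h1 h2 h3 h4 /h; apply: hg.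
- move=> A A' [Y [hY hg]] [Y' [hY' hg']]; have [h|h] := Ft hY hY'.
    exists Y'; split=> // x a w h1 h2 h3 h4 [h5|h5]; last exact: hg'.
    by have [y [h6 h7]] := hg x a w h1 h2 h3 h4 h5; exists y; split=> //; apply: h.
  exists Y; split=> // x a w h1 h2 h3 h4 [h5|h5]; first exact: hg.
  by have [y [h6 h7]] := hg' x a w h1 h2 h3 h4 h5; exists y; split=> //; apply: h.
- by have [Y hY] := Fn; exists Y.
- move=> [Y [hY hg]]; have [w [hw [x [hx [x1 hx2]]]]] := hR Y hY n (/ 2) ltac:(lra).
  have [a [w' [h1 [h2 e]]]] := hw.
  have [|y [h3 h4]] := hg x a w' hx x1 h1 h2.
    exists a, (w' x); do 2 (split=> //); via (bnle _ _).
    by have := hB _ _ h2; have := nrm_ge0 x; have := nrm_ge0 w'; nra.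
  by have := hx2 y h3; rewrite e blME; lra.
have near r Y : 0 < r -> F Y -> exists x a w, Z x /\ nrm x <= 1 /\ a \in M /\ word M n w /\
    nrm (a (w x) - v) < r /\ forall y, Y y -> / 2 <= nrm (a (w x) - y).
  move=> r0 hY; apply: contrapT => hn; apply: (hv r r0); exists Y; split=> // x a w h1 h2 h3 h4 [_ h5].
  apply: contrapT => h6; apply: hn; exists x, a, w; do 5 (split=> //).
  by move=> y hy; apply: Rnot_lt_le => h7; apply: h6; exists y.
have dv Y y : F Y -> Y y -> / 2 <= nrm (v - y)%V.
  move=> hY hy; apply: Rnot_lt_le => h.
  have [x [a [w [h1 [h2 [h3 [h4 [h5 h6]]]]]]]] := near (/ 2 - nrm (v - y)%V) Y ltac:(lra) hY.
  by have := h6 y hy; have := nrm_tri (a (w x)) v y; vlra.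
have [Y hY] := Fn; have [x [a [w [h1 [h2 [h3 [h4 [h5 h6]]]]]]]] := near (/ 8) Y ltac:(lra) hY.
exists (a * w)%V; split; first by exists a, w.
exists x; split=> //; split=> // y /(_ (/ 8) ltac:(lra)) [y' [[S' [hS' Sy]] hy']].
have := dv S' y' hS' Sy; rewrite blME => h7.
have := nrm_tri v (a (w x)) y'; have := nrm_tri (a (w x)) y y'; have := nrmC v (a (w x)); vlra.
Qed.
End Fixed.
End Words.

Section Chain.
Variable X : CBanach.
Implicit Types (M : BL X -> Prop) (S : X -> Prop) (Ch : (X -> Prop) -> Prop).
Definition invs M S := csub S /\ forall a, M a -> forall x, S x -> S (a x).
Definition le_s S S' := forall x : X, S x -> S' x.
Definition mchain M Ch := (forall S, Ch S -> invs M S) /\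
  (forall S S', Ch S -> Ch S' -> le_s S S' \/ le_s S' S) /\
  (forall S, invs M S -> (forall S', Ch S' -> le_s S S' \/ le_s S' S) -> Ch S).
Lemma mchain_ex M : exists Ch, mchain M Ch.
Proof.
pose P Ch := (forall S, Ch S -> invs M S) /\ (forall S S', Ch S -> Ch S' -> le_s S S' \/ le_s S' S).
have [F FP tF|Ch [[h1 h2] h3]] := @classical_sets.Zorn_bigcup _ P.
  split=> [S [A FA AS]|S S' [A FA AS] [A' FA' AS']]; first exact: (FP A FA).1.
  have [h|h] := tF A A' FA FA'.
    by apply: (FP A' FA').2; mono.
  by apply: (FP A FA).2; mono.
exists Ch; split=> //; split=> // S hS hc; apply: contrapT => nS.
apply: (h3 (fun S' => Ch S' \/ S' = S)).
  split; first mono.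
  mono.
split=> [S' [/h1 //|-> //]|S1 S2 [c1|->] [|->]]; first mono.
have [] := hc _ c1; mono.
mono.
mono.
Qed.
Lemma mchainT M Ch : mchain M Ch -> Ch (fun=> True).
Proof. by move=> [_ [_ h]]; apply: h; [|right]. Qed.
Lemma mchain0 M Ch : mchain M Ch -> Ch (fun x => x = 0%V).
Proof.
move=> [h1 [_ h]]; apply: h => [|S' /h1 [hS _]].
  by split; [exact: csub0|move=> a _ x ->; exact: bl0].
by left => x ->; apply: lsub0 hS.1.
Qed.
End Chain.
Definition gap (X : CBanach) (L : BL X -> Prop) p := (forall a, L a -> stab p a) /\
  forall S, invs L S -> le_s (lo p) S -> le_s S (hi p) -> le_s S (lo p) \/ le_s (hi p) S.
Section ChainCap.
Variables (X : CBanach) (M : BL X -> Prop) (Ch F : (X -> Prop) -> Prop).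
Hypotheses (hC : mchain M Ch) (FC : forall S, F S -> Ch S).
Lemma mchain_cap : Ch (Fcap F).
Proof.
have [c1 [c2 c3]] := hC; apply: c3 => [|S' hS'].
  split; first by apply: Fcap_csub => S /FC /c1 [].
  by move=> a ha x hx S hS; apply: (c1 S (FC hS)).2 => //; apply: hx.
have [[S [hS hSS]]|hn] := EM (exists S, F S /\ le_s S S').
  by left => x hx; apply: hSS; apply: hx.
right => x hx S hS; have [h|h] := c2 S S' (FC hS) hS'; first by case: hn; exists S.
exact: h.
Qed.
Lemma mchain_cup : (exists S, F S) -> Ch (Fcup F).
Proof.
have [c1 [c2 c3]] := hC => Fn; apply: c3 => [|S' hS'].
  split; first by apply: Fcup_csub => // [S /FC /c1 []|S S' /FC h /FC h'] //; exact: c2.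
  by move=> a ha; apply: cl_pres => x [S [hS Sx]]; exists S; split=> //; apply: (c1 S (FC hS)).2.
have [h|hn] := EM (forall S, F S -> le_s S S').
  by left; apply: cl_sub (c1 S' hS').1 _ => x [S [/h hS /hS]].
right; have [S [hS h]] : exists S, F S /\ ~ le_s S S'.
  by apply: contrapT => h; apply: hn => S hS; apply: contrapT => h1; apply: h; exists S.
have [//|h'] := c2 S S' (FC hS) hS'; move=> x hx; apply: cl_incl; exists S; mono.
Qed.
End ChainCap.
Lemma mchain_gap (X : CBanach) (M : BL X -> Prop) Ch (p : spair X) : mchain M Ch -> Ch (lo p) -> Ch (hi p) ->
  (forall S, Ch S -> le_s S (lo p) \/ le_s (hi p) S) -> gap M p.
Proof.
move=> [c1 [_ c3]] cY cZ h; split=> [|S hS h1 h2].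
  by split=> x; [exact: (c1 _ cZ).2|exact: (c1 _ cY).2].
apply: (h); apply: c3 => // S' /h []; [right|left] => x; auto.
Qed.
(** By [RRb] there is a least member [C0] of the chain on which the radius is at least [1]. By [RRd]
    the same holds for [C0] modulo each smaller member, and [RRc] passes to the closure of their
    union. *)
Lemma gap_chain (X : CBanach) (M : BL X -> Prop) (M1 : seq (BL X)) : (forall S, invs M S -> pres M1 S) ->
  (forall a, a \in M1 -> cpt a) -> RR M1 (fun=> True) (fun x => x = 0%V) ->
  exists p : spair X, gap M p /\ RR M1 (hi p) (lo p).
Proof.
move=> hp cM hR; have [Ch hC] := mchain_ex M; have [c1 [c2 c3]] := hC.
pose F S := Ch S /\ RR M1 S (fun x => x = 0%V).
have Fc S : F S -> csub S by move=> [/c1 []].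
have Fp S : F S -> pres M1 S by move=> [/c1 /hp].
have Ft S S' : F S -> F S' -> le_s S S' \/ le_s S' S by move=> [h _] [h' _]; apply: c2.
have Fn : exists S, F S by exists (fun=> True); split; [exact: mchainT hC|].
pose C0 := Fcap F; have ChC0 : Ch C0 by apply: (mchain_cap hC) => S [].
have R0 : RR M1 C0 (fun x => x = 0%V) by apply: RRb => // S [].
have i0 := (c1 C0 ChC0).1; pose F' S := Ch S /\ le_s S C0 /\ ~ le_s C0 S.
have F'c S : F' S -> csub S by move=> [/c1 []].
have F'p S : F' S -> pres M1 S by move=> [/c1 /hp].
have F't S S' : F' S -> F' S' -> le_s S S' \/ le_s S' S by move=> [h _] [h' _]; apply: c2.
have F'n : exists S, F' S.
  exists (fun x => x = 0%V); split; first exact: mchain0 hC.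
  split=> [x ->|h]; first exact: lsub0 i0.1.
  have [w [_ [x [/h -> [_ hx]]]]] := R0 0%N (/ 2) ltac:(lra).
  by have := hx 0%V erefl; rewrite bl0 subr0 nrm0; lra.
have R1 S : F' S -> RR M1 C0 S.
  move=> [hS [h1 h2]]; have iS := (c1 S hS).1; apply: (@RRd X M1 C0 S (fun x => x = 0%V)) => //.
  - exact: csub0.
  - by move=> x ->; apply: lsub0 iS.1.
  - exact: hp (c1 _ ChC0).
  - exact: hp (c1 _ hS).
  - by move=> a _ x ->; exact: bl0.
  by move=> hRS; apply: h2 => x hx; apply: hx.
have ChC1 : Ch (Fcup F') by apply: (mchain_cup hC) => // S [].
have leC1 : le_s (Fcup F') C0 by apply: cl_sub i0 _ => x [S [[_ [h _]] /h]].
pose p := SPair i0 (c1 _ ChC1).1 leC1; exists p; split.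
  apply: (mchain_gap (p := p) hC ChC1 ChC0) => S hS; have [h|h] := EM (le_s C0 S); first by right.
  left=> x hx; have [//|h'] := c2 C0 S ChC0 hS.
  by apply: cl_incl; exists S.
by apply: RRc => //; [exact: hp (c1 _ ChC0)|move=> S [_ []]].
Qed.
(** * Entire functions and products of exponentials *)

Section Cauchy.
Variable X : CBanach.
Implicit Types (phi psi : nat -> X).
Lemma serD (u v : nat -> X) : summ u -> summ v ->
  summ (fun i => u i + v i)%V /\ ser (fun i => u i + v i)%V = (ser u + ser v)%V.
Proof.
move=> hu hv; split.
  have [A hA] := hu; have [B hB] := hv; exists (A + B) => n.
  mid (rsum (fun i => nrm (u i) + nrm (v i)) n).
    by apply: rsum_le => i _; apply: nrmD.
  by rewrite rsumD; mono.
apply: ser_uniq; apply: cvg_eq (cvgD (serP hu) (serP hv)) => n.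
by rewrite big_split.
Qed.
Definition mask j k phi i : X := if ((i %% 2 ^ k) == (j %% 2 ^ k))%N then phi i else 0%V.
Lemma ent_dom phi psi : (forall i, nrm (psi i) <= nrm (phi i)) -> ent phi -> ent psi.
Proof.
move=> h hp r r0; have [M hM] := hp r r0; exists M => n; apply: Rle_trans (hM n).
by apply: rsum_le; mono.
Qed.
Lemma mask_le j k phi i : nrm (mask j k phi i) <= nrm (phi i).
Proof. by rewrite /mask; case: ifP; [lra|rewrite nrm0; pos]. Qed.
Lemma root2 k : exists z : C, Cmod z = 1 /\ (z ^+ (2 ^ k) = -1)%V.
Proof.
elim: k => [|k [z []]].
  by exists (-1)%V; split=> //; rewrite -Cmod1; exact: CmodN.
have [w hw] := Csqrt z; exists w; split; last by rewrite expnS exprM expr2 hw.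
have := CmodM w w; rewrite hw; have := Cmod_ge0 w; nra.
Qed.
Lemma signC n : ((-1) ^+ n = (if odd n then -1 else 1) :> C)%V.
Proof. by elim: n => [|n IH]; rewrite // exprS IH /=; case: (odd n); cring. Qed.
Lemma odd_mod k i j : (i %% 2 ^ k = j %% 2 ^ k)%N ->
  (odd (i %/ 2 ^ k) == odd (j %/ 2 ^ k)) = ((i %% 2 ^ k.+1) == (j %% 2 ^ k.+1))%N.
Proof.
move=> h; have e n : (n %% 2 ^ k.+1 = odd (n %/ 2 ^ k) * 2 ^ k + n %% 2 ^ k)%N.
  rewrite {1}(divn_eq n (2 ^ k)) -{1}(odd_double_half (n %/ 2 ^ k)) mulnDl -muln2 -mulnA -expnS.
  rewrite addnAC addnC modnMDl modn_small //.
  rewrite expnS; lia.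
rewrite !e h eqn_add2r eqn_mul2r expn_eq0.
by case: (odd _); case: (odd _).
Qed.
(** Cauchy's estimate by averaging. [mask] keeps the coefficients whose index is congruent to [j]
    modulo [2 ^ k]; the step to [k.+1] is the mean of f(t) and z^(-j) f(zt) with z^(2^k) = -1, which
    respects a bound on the circle. For large [k] only [phi j] and a small tail remain. *)
Lemma cauchy_est phi r s j : 0 <= r -> ent phi ->
  (forall t, Cmod t = r -> nrm (pser phi t) <= s) -> r ^ j * nrm (phi j) <= s.
Proof.
move=> r0 hp hs.
have hm k t : Cmod t = r -> nrm (pser (mask j k phi) t) <= s.
  elim: k t => [|k IH] t ht.
    have -> : mask j 0 phi = phi by apply/funext => i; rewrite /mask !modn1.
    mono.
  have [z [z1 zk]] := root2 k.
  have z0 : z != 0%V by apply/eqP => h; move: z1; rewrite h Cmod0; lra.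
  have em := ent_dom (mask_le j k phi) hp.
  have h1 := ent_summ t em; have h2 := ent_summ (z * t)%V em.
  have [_ e2] := serD (summZ (rc (/ 2)) h1) (summZ (rc (/ 2) * z ^- j)%V h2).
  have hlf : Cmod (rc (/ 2)) = / 2 by rewrite Cmod_rc; lra.
  have -> : pser (mask j k.+1 phi) t = (rc (/ 2) *: pser (mask j k phi) t +
      (rc (/ 2) * z ^- j) *: pser (mask j k phi) (z * t))%V.
    rewrite -!serZ // -e2; congr ser; apply/funext => i.
    rewrite exprMn !scalerA -scalerDl /mask.
    have zq n : (z ^+ n = (-1) ^+ (n %/ 2 ^ k) * z ^+ (n %% 2 ^ k))%V.
      by rewrite {1}(divn_eq n (2 ^ k)) exprD mulnC exprM zk.
    case: (boolP ((i %% 2 ^ k) == (j %% 2 ^ k))%N) => [/eqP h|hn]; last first.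
      have -> : ((i %% 2 ^ k.+1) == (j %% 2 ^ k.+1))%N = false; last by rewrite !scaler0.
      apply/eqP => h; move/eqP: hn.
      have d : (2 ^ k %| 2 ^ k.+1)%N by rewrite dvdn_exp2l.
      by rewrite -(modn_dvdm i d) h modn_dvdm.
    rewrite -(odd_mod h).
    have zr : (z ^+ (j %% 2 ^ k) != 0)%V by rewrite expf_neq0.
    have -> : (rc (/ 2) * t ^+ i + rc (/ 2) * z ^- j * (z ^+ i * t ^+ i) =
       rc (/ 2) * (1 + z ^- j * z ^+ i) * t ^+ i)%V by cring.
    have -> : (z ^- j * z ^+ i = (-1) ^+ (j %/ 2 ^ k) * (-1) ^+ (i %/ 2 ^ k))%V.
      rewrite (zq i) (zq j) h invfM -(signr_odd _ (i %/ 2 ^ k)).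
      rewrite mulrACA mulVf // mulr1.
      by rewrite signC; case: (odd _); rewrite ?invrN1 ?invr1.
    rewrite !signC; case: (odd (i %/ 2 ^ k)); case: (odd (j %/ 2 ^ k)).
    by rewrite mulrN1 opprK half2 mul1r.
    by rewrite mulrN1 subrr mulr0 mul0r scale0r scaler0.
    by rewrite mulr1 subrr mulr0 mul0r scale0r scaler0.
    by rewrite mulr1 half2 mul1r.
  via (nrmD _ _); rewrite !nrmZ CmodM hlf CmodV; last first.
    by apply/eqP; rewrite expf_neq0.
  rewrite CmodX z1 pow1.
  have := IH t; have := IH (z * t)%V; rewrite CmodM z1; lra.
pose t := rc r; have tr : Cmod t = r by rewrite Cmod_rc.
have -> : r ^ j * nrm (phi j) = nrm (t ^+ j *: phi j)%V by rewrite nrmZ CmodX tr.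
apply: le_epsilon => e e0.
pose f i := r ^ i * nrm (phi i).
have f0 i : 0 <= f i by apply: Rmult_le_pos; pos.
have [N hN] := rsum_tail f0 (hp r r0) e0.
pose k := (N + j)%N; have jk : (j < 2 ^ k)%N by apply: leq_ltn_trans (ltn_expl k (leqnn 2)); lia.
have Nk : (N <= 2 ^ k)%N by apply: ltnW; apply: leq_ltn_trans (ltn_expl k (leqnn 2)); lia.
have em := ent_dom (mask_le j k phi) hp.
have h : nrm (t ^+ j *: phi j - pser (mask j k phi) t)%V <= e.
  apply: (cvg_le (cvgB (cvg_cst _) (serP (ent_summ t em)))); exists (2 ^ k)%N => n hn.
  pose g i := (if (i < 2 ^ k)%N then 0 else t ^+ i *: mask j k phi i)%V.
  have -> : (t ^+ j *: phi j - \sum_(i < n) t ^+ i *: mask j k phi i = - \sum_(i < n) g i)%V.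
    have jn : (j < n)%N by apply: leq_trans hn.
    rewrite (bigD1 (Ordinal jn)) //= [X in _ = (- X)%V](bigD1 (Ordinal jn)) //=.
    rewrite /g jk add0r {1}/mask eqxx opprD addrA subrr add0r; congr (- _)%V.
    apply: eq_bigr => i hi; case: ifP => // ik.
    rewrite /mask !modn_small //; case: eqP => lra; last by rewrite scaler0.
    by case/eqP: hi; apply: val_inj.
  rewrite nrmN; via (nrm_sum g n).
  mid (rsum (fun i => if (i < 2 ^ k)%N then 0 else f i) n).
    apply: rsum_le => i _; rewrite /g; case: ifP => _; first by rewrite nrm0; lra.
    rewrite nrmZ CmodX tr; apply: Rmult_le_compat_l; [pos|exact: mask_le].
  by rewrite rsum_cut //; left; apply: hN => //; apply: leq_trans hn.
have := hm k t; have := nrm_le (t ^+ j *: phi j)%V (pser (mask j k phi) t); vlra.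
Qed.
Lemma pser_lip phi r : 1 <= r -> ent phi -> exists M, 0 <= M /\
  forall t s, Cmod t <= r -> Cmod s <= r -> nrm (pser phi t - pser phi s) <= M * Cmod (t - s)%V.
Proof.
move=> r1 hp; have [M hM] := hp (2 * r) ltac:(lra); exists M; split; first by have := hM 0%N.
move=> t s ht hs.
have pw (a b : C) i : Cmod a <= r -> Cmod b <= r -> Cmod (a ^+ i - b ^+ i)%V <= (2 * r) ^ i * Cmod (a - b)%V.
  move=> ha hb; elim: i => [|i IH]; first by rewrite subrr Cmod0; pos.
  have -> : (a ^+ i.+1 - b ^+ i.+1 = a * (a ^+ i - b ^+ i) + (a - b) * b ^+ i)%V by rewrite !exprS; cring.
  via (Cmod_tri _ _); rewrite !CmodM CmodX.
  have d0 := Cmod_ge0 (a - b)%V.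
  have bi : Cmod b ^ i <= (2 * r) ^ i by mono.
  have p0 : 0 <= (2 * r) ^ i by pos.
  have h1 : Cmod a * Cmod (a ^+ i - b ^+ i)%V <= r * ((2 * r) ^ i * Cmod (a - b)%V).
    mono.
  have h2 : Cmod (a - b)%V * Cmod b ^ i <= Cmod (a - b)%V * (r * (2 * r) ^ i).
    by apply: Rmult_le_compat_l; nra.
  by rewrite [(2 * r) ^ i.+1]/=; nra.
apply: (cvg_le (cvgB (serP (ent_summ t hp)) (serP (ent_summ s hp)))); exists 0%N => n _.
rewrite -sumrB; via (nrm_sum (fun i => t ^+ i *: phi i - s ^+ i *: phi i)%V n).
mid (Cmod (t - s)%V * rsum (fun i => (2 * r) ^ i * nrm (phi i)) n); last first.
  by rewrite Rmult_comm; mono.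
rewrite -rsumZ; apply: rsum_le => i _; rewrite -scalerBl nrmZ.
rewrite -Rmult_assoc; apply: Rmult_le_compat_r; first pos.
by rewrite Rmult_comm; mono.
Qed.
End Cauchy.

(** * The derivative of the exponential map *)

Section Phi1.
Variable X : CBanach.
Implicit Types (T c x y : BL X).
(** Terms of the power series of (exp T - 1) / T, through which the derivative of [exp] is
    expressed. *)
Definition ph1 T j : BL X := ((j.+1`!%:R : C)^-1 *: T ^+ j)%V.
Definition phi1 T : BL X := ser (ph1 T).
Lemma nrm_ph1 T j : nrm (ph1 T j) <= / INR (j`!) * nrm T ^ j.
Proof.
rewrite nrmZ Cmod_factV; apply: Rmult_le_compat; try pos; last exact: bnX.
  by left; apply: Rinv_0_lt_compat; apply: fact_gt0R.
apply: Rinv_le_contravar; first exact: fact_gt0R.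
by apply: le_INR; apply/leP; rewrite leq_pmull.
Qed.
Lemma ph1_summ T : summ (ph1 T).
Proof.
apply: summ_le (nrm_ph1 T) _; exists (exp (nrm T)) => n; apply: expsum_le; pos.
Qed.
Lemma bexp_phi1 T : bexp T = (1 + T * phi1 T)%V.
Proof.
have [_ e] := ser_recl (ec_summ T); rewrite /bexp e ec0; congr (_ _)%V.
have [_ <-] := @bl_ser (BB X) (BB X) (fun U => (T * U)%V) _ (nrm T) (mulrDr T) (bnM T) (ph1_summ T).
by congr ser; apply/funext => i; rewrite /ec exprS scalerAr.
Qed.
Lemma ser_comm (u : nat -> BL X) T : summ u -> (forall i, T * u i = u i * T)%V -> (T * ser u = ser u * T)%V.
Proof.
move=> hu h; apply: (cvg_uniq (bcvgMl T (serP hu))).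
apply: cvg_eq (bcvgMr T (serP hu)) => n; rewrite mulr_suml mulr_sumr.
by apply: eq_bigr.
Qed.
Lemma phi1_comm T : (T * phi1 T = phi1 T * T)%V.
Proof.
apply: ser_comm (ph1_summ T) _ => i; rewrite -scalerAl -scalerAr.
by rewrite -exprS -exprSr.
Qed.
Lemma qn_bexp T : qn T -> qn (bexp T - 1)%V.
Proof. rewrite bexp_phi1 addrC addKr; apply: qn_comm; exact: phi1_comm. Qed.
Lemma cpt_bexp T : cpt T -> cpt (bexp T - 1)%V.
Proof. by rewrite bexp_phi1 addrC addKr; apply: cptMr. Qed.
Lemma nrm_phi1 T : nrm T <= / 2 -> nrm (1 - phi1 T)%V <= / 2.
Proof.
move=> h; have [hs e] := ser_recl (ph1_summ T).
have -> : (1 - phi1 T = - ser (fun i => ph1 T i.+1))%V.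
  have -> : phi1 T = (1 + ser (fun i => ph1 T i.+1))%V.
    by rewrite /phi1 e {1}/ph1 (_ : (1`!%:R : C)^-1 = 1)%V ?scale1r // invr1.
  by vec.
rewrite nrmN; apply: ser_le => n.
mid (rsum (fun i => / 4 * (/ 2) ^ i) n).
  apply: rsum_le => i _; rewrite nrmZ Cmod_factV.
  have -> : / 4 * (/ 2) ^ i = / 2 * (/ 2) ^ i.+1 by rewrite /=; lra.
  apply: Rmult_le_compat; [|pos| |].
  by left; apply: Rinv_0_lt_compat; apply: fact_gt0R.
  apply: Rinv_le_contravar; first lra.
    have -> : 2 = INR 2 by [].
    by apply: le_INR; apply/leP; rewrite factS; apply: leq_trans (leq_pmulr _ (fact_gt0 _)).
  by via (bnX _ _); mono.
rewrite rsumZ; have := @geo_le (/ 2) n.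
set s := rsum _; lra.
Qed.
End Phi1.

Section Dexp.
Variable X : CBanach.
Implicit Types (c x y b : BL X).
(* [sn c n y] is the derivative of the n-th power at [c] in the direction [y]. *)
Fixpoint sn c n : BL (BB X) := if n is k.+1 then (Rm c * sn c k + Lm c ^+ k)%V else 0%V.
Lemma snS c k : sn c k.+1 = (Rm c * sn c k + Lm c ^+ k)%V. Proof. by []. Qed.
(** Left multiplication is replaced by [R_c + ad c], whose summands commute; the coefficients add up
    by Pascal's rule. *)
Lemma snE c n : sn c n.+1 = (\sum_(j < n.+1) (adm c ^+ j * Rm c ^+ (n - j)) *+ 'C(n.+1, j.+1))%V.
Proof.
pose A := adm c; pose R1 := Rm c.
have cAR : (R1 * A = A * R1)%V by rewrite mulrBr mulrBl LRm.
have cARn i k : (R1 ^+ i * A ^+ k = A ^+ k * R1 ^+ i)%V.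
  by apply: commrX; apply/commr_sym/commrX/commr_sym.
have Ln k : (Lm c ^+ k = \sum_(j < k.+1) (A ^+ j * R1 ^+ (k - j)) *+ 'C(k, j))%V.
  have -> : Lm c = (R1 + A)%V by rewrite addrC subrK.
  by rewrite exprDn_comm //; apply: eq_bigr => j; rewrite cARn.
elim: n => [|n IH].
  by rewrite big_ord1 /= mulr1 mulr0 add0r.
rewrite snS IH Ln mulr_sumr.
have -> : (\sum_(i < n.+1) R1 * (A ^+ i * R1 ^+ (n - i) *+ 'C(n.+1, i.+1)) = \sum_(j < n.+2) (A ^+ j * R1 ^+ (n.+1 - j)) *+ 'C(n.+1, j.+1))%V; last first.
  by rewrite -big_split; apply: eq_bigr => j /=; rewrite -mulrnDr.
rewrite [RHS]big_ord_recr /= bin_small // addr0; apply: eq_bigr => j.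
rewrite mulrnAr.
have hj : (j <= n)%N by rewrite -ltnS.
by rewrite mulrA (_ : R1 * A ^+ j = A ^+ j * R1)%V -?mulrA -?exprS ?subSn; have := cARn 1%N.
Qed.
Lemma sn_conv c n : ((n.+1`!%:R : C)^-1 *: sn c n.+1 = conv (ph1 (adm c)) (ec (Rm c)) n)%V.
Proof.
rewrite snE scaler_sumr; apply: eq_bigr => j.
have hj : (j.+1 <= n.+1)%N by [].
have := binC hj; rewrite subSS => hb.
by rewrite -scalerAl -scalerAr scalerA -hb -scalerA scaler_nat.
Qed.
Lemma bexp_Rm c y : bexp (Rm c) y = (y * bexp c)%V.
Proof.
apply: (cvg_uniq (bn_cvg y (serP (ec_summ (Rm c))))).
apply: cvg_eq (bcvgMl y (serP (ec_summ c))) => n.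
rewrite bl_sumE mulr_sumr; apply: eq_bigr => i.
by rewrite blZE RmX scalerAr.
Qed.
Definition dn c y n : BL X := ((c + y) ^+ n - c ^+ n - sn c n y)%V.
Lemma sn_bound c y n : nrm c <= 1 -> nrm (sn c n y) <= INR n * nrm y.
Proof.
move=> c1; elim: n => [|n IH]; first by rewrite nrm0 /=; lra.
rewrite S_INR; via (nrmD _ _); rewrite Rmult_plus_distr_r.
apply: Rplus_le_compat.
  via (bnM _ _).
  rewrite -[X in _ <= X]Rmult_1_r.
  mono.
rewrite LmX; apply: bnM_le => //.
have h : nrm (c ^+ n)%V <= 1.
  by via (bnX _ _); rewrite -(pow1 n); mono.
by have := nrm_ge0 y; nra.
Qed.
Lemma dn_bound c y n : nrm c + nrm y <= 1 -> nrm (dn c y n) <= INR n * INR n * (nrm y * nrm y).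
Proof.
move=> h; have y0 := nrm_ge0 y.
elim: n => [|n IH]; first by rewrite /dn subrr subr0 nrm0 /=; lra.
have -> : dn c y n.+1 = (dn c y n * (c + y) + sn c n y * y)%V.
  have e : ((c + y) ^+ n = dn c y n + (c ^+ n + sn c n y))%V by rewrite /dn; vec.
  have -> : dn c y n.+1 = ((c + y) ^+ n * (c + y) - c ^+ n * c - (sn c n y * c + c ^+ n * y))%V.
    by rewrite /dn -!exprSr blDE LmX.
  by rewrite e !mulrDl !mulrDr; vec.
via (nrmD _ _).
have b1 : nrm (dn c y n * (c + y))%V <= INR n * INR n * (nrm y * nrm y).
  via (bnM _ _); apply: Rle_trans IH; rewrite -[X in _ <= X]Rmult_1_r.
  by apply: Rmult_le_compat_l; [pos|exact: Rle_trans (nrmD c y) h].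
have b2 : nrm (sn c n y * y)%V <= INR n * (nrm y * nrm y).
  via (bnM _ _); rewrite -Rmult_assoc; apply: Rmult_le_compat_r => //.
  by apply: sn_bound; lra.
via (Rplus_le_compat _ _ _ _ b1 b2); rewrite S_INR.
have n0 := pos_INR n.
nra.
Qed.
(* The derivative of [exp] at [c] is [phi1 (ad c) y * exp c]. *)
Lemma bexp_taylor c y : nrm c + nrm y <= 1 ->
  nrm (bexp (c + y) - bexp c - phi1 (adm c) y * bexp c)%V <= exp 4 * (nrm y * nrm y).
Proof.
move=> h; have [h1 h2] := conv_ser (ph1_summ (adm c)) (ec_summ (Rm c)).
have yy : 0 <= nrm y * nrm y by nra.
have cv : cvg (fun n => \sum_(i < n) (conv (ph1 (adm c)) (ec (Rm c)) i) y)%V (phi1 (adm c) y * bexp c)%V.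
  have e : (phi1 (adm c) y * bexp c)%V = ser (conv (ph1 (adm c)) (ec (Rm c))) y.
    rewrite h2.
    have cm : (bexp (Rm c) * phi1 (adm c) = phi1 (adm c) * bexp (Rm c))%V.
      apply: ser_comm (ph1_summ _) _ => i; apply: esym; apply: ser_comm (ec_summ _) _ => k.
      have cAR : (Rm c * adm c = adm c * Rm c)%V by rewrite mulrBr mulrBl LRm.
      have cc : (adm c ^+ i * Rm c ^+ k = Rm c ^+ k * adm c ^+ i)%V by apply: commrX; apply/commr_sym/commrX.
      by rewrite -!scalerAl -!scalerAr cc scalerA mulrC -scalerA.
    by rewrite -cm blME bexp_Rm.
  rewrite e; apply: cvg_eq (bn_cvg y (serP h1)) => n; by rewrite bl_sumE.
have cv1 := serP (ec_summ (c + y)%V); have cv2 := serP (ec_summ c).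
have sh (u : nat -> BL X) l : cvg u l -> cvg (fun n => u n.+1) l.
  by move=> hu e /hu [N hN]; exists N; mono.
apply: (cvg_le (cvgB (cvgB (sh _ _ cv1) (sh _ _ cv2)) cv)); exists 0%N => n _.
have -> : (\sum_(i < n.+1) ec (c + y) i - \sum_(i < n.+1) ec c i -
   \sum_(i < n) (conv (ph1 (adm c)) (ec (Rm c)) i) y =
   \sum_(i < n.+1) (i`!%:R : C)^-1 *: dn c y i)%V.
  have d0 : dn c y 0 = 0%V by rewrite /dn subrr subr0.
  rewrite -sumrB big_ord_recl [in RHS]big_ord_recl d0 scaler0 add0r.
  rewrite subrr add0r -sumrB; apply: eq_bigr => i.
  by rewrite -sn_conv !scalerBr.
via (nrm_sum (fun i => (i`!%:R : C)^-1 *: dn c y i)%V n.+1).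
(* The constant [exp 4] arises from [i * i <= 4 ^ i] in the second-order remainders of the
   powers. *)
mid (rsum (fun i => nrm y * nrm y * (/ INR (i`!) * 4 ^ i)) n.+1).
  apply: rsum_le => i _; rewrite nrmZ Cmod_factV.
  have f0 : 0 <= / INR (i`!) by left; apply: Rinv_0_lt_compat; apply: fact_gt0R.
  have i4 : INR i * INR i <= 4 ^ i.
    have : INR i <= 2 ^ i.
      elim: (i) => [|k IHk]; first by rewrite /=; lra.
      have : 1 <= 2 ^ k by apply: pow_R1_Rle; lra.
      by rewrite S_INR [2 ^ k.+1]/=; lra.
    have -> : 4 ^ i = 2 ^ i * 2 ^ i by rewrite -Rpow_mult_distr.
    mono.
  have := @dn_bound c y i h => hd.
  mid (/ INR (i`!) * (4 ^ i * (nrm y * nrm y))); last lra.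
  apply: Rmult_le_compat_l => //; pos; mono.
rewrite rsumZ Rmult_comm; apply: Rmult_le_compat_r => //.
by apply: expsum_le; lra.
Qed.
End Dexp.

(** * Entire families of quasinilpotent operators *)

Section Entire.
Variable X : CBanach.
Implicit Types (f g : C -> BL X) (a : BL X).
Definition entire f : Prop := exists phi : nat -> BL X, ent phi /\ forall t, pser phi t = f t.
Lemma entire_cst a : entire (fun=> a).
Proof.
pose phi i := if i is 0%N then a else 0%V.
have hp : ent phi.
  exists (nrm a) => n; mid (rsum (fun i => if i is 0%N then nrm a else 0) n).
    by apply: rsum_le => -[|i] /=; rewrite ?nrm0; lra.
  elim: n => [|[|n] IH] /=; [pos|lra|]; rewrite /= in IH; lra.
exists phi; split=> // t; apply: ser_uniq; exists 1%N => -[//|n].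
rewrite big_ord_recl big1 => [|i _]; last by rewrite scaler0.
by rewrite scale1r addr0 subrr nrm0.
Qed.
Lemma entireD f g : entire f -> entire g -> entire (fun t => f t + g t)%V.
Proof.
move=> [p [hp ep]] [q [hq eq]]; exists (fun i => p i + q i)%V; split.
  move=> r r0; have [A hA] := hp r r0; have [B hB] := hq r r0; exists (A + B) => n.
  apply: Rle_trans (Rplus_le_compat _ _ _ _ (hA n) (hB n)); rewrite -rsumD; apply: rsum_le => i _.
  rewrite -Rmult_plus_distr_l; apply: Rmult_le_compat_l; [pos|exact: nrmD].
move=> t; rewrite -ep -eq; have [_ <-] := serD (ent_summ t hp) (ent_summ t hq).
by congr ser; apply/funext => i; rewrite scalerDr.
Qed.
Lemma entireM f g : entire f -> entire g -> entire (fun t => f t * g t)%V.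
Proof.
move=> [p [hp ep]] [q [hq eq]]; exists (conv p q); have [h1 h2] := ent_mul hp hq.
by split=> // t; rewrite h2 ep eq.
Qed.
Lemma entireX f n : entire f -> entire (fun t => f t ^+ n)%V.
Proof.
move=> hf; elim: n => [|n IH].
  by rewrite (_ : (fun t => f t ^+ 0)%V = fun=> 1%V); [exact: entire_cst|].
by rewrite (_ : (fun t => f t ^+ n.+1)%V = fun t => (f t * f t ^+ n)%V); [exact: entireM|apply/funext => t; rewrite exprS].
Qed.
Lemma entire_bexp a : entire (fun t => bexp (t *: a)%V).
Proof. by exists (ec a); split=> [|t]; [exact: ec_ent|rewrite bexpZ]. Qed.
Lemma entire_lip f r : entire f -> exists M, 0 <= M /\ forall t s, Cmod t <= r -> Cmod s <= r ->
  nrm (f t - f s)%V <= M * Cmod (t - s)%V.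
Proof.
move=> [p [hp ep]]; have [M [M0 hM]] := pser_lip (Rmax_l 1 r) hp; exists M; split=> // t s ht hs.
by rewrite -!ep; apply: hM; apply: Rle_trans (Rmax_r _ _).
Qed.
Lemma entire_tb f r : entire f -> tb (fun a => exists t, Cmod t <= r /\ a = f t).
Proof.
move=> hf e e0; have [M [M0 hM]] := entire_lip r hf.
have [|l [hl1 hl2]] := @tb_net CC _ (@tb_CC r) (e / (M + 1)); first pos.
exists (map f l) => _ [t [ht ->]]; have [s sl hs] := hl2 t ht; exists (f s); first exact: map_f.
apply: Rle_lt_trans (hM t s ht (hl1 _ sl)) _.
have h0 := Cmod_ge0 (t - s)%V; have {}hs : Cmod (t - s)%V < e / (M + 1) := hs.
have e1 : (M + 1) * (e / (M + 1)) = e by rfield; lra.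
have M1 : M * Cmod (t - s)%V <= M * (e / (M + 1)) by mono.
apply: Rle_lt_trans M1 _; lra.
Qed.
(** At each point one power is below the corresponding power of [e], with room to spare, hence so it
    is nearby by continuity; division with remainder bounds the other powers, and the disc is
    totally bounded. *)
Lemma qn_unif f r e : entire f -> (forall t, Cmod t <= r -> qn (f t)) -> 0 < e ->
  exists D, forall t m, Cmod t <= r -> nrm (f t ^+ m)%V <= D * e ^ m.
Proof.
move=> hf hq e0; pose good (A : CC -> Prop) := exists D, forall t m, A t -> Cmod t <= r -> nrm (f t ^+ m)%V <= D * e ^ m.
have [[D hD]|hn] := pselect (good (fun z => Cmod z <= r)).
  by exists D; mono.
have [|||y hy] := @tb_cluster CC _ good (@tb_CC r) _ _ _ hn.
move=> A B h [D hD]; exists D; mono.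
move=> A B [D hD] [D' hD']; exists (Rmax D D') => t m [h|h] ht.
    via (hD t m h ht); apply: Rmult_le_compat_r; [pos|exact: Rmax_l].
  via (hD' t m h ht); apply: Rmult_le_compat_r; [pos|exact: Rmax_r].
by exists 0.
exfalso; have yr : Cmod y <= r.
  apply: Rnot_lt_le => h; apply: (hy (Cmod y - r) ltac:(lra)); exists 0 => t m [_ h1].
  have {}h1 : Cmod (t - y)%V < Cmod y - r := h1.
  have := Cmod_tri t (- (t - y))%V; rewrite CmodN.
  have -> : (t - (t - y) = y)%V by vec.
  lra.
have [N hN] := hq y yr (e / 2) ltac:(lra).
have /hN hp : (N <= N.+1)%N by lia.
have [M [M0 hM]] := entire_lip r (entireX N.+1 hf).
have [B [B0 hB]] : exists B, 0 <= B /\ forall t, Cmod t <= r -> nrm (f t) <= B.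
  have [B [B0 hB]] := tb_bounded (entire_tb r hf).
  by exists B; split=> // t ht; apply: hB; exists t.
have ep : 0 < e ^ N.+1 - (e / 2) ^ N.+1.
  have e2 : (/ 2) ^ N.+1 < 1 by apply: (proj2 (pow_lt_1_compat (/ 2) N.+1 _ _)); [lra|lia].
  rewrite Rpow_mult_distr; have : 0 < e ^ N.+1 by pos.
  nra.
apply: (hy ((e ^ N.+1 - (e / 2) ^ N.+1) / (M + 1))); first pos.
have [D [D0 hD]] : exists D, 0 <= D /\ forall i, (i <= N)%N -> B ^ i <= D * e ^ i.
  elim: (N) => [|k [D [D0 hD]]]; first by exists 1; split; [lra|case=> //; lra].
  exists (D + (B / e) ^ k.+1); have q0 : 0 <= (B / e) ^ k.+1.
    pos.
  split=> [|i]; first lra.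
  rewrite leq_eqVlt => /orP [/eqP ->|/hD h]; last first.
    via h; mono.
  have -> : B ^ k.+1 = (B / e) ^ k.+1 * e ^ k.+1.
    by rewrite -Rpow_mult_distr; congr (_ ^ _); rfield; lra.
  mono.
exists D => t m [_ ht] tr.
have {}ht : Cmod (t - y)%V < (e ^ N.+1 - (e / 2) ^ N.+1) / (M + 1) := ht.
have hx : nrm (f t ^+ N.+1)%V <= e ^ N.+1.
  have h1 := hM t y tr yr; have h2 := nrm_le (f t ^+ N.+1)%V (f y ^+ N.+1)%V.
  have h3 : M * Cmod (t - y)%V <= e ^ N.+1 - (e / 2) ^ N.+1.
    have e1 : (M + 1) * ((e ^ N.+1 - (e / 2) ^ N.+1) / (M + 1)) = e ^ N.+1 - (e / 2) ^ N.+1 by rfield; lra.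
    nra.
  by via h2; via (Rplus_le_compat _ _ _ _ hp (Rle_trans _ _ _ h1 h3)); lra.
rewrite {1}(divn_eq m N.+1) exprD mulnC exprM; via (bnM _ _).
have h4 : nrm ((f t ^+ N.+1) ^+ (m %/ N.+1))%V <= (e ^ N.+1) ^ (m %/ N.+1).
  by via (bnX _ _); mono.
have h5 : nrm (f t ^+ (m %% N.+1))%V <= D * e ^ (m %% N.+1).
  via (bnX _ _); mid (B ^ (m %% N.+1)).
    mono.
  by apply: hD; lia.
via (Rmult_le_compat _ _ _ _ (nrm_ge0 _) (nrm_ge0 _) h4 h5); right.
rewrite -pow_mult -Rmult_assoc (Rmult_comm _ D) Rmult_assoc -pow_add; congr (_ * _ _).
by rewrite [in RHS](divn_eq m N.+1); lia.
Qed.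
(* Three circles: a bound on the radius [r] and one on the radius [16 r] control the radius [2 r]. *)
Lemma qn_double f r : 0 < r -> entire f -> (forall t, Cmod t <= r -> qn (f t)) ->
  forall t, Cmod t <= 2 * r -> qn (f t).
Proof.
move=> r0 hf hq t ht; apply: qn_of_bound => e e0.
have [B [B1 hB]] : exists B, 1 <= B /\ forall s, Cmod s <= 16 * r -> nrm (f s) <= B.
  have [B [B0 hB]] := tb_bounded (entire_tb (16 * r) hf).
  by exists (B + 1); split=> [|s hs]; [lra|via (hB (f s) _); [exists s|lra]].
(* The rates [e * e / B] at radius [r] and [B] at radius [16 * r] have geometric mean [e], which
   governs the radius [4 * r]; at [2 * r] the series is then dominated by a geometric one. *)
have e1 : 0 < e * e / B by pos.
have [D hD] := qn_unif hf hq e1; exists (2 * (1 + D)) => m.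
have [p [hp ep]] := entireX m hf; have em : 0 < e ^ m by pos.
have D0 : 0 <= D by have := hD 0%V 0%N; rewrite Cmod0 expr0; have := nrm_ge0 (1 : BL X)%V; lra.
have hc j : (4 * r) ^ j * nrm (p j) <= (1 + D) * e ^ m.
  have h1 : r ^ j * nrm (p j) <= D * (e * e / B) ^ m.
    by apply: cauchy_est hp _; [lra|move=> s hs; rewrite ep; apply: hD; lra].
  have h2 : (16 * r) ^ j * nrm (p j) <= B ^ m.
    apply: cauchy_est hp _; [lra|move=> s hs; rewrite ep; via (bnX _ _)].
    by apply: pow_incr; split; [pos|apply: hB; lra].
  have e2 : (4 * r) ^ j * (4 * r) ^ j = r ^ j * (16 * r) ^ j.
    by rewrite -!Rpow_mult_distr; congr (_ ^ _); lra.
  have e3 : (e * e / B) ^ m * B ^ m = e ^ m * e ^ m.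
    by rewrite -!Rpow_mult_distr; congr (_ ^ _); rfield; lra.
  have h3 : (r ^ j * nrm (p j)) * ((16 * r) ^ j * nrm (p j)) <= (D * (e * e / B) ^ m) * B ^ m.
    mono.
  have h4 : ((4 * r) ^ j * nrm (p j)) * ((4 * r) ^ j * nrm (p j)) <= D * (e ^ m * e ^ m).
    nra.
  have : 0 <= (4 * r) ^ j * nrm (p j) by pos.
  have aux x u : 0 <= x -> 0 < u -> x * x <= D * (u * u) -> x <= (1 + D) * u.
    move=> hx hu h5; apply: Rnot_lt_le => h; have w0 : 0 <= (1 + D) * u by nra.
    have h6 := Rmult_le_0_lt_compat _ _ _ _ w0 w0 h h.
    have : D * (u * u) <= (1 + D) * u * ((1 + D) * u) by nra.
    lra.
  mono.
rewrite -ep; apply: ser_le => n.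
mid (rsum (fun i => (1 + D) * e ^ m * (/ 2) ^ i) n).
  apply: rsum_le => i _; rewrite nrmZ CmodX.
  mid ((2 * r) ^ i * nrm (p i)).
    mono.
  have -> : 2 * r = / 2 * (4 * r) by lra.
  rewrite Rpow_mult_distr Rmult_assoc Rmult_comm; apply: Rmult_le_compat_r => //.
  pos.
rewrite rsumZ; have := @geo_le (/ 2) n.
have : 0 <= (1 + D) * e ^ m by nra.
move: (rsum _) => s; nra.
Qed.
Lemma qn_entire f r : 0 < r -> entire f -> (forall t, Cmod t <= r -> qn (f t)) -> forall t, qn (f t).
Proof.
move=> r0 hf hq t.
have h n : forall s, Cmod s <= 2 ^ n * r -> qn (f s).
  elim: n => [|n IH] s hs; first by apply: hq; lra.
  apply: (@qn_double f (2 ^ n * r)) => //; last by rewrite /= in hs; lra.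
  pos.
have [N hN] := @pow_small (/ 2) (r / (1 + Cmod t)) ltac:(lra) ltac:(lra) ltac:(pos).
apply: (h N); have := hN N; have := Cmod_ge0 t; rewrite pow_inv => t0 h1.
have p2 : 0 < 2 ^ N by pos.
have : (1 + Cmod t) * (/ 2 ^ N * 2 ^ N) < (1 + Cmod t) * (r / (1 + Cmod t) * 2 ^ N).
  by apply: Rmult_lt_compat_l; mono.
have -> : (1 + Cmod t) * (r / (1 + Cmod t) * 2 ^ N) = 2 ^ N * r by rfield; lra.
rewrite Rinv_l; lra.
Qed.
End Entire.

(** * Products of exponentials of elements of a closed Lie algebra *)

Section Euler.
Variables (X : CBanach) (L : BL X -> Prop).
Definition lie (L : BL X -> Prop) : Prop := lsub L /\ forall a b, L a -> L b -> L (a * b - b * a)%V.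
Hypotheses (cL : csub L) (lL : lie L).
Implicit Types (b c x y : BL X).
(** For such [c] the series is within [/ 2] of the identity, and the Neumann series for its inverse
    involves only brackets with [c], so it stays in the closed algebra. *)
Lemma phi1_solve c b : L c -> nrm c <= / 4 -> L b -> exists x, L x /\ nrm x <= 2 * nrm b /\ phi1 (adm c) x = b.
Proof.
move=> c4 hb; have nA : nrm (adm c) <= / 2.
  by via (nrmB _ _); have := nrm_Lm c; have := nrm_Rm c; lra.
have h := nrm_phi1 nA; have [|S [_ [S2 [S3 S4]]]] := @neumann (BB X) (1 - phi1 (adm c))%V; first lra.
have hA x n : L x -> L ((adm c ^+ n)%V x).
  by move=> hx; elim: n => [|n IH]; rewrite // exprS; apply: (proj2 lL).
have hP x : L x -> L (phi1 (adm c) x).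
  move=> hx; apply: (csub_cvg cL _ (bn_cvg x (serP (ph1_summ (adm c))))) => n.
  rewrite bl_sumE; apply: lsub_sum (proj1 lL) _ => i _.
  by apply: lsubZ (proj1 lL) _; mono.
exists (S b); split.
  apply: (csub_cvg cL _ (bn_cvg b S4)) => n; rewrite bl_sumE; apply: lsub_sum (proj1 lL) _ => i _.
  elim: (nat_of_ord i) => [|k IH]; rewrite // exprS.
  by apply: lsubB (proj1 lL) _ _; mono.
split; last by rewrite -blME -[phi1 _](_ : 1 - (1 - phi1 (adm c)) = phi1 (adm c))%V ?S2 // opprB addrC subrK.
apply: bnle_le => //.
via S3; rewrite -[X in _ <= X]Rinv_inv; apply: Rinv_le_contravar; lra.
Qed.
Let K := exp 4 * (4 + exp 1).
(** The direction [x] is chosen so that the derivative of [exp] at [c] along [x] is [y * bexp c];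
    then both sides agree to second order in [y]. *)
Lemma euler_step c y : L c -> L y -> nrm c + 2 * nrm y <= / 4 -> exists c', L c' /\
  nrm c' <= nrm c + 2 * nrm y /\ nrm (bexp c' - bexp y * bexp c)%V <= K * (nrm y * nrm y).
Proof.
move=> hc hy h; have c0 := nrm_ge0 c; have y0 := nrm_ge0 y.
have [|x [hx [x1 x2]]] := phi1_solve hc _ hy; first lra.
exists (c + x)%V; split; first exact: lsubD (proj1 lL) _ _.
split; first by have := nrmD c x; vlra.
have h1 : nrm c + nrm x <= 1 by lra.
have t1 := bexp_taylor h1; rewrite x2 in t1.
have h2 : nrm (0 : BL X)%V + nrm y <= 1 by rewrite nrm0; lra.
have t2 := bexp_taylor h2.
have a0 : adm (0 : BL X)%V = 0%V by apply: BLext => z; rewrite admE mul0r mulr0 subr0.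
have p0 : phi1 (0 : BL (BB X))%V = 1%V.
  apply: ser_uniq => e e0; exists 1%N => -[//|n] _; rewrite big_ord_recl big1 => [|i _].
    by rewrite /ph1 /= expr0 invr1 scale1r addr0 subrr nrm0.
  by rewrite /ph1 exprS mul0r scaler0.
rewrite a0 p0 bl1E bexp0 mulr1 add0r in t2.
have -> : (bexp (c + x) - bexp y * bexp c = (bexp (c + x) - bexp c - y * bexp c) - (bexp y - 1 - y) * bexp c)%V by bvec.
via (nrmB _ _).
have b1 := bnM (bexp y - 1 - y)%V (bexp c).
have b2 : nrm (bexp c) <= exp 1.
  by via (nrm_bexp c); left; apply: exp_increasing; lra.
have e4 := exp_pos 4; have bc := nrm_ge0 (bexp c).
have yy : 0 <= nrm y * nrm y by nra.
have t3 : nrm ((bexp y - 1 - y) * bexp c)%V <= exp 4 * (nrm y * nrm y) * exp 1.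
  by via b1; mono.
have t4 : exp 4 * (nrm x * nrm x) <= exp 4 * (4 * (nrm y * nrm y)).
  by apply: Rmult_le_compat_l; [lra|have := nrm_ge0 x; nra].
via (Rplus_le_compat _ _ _ _ (Rle_trans _ _ _ t1 t4) t3).
by rewrite /K; right; rring.
Qed.
Lemma euler_steps c y k : L c -> L y -> nrm c + INR k * (2 * nrm y) <= / 4 -> exists c', L c' /\
  nrm c' <= nrm c + INR k * (2 * nrm y) /\
  nrm (bexp c' - bexp y ^+ k * bexp c)%V <= INR k * (K * (nrm y * nrm y)) * exp (nrm y) ^ k.
Proof.
move=> hc hy; have y0 := nrm_ge0 y; have K0 : 0 <= K by rewrite /K; pos.
have E1 : 1 <= exp (nrm y) by have := exp_ineq1_le (nrm y); lra.
elim: k => [|k IH] h.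
  by exists c; split=> //; split; [rewrite /=; lra|rewrite mul1r subrr nrm0 /=; lra].
rewrite S_INR in h *; have [|c1 [l1 [n1 e1]]] := IH; first lra.
have [|c2 []] := euler_step l1 hy; first lra.
exists c2; split=> //; split; first lra.
have -> : (bexp c2 - bexp y ^+ k.+1 * bexp c = (bexp c2 - bexp y * bexp c1) + bexp y * (bexp c1 - bexp y ^+ k * bexp c))%V.
  by rewrite exprS mulrBr mulrA; vec.
via (nrmD _ _).
have e3 : nrm (bexp y * (bexp c1 - bexp y ^+ k * bexp c))%V <= exp (nrm y) * (INR k * (K * (nrm y * nrm y)) * exp (nrm y) ^ k).
  by apply: bnM_le => //; exact: nrm_bexp.
have p1 : 1 <= exp (nrm y) ^ k.+1 by apply: pow_R1_Rle.
have q0 : 0 <= K * (nrm y * nrm y) by nra.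
move: p1; rewrite [_ k.+1]/=; nra.
Qed.
(** Steps of size [b / (N + 1)] accumulate an error of order [/ INR N.+1]. This gives approximate
    logarithms in [L] of products of exponentials, in place of the Campbell-Hausdorff series. *)
Lemma euler c b e : L c -> L b -> nrm c + 2 * nrm b <= / 4 -> 0 < e -> exists c', L c' /\
  nrm c' <= nrm c + 2 * nrm b /\ nrm (bexp c' - bexp b * bexp c)%V <= e.
Proof.
move=> hc hb h e0.
have K0 : 0 <= K by rewrite /K; pos.
pose Q := K * (nrm b * nrm b) * exp (nrm b).
have Q0 : 0 <= Q by apply: Rmult_le_pos; pos.
have [N hN] := @archi_inv (e / (Q + 1)) ltac:(pos).
have n0 : 0 < INR N.+1 by apply: lt_0_INR; lia.
pose y := (rc (/ INR N.+1) *: b)%V.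
have ny : nrm y = / INR N.+1 * nrm b by rewrite nrmZ Cmod_rc; pos.
have ny2 : INR N.+1 * nrm y = nrm b by rewrite ny; rfield; lra.
have yb : (y *+ N.+1 = b)%V.
  by rewrite -scaler_nat scalerA -rc_nat -rcM Rinv_r ?scale1r //; lra.
have [||c' [l' [n' e']]] := @euler_steps c y N.+1 hc; first by apply: lsubZ (proj1 lL) _.
  lra.
exists c'; split=> //; split; first lra.
rewrite -bexpMn yb in e'; via e'.
have -> : exp (nrm y) ^ N.+1 = exp (nrm b).
  by rewrite -ny2; elim: (N.+1) => [|k IH]; rewrite ?S_INR ?Rmult_0_l ?exp_0 // Rmult_plus_distr_r Rmult_1_l exp_plus -IH Rmult_comm.
have -> : INR N.+1 * (K * (nrm y * nrm y)) * exp (nrm b) = / INR N.+1 * Q by rewrite ny /Q; rfield; lra.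
have := hN N (leqnn N).
have e1 : (Q + 1) * (e / (Q + 1)) = e by rfield; lra.
nra.
Qed.
Fixpoint bprod (bs : seq (BL X)) : BL X := if bs is b :: bs' then (bexp b * bprod bs')%V else 1%V.
Fixpoint nsum (bs : seq (BL X)) : R := if bs is b :: bs' then nrm b + nsum bs' else 0.
Lemma nsum_ge0 bs : 0 <= nsum bs. Proof. by elim: bs => /=; pos. Qed.
Lemma euler_prod bs e : (forall b, b \in bs -> L b) -> 2 * nsum bs <= / 4 -> 0 < e ->
  exists c, L c /\ nrm c <= 2 * nsum bs /\ nrm (bexp c - bprod bs)%V <= e.
Proof.
elim: bs e => [|b bs IH] e hb h e0.
  exists 0%V; split; first exact: lsub0 (proj1 lL).
  by rewrite nrm0 bexp0 /= subrr nrm0; lra.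
rewrite /= in h; have b0 := nrm_ge0 b; have e1 := exp_pos (nrm b).
have [|||c [lc [nc ec1]]] := IH (e / 2 / exp (nrm b)); last first.
- have [|||c' [l' [n' e']]] := @euler c b (e / 2) lc; first by apply: hb; rewrite inE eqxx.
  + lra.
  + lra.
  exists c'; split=> //; split; first by rewrite /=; lra.
  have -> : (bexp c' - bprod (b :: bs) = (bexp c' - bexp b * bexp c) + bexp b * (bexp c - bprod bs))%V by rewrite /=; bvec.
  via (nrmD _ _).
  have : nrm (bexp b * (bexp c - bprod bs))%V <= exp (nrm b) * (e / 2 / exp (nrm b)).
    by apply: bnM_le => //; exact: nrm_bexp.
  have -> : exp (nrm b) * (e / 2 / exp (nrm b)) = e / 2 by rfield; lra.
  by move: e'; vlra.
- by apply: Rdiv_lt_0_compat; lra.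
- by lra.
- by move=> x hx; apply: hb; rewrite inE hx orbT.
Qed.
Hypotheses (kL : forall a, L a -> cpt a) (qL : forall a, L a -> qn a).
Lemma cpt_bprod bs : (forall b, b \in bs -> L b) -> cpt (bprod bs - 1)%V.
Proof.
elim: bs => [|b bs IH] hb; first by rewrite subrr; exact: cpt0.
have -> : (bprod (b :: bs) - 1 = (bexp b - 1) * bprod bs + (bprod bs - 1))%V by rewrite /=; bvec.
apply: cptD; last by apply: IH => x hx; apply: hb; rewrite inE hx orbT.
by apply: cptMr; apply: cpt_bexp; apply: kL; apply: hb; rewrite inE eqxx.
Qed.
Lemma entire_bprod bs : entire (fun t => bprod [seq (t *: b)%V | b <- bs]).
Proof. by elim: bs => [|b IH]; [exact: entire_cst|apply: entireM; exact: entire_bexp]. Qed.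
(* For small parameters Euler's method approximates the product by exponentials of elements of [L]. *)
Lemma qn_bprod bs : (forall b, b \in bs -> L b) -> qn (bprod bs - 1)%V.
Proof.
move=> hb; pose f (t : C) := (bprod [seq (t *: b)%V | b <- bs] - 1)%V.
have hf : entire f by apply: entireD (entire_bprod bs) (entire_cst _).
have nZ t : nsum [seq (t *: b)%V | b <- bs] = Cmod t * nsum bs.
  by elim: (bs) => [|b IH] /=; rewrite ?nrmZ; lra.
have n0 := nsum_ge0 bs.
have -> : bprod bs = bprod [seq (1%V *: b)%V | b <- bs] by elim: (bs) => [|b l IH] //=; rewrite scale1r -IH.
apply: (qn_entire (r := / (8 * nsum bs + 1)) _ hf); first pos.
move=> t ht; rewrite /f; set bt := map _ _.
have hbt b : b \in bt -> L b.
  by move=> /mapP [x /hb hx ->]; apply: lsubZ (proj1 lL) _.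
have small : 2 * nsum bt <= / 4.
  rewrite nZ; have : (8 * nsum bs + 1) / (8 * nsum bs + 1) = 1 by rfield; lra.
  nra.
have [c hc] : exists c : nat -> BL X, forall n, L (c n) /\ nrm (bexp (c n) - bprod bt)%V <= / INR n.+1.
  have h n : exists c, L c /\ nrm (bexp c - bprod bt)%V <= / INR n.+1.
    by have [c [l1 []]] := euler_prod hbt small (inv_pos n); exists c.
  by exists (fun n => sval (cid (h n))) => n; exact: (svalP (cid (h n))).
apply: (qn_lim (u := fun n => (bexp (c n) - 1)%V)); first exact: cpt_bprod.
  apply: (cvg_dom (r := fun n => / INR n.+1)) => [n|]; last exact: archi_inv.
  have -> : (bexp (c n) - 1 - (bprod bt - 1) = bexp (c n) - bprod bt)%V by vec.
  exact: (proj2 (hc n)).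
move=> e e0; exists 0%N => n; have [D []] := qn_bound (qn_bexp (qL (proj1 (hc n)))) e0.
by exists D.
Qed.
End Euler.
Lemma lie_cl X (L : BL X -> Prop) : lie L -> lie (cl L).
Proof.
move=> [l1 l2]; split; first exact: (proj1 (@cl_csub (BB X) _ l1)).
move=> a b /cl_seq [u [hu cu]] /cl_seq [v [hv cv]].
have := cvgB (bcvgM cu cv) (bcvgM cv cu); apply: cvg_cl => n.
by apply: cl_incl; mono.
Qed.
Lemma cpt_cl X (L : BL X -> Prop) : (forall a, L a -> cpt a) -> forall a, cl L a -> cpt a.
Proof. by move=> h a /cl_seq [u [hu cu]]; apply: cpt_lim; mono. Qed.
Lemma qn_cl X (L : BL X -> Prop) : (forall a, L a -> cpt a) -> (forall a, L a -> qn a) ->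
  forall a, cl L a -> qn a.
Proof.
move=> k q a ha; have [u [hu cu]] := cl_seq ha; apply: (qn_lim (cpt_cl k ha) cu) => e e0.
by exists 0%N => n; have [D []] := qn_bound (q _ (hu n)) e0; exists D.
Qed.
(** * Irreducible families *)
Section Alg.
Variable X : CBanach.
Implicit Types (M : BL X -> Prop) (u v a T K : BL X) (x y z : X).
Inductive alg M : BL X -> Prop :=
| alg_in a : M a -> alg M a
| alg0 : alg M 0%V
| algD u v : alg M u -> alg M v -> alg M (u + v)%V
| algZ c u : alg M u -> alg M (c *: u)%V
| algM u v : alg M u -> alg M v -> alg M (u * v)%V.
Definition irred M := forall S, invs M S -> (forall x, S x -> x = 0%V) \/ (forall x, S x).
Lemma alg_inv M S u x : invs M S -> alg M u -> S x -> S (u x).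
Proof.
move=> [cS hS] hu; elim: hu x => [|x|v w _ h1 _ h2 x|c v _ h x|v w _ h1 _ x] hx.
mono.
exact: lsub0 (proj1 cS).
by apply: lsubD (proj1 cS) _ _; auto.
by apply: lsubZ (proj1 cS) _; auto.
by rewrite blME; auto.
Qed.
Lemma alg_mono M M' u : (forall a, M a -> M' a) -> alg M u -> alg M' u.
Proof. by move=> h; elim=> *; [apply: alg_in; auto|exact: alg0|exact: algD|exact: algZ|exact: algM]. Qed.
Lemma alg_triv M u : (forall a, M a -> a = 0%V) -> alg M u -> u = 0%V.
Proof.
move=> h; elim=> // [v w _ -> _ ->|c v _ ->|v w _ -> _ ->]; by rewrite ?addr0 ?scaler0 ?mulr0.
Qed.
Lemma alg_fin M u : alg M u -> exists l : seq (BL X), (forall a, a \in l -> M a) /\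
  alg (fun a => a \in l) u.
Proof.
have cat l l' v : alg (fun a => a \in l) v -> alg (fun a => a \in l ++ l') v.
  by apply: alg_mono => a h; rewrite mem_cat h.
have cat' l l' v : alg (fun a => a \in l) v -> alg (fun a => a \in l' ++ l) v.
  by apply: alg_mono => a h; rewrite mem_cat h orbT.
elim=> [a ha||v w _ [l [h1 h2]] _ [k [h3 h4]]|c v _ [l []]|v w _ [l [h1 h2]] _ [k [h3 h4]]].
- exists [:: a]; split=> [b|]; first by rewrite inE => /eqP ->.
  by apply: alg_in; rewrite inE.
exists [::]; split=> //; exact: alg0.
exists (l ++ k); split=> [a|]; first by rewrite mem_cat => /orP [/h1|/h3].
  by apply: algD; mono.
by exists l; split=> //; apply: algZ.
exists (l ++ k); split=> [a|]; first by rewrite mem_cat => /orP [/h1|/h3].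
  by apply: algM; mono.
Qed.
Lemma alg_fins M (us : seq (BL X)) : (forall u, u \in us -> alg M u) ->
  exists l : seq (BL X), (forall a, a \in l -> M a) /\
  forall u, u \in us -> alg (fun a => a \in l) u.
Proof.
elim: us => [|u us IH] h; first by exists [::].
have [|l [h1 h2]] := IH; first by move=> v hv; apply: h; rewrite inE hv orbT.
have [|k [h3 h4]] := @alg_fin M u; first by apply: h; rewrite inE eqxx.
exists (l ++ k); split=> v; first by rewrite mem_cat => /orP [/h1|/h3].
rewrite inE => /orP [/eqP ->|/h2 hv]; first by apply: alg_mono h4 => a ha; rewrite mem_cat ha orbT.
by apply: alg_mono hv => a ha; rewrite mem_cat ha.
Qed.
Lemma orbit_csub M x : csub (cl (fun z => exists u, alg M u /\ z = u x)).
Proof.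
apply: cl_csub; split; first by exists 0%V; split; [exact: alg0|].
split=> [y z [u [hu ->]] [v [hv ->]]|c y [u [hu ->]]].
  by exists (u + v)%V; split; [exact: algD|].
by exists (c *: u)%V; split; [exact: algZ|].
Qed.
(** The closure of the orbit is invariant. As [alg] has no unit, the orbit might be zero; but then
    the line of [x] would be invariant, hence everything, and [K] would vanish. *)
Lemma alg_dense M K x : irred M -> M K -> K <> 0%V -> x <> 0%V ->
  forall y, cl (fun z => exists u, alg M u /\ z = u x) y.
Proof.
move=> hI hK K0 x0; have iO : invs M (cl (fun z => exists u, alg M u /\ z = u x)).
  split; first exact: orbit_csub.
  move=> a ha; apply: cl_pres => y [u [hu ->]]; exists (a * u)%V; split => //.
  by apply: algM => //; exact: alg_in.
have [h|//] := hI _ iO.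
have ax a : M a -> a x = 0%V by move=> ha; apply: h; apply: cl_incl; exists a; split=> //; exact: alg_in.
have iS : invs M (span [:: x]).
  split; first exact: span_csub.
  by move=> a ha y [c [z [-> ->]]]; rewrite addr0 blZ ax // scaler0; exact: lsub0 (span_lsub _).
have [h'|h'] := hI _ iS; first by case: x0; apply: h'; apply: span_in; rewrite inE.
exfalso; apply: K0; apply: BLext => y; have [c [z [-> ->]]] := h' y.
by rewrite addr0 blZ ax // scaler0.
Qed.
Lemma alg_zero M K T : irred M -> M K -> K <> 0%V -> T <> 0%V ->
  (forall u, alg M u -> T * u * T = 0)%V -> False.
Proof.
move=> hI hK K0 T0 h; have [x hx] : exists x, T x <> 0%V.
  by apply: contrapT => hn; apply: T0; apply: BLext => x; apply: contrapT => hx; apply: hn; exists x.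
apply: (hx); apply: (cl_sub (W := fun y => T y = 0%V) _ _ (alg_dense hI hK K0 hx x)).
  exact: csub_preB (csub0 X).
by move=> y [u [hu ->]]; have := congr1 (fun S : BL X => S x) (h u hu).
Qed.
(* Hilden's argument: finitely many [u K] send a ball away from [0] into itself, piecewise. *)
Lemma hilden M K : irred M -> M K -> K <> 0%V -> cpt K -> exists us : seq (BL X),
  (forall v, v \in us -> exists u, alg M u /\ v = (u * K)%V) /\
  RR us (fun=> True) (fun x => x = 0%V).
Proof.
move=> hI hK K0 cK; have nK := nrm_gt0 (x := (K : BB X)) K0.
have [x0 hx0] : exists x0, 2 * nrm K <= nrm (K x0).
  have [x []] := @bn_wit X K (nrm K / 2) ltac:(lra).
  by exists (rc 4 *: x)%V; rewrite blZ nrmZ Cmod_rc; lra.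
have x02 : 2 <= nrm x0 by have := bnle K x0; nra.
have low y : nrm (y - x0) <= 1 -> nrm K <= nrm (K y).
  have := nrm_le (K x0) (K y); rewrite nrmC; have := blip K y x0; nra.
pose S z := exists y, nrm (y - x0) <= 1 /\ z = K y.
have tS : tb S.
  apply: tb_mono (cpt_ball (nrm x0 + 1) cK) => z [y []]; exists y; split=> //.
  by have := nrm_le y x0; lra.
pose good A := exists us : seq (BL X), (forall u, u \in us -> alg M u) /\
  forall z, S z -> A z -> exists u, u \in us /\ nrm (u z - x0) <= 1.
have [us [us1 us2]] : good S.
  apply: contrapT => hn; have [|||y hy] := tb_cluster tS _ _ _ hn.
  move=> A B h [us []]; exists us; mono.
  move=> A B [us [h1 h2]] [vs [h3 h4]]; exists (us ++ vs).
    split=> [u|z hz]; first by rewrite mem_cat => /orP [/h1|/h3].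
    by case=> [/(h2 z hz)|/(h4 z hz)] [u [hu h]]; exists u; rewrite mem_cat hu ?orbT.
  by exists [::].
  have [h|h] := Rlt_le_dec (nrm y) (nrm K).
    apply: (hy (nrm K - nrm y)); first lra.
    exists [::]; split=> // z [v [hv ev]]; have := low v; rewrite -ev.
    by have := nrm_le z y; lra.
  have y0 : y <> 0%V by move=> e; rewrite e nrm0 in h; lra.
  have [_ [[u [hu ->]] h1]] := alg_dense hI hK K0 y0 x0 (ltac:(lra) : 0 < / 2).
  apply: (hy (/ (2 * (nrm u + 1)))); first by apply: Rinv_0_lt_compat; have := nrm_ge0 (u : BB X); lra.
  exists [:: u]; split=> [v|z hz [_ hzy]]; first by rewrite inE => /eqP ->.
  exists u; split; first by rewrite inE.
  have h2 := nrm_tri (u z) (u y) x0; have h3 := blip u z y; rewrite (nrmC (u y)) in h2.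
  have u0 : 0 <= nrm u := nrm_ge0 _.
  have e1 : (nrm u + 1) / (2 * (nrm u + 1)) = / 2 by rfield; lra.
  have h4 : nrm u * nrm (z - y)%V <= (nrm u + 1) * / (2 * (nrm u + 1)) by mono.
  lra.
exists [seq (u * K)%V | u <- us]; split.
  by move=> _ /mapP [u /us1 hu ->]; exists u.
have hw n : exists w, word [seq (u * K)%V | u <- us] n w /\ nrm (w x0 - x0) <= 1.
  elim: n => [|n [w [hw h]]]; first by exists 1%V; split=> //; rewrite subrr nrm0; lra.
  have [||u []] := us2 (K (w x0)); try by exists (w x0).
  exists ((u * K) * w)%V; split => //.
  by exists (u * K)%V, w; split; [apply: map_f|].
apply: (RRa (c := / nrm x0)) => //.
exact: csub0.
by move=> a _ x ->; rewrite bl0.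
pos.
move=> n; have [w []] := hw n.+1; exists w; split=> //.
exists (rc (/ nrm x0) *: x0)%V; split=> //; split; first by apply: nrm_unscale; lra.
move=> _ ->; rewrite subr0 blZ nrmZ Cmod_rc; last pos.
have := nrm_le x0 (w x0); rewrite nrmC => h3; have i0 : 0 < / nrm x0 by pos.
have : 1 <= nrm (w x0) by lra.
nra.
Qed.
End Alg.

Section TbOps.
Variable X : CBanach.
Lemma tb_bigU (Y : CBanach) (T : eqType) (s : seq T) (F : T -> Y -> Prop) :
  (forall i, i \in s -> tb (F i)) -> tb (fun x => exists i, i \in s /\ F i x).
Proof.
elim: s => [|i s IH] h; first by exists [::] => x [i []].
apply: tb_mono (tb_or (h i _) (IH _)); last 2 first.
by rewrite inE eqxx.
by move=> j hj; apply: h; rewrite inE hj orbT.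
move=> x [j [hj hx]]; move: hj; rewrite inE => /orP [/eqP e|]; first by left; rewrite -e.
by right; exists j.
Qed.
Lemma tb_mul (A B : BL X -> Prop) : tb A -> tb B ->
  tb (fun c => exists a b, A a /\ B b /\ c = (a * b)%V).
Proof.
move=> hA hB; have [MA [MA0 hMA]] := tb_bounded hA; have [MB [MB0 hMB]] := tb_bounded hB.
apply: (@tb_approx (BB X)) => e e0; have e1 : 0 < e / (2 * (MA + MB + 1)) by pos.
have [l [l1 l2]] := tb_net hA e1; have [k [k1 k2]] := tb_net hB e1.
exists (fun c => c \in [seq (a * b)%V | a <- l, b <- k]); split.
  exists [seq (a * b)%V | a <- l, b <- k] => x; exists x => //.
  by rewrite subrr nrm0.
move=> _ [a [b [ha [hb ->]]]]; have [a' da] := l2 a ha; have [b' db] := k2 b hb.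
exists (a' * b')%V; split; first exact: allpairs_f.
have -> : ((a : BL X) * b - (a' : BL X) * b' = (a - a') * b + a' * (b - b'))%V by bvec.
apply: Rle_lt_trans (nrmD _ _) _.
have h1 : nrm ((a - a') * b)%V <= e / (2 * (MA + MB + 1)) * MB.
  by apply: bnM_le; mono.
have h2 : nrm ((a' : BL X) * (b - b'))%V <= MA * (e / (2 * (MA + MB + 1))).
  via (bnM _ _).
  mono.
have e2 : (MA + MB + 1) * (e / (2 * (MA + MB + 1))) = e / 2 by rfield; lra.
lra; lra.
Qed.
(** Finite nets for [A] and [B] reduce this to finitely many instances of [vala]. *)
Lemma tb_sandwich (A B : BL X -> Prop) D : tb A -> tb B -> 0 <= D ->
  (forall a, A a -> cpt a) -> (forall a, B a -> cpt a) ->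
  tb (fun c => exists a h b, A a /\ B b /\ nrm (h : BL X) <= D /\ c = (a * h * b)%V).
Proof.
move=> hA hB D0 cA cB; have [MA [MA0 hMA]] := tb_bounded hA; have [MB [MB0 hMB]] := tb_bounded hB.
apply: (@tb_approx (BB X)) => e e0.
have p1 : 0 <= D * (MA + MB) by pos.
have e1 : 0 < e / (D * (MA + MB) + 1) by pos.
have [l [l1 l2]] := tb_net hA e1; have [k [k1 k2]] := tb_net hB e1.
exists (fun c => exists a, a \in l /\ exists b, b \in k /\
   exists T : BL X, nrm T <= D /\ c = (a * T * b)%V); split.
  apply: tb_bigU => a ha; apply: tb_bigU => b hb; apply: vala; mono.
move=> _ [a [h [b [ha [hb [hD ->]]]]]]; have [a' la da] := l2 a ha; have [b' kb db] := k2 b hb.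
exists (a' * h * b')%V; split; first by exists a'; split=> //; exists b'; split=> //; exists h.
have -> : (a * h * b - (a' : BL X) * h * b' = (a - a') * h * b + a' * h * (b - b'))%V by bvec.
apply: Rle_lt_trans (nrmD _ _) _.
have b3 (u v w : BL X) x y z : nrm u <= x -> nrm v <= y -> nrm w <= z -> nrm (u * v * w)%V <= x * y * z.
  move=> hx hy hz; apply: bnM_le => //.
  by apply: bnM_le.
have h1 := b3 _ _ _ _ _ _ (Rlt_le _ _ da) hD (hMB _ hb).
have h2 := b3 _ _ _ _ _ _ (hMA _ (l1 _ la)) hD (Rlt_le _ _ db).
apply: Rle_lt_trans (Rplus_le_compat _ _ _ _ h1 h2) _.
have e2 : (D * (MA + MB) + 1) * (e / (D * (MA + MB) + 1)) = e by rfield; lra.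
nra; nra.
Qed.
(** The length [k] is found before the sequence; later it determines the length of the word whose
    prefixes are compared. *)
Lemma tb_pigeon (Y : CBanach) (S : Y -> Prop) e : tb S -> 0 < e -> exists k, forall u : nat -> Y,
  (forall i, (i <= k)%N -> S (u i)) -> exists i j, (i < j)%N /\ (j <= k)%N /\ nrm (u i - u j) < e.
Proof.
move=> hS e0; have [l hl] := hS (e / 2) ltac:(lra); exists (size l) => u hu.
have [f hf] : exists f : nat -> Y, forall i, (i <= size l)%N -> f i \in l /\ nrm (u i - f i) < e / 2.
  have h i : exists y : Y, (i <= size l)%N -> y \in l /\ nrm (u i - y) < e / 2.
    by have [/hu/hl [y h2]|] := boolP (i <= size l)%N; [exists y|exists 0%V].
  by exists (fun i => sval (cid (h i))) => i; exact: (svalP (cid (h i))).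
have [|/uniqPn] := boolP (uniq (mkseq f (size l).+1)).
  move/uniq_leq_size => h; have : (size (mkseq f (size l).+1) <= size l)%N.
    by apply: h => _ /mapP [i hi ->]; rewrite mem_iota in hi; apply: (proj1 (hf i _)).
  by rewrite size_mkseq ltnn.
move=> /(_ 0%V) [i [j [ij]]]; rewrite size_mkseq => hj; rewrite !nth_mkseq //; last lia.
move=> e1; exists i, j; split=> //; split => //.
have [_ h1] := hf i ltac:(lia); have [] := hf j ltac:(lia).
by have := nrm_tri (u i) (f i) (u j); rewrite e1 in h1 *; rewrite (nrmC (f j)); lra.
Qed.
End TbOps.
(** * Irreducible Lie algebras of compact quasinilpotent operators *)
Lemma expM a n : exp a ^ n = exp (INR n * a).
Proof. elim: n => [|n IH]; first by rewrite Rmult_0_l exp_0. by rewrite S_INR Rmult_plus_distr_r Rmult_1_l exp_plus -IH /=; lra. Qed.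
Lemma expW x y : x <= y -> exp x <= exp y.
Proof. by case=> [|->]; [left; exact: exp_increasing|lra]. Qed.
Lemma argmax (f : nat -> R) C e : 0 < e -> (forall n, f n <= C - e * INR n) -> exists N, forall n, f n <= f N.
Proof.
move=> e0 h.
have fin m : exists N, forall n, (n <= m)%N -> f n <= f N.
  elim: m => [|m [N hN]]; first by exists 0%N => n; rewrite leqn0 => /eqP ->; lra.
  have [] := Rle_lt_dec (f m.+1) (f N).
    by exists N => n; rewrite leq_eqVlt => /orP [/eqP ->|/hN].
  exists m.+1 => n; rewrite leq_eqVlt => /orP [/eqP ->|/hN]; lra.
have [m hm] : exists m, C - f 0%N < e * INR m.
  have p := Rabs_pos (C - f 0%N); have [m hm] := @archi_inv (e / (Rabs (C - f 0%N) + 1)) ltac:(pos).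
  exists m.+1; have := hm m (leqnn m) => h1; have n0 : 0 < INR m.+1 by apply: lt_0_INR; lia.
  have h2 : / INR m.+1 * (INR m.+1 * (Rabs (C - f 0%N) + 1)) < e / (Rabs (C - f 0%N) + 1) * (INR m.+1 * (Rabs (C - f 0%N) + 1)).
    by apply: Rmult_lt_compat_r; pos.
  rewrite -Rmult_assoc Rinv_l in h2; last lra.
  have e1 : e / (Rabs (C - f 0%N) + 1) * (INR m.+1 * (Rabs (C - f 0%N) + 1)) = e * INR m.+1 by rfield; lra.
  have := Rle_abs (C - f 0%N); lra.
have [N hN] := fin m; exists N => n; case: (leqP n m) => [/hN //|hn].
apply: Rle_trans (hN 0%N (leq0n m)); have := h n.
have : INR m <= INR n by apply: le_INR; lia.
nra.
Qed.
Section Core.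
Variables (X : CBanach) (L : BL X -> Prop) (M : seq (BL X)).
Hypotheses (cL : csub L) (lL : lie L) (kL : forall a, L a -> cpt a) (qL : forall a, L a -> qn a)
  (ML : forall a, a \in M -> L a) (M0 : (0%V : BL X) \in M).
Implicit Types (g h u v T : BL X).
Let inM a := a \in M.
Definition Lam R (b : BL X) := exists t a, Cmod t <= R /\ a \in M /\ b = (t *: a)%V.
(** Words in exponentials replace words in [M]: by [cpt_bprod] and [qn_bprod] they differ from [1]
    by compact quasinilpotent operators, whereas nothing is known about products of elements of
    [L]. *)
Definition lw R n g := exists bs, size bs = n /\ (forall b, b \in bs -> Lam R b) /\ g = bprod bs.
Lemma bprod_cat (s t : seq (BL X)) : bprod (s ++ t) = (bprod s * bprod t)%V.
Proof. by elim: s => [|b s IH] /=; rewrite ?mul1r // IH mulrA. Qed.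
Lemma lw_cat R m n g h : lw R m g -> lw R n h -> lw R (m + n)%N (g * h)%V.
Proof.
move=> [s [<- [h1 ->]]] [t [<- [h2 ->]]]; exists (s ++ t); rewrite size_cat bprod_cat; split=> //; split=> // b.
by rewrite mem_cat => /orP [/h1|/h2].
Qed.
Lemma lw_split R m n g : lw R (m + n)%N g -> exists u v, lw R m u /\ lw R n v /\ g = (u * v)%V.
Proof.
move=> [s [hs [h1 ->]]]; exists (bprod (take m s)), (bprod (drop m s)); rewrite -bprod_cat cat_take_drop.
split; [exists (take m s)|split; [exists (drop m s)|]]; rewrite ?size_drop ?size_takel ?hs ?addKn ?leq_addr //.
  by split=> //; split=> // b /mem_take /h1.
by split=> //; split=> // b /mem_drop /h1.
Qed.
(** Because [0] is a letter, [exp 0] pads words to any greater length. *)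
Lemma lw1 R n : 0 <= R -> lw R n 1%V.
Proof.
exists (nseq n 0%V); rewrite size_nseq; split=> //; split=> [b /nseqP []|].
  by exists 0%V, 0%V; rewrite Cmod0 scale0r.
by elim: n => //= n; rewrite bexp0 mul1r.
Qed.
Lemma lw_pad R m n g : 0 <= R -> lw R m g -> lw R (m + n)%N g.
Proof. by move=> R0 hg; have := lw_cat hg (lw1 n R0); rewrite mulr1. Qed.
Lemma lw_bound R : 0 <= R -> exists B, 1 <= B /\ forall n g, lw R n g -> nrm g <= B ^ n.
Proof.
have [B [B1 [hB _]]] := word_bound M; exists (exp (R * B)); split.
  have h0 : 0 <= R * B by pos.
  by have := exp_ineq1_le (R * B); lra.
move=> n _ [bs [<- [hb ->]]]; elim: bs hb => [|b bs IH] hb; first exact: bn1.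
apply: bnM_le; try pos; last first.
  by apply: IH => c hc; apply: hb; rewrite inE hc orbT.
have [|t [a [ht [ha ->]]]] := hb b; first by rewrite inE eqxx.
via (nrm_bexp _); rewrite nrmZ.
have h : Cmod t * nrm a <= R * B by mono.
exact: expW.
Qed.
Lemma lw_tb R n : 0 <= R -> tb (lw R n).
Proof.
move=> R0; elim: n => [|n IH].
  by apply: tb_mono (@tb1 (BB X) 1%V) => g [bs [/eqP]]; rewrite size_eq0 => /eqP -> [].
apply: tb_mono (tb_mul (tb_bigU (s := M) (F := fun a b => exists t, Cmod t <= R /\ b = bexp (t *: a)%V) _) IH).
  move=> g [[|b bs] [] //= [hs] [hb ->]]; have [|t [a [ht [ha ->]]]] := hb b; first by rewrite inE eqxx.
  exists (bexp (t *: a)%V), (bprod bs); split; first by exists a; split=> //; exists t.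
  by split=> //; exists bs; split=> //; split=> // c hc; apply: hb; rewrite inE hc orbT.
by move=> a _; exact: entire_tb (entire_bexp a).
Qed.
(* Averaging [A exp (t a) B] over [|t| = R] recovers [A a B] at the cost of a factor [1 / R]. *)
Lemma rep u : alg inM u -> exists C d, 0 <= C /\ forall R A B s, 1 <= R ->
  (forall g, lw R d g -> nrm (A * g * B)%V <= s) -> nrm (A * u * B)%V <= C / R * s.
Proof.
have pad R d d' A B s : 1 <= R -> (forall g, lw R (d + d')%N g -> nrm (A * g * B)%V <= s) ->
  (forall g, lw R d g -> nrm (A * g * B)%V <= s) /\ forall g, lw R d' g -> nrm (A * g * B)%V <= s.
  move=> R1 h; split=> g hg; apply: h; last rewrite addnC; apply: lw_pad => //; lra.
have s0 R d A B s : 1 <= R -> (forall g, lw R d g -> nrm (A * g * B)%V <= s) -> 0 <= s.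
  by move=> R1 h; apply: Rle_trans (nrm_ge0 _) (h _ (lw1 d _)); lra.
elim=> [||v w _ [C [d [C0 h]]] _ [C' [d' [C0' h']]]|c v _ [C [d [C0 h]]]|v w _ [C [d [C0 h]]] _ [C' [d' [C0' h']]]].
exists 1, 1%N; split; first lra; move=> R A B s R1 hs.
  have ep : ent (fun i => A * ec a i * B)%V.
    move=> r r0; have [K hK] := ec_ent a r0; exists (nrm A * nrm B * K) => n.
    mid (nrm A * nrm B * rsum (fun i => r ^ i * nrm (ec a i)) n); last first.
      mono.
    rewrite -rsumZ; apply: rsum_le => i _.
    have -> : nrm A * nrm B * (r ^ i * nrm (ec a i)) = r ^ i * (nrm A * nrm (ec a i) * nrm B) by lra.
    apply: Rmult_le_compat_l; first pos.
    apply: bnM_le => //; exact: bnM.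
  have := @cauchy_est _ _ R s 1 _ ep; rewrite pow_1 /ec invr1 scale1r => h.
  have {}h : R * nrm (A * a * B)%V <= s.
    apply: h; first lra; move=> t ht.
    have e : pser (fun i => A * ec a i * B)%V t = (A * bexp (t *: a) * B)%V.
      rewrite bexpZ; have [||_ <-] := @bl_ser (BB X) (BB X) (fun U => (A * U * B)%V) _ (nrm A * nrm B) _ _ (ent_summ t (ec_ent a)).
      by move=> U V; rewrite mulrDr mulrDl.
      move=> U; have -> : nrm A * nrm B * nrm U = nrm A * nrm U * nrm B by lra.
        by apply: bnM_le => //; exact: bnM.
      by congr ser; apply/funext => i; rewrite (scalerAl (t ^+ i)%V (A * ec a i)%V B) (scalerAr (t ^+ i)).
    rewrite e; apply: hs; exists [:: (t *: a)%V]; split=> //; split=> [b|]; last by rewrite /= mulr1.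
    by rewrite inE => /eqP; exists t, a; split=> //; lra.
  by apply: (Rmult_le_reg_l R); [lra|via h; right; rfield; lra].
exists 0, 0%N; split=> [|R A B s]; rewrite ?mulr0 ?mul0r ?nrm0; lra.
exists (C + C'), (d + d')%N; split=> [|R A B s R1 /pad [//|h1 h2]]; first lra.
  rewrite mulrDr mulrDl; via (nrmD _ _).
  by have := h _ _ _ _ R1 h1; have := h' _ _ _ _ R1 h2; lra.
exists (Cmod c * C), d; split=> [|R A B s R1 hs]; first pos.
  rewrite -scalerAr -scalerAl nrmZ; have := h _ _ _ _ R1 hs.
  rewrite !Rmult_assoc; mono.
exists (C * C'), (d + d')%N; split=> [|R A B s R1 hs]; first pos.
  have hA : nrm (A * v * (w * B))%V <= C / R * (C' / R * s).
    apply: h => // g hg; rewrite mulrA; apply: h' => // k hk.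
    by rewrite -(mulrA A); apply: hs; exact: lw_cat.
  via hA; have sp := s0 _ _ _ _ _ R1 hs.
  have q1 : / R <= 1 by rewrite -Rinv_1; apply: Rinv_le_contravar; lra.
  have q0 : 0 < / R by pos.
  rewrite /Rdiv; move: (/ R) q1 q0 => q q0 hh.
  have -> : C * q * (C' * q * s) = C * C' * s * q * q by lra.
  have -> : C * C' * q * s = C * C' * s * q by lra.
  have : 0 <= C * C' * s * q by pos.
  move: (_ q) => z; nra.
Qed.
Section Growth.
Variables (R la : R) (l : nat -> RbaseSymbolsImpl.R).
Hypotheses (R1 : 1 <= R) (la0 : 0 < la) (l1 : forall n g, lw R n g -> nrm g <= exp (l n))
  (l2 : forall n, exists g, lw R n g /\ exp (l n) <= 2 * nrm g) (l3 : forall n, 0 <= l n)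
  (l4 : forall n, la * INR n <= l n)
  (l5 : forall e, 0 < e -> exists C, forall n, l n <= la * INR n + e * INR n + C).
Let q := exp (- la).
Let qP : 0 < q /\ q < 1.
Proof. by split; [exact: exp_pos|rewrite -exp_0; apply: exp_increasing; lra]. Qed.
Let qE n : q ^ n = exp (- (la * INR n)).
Proof. by rewrite expM; congr exp; lra. Qed.
Let R0 : 0 <= R. Proof. lra. Qed.
Let cM b : Lam R b -> L b.
Proof. by move=> [t [a [_ [/ML ha ->]]]]; apply: lsubZ (proj1 lL) _. Qed.
Definition WT D T := exists x N g, 0 <= x /\ lw R N g /\
  (forall k, (k <= N)%N -> x * exp (l k) <= D * q ^ (N - k)) /\ T = (rc x *: g)%V.
(** Write the word as [a * h * b] with [a] and [b] of length [J]. In [(a - 1) * h * (b - 1)] the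
    outer factors run over totally bounded sets of compact operators, so [tb_sandwich] applies. The
    three correction terms are shorter words, each at most [D * q ^ J] after rescaling. *)
Lemma WT_tb D : 0 <= D -> tb (WT D).
Proof.
move=> D0; apply: (@tb_approx (BB X)) => e e0; have [q0 q1] := qP.
have [J hJ] := @pow_small q (e / (3 * D + 1)) ltac:(lra) q1 ltac:(by apply: Rdiv_lt_0_compat; lra).
have {hJ} := hJ J (leqnn J) => hJ.
pose S1 (a : BL X) := exists g, lw R J g /\ a = (g - 1)%V.
have tS : tb S1 by apply: (@tb_lip (BB X) (BB X) _ 1 _ _ (lw_tb J R0)) => g h; rewrite Rmult_1_l; right; congr nrm; vec.
have cS a : S1 a -> cpt a by move=> [g [[bs [_ [hb ->]]] ->]]; apply: (cpt_bprod kL) => b /hb /cM.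
exists (fun c => (exists a h b, S1 a /\ S1 b /\ nrm (h : BL X) <= D /\ c = (a * h * b)%V) \/
  (exists a b, (exists z : C, Cmod z <= D /\ a = (z *: Id)%V) /\ lw R (J + J) b /\ c = (a * b)%V)); split.
  apply: tb_or; first exact: tb_sandwich.
  by apply: tb_mul (lw_tb _ R0); exact: (@tb_line (BB X)).
move=> _ [x [N [g [x0 [hg [hx ->]]]]]].
case: (leqP (J + J) N) => hN; last first.
  exists (rc x *: g)%V; split; last by rewrite subrr nrm0.
  right; exists (rc x *: Id)%V, g; split; last first.
    split; last by rewrite -scalerAl mul1r.
    by have := lw_pad (J + J - N) R0 hg; rewrite subnKC // ltnW.
  exists (rc x); split=> //; rewrite Cmod_rc //; have := hx 0%N (leq0n _).
  have := exp_ineq1_le (l 0%N); have := l3 0%N; have h1 : q ^ (N - 0) <= 1 ^ (N - 0) by mono.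
  rewrite pow1 in h1; nra.
have eN : N = (J + ((N - (J + J)) + J))%N by lia.
move: (hg); rewrite {1}eN => /lw_split [a [_ [ha [/lw_split [h [b [hh [hb ->]]]] eg]]]]; rewrite eg.
exists ((a - 1) * (rc x *: h) * (b - 1))%V; split.
  left; exists (a - 1)%V, (rc x *: h)%V, (b - 1)%V; split; first by exists a.
  split; first by exists b.
  split=> //; rewrite nrmZ Cmod_rc //; mid (x * exp (l (N - (J + J))%N)).
    mono.
  via (hx _ _); first by lia.
  have h1 : q ^ (N - (N - (J + J))) <= 1 ^ (N - (N - (J + J))) by mono.
  rewrite pow1 in h1; nra.
have -> : (rc x *: (a * (h * b)) - (a - 1) * (rc x *: h) * (b - 1) = rc x *: (a * h) + rc x *: (h * b) - rc x *: h)%V.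
  by rewrite -scalerAr -scalerAl; bvec.
have bd k u : lw R k u -> (k <= N - J)%N -> nrm (rc x *: u)%V <= D * q ^ J.
  move=> hu hk; rewrite nrmZ Cmod_rc //; mid (x * exp (l k)).
    by mono.
  via (hx _ _); first by lia.
  apply: Rmult_le_compat_l => //; have -> : (N - k = J + (N - k - J))%N by lia.
  have h1 : q ^ (N - k - J) <= 1 ^ (N - k - J) by mono.
  have h2 : 0 <= q ^ J by pos.
  rewrite pow_add; rewrite pow1 in h1; nra.
have b1 := bd _ _ (lw_cat ha hh) ltac:(lia); have b2 := bd _ _ (lw_cat hh hb) ltac:(lia).
have b3 := bd _ _ hh ltac:(lia).
apply: Rle_lt_trans (nrmB _ _) _.
have := nrmD (rc x *: (a * h))%V (rc x *: (h * b))%V.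
have e1 : (3 * D + 1) * (e / (3 * D + 1)) = e by rfield; lra.
have : 3 * D * q ^ J < e by nra.
vlra.
Qed.
(** Rescaled words then lie in a totally bounded set. Two prefixes of a nearly maximal word nearly
    agree, so [P] is close to [P * Q] for a long rescaled word [Q]. Limits of such [Q] are compact
    and quasinilpotent, so [1 - T] is invertible and [P] tends to [0]; yet a prefix of a nearly
    maximal word has norm at least [exp (- F) / 2] after rescaling. *)
Lemma bounded_case F : (forall n, l n <= la * INR n + F) -> False.
Proof.
move=> hF; have [q0 q1] := qP; have F0 := exp_pos F.
have WTq n g : lw R n g -> WT (exp F) (rc (q ^ n) *: g)%V.
  move=> hg; exists (q ^ n), n, g; split; first pos.
  split=> //; split=> // k hk; rewrite !qE -!exp_plus minus_INR; last by apply/leP.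
  by apply: expW; have := hF k; lra.
have tW := WT_tb (Rlt_le _ _ F0).
have h k : exists pg : BL X * (nat * BL X), let P := pg.1 in let n := pg.2.1 in let g := pg.2.2 in
    (k < n)%N /\ lw R n g /\ nrm (P - P * (rc (q ^ n) *: g))%V < / INR k.+1 /\ exp (- F) / 2 <= nrm P /\ nrm P <= exp F.
  have [K hK] := tb_pigeon tW (inv_pos k); have [g [[bs [hs [hb eg]]] hg]] := l2 (k.+1 * K).
  pose P i : BL X := (rc (q ^ (k.+1 * i)) *: bprod (take (k.+1 * i) bs))%V.
  have lwt i : (i <= K)%N -> lw R (k.+1 * i) (bprod (take (k.+1 * i) bs)).
    move=> hi; exists (take (k.+1 * i) bs); rewrite size_takel ?hs; last by rewrite leq_pmul2l.
    by split=> //; split=> // b /mem_take /hb.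
  have hP i : (i <= K)%N -> WT (exp F) (P i) by move=> /lwt /WTq.
  have [i [j [ij [jK hij]]]] := hK P hP.
  pose s2 := take (k.+1 * (j - i)) (drop (k.+1 * i) bs).
  have lw2 : lw R (k.+1 * (j - i)) (bprod s2).
    exists s2; rewrite /s2 size_takel ?size_drop ?hs; last by rewrite mulnBr leq_sub2r // leq_pmul2l.
    by split=> //; split=> // b /mem_take /mem_drop /hb.
  exists (P i, ((k.+1 * (j - i))%N, bprod s2)) => /=; split.
    by apply: (leq_trans (ltnSn k)); apply: leq_pmulr; rewrite subn_gt0.
  split=> //; split.
    have -> : (P i * (rc (q ^ (k.+1 * (j - i))) *: bprod s2) = P j)%V; last exact: hij.
    rewrite /P -scalerAl -scalerAr scalerA -rcM -pow_add -bprod_cat /s2 -takeD.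
    by rewrite plusE -mulnDr subnKC // ltnW.
  have [x1 x2] : exists2 r, lw R (k.+1 * K - k.+1 * i) r & g = (bprod (take (k.+1 * i) bs) * r)%V.
    exists (bprod (drop (k.+1 * i) bs)); last by rewrite -bprod_cat cat_take_drop.
    by exists (drop (k.+1 * i) bs); rewrite size_drop hs; split=> //; split=> // b /mem_drop /hb.
  move=> eg2; split; last first.
    have [x [N [g' [x0 [hg' [hx ->]]]]]] := hP i ltac:(lia).
    rewrite nrmZ Cmod_rc //; mid (x * exp (l N)); first mono.
    by have := hx N (leqnn _); rewrite subnn /= Rmult_1_r.
  have := bnM (bprod (take (k.+1 * i) bs)) x1; rewrite -eg2 => h1; have h3 := l1 x2.
  set n := (k.+1 * K)%N in hg x2 h3 *; set m := (k.+1 * i)%N in x2 h3 h1 *.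
  have mn : (m <= n)%N by rewrite /m /n leq_pmul2l //; lia.
  rewrite /P -/m nrmZ Cmod_rc; last pos.
  have n0 := nrm_ge0 (bprod (take m bs)).
  have h4 : exp (l n) <= 2 * (nrm (bprod (take m bs)) * exp (l (n - m)%N)).
    have : nrm (bprod (take m bs)) * nrm x1 <= nrm (bprod (take m bs)) * exp (l (n - m)%N) by pos.
    pos.
  have h5 : exp (la * INR n) <= exp (l n).
    exact: expW.
  have h6 : exp (l (n - m)%N) <= exp (la * INR (n - m)%N + F).
    exact: expW.
  have h7 : exp (la * INR n) <= 2 * (nrm (bprod (take m bs)) * exp (la * INR (n - m)%N + F)).
    pos.
  have e1 : exp (la * INR n) * (q ^ m * exp (- (la * INR (n - m)%N + F))) = exp (- F) * q ^ m * q ^ m * exp (la * INR m) * exp (la * INR m).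
    by rewrite !qE -!exp_plus minus_INR; [congr exp; rring|apply/leP].
  have e2 : exp (la * INR (n - m)%N + F) * exp (- (la * INR (n - m)%N + F)) = 1 by rewrite -exp_plus Rplus_opp_r exp_0.
  have e3 : q ^ m * exp (la * INR m) = 1 by rewrite qE -exp_plus Rplus_opp_l exp_0.
  have p1 : 0 <= q ^ m * exp (- (la * INR (n - m)%N + F)) by pos.
  have := Rmult_le_compat_r _ _ _ p1 h7; rewrite e1.
  have -> : exp (- F) * q ^ m * q ^ m * exp (la * INR m) * exp (la * INR m) = exp (- F) * (q ^ m * exp (la * INR m)) * (q ^ m * exp (la * INR m)) by rring.
  rewrite e3; have -> : 2 * (nrm (bprod (take m bs)) * exp (la * INR (n - m)%N + F)) * (q ^ m * exp (- (la * INR (n - m)%N + F))) =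
    2 * (q ^ m * nrm (bprod (take m bs))) * (exp (la * INR (n - m)%N + F) * exp (- (la * INR (n - m)%N + F))) by rring.
  by rewrite e2; lra.
have [f hf] := choice h; pose Q k : BL X := (rc (q ^ (f k).2.1) *: (f k).2.2)%V.
have [phi [phi1 [T hT]]] : exists phi : nat -> nat, (forall n, (phi n < phi n.+1)%N) /\ exists T, cvg (Q \o phi) T.
  by apply: (tb_subseq tW) => k; have [_ [h1 _]] := hf k; exact: WTq.
have pge := incr_ge phi1.
have qs k : q ^ (f (phi k)).2.1 <= q ^ k.
  have [h1 _] := hf (phi k); have := pge k => h2.
  have -> : ((f (phi k)).2.1 = k + ((f (phi k)).2.1 - k))%N by lia.
  have h3 : q ^ ((f (phi k)).2.1 - k) <= 1 ^ ((f (phi k)).2.1 - k) by mono.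
  by rewrite pow_add; rewrite pow1 in h3; have : 0 <= q ^ k by [pos]; nra.
(* As the lengths tend to infinity, subtracting [1] before rescaling does not change the limit, but
   it makes the approximants compact and quasinilpotent. *)
pose U k : BL X := (rc (q ^ (f (phi k)).2.1) *: ((f (phi k)).2.2 - 1))%V.
have cU : cvg U T.
  have c0 : cvg (fun k => rc (q ^ (f (phi k)).2.1) *: (1 : BL X))%V 0%V.
    apply: (cvg_dom (r := fun k => q ^ k)) => [k|e e0].
      rewrite subr0 nrmZ Cmod_rc; last pos.
      rewrite -[X in _ <= X]Rmult_1_r; apply: Rmult_le_compat (qs k) (@bn1 X); pos.
    by apply: pow_small; lra.
  have := cvgB hT c0; rewrite subr0; apply: cvg_eq => k; by rewrite /U /Q /= scalerBr.
have bsL k : exists bs, (forall b, b \in bs -> L b) /\ (f k).2.2 = bprod bs.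
  by have [_ [[bs [_ [h1 h2]]] _]] := hf k; exists bs; split=> // b /h1 /cM.
have cT : cpt T.
  apply: cpt_lim cU => k; have [bs [h1 h2]] := bsL (phi k); apply: cptZ; rewrite h2; exact: (cpt_bprod kL).
have qT : qn T.
  apply: (qn_lim cT cU) => e e0; exists 0%N => k _; have [bs [h1 h2]] := bsL (phi k).
  have [|D [_ hD]] := @qn_bound _ (U k) _ _ e0; last by exists D.
  by apply: qnZ; rewrite h2; exact: (qn_bprod cL lL kL qL).
have [||S [_ hS]] := @fredholm X T 1%V cT.
- by move/eqP; rewrite oner_eq0.
- move=> v hv; apply: contrapT => v0; have := qn_eig qT hv v0; move/eqP; by rewrite oner_eq0.
rewrite scale1r in hS; have S0 := nrm_ge0 S.
pose kp := exp (- F) / 2; have kp0 : 0 < kp by have := exp_pos (- F); rewrite /kp; lra.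
have [N1 hN1] := hT (kp / (4 * exp F * (nrm S + 1))) ltac:(pos).
have [N2 hN2] := @archi_inv (kp / (4 * (nrm S + 1))) ltac:(by apply: Rdiv_lt_0_compat => //; lra).
pose k := maxn N1 N2; have := hN1 k (leq_maxl _ _); have := hN2 (phi k) (leq_trans (leq_maxr _ _) (pge k)).
have [_ [_ [h3 [h4 h5]]]] := hf (phi k); rewrite /= -/(Q (phi k)) in h3; set P := (f (phi k)).1 in h3 h4 h5.
move=> h1 h2; have e1 : P = ((P - P * Q (phi k) + P * (Q (phi k) - T)) * S)%V.
  have -> : (P - P * Q (phi k) + P * (Q (phi k) - T) = P * (1 - T))%V by bvec.
  by rewrite -mulrA hS mulr1.
have h6 : nrm (P - P * Q (phi k) + P * (Q (phi k) - T))%V <= kp / (4 * (nrm S + 1)) + exp F * (kp / (4 * exp F * (nrm S + 1))).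
  via (nrmD _ _); apply: Rplus_le_compat; first by apply: Rlt_le; apply: Rlt_trans h3 h1.
  by apply: bnM_le; mono.
have h7 : nrm P <= (kp / (4 * (nrm S + 1)) + exp F * (kp / (4 * exp F * (nrm S + 1)))) * nrm S.
  by rewrite {1}e1; apply: bnM_le.
have e2 : kp / (4 * (nrm S + 1)) + exp F * (kp / (4 * exp F * (nrm S + 1))) = kp / 2 * / (nrm S + 1) by rfield; lra.
rewrite e2 in h7; have i0 : 0 < / (nrm S + 1) by pos.
have e3 : (nrm S + 1) * / (nrm S + 1) = 1 by rfield; lra.
have : kp / 2 / (nrm S + 1) * nrm S <= kp / 2 * 1.
  rewrite Rmult_assoc; apply: Rmult_le_compat_l; first lra.
  lra.
rewrite -/kp in h4; lra.
Qed.
Hypothesis h0 : forall T, T <> 0%V -> (forall u, alg inM u -> T * u * T = 0)%V -> False.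
(** The length [N j] maximises [l n - la * INR n - / INR j.+1 * INR n], a quantity that exceeds any
    bound as [j] grows. Maximality puts the normalised words into [WT 2], where they cluster at some
    [T <> 0], and makes the norm of [g j * u * g j] negligible against the square of that of [g j].
    Hence [T * u * T = 0] for all words [u]. *)
Lemma unbounded_case : (forall F, exists n, la * INR n + F < l n) -> False.
Proof.
move=> hU; have [q0 q1] := qP.
have h j : exists Ng : nat * BL X, lw R Ng.1 Ng.2 /\ exp (l Ng.1) <= 2 * nrm Ng.2 /\
    forall n, l n - la * INR n - / INR j.+1 * INR n <= l Ng.1 - la * INR Ng.1 - / INR j.+1 * INR Ng.1.
  have j0 := inv_pos j; have [C hC] := @l5 (/ INR j.+1 / 2) ltac:(lra).
  have [|N hN] := @argmax (fun n => l n - la * INR n - / INR j.+1 * INR n) C (/ INR j.+1 / 2) ltac:(lra).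
    by move=> n; have := hC n; pos.
  by have [g [h1 h2]] := l2 N; exists (N, g).
have [f hf] := choice h; pose N j := (f j).1; pose g j := (f j).2.
have gpos j : 0 < nrm (g j) by have [_ [h1 _]] := hf j; have := exp_pos (l (f j).1); rewrite /g; lra.
pose V j : BL X := (rc (/ nrm (g j)) *: g j)%V.
have ig j : / nrm (g j) <= 2 * exp (- l (N j)).
  have [_ [h1 _]] := hf j; have e1 : exp (- l (N j)) * exp (l (N j)) = 1 by rewrite -exp_plus Rplus_opp_l exp_0.
  have p1 := exp_pos (- l (N j)); have p2 := gpos j; apply: (Rmult_le_reg_r (nrm (g j))) => //.
  rewrite Rinv_l; last lra.
  rewrite -/(N j) -/(g j) in h1; nra.
have ip j : 0 <= / nrm (g j) by pos.
have hV j : WT 2 (V j).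
  exists (/ nrm (g j)), (N j), (g j); split=> //; have [h1 [h2 h3]] := hf j; split=> //; split=> // k hk.
  mid (2 * exp (- l (N j)) * exp (l k)); first mono.
  rewrite qE Rmult_assoc -exp_plus minus_INR; last by apply/leP.
  apply: Rmult_le_compat_l; first lra.
  have hh : - l (N j) + l k <= - (la * (INR (N j) - INR k)).
    have := h3 k; rewrite -/(N j); have := inv_pos j; have : INR k <= INR (N j) by apply: le_INR; apply/leP.
    nra.
  exact: expW.
have [phi [phi1 [T hT]]] := tb_subseq (WT_tb (ltac:(lra) : 0 <= 2)) hV.
have nV j : nrm (V j) = 1 by rewrite nrmZ Cmod_rc // Rinv_l //; have := gpos j; lra.
have T0 : T <> 0%V.
  move=> e; rewrite e in hT; have [n hn] := hT 1 ltac:(lra).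
  by have := hn n (leqnn n); rewrite subr0 nV; lra.
have TT k u : lw R k u -> (T * u * T = 0)%V.
  move=> hu; have c1 := bcvgM (bcvgMr u hT) hT; apply: (cvg_uniq c1) => e e0.
  have [n hn] := hU (la * INR k + INR k - ln (e / 4) + 1).
  have [j1 hj1] := @archi_inv (/ INR n.+1) (inv_pos n); exists j1 => i hi /=; set j := phi i.
  have hj : / INR j.+1 < / INR n.+1 by apply: hj1; apply: leq_trans hi (incr_ge phi1 i).
  have [h1 [h2 h3]] := hf j; rewrite -/(N j) -/(g j) in h1 h2 h3.
  rewrite subr0 /V -!scalerAl -scalerAr scalerA nrmZ CmodM !Cmod_rc //.
  have h4 : nrm (g j * u * g j)%V <= exp (l (N j + k + N j)%N) by apply: l1; apply: lw_cat => //; exact: lw_cat.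
  apply: (Rle_lt_trans _ (2 * exp (- l (N j)) * (2 * exp (- l (N j))) * exp (l (N j + k + N j)%N))).
    mono.
  have -> : 2 * exp (- l (N j)) * (2 * exp (- l (N j))) * exp (l (N j + k + N j)%N) = 4 * exp (- l (N j) - l (N j) + l (N j + k + N j)%N).
    by rewrite !exp_plus; rring.
  have j0 := inv_pos j; have j2 : / INR j.+1 <= 1.
    by rewrite -[X in _ <= X]Rinv_1; apply: Rinv_le_contravar; [lra|rewrite S_INR; have := pos_INR j; lra].
  have n2 : / INR j.+1 * INR n <= 1.
    have : / INR n.+1 * INR n.+1 = 1 by apply: Rinv_l; apply: not_0_INR.
    have nn := pos_INR n; move: hj j0; rewrite S_INR; move: (/ INR j.+1) => a.
    by rewrite -S_INR; move: (/ INR n.+1) => b ab a0; rewrite S_INR; nra.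
  have h5 := h3 (N j + k + N j)%N; have h6 := h3 n; rewrite !plus_INR in h5.
  have k0 := pos_INR k; have N0 := pos_INR (N j).
  have lt : - l (N j) - l (N j) + l (N j + k + N j)%N < ln (e / 4) by nra.
  have := exp_increasing _ _ lt; rewrite exp_ln; lra.
apply: (h0 T0) => u hu; have [C [d [C0 hC]]] := rep hu.
apply: (@nrm_eq0 (BB X)); apply: Rle_antisym; last pos.
have := hC R T T 0 R1; rewrite Rmult_0_r; apply=> g0 hg0; rewrite (TT _ _ hg0) nrm0; lra.
Qed.
End Growth.
End Core.
Section Growth.
Variables (X : CBanach) (L : BL X -> Prop) (M us : seq (BL X)).
Hypotheses (cL : csub L) (lL : lie L) (kL : forall a, L a -> cpt a) (qL : forall a, L a -> qn a)
  (ML : forall a, a \in M -> L a) (M0 : (0%V : BL X) \in M).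
Let inM (a : BL X) := a \in M.
Hypotheses (hus : forall u, u \in us -> alg inM u)
  (hw : forall n q, q < 1 -> exists w, word us n.+1 w /\ q <= nrm w)
  (h0 : forall T : BL X, T <> 0%V -> (forall u, alg inM u -> T * u * T = 0)%V -> False).
Lemma rep_word : exists C d, 0 <= C /\ forall n w, word us n w -> forall R A B s, 1 <= R ->
  (forall g, lw M R (d.+1 * n) g -> nrm (A * g * B)%V <= s) -> nrm (A * w * B)%V <= (C / R) ^ n * s.
Proof.
have [C [d [C0 h]]] : exists C d, 0 <= C /\ forall u, u \in us -> forall R A B s, 1 <= R ->
    (forall g, lw M R d g -> nrm (A * g * B)%V <= s) -> nrm (A * u * B)%V <= C / R * s.
  elim: us hus => [|u vs IH] hv; first by exists 0, 0%N; split=> //; lra.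
  have [|C [d [C0 h]]] := IH; first by move=> v h; apply: hv; rewrite inE h orbT.
  have [|C' [d' [C0' h']]] := rep M0 (u := u); first by apply: hv; rewrite inE eqxx.
  exists (C + C'), (d + d')%N; split=> [|v]; first lra; rewrite inE => hvv R A B s R1 hs.
  have s0 : 0 <= s by apply: Rle_trans (nrm_ge0 _) (hs _ (lw1 M0 _ _)); lra.
  have i0 : 0 < / R by pos.
  have [] : 0 <= C * s /\ 0 <= C' * s.
    by split; pos.
  case/orP: hvv => [/eqP ->|hvv].
    have : nrm (A * u * B)%V <= C' / R * s.
      by apply: h' => // g hg; apply: hs; rewrite addnC; apply: lw_pad => //; lra.
    nra.
  have : nrm (A * v * B)%V <= C / R * s.
    by apply: h => // g hg; apply: hs; apply: lw_pad => //; lra.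
  nra.
exists C, d; split=> //; elim=> [|n IH] w.
  move=> -> R A B s R1 hs; rewrite Rmult_1_l; apply: hs; apply: lw1 => //; lra.
move=> [a [w' [ha [hw' ->]]]] R A B s R1 hs.
have -> : (A * (a * w') * B = A * a * (w' * B))%V by rewrite !mulrA.
have -> : (C / R) ^ n.+1 * s = C / R * ((C / R) ^ n * s) by rewrite /=; lra.
apply: (h a ha) => // g hg; rewrite mulrA; apply: IH => // k hk; rewrite -(mulrA A).
by apply: hs; rewrite mulnS; apply: lw_cat hk; rewrite -addn1; apply: lw_pad => //; lra.
Qed.
Lemma core : False.
Proof.
(* With [C / R] below [/ 3], words in [us] of norm close to [1] or more force the words in
   exponentials to grow at least like [3 ^ n]. This makes the growth rate [la] positive. *)
have [C [d [C0 hC]]] := rep_word; pose R := 3 * C + 1; have R1 : 1 <= R by rewrite /R; lra.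
have R0 : 0 <= R by lra.
have id1 : 1 <= nrm (1 : BL X)%V.
  have p1 : 0 < nrm (1 : BL X)%V.
    have [w [_ h]] := @hw 0%N (/ 2) ltac:(lra); apply: (@nrm_gt0 (BB X)) => e.
    by rewrite -(mulr1 w) e mulr0 nrm0 in h; lra.
  by have := bnM Id (1 : BL X)%V; rewrite mulr1; nra.
have [B [B1 hB]] := lw_bound M R0.
have /choice [m hm] n : exists x, is_lub (fun r => exists g, lw M R n g /\ r = nrm g) x.
  have [||x hx] := completeness (fun r => exists g, lw M R n g /\ r = nrm g); last by exists x.
    by exists (B ^ n) => r [g [/hB hg ->]].
  by exists (nrm (1 : BL X)%V), 1%V; split=> //; exact: lw1.
have m1 n g : lw M R n g -> nrm g <= m n by move=> hg; apply: (proj1 (hm n)); exists g.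
have m2 n s : (forall g, lw M R n g -> nrm g <= s) -> m n <= s by move=> h; apply: (proj2 (hm n)) => r [g [/h hg ->]].
have mge n : 1 <= m n by apply: Rle_trans id1 (m1 _ _ _); exact: lw1.
pose l n := ln (m n); have el n : exp (l n) = m n by apply: exp_ln; have := mge n; lra.
have expV x y : exp x <= exp y -> x <= y.
  by move=> h; apply: Rnot_lt_le => h1; have := exp_increasing _ _ h1; lra.
have l1 n g : lw M R n g -> nrm g <= exp (l n) by rewrite el; mono.
have l2 n : exists g, lw M R n g /\ exp (l n) <= 2 * nrm g.
  apply: contrapT => hn; have := mge n; have : m n <= m n / 2.
    apply: m2 => g hg; apply: Rnot_lt_le => h; apply: hn; exists g; split=> //; rewrite el; lra.
  lra.
have l3 n : 0 <= l n by apply: expV; rewrite exp_0 el.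
have sub a b : l (a + b)%N <= l a + l b.
  apply: expV; rewrite exp_plus !el; apply: m2 => g /lw_split [u [v [/m1 hu [/m1 hv ->]]]].
  by apply: bnM_le.
have l00 : l 0%N = 0.
  apply: Rle_antisym => //; apply: expV; rewrite el exp_0; apply: m2 => g [bs [/eqP]].
  by rewrite size_eq0 => /eqP -> [_ ->]; exact: bn1.
have lM k n : l (k * n)%N <= INR k * l n.
  elim: k => [|k IH]; first by rewrite l00 /=; lra.
  by rewrite mulSn S_INR; have := sub n (k * n)%N; lra.
have grow n : INR n <= l (d.+1 * n)%N.
  case: n => [|n] //.
  apply: expV; rewrite el; have -> : exp (INR n.+1) = exp 1 ^ n.+1 by rewrite expM Rmult_1_r.
  mid (3 ^ n.+1); first by apply: pow_incr; have := exp_pos 1; have := exp_le_3; lra.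
  apply: Rnot_lt_le => h; have p3 : 0 < 3 ^ n.+1 by pos.
  have e1 : m (d.+1 * n.+1)%N / 3 ^ n.+1 * 3 ^ n.+1 = m (d.+1 * n.+1)%N by rfield; lra.
  have [|w [w1 w2]] := @hw n ((1 + m (d.+1 * n.+1)%N / 3 ^ n.+1) / 2); first nra.
  have := hC _ _ w1 R 1%V 1%V (m (d.+1 * n.+1)%N) R1; rewrite mulr1 => w3.
  have {}w3 : nrm w <= (C / R) ^ n.+1 * m (d.+1 * n.+1)%N.
    by apply: w3; exact: m1.
  have w4 : (C / R) ^ n.+1 <= (/ 3) ^ n.+1.
    apply: pow_incr; split; first pos.
    apply: (Rmult_le_reg_r R); first lra.
    have -> : C / R * R = C by rfield; lra.
    rewrite /R; lra.
  have e2 : (/ 3) ^ n.+1 * 3 ^ n.+1 = 1 by rewrite -Rpow_mult_distr Rinv_l ?pow1.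
  have := mge (d.+1 * n.+1)%N; move: (m _) h e1 w2 w3 => mm h e1 w2 w3 mg.
  have : nrm w <= (/ 3) ^ n.+1 * mm by via w3; mono.
  nra.
(* Fekete's argument: by subadditivity the infimum of the quotients is also their limit. *)
have [la [la1 la2]] : exists la, is_glb (fun r => exists n, r = l n.+1 / INR n.+1) la.
  apply: glb_ex; first by exists (l 1%N / 1), 0%N.
  by move=> _ [n ->]; apply: Rmult_le_pos => //; left; exact: inv_pos.
have nn n : 0 < INR n.+1 by apply: lt_0_INR; lia.
have la0 : 0 < la.
  apply: (Rlt_le_trans _ (/ INR d.+1)); first pos.
  apply: la2 => _ [n ->]; have := grow n.+1; have := lM d.+1 n.+1 => h1 h2.
  apply: (Rmult_le_reg_r (INR n.+1)) => //; apply: (Rmult_le_reg_l (INR d.+1)) => //.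
  have -> : INR d.+1 * (/ INR d.+1 * INR n.+1) = INR n.+1 by rfield; have := nn d; lra.
  have -> : l n.+1 / INR n.+1 * INR n.+1 = l n.+1 by rfield; have := nn n; lra.
  lra.
have l4 n : la * INR n <= l n.
  case: n => [|n]; first by rewrite /=; lra.
  have h : la <= l n.+1 / INR n.+1 by apply: la1; exists n.
  have e : l n.+1 / INR n.+1 * INR n.+1 = l n.+1 by rfield; have := nn n; lra.
  by have := nn n; nra.
have l5 e : 0 < e -> exists C, forall n, l n <= la * INR n + e * INR n + C.
  move=> e0; have [p hp] : exists p, l p.+1 <= (la + e) * INR p.+1.
    apply: contrapT => hn; have : la + e <= la.
      apply: la2 => _ [n ->]; apply: Rnot_lt_le => h; apply: hn; exists n.
      have e1 : l n.+1 / INR n.+1 * INR n.+1 = l n.+1 by rfield; have := nn n; lra.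
      by have := nn n; nra.
    lra.
  exists (rsum l p.+1) => n; rewrite {1}(divn_eq n p.+1); have h1 := sub (n %/ p.+1 * p.+1)%N (n %% p.+1)%N.
  have h2 := lM (n %/ p.+1) p.+1; have hr := ltn_pmod n (ltn0Sn p).
  have h3 : l (n %% p.+1)%N <= rsum l p.+1.
    by apply: Rle_trans (rsum_mono l3 hr) => /=; have := rsum_ge0 (n %% p.+1)%N l3; lra.
  have h4 : INR (n %/ p.+1) * l p.+1 <= INR (n %/ p.+1) * ((la + e) * INR p.+1) by mono.
  have h5 : INR (n %/ p.+1) * INR p.+1 <= INR n by rewrite -mult_INR; apply: le_INR; apply/leP; exact: leq_divM.
  nra.
have [[F hF]|hn] := pselect (exists F, forall n, l n <= la * INR n + F).
  exact: (bounded_case cL lL kL qL ML M0 R1 la0 l1 l2 l3 l4 hF).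
apply: (unbounded_case lL kL ML M0 R1 la0 l1 l2 l3 l5 h0) => F; apply: contrapT => h; apply: hn; exists F => n.
by apply: Rnot_lt_le => h1; apply: h; exists n.
Qed.
End Growth.

(** * Passage to gaps and the theorem of Shulman and Turovskii *)

Section QuotOps.
Variables (X : CBanach) (p : spair X).
Implicit Types (M L : BL X -> Prop) (u w : BL X).
Lemma ind0 : ind p 0%V = 0%V.
Proof. by have := indZ 0%V (stab0 p); rewrite !scale0r. Qed.
Definition imf M (b : BL (qsp p)) := exists a, M a /\ b = ind p a.
Lemma alg_imf M u : (forall a, M a -> stab p a) -> alg M u -> stab p u /\ alg (imf M) (ind p u).
Proof.
move=> hM; elim=> [||v w _ [s1 h1] _ []|c v _ []|v w _ [s1 h1] _ []].
by split; [mono|apply: alg_in; exists a].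
by split; [exact: stab0|rewrite ind0; exact: alg0].
split; [exact: stabD|rewrite indD //; exact: algD].
split; [exact: stabZ|rewrite indZ //; exact: algZ].
split; [exact: stabM|rewrite indM //; exact: algM].
Qed.
Lemma word_ind us n w : (forall u, u \in us -> stab p u) -> word us n w ->
  stab p w /\ word [seq ind p u | u <- us] n (ind p w).
Proof.
move=> hu; elim: n w => [|n IH] w; first by move=> ->; split; [|exact: ind1].
move=> [a [w' [ha [/IH [h1 h2] ->]]]]; split; first by apply: stabM; mono.
by exists (ind p a), (ind p w'); rewrite indM //; [split=> //; exact: map_f|mono].
Qed.
Lemma NN_ind w q : stab p w -> NN (hi p) (lo p) w q -> q <= nrm (ind p w).
Proof.
move=> sw [x [hx [x1 h]]]; apply: le_epsilon => e e0.
have [y [hy [ey ny]]] := pi_wit (ind p w (pi p x)) e0; rewrite indE // in ey ny.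
have hwx : hi p (w x) by apply: (proj1 sw).
have hl : lo p (w x - y)%V.
  by apply/(pi_eq0 (p := p)); [exact: lsubB (proj1 (hiP p)) _ _|rewrite piB // ey subrr].
have := h _ hl; have -> : (w x - (w x - y) = y)%V by vec.
have := bnle (ind p w) (pi p x); rewrite indE //; have := pi_le hx; have := nrm_ge0 (ind p w).
by nra.
Qed.
Lemma lie_ind L : lie L -> (forall a, L a -> stab p a) -> lie (imf L).
Proof.
move=> [lL bL] sL; split; first split.
by exists 0%V; split; [exact: lsub0 lL|rewrite ind0].
split=> [_ _ [a [ha ->]] [b [hb ->]]|c _ [a [ha ->]]].
    by exists (a + b)%V; split; [exact: (lsubD lL)|rewrite indD; mono].
  by exists (c *: a)%V; split; [exact: (lsubZ _ lL)|rewrite indZ; mono].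
move=> _ _ [a [ha ->]] [b [hb ->]]; exists (a * b - b * a)%V; split; first mono.
have sa := sL a ha; have sb := sL b hb.
by rewrite indB ?indM //; exact: stabM.
Qed.
End QuotOps.
Arguments imf {X} p M b.
Lemma irred_ind (X : CBanach) (M : BL X -> Prop) p : gap M p -> irred (imf p M).
Proof.
move=> [sM h] S [cS iS]; have [|||hl|hh] := h (lift S).
split; first exact: lift_csub.
  move=> a ha x [x1 x2]; have sa := sM a ha; split; first exact: (proj1 sa).
  by rewrite -indE //; apply: iS x2; exists a.
exact: lift_lo.
by move=> x [].
by left=> q hq; have [x [x1 x2]] := pi_ex q; rewrite -x2; apply/pi_eq0 => //; apply: hl; split=> //; rewrite x2.
by right=> q; have [x [x1 <-]] := pi_ex q; have [] := hh x.
Qed.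
Lemma gap_words (X : CBanach) (M : BL X -> Prop) us : (forall u, u \in us -> alg M u /\ cpt u) ->
  RR us (fun=> True) (fun x => x = 0%V) -> exists p, gap M p /\
  forall n q, q < 1 -> exists w, word [seq ind p u | u <- us] n.+1 w /\ q <= nrm w.
Proof.
move=> hu hR; have [|u /hu []//|p [gp hp]] := gap_chain (M := M) _ _ hR.
  by move=> S hS u /hu [h _] x; exact: alg_inv h.
exists p; split=> // n q /(hp n) [w [w1 w2]]; have [u /hu [h _]|] := word_ind (p := p) _ w1.
  by have [] := alg_imf gp.1 h.
by exists (ind p w); split=> //; exact: NN_ind.
Qed.
(** Hilden's argument needs finitely many letters only, but these need not act irreducibly.
    Irreducibility is regained on a gap of a maximal chain for the letters where words remain large;
    there [L] is replaced by its part [L1] that preserves the gap. *)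
Theorem shulman_turovskii (X : CBanach) (L : BL X -> Prop) : lie L -> (forall a, L a -> cpt a) ->
  (forall a, L a -> qn a) -> irred L -> forall a, L a -> a = 0%V.
Proof.
move=> lL kL qL iL K hK; apply: contrapT => K0.
have [us [us1 us2]] := hilden iL hK K0 (kL K hK).
have [|M0 [M1 M2]] := alg_fins (M := L) (us := us).
  by move=> v /us1 [u [hu ->]]; apply: algM => //; exact: alg_in.
pose M := (0%V : BL X) :: M0; pose inM (a : BL X) := a \in M.
have ML a : inM a -> L a by rewrite /inM => /orP [/eqP ->|/M1 //]; exact: lsub0 (proj1 lL).
have uM u : u \in us -> alg inM u by move=> /M2; apply: alg_mono => a ha; rewrite /inM inE ha orbT.
have [u hu|p [gp grow]] := gap_words (M := inM) _ us2.
  by split; [mono|have [v [_ ->]] := us1 u hu; apply: cptMl; mono].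
have [sM _] := gp; have iQ := irred_ind gp; pose L1 (a : BL X) := L a /\ stab p a.
have lL1 : lie L1.
  split; first split; first by split; [exact: lsub0 (proj1 lL)|exact: stab0].
    split=> [a b [a1 a2] []|c a []].
      by split; [exact: (lsubD (proj1 lL))|exact: stabD].
    by split; [exact: (lsubZ _ (proj1 lL))|exact: stabZ].
  move=> a b [a1 a2] []; split; first exact: (proj2 lL).
  by apply: stabB; exact: stabM.
have lQ := lie_ind lL1 (fun a h => proj2 h).
have kQ b : imf p L1 b -> cpt b by move=> [a [[ha _] ->]]; apply: cpt_ind; mono.
have qQ b : imf p L1 b -> qn b by move=> [a [[ha sa] ->]]; apply: qn_ind; mono.
have imM b : imf p inM b -> b \in map (ind p) M by move=> [a [ha ->]]; exact: map_f.
have algQ u : u \in [seq ind p u | u <- us] -> alg (imf p inM) u.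
  by move=> /mapP [v /uM hv ->]; have [] := alg_imf sM hv.
have [b [hb b0]] : exists b, imf p inM b /\ b <> 0%V.
  apply: contrapT => hn; have [w [[a [w' [ha [_ ->]]]] hw]] := grow 0%N (/ 2) ltac:(lra).
  rewrite (@alg_triv _ (imf p inM) a) ?mul0r ?nrm0 in hw; [lra| |mono].
  by move=> b hb; apply: contrapT => h; apply: hn; exists b.
have zM : (0%V : BL (qsp p)) \in map (ind p) M.
  by rewrite inE ind0 eqxx.
apply: (@core _ (@cl (BB (qsp p)) (imf p L1)) (map (ind p) M) [seq ind p u | u <- us]) => //.
exact: cl_csub (proj1 lQ).
exact: lie_cl.
exact: cpt_cl.
exact: qn_cl.
move=> _ /mapP [a ha ->]; apply: cl_incl; exists a; split=> //; split; mono.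
by move=> u /algQ; apply: alg_mono.
move=> T T0 hT; apply: (alg_zero iQ hb b0 T0) => u hu; apply: hT; exact: alg_mono hu.
Qed.
(* Otherwise the powers of [s], rescaled, would remain large on some gap. *)
Lemma gap_pow (X : CBanach) (M : BL X -> Prop) s e : cpt s -> alg M s -> 0 < e ->
  (forall p, gap M p -> 2 * nrm (ind p s) <= e) -> exists D, forall m, nrm (s ^+ m)%V <= D * e ^ m.
Proof.
move=> ks hs e0 h; pose s' := (rc (/ e) *: s)%V; have i0 := Rinv_0_lt_compat e.
have hn : ~ RR [:: s'] (fun=> True) (fun x => x = 0%V).
  move=> hR; have [u|p [gp /(_ 0%N (3 / 4)) [|w [[b [w' [hb [-> ->]]]]]]]] := gap_words (M := M) _ hR; last 1 first.
  move: hb; rewrite inE mulr1 => /eqP ->; have [ss _] := alg_imf gp.1 hs.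
    rewrite indZ // nrmZ Cmod_rc; last lra.
    have : / e * nrm (ind p s) <= / e * (e / 2) by apply: Rmult_le_compat_l; [lra|have := h p gp; lra].
    by rewrite (_ : / e * (e / 2) = / 2); [lra|rfield; lra].
  by rewrite inE => /eqP ->; split; [exact: algZ|exact: cptZ].
  lra.
have [n [q [q01 hq]]] := notRR hn; apply: (@pow_bound _ _ _ n.+1) => //.
have hs' : nrm (s' ^+ n.+1)%V <= 1.
  apply: bn_bound1 => x x1; have [|y' [-> hy']] := hq (s' ^+ n.+1)%V _ x I x1; last by rewrite subr0 in hy'; lra.
  elim: n.+1 => [|k IH] //.
  by rewrite exprS; exists s', (s' ^+ k)%V; rewrite inE.
have h2 := pow_lt e n.+1; have -> : s = (rc e *: s')%V by rewrite scaleKrc //; lra.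
by rewrite blZX nrmZ CmodX Cmod_rc; nra.
Qed.
(** * Semigroups of finite-rank operators *)
Lemma nat_min (P : nat -> Prop) : (exists n, P n) -> exists n, P n /\ forall m, P m -> (n <= m)%N.
Proof.
move=> [n hn]; apply: contrapT => h; have : forall k m, (m < k)%N -> ~ P m.
  elim=> [|k IH] m mk hm; apply: h; exists m; split=> // j hj.
  apply/negP => jm; apply: (IH j) => //; lia.
by move/(_ n.+1 n (ltnSn n)).
Qed.
Section Nil.
Variable X : CBanach.
Implicit Types (a b s g h T u : BL X) (bs cs : seq (BL X)).
Lemma entire_zero (f : C -> BL X) r : 0 < r -> entire f -> (forall t, Cmod t <= r -> f t = 0%V) -> forall t, f t = 0%V.
Proof.
move=> r0 [phi [hp ep]] h t; rewrite -ep; apply: ser_uniq; exists 0%N => n.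
rewrite big1 ?subrr ?nrm0 // => i; rewrite (_ : phi i = 0%V) ?scaler0 //.
apply: nrm_eq0; apply: Rle_antisym; last pos.
have := @cauchy_est _ phi r 0 i (Rlt_le _ _ r0) hp => h1.
have {}h1 : r ^ i * nrm (phi i) <= 0 by apply: h1 => s hs; rewrite ep h ?nrm0; lra.
have := pow_lt r i; nra.
Qed.
Fixpoint binv bs : BL X := if bs is b :: bs' then (binv bs' * bexp (- b))%V else 1%V.
Lemma binvP bs : (bprod bs * binv bs = 1)%V /\ (binv bs * bprod bs = 1)%V.
Proof.
elim: bs => [|b bs [h1 h2]]; first by rewrite mulr1.
split; first by rewrite mulrA -(mulrA (bexp b)) h1 mulr1 bexpNr.
by rewrite mulrA -(mulrA (binv bs)) bexpNl mulr1.
Qed.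
Lemma binvE bs : binv bs = bprod (rev [seq (- b)%V | b <- bs]).
Proof. by elim: bs => //= b bs ->; rewrite rev_cons -cats1 bprod_cat /= mulr1. Qed.
Lemma binv_cat bs cs : binv (bs ++ cs) = (binv cs * binv bs)%V.
Proof. by elim: bs => [|b bs IH] /=; rewrite ?mulr1 // IH mulrA. Qed.
Lemma binv_rev bs : binv (rev [seq (- b)%V | b <- bs]) = bprod bs.
Proof.
have [_ h] := binvP bs; rewrite -[LHS]mulr1 -h mulrA (binvE bs).
by rewrite (proj2 (binvP (rev [seq (- b)%V | b <- bs]))) mul1r.
Qed.
Lemma entire_binv bs : entire (fun t => binv [seq (t *: b)%V | b <- bs]).
Proof.
elim: bs => [|b bs IH] /=; first exact: entire_cst.
apply: entireM => //; rewrite (_ : (fun t => bexp _) = fun t => bexp (t *: (- b))%V); first exact: entire_bexp.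
by apply/funext => t; rewrite scalerN.
Qed.
Lemma bprodZ0 bs : bprod [seq (0%V *: b)%V | b <- bs] = 1%V /\ binv [seq (0%V *: b)%V | b <- bs] = 1%V.
Proof.
by elim: bs => [|b bs [IH1 IH2]] //=; rewrite IH1 IH2 scale0r oppr0 bexp0 mul1r.
Qed.
Lemma mapZ1 bs : [seq (1%V *: b)%V | b <- bs] = bs.
Proof. by elim: bs => //= b bs ->; rewrite scale1r. Qed.
Inductive sgp (D : BL X -> Prop) : BL X -> Prop :=
| sgp_in a : D a -> sgp D a
| sgpM a b : sgp D a -> sgp D b -> sgp D (a * b)%V.
Variables (L D : BL X -> Prop) (K : BL X).
Hypotheses (lL : lsub L) (iL : irred L) (hK : L K) (K0 : K <> 0%V) (fD : forall d, D d -> frk d)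
  (cD : forall b d, L b -> D d -> D (bexp b * d * bexp (- b))%V) (qD : forall s, sgp D s -> qn s).
Let inL bs := forall b, b \in bs -> L b.
Lemma inL_cat bs cs : inL bs -> inL cs -> inL (bs ++ cs).
Proof. by move=> h1 h2 b; rewrite mem_cat => /orP [/h1|/h2]. Qed.
Lemma inL_inv bs : inL bs -> inL (rev [seq (- b)%V | b <- bs]).
Proof. by move=> h b; rewrite mem_rev => /mapP [c /h hc ->]; exact: (lsubN lL). Qed.
Lemma inL_map t bs : inL bs -> inL [seq (t *: b)%V | b <- bs].
Proof. by move=> h b /mapP [c /h hc ->]; exact: (lsubZ _ lL). Qed.
Lemma sgp_conj s bs : inL bs -> sgp D s -> sgp D (bprod bs * s * binv bs)%V.
Proof.
move=> hb; elim=> [a ha|a b _ h1 h2]; last first.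
  have -> : (bprod bs * (a * b) * binv bs = bprod bs * a * binv bs * (bprod bs * b * binv bs))%V; last exact: sgpM.
  by rewrite !mulrA -(mulrA _ (binv bs)) (proj2 (binvP bs)) mulr1.
apply: sgp_in; elim: bs hb => [|b bs IH] hb; first by rewrite mul1r mulr1.
have -> : (bexp b * bprod bs * a * (binv bs * bexp (- b)) = bexp b * (bprod bs * a * binv bs) * bexp (- b))%V by rewrite !mulrA.
apply: cD; first by apply: hb; rewrite inE eqxx.
by apply: IH => c hc; apply: hb; rewrite inE hc orbT.
Qed.
Let cls T := exists s bs, sgp D s /\ inL bs /\ T = (s * bprod bs)%V.
Let rg T := fun y : X => exists x, y = T x.
(** Let [T] be nonzero of minimal rank among the products of a semigroup element [s] with an element
    [g] of the group generated by the exponentials. If [T h T] is nonzero for a group element [h],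
    then [T h] maps the range of [T] onto itself. If g h g h' = 1, then T h T h' lies in the
    semigroup, and it cannot be both quasinilpotent and onto on that range; hence [dich]. *)
Theorem nil_theorem d : D d -> d = 0%V.
Proof.
move=> hd; apply: contrapT => d0.
have frs s : sgp D s -> frk s by elim=> [a /fD|a b _ h _ _] //; exact: frkMr.
have [|n [[T [[s [gs [hs [hg eT]]]] [T0 rT]]] hmin]] := @nat_min (fun n => exists T, cls T /\ T <> 0%V /\ dle (rg T) n).
  have [n hn] := fd_dle (fD hd); exists n, d; split=> //; exists d, [::]; split; first exact: sgp_in.
  by rewrite /= mulr1.
pose g := bprod gs; pose gi := binv gs; have [gg1 gg2] := binvP gs.
have fT : fd (rg T) by rewrite eT; apply: frkMr; exact: frs.
have lT := range_lsub T.
have surj hs' : inL hs' -> (T * bprod hs' * T <> 0)%V -> forall y, rg T y -> exists z, rg T z /\ (T * bprod hs')%V z = y.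
  move=> hh h0 y hy; apply: contrapT => hn.
  have cl2 : cls (T * bprod hs' * T)%V.
    exists (s * (bprod (gs ++ hs') * s * binv (gs ++ hs')))%V, (gs ++ hs' ++ gs).
    split; first by apply: sgpM => //; apply: sgp_conj => //; exact: inL_cat.
    split; first by do !apply: inL_cat.
    have [_ e] := binvP (gs ++ hs'); rewrite catA [bprod ((gs ++ hs') ++ gs)]bprod_cat.
    have -> : (s * (bprod (gs ++ hs') * s * binv (gs ++ hs')) * (bprod (gs ++ hs') * bprod gs) =
      s * bprod (gs ++ hs') * s * (binv (gs ++ hs') * bprod (gs ++ hs')) * bprod gs)%V by rewrite !mulrA.
    by rewrite e mulr1 eT bprod_cat !mulrA.
  have : dle (rg (T * bprod hs' * T)%V) n.-1.
    apply: (dle_strict (V := rg T) (v := y)) => //.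
    - exact: range_lsub.
    - by move=> x [z ->]; exists (bprod hs' (T z)); rewrite !blME.
    by move=> [z hz]; apply: hn; exists (T z); split; [exists z|].
    case: (n) rT => [|//] rT; exfalso; apply: T0; apply: BLext => x; apply: (dle0 rT); by exists x.
  move=> h; have : (n <= n.-1)%N by apply: hmin; exists (T * bprod hs' * T)%V.
  case: (n) rT => [|m _]; last by rewrite ltnn.
  by move=> rT _; apply: T0; apply: BLext => x; apply: (dle0 rT); exists x.
have [x0 hx0] : exists x, T x <> 0%V.
  by apply: contrapT => hn; apply: T0; apply: BLext => x; apply: contrapT => hx; apply: hn; exists x.
have dich hs' hs2 : inL hs' -> inL hs2 -> (g * bprod hs' * g * bprod hs2 = 1)%V ->
    (T * bprod hs' * T = 0)%V \/ (T * bprod hs2 * T = 0)%V.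
  move=> i1 i2 e; apply: contrapT => hn.
  have n1 : (T * bprod hs' * T <> 0)%V by mono.
  have n2 : (T * bprod hs2 * T <> 0)%V by mono.
  pose A := (T * bprod hs' * (T * bprod hs2))%V.
  have qA : qn A.
    have -> : A = (s * (bprod (gs ++ hs') * s * binv (gs ++ hs')))%V; last first.
      by apply: qD; apply: sgpM => //; apply: sgp_conj => //; exact: inL_cat.
    have [] := binvP (gs ++ hs'); have e2 : (g * bprod hs2 = binv (gs ++ hs'))%V.
      have [_ e3] := binvP (gs ++ hs'); rewrite -[LHS]mul1r -e3 -mulrA bprod_cat.
      by rewrite (mulrA (g * bprod hs')%V) e mulr1.
    by rewrite /A eT -e2 bprod_cat !mulrA.
  have sA y : rg T y -> exists z, rg T z /\ A z = y.
    move=> /(surj _ i1 n1) [z [/(surj _ i2 n2) [w [hw <-]] <-]]; by exists w.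
  have stA v : rg T v -> rg T (A v) by exists (bprod hs' ((T * bprod hs2)%V v)).
  have [x [c [hx [xn ex]]]] := fd_eig lT fT stA (ex_intro _ x0 erefl) hx0.
  have c0 := qn_eig qA ex xn; apply: xn; apply: (surj_inj lT fT stA sA hx).
  by rewrite ex c0 scale0r.
have zero hs' : inL hs' -> (T * bprod hs' * T = 0)%V.
  move=> i1; apply: contrapT => n1.
  pose cs := rev [seq (- b)%V | b <- gs ++ hs' ++ gs].
  have i2 : inL cs by apply: inL_inv; do !apply: inL_cat.
  have ecs : binv cs = (g * bprod hs' * g)%V by rewrite binv_rev !bprod_cat mulrA.
  (* An analytic path from [hs'] at [t = 0] to [cs], the partner of [hs'] in [dich], at [t = 1]. At
     every [t] one of [f] and [k] vanishes. As [f] is nonzero near [0], the entire function [k]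
     vanishes identically, while [k 1] is the nonzero operator [T * bprod hs' * T]. *)
  pose H t := hs' ++ rev [seq (- b)%V | b <- [seq (t *: b)%V | b <- hs']] ++ [seq (t *: b)%V | b <- cs].
  have iH t : inL (H t) by apply: inL_cat => //; apply: inL_cat; [apply: inL_inv|]; exact: inL_map.
  have eH t : bprod (H t) = (bprod hs' * binv [seq (t *: b)%V | b <- hs'] * bprod [seq (t *: b)%V | b <- cs])%V.
    by rewrite !bprod_cat -binvE mulrA.
  have eHi t : binv (H t) = (binv [seq (t *: b)%V | b <- cs] * bprod [seq (t *: b)%V | b <- hs'] * binv hs')%V.
    by rewrite !binv_cat binv_rev.
  pose f t := (T * bprod (H t) * T)%V; pose k t := (T * (gi * binv (H t) * gi) * T)%V.
  have fk t : f t = 0%V \/ k t = 0%V.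
    have h1 : inL (rev [seq (- b)%V | b <- gs ++ H t ++ gs]) by apply: inL_inv; apply: inL_cat => //; apply: inL_cat.
    have e1 : binv (gs ++ H t ++ gs) = (gi * binv (H t) * gi)%V by rewrite (binv_cat gs) (binv_cat (H t)).
    have e2 : bprod (gs ++ H t ++ gs) = (g * bprod (H t) * g)%V by rewrite (bprod_cat gs) (bprod_cat (H t)) mulrA.
    have := dich (H t) _ (iH t) h1; rewrite -binvE e1 => h2.
    by have := proj1 (binvP (gs ++ H t ++ gs)); rewrite e1 e2.
  have ef : entire f.
    apply: entireM (entire_cst _); apply: entireM (entire_cst _) _.
    rewrite (_ : (fun => _) = fun t => (bprod hs' * binv [seq (t *: b)%V | b <- hs'] * bprod [seq (t *: b)%V | b <- cs])%V); last by apply/funext.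
    by apply: entireM (entire_bprod _); apply: entireM (entire_cst _) (entire_binv _).
  have ek : entire k.
    apply: entireM (entire_cst _); apply: entireM (entire_cst _) _; apply: entireM (entire_cst _); apply: entireM (entire_cst _) _.
    rewrite (_ : (fun => _) = fun t => (binv [seq (t *: b)%V | b <- cs] * bprod [seq (t *: b)%V | b <- hs'] * binv hs')%V); last by apply/funext.
    by apply: entireM (entire_cst _); apply: entireM (entire_binv _) (entire_bprod _).
  have f0 : f 0%V = (T * bprod hs' * T)%V.
    by rewrite /f eH (proj2 (bprodZ0 _)) (proj1 (bprodZ0 _)) !mulr1.
  have k1 : k 1%V = (T * bprod hs' * T)%V.
    rewrite /k eHi !mapZ1 ecs -(mulrA (g * _ * g)%V) (proj1 (binvP hs')) mulr1.
    by rewrite !mulrA -(mulrA T gi) gg2 mulr1 -(mulrA _ g gi) gg1 mulr1.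
  have [M [M0 hM]] := entire_lip 1 ef; have p0 : 0 < nrm (f 0%V) by apply: (@nrm_gt0 (BB X)); rewrite f0.
  pose r := Rmin 1 (nrm (f 0%V) / (2 * (M + 1))).
  have r0 : 0 < r by apply: Rmin_pos; pos.
  case: n1; rewrite -k1; apply: (entire_zero r0 ek) => t ht; case: (fk t) => // h.
  have h1 : Cmod t <= 1 by apply: Rle_trans ht (Rmin_l _ _).
  have h2 : Cmod t <= nrm (f 0%V) / (2 * (M + 1)) by apply: Rle_trans ht (Rmin_r _ _).
  have := hM t 0%V h1 ltac:(rewrite Cmod0; lra); rewrite h sub0r nrmN subr0 => h3.
  have e1 : (M + 1) * (nrm (f 0%V) / (2 * (M + 1))) = nrm (f 0%V) / 2 by rfield; lra.
  have h4 : M * Cmod t <= (M + 1) * (nrm (f 0%V) / (2 * (M + 1))) by mono.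
  by have := Rle_trans _ _ _ h3 h4; rewrite e1; set q := (f 0%V); move: p0; rewrite -/q; lra.
apply: (alg_zero iL hK K0 T0) => u hu; have [l' [m1 m2]] := alg_fin hu.
pose M := (0%V : BL X) :: l'.
have zM : (0%V : BL X) \in M by rewrite inE eqxx.
have [|C [d' [C0 h]]] := @rep X M zM u; first by apply: alg_mono m2 => a ha; rewrite inE ha orbT.
apply: nrm_eq0; apply: Rle_antisym; last pos.
have := h 1 T T 0 (Rle_refl 1); rewrite Rmult_0_r; apply=> k [bs [_ [hb ->]]]; rewrite zero ?nrm0; first lra.
move=> b /hb [t [a [_ [ha ->]]]]; apply: (lsubZ _ lL); move: ha; rewrite inE => /orP [/eqP ->|/m1 //].
exact: lsub0 lL.
Qed.
End Nil.
(** * Lie algebras on finite-dimensional spaces *)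
Section Bracket.
Variable X : CBanach.
Implicit Types (a b c w x y z t : BL X).
(** The commutator is locked so that rewriting with ring lemmas does not expand it. *)
Fact br_key : unit. Proof. exact: tt. Qed.
Definition br a b : BL X := locked_with br_key (a * b - b * a)%V.
Lemma brX a b : br a b = (a * b - b * a)%V. Proof. by rewrite /br unlock. Qed.
Lemma brE a b : br a b = adm a b. Proof. by rewrite brX. Qed.
Lemma jac a b t : br (br a b) t = (br a (br b t) - br b (br a t))%V. Proof. by rewrite !brX; bvec. Qed.
Lemma brDr a x y : br a (x + y)%V = (br a x + br a y)%V. Proof. by rewrite !brE blD. Qed.
Lemma brBr a x y : br a (x - y)%V = (br a x - br a y)%V. Proof. by rewrite !brE blB. Qed.
Lemma brZr a k x : br a (k *: x)%V = (k *: br a x)%V. Proof. by rewrite !brE blZ. Qed.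
Lemma brNr a x : br a (- x)%V = (- br a x)%V. Proof. by rewrite !brE blN. Qed.
Lemma br0r a : br a 0%V = 0%V. Proof. by rewrite !brE bl0. Qed.
Lemma br0l a : br 0%V a = 0%V. Proof. by rewrite brX mul0r mulr0 subrr. Qed.
Lemma brC a b : br a b = (- br b a)%V. Proof. by rewrite !brX opprB. Qed.
Lemma brZl k a x : br (k *: a)%V x = (k *: br a x)%V. Proof. by rewrite brC brZr -scalerN -brC. Qed.
Lemma brDl a b x : br (a + b)%V x = (br a x + br b x)%V. Proof. by rewrite brC brDr opprD -!brC. Qed.
Lemma br_conj a b (e e' : BL X) : (e' * e = 1)%V ->
  br (e * a * e')%V (e * b * e')%V = (e * br a b * e')%V.
Proof.
move=> h; rewrite !brX mulrBr mulrBl !mulrA; congr (_ _)%V.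
  by rewrite -(mulrA _ e' e) h mulr1.
by rewrite -(mulrA _ e' e) h mulr1.
Qed.
Lemma nrm_br a b : nrm (br a b) <= 2 * nrm a * nrm b.
Proof. by rewrite brX; via (nrmB _ _); have := bnM a b; have := bnM b a; nra. Qed.
(* Kleinecke's trick: [(ad a)^n (b^n) = n! [a, b]^n]. *)
Lemma kleinecke a b : br a (br a b) = 0%V -> qn (br a b).
Proof.
rewrite !brE; set d := adm a; set c := d b => dc.
have der x y : d (x * y)%V = (d x * y + x * d y)%V by rewrite !admE; bvec.
have leib m y : ((d ^+ m.+1)%V (b * y) = b * (d ^+ m.+1)%V y + (c * (d ^+ m)%V y) *+ m.+1)%V.
  elim: m => [|m IH]; first by rewrite addrC.
  rewrite blME IH blD der.
  have -> : d (c * (d ^+ m)%V y *+ m.+1)%V = (c * (d ^+ m.+1)%V y *+ m.+1)%V.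
    by rewrite -scaler_nat blZ der dc mul0r add0r scaler_nat exprS.
  by rewrite addrA; congr (_ _)%V; rewrite addrC.
have key n : (d ^+ n)%V (b ^+ n)%V = ((c ^+ n) *+ n`!)%V /\ (d ^+ n.+1)%V (b ^+ n)%V = 0%V.
  elim: n => [|n [h1 h2]].
    by rewrite admE mul1r mulr1 subrr.
  rewrite [(b ^+ n.+1)%V]exprS !leib h1 h2 mulr0 add0r exprS blME h2 bl0 !mulr0 mul0rn addr0.
  by rewrite mulrnAr -mulrnA mulnC.
apply: qn_of_bound => e; pose K := nrm d * nrm b.
have K0 : 0 <= K by apply: Rmult_le_pos; pos.
exists (exp (K / e)) => n.
have h1 : INR (n`!) * nrm (c ^+ n)%V <= K ^ n.
  have [h _] := key n; have := congr1 (fun z => nrm z) h; rewrite -scaler_nat nrmZ -rc_nat Cmod_rc; last pos.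
  move=> <-; via (bnle _ _); rewrite Rpow_mult_distr.
  by apply: Rmult_le_compat; try pos; exact: bnX.
have ke : 0 <= K / e by pos.
have h2 := expsum_le n.+1 ke; have f0 := fact_gt0R n.
have h3 : / INR (n`!) * (K / e) ^ n <= exp (K / e).
  apply: Rle_trans h2 => /=; have : 0 <= rsum (fun i => / INR (i`!) * (K / e) ^ i) n; last lra.
  by apply: rsum_ge0 => i; apply: Rmult_le_pos; [left; apply: Rinv_0_lt_compat; exact: fact_gt0R|pos].
have e1 : (K / e) ^ n * e ^ n = K ^ n by rewrite -Rpow_mult_distr; congr (_ ^ _); rfield; lra.
mid (/ INR (n`!) * (K / e) ^ n * e ^ n); last mono.
rewrite Rmult_assoc; apply: (Rmult_le_reg_l (INR (n`!))) => //.
by rewrite -Rmult_assoc Rinv_r; lra.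
Qed.
Lemma nil_of_eig (V : X -> Prop) (T : BL X) : lsub V -> fd V -> (forall v, V v -> V (T v)) ->
  (forall v (k : C), V v -> v <> 0%V -> T v = (k *: v)%V -> k = 0%V) -> exists k, forall v, V v -> (T ^+ k)%V v = 0%V.
Proof.
move=> lV fV sV h; have [rs [h1 h2]] := annih lV fV sV; exists (size rs) => v /h2 <-.
have {h2}h1 r : r \in rs -> r = 0%V by move=> /h1 [x [hx [x0 e]]]; exact: h e.
elim: rs h1 v => [|r rs IH] h1 v //; rewrite exprSr.
rewrite !blME IH => [|s hs]; last by apply: h1; rewrite inE hs orbT.
by rewrite (h1 r) ?inE ?eqxx // scale0r subr0.
Qed.
Lemma bexp_Lm a y : bexp (Lm a) y = (bexp a * y)%V.
Proof.
apply: (cvg_uniq (bn_cvg y (serP (ec_summ (Lm a))))); apply: cvg_eq (bcvgMr y (serP (ec_summ a))) => n.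
by rewrite bl_sumE mulr_suml; apply: eq_bigr => i; rewrite blZE LmX scalerAl.
Qed.
Lemma bexp_adm a y : bexp (adm a) y = (bexp a * y * bexp (- a))%V.
Proof.
have eR : (- Rm a = Rm (- a))%V by apply: BLext => z; rewrite !RmE mulrN.
rewrite /adm eR bexpD; last exact: LRm.
by rewrite blME bexp_Rm bexp_Lm mulrA.
Qed.
Lemma adm_lsub (L : BL X -> Prop) a n x : lie L -> L a -> L x -> L ((adm a ^+ n)%V x).
Proof.
move=> lL ha hx; elim: n => [|n IH]; rewrite // exprS; exact: (proj2 lL).
Qed.
Lemma lie_bexp (L : BL X -> Prop) a x : csub L -> lie L -> L a -> L x -> L (bexp (adm a) x).
Proof.
move=> cL lL ha hx; apply: (csub_cvg cL _ (bn_cvg x (serP (ec_summ (adm a))))) => n.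
rewrite bl_sumE; apply: (lsub_sum _ (proj1 lL)) => i _.
by apply: (lsubZ _ (proj1 lL)); exact: adm_lsub.
Qed.
Lemma qn_conj a (e e' : BL X) : (e' * e = 1)%V -> qn a -> qn (e * a * e')%V.
Proof.
move=> h q; apply: qn_of_bound => r r0; have [D []] := qn_bound q r0.
have h1 n : ((e * a * e') ^+ n.+1 = e * a ^+ n.+1 * e')%V.
  elim: n => [|n IH] //.
  by rewrite exprS IH !mulrA -(mulrA _ e' e) h mulr1.
exists (1 + nrm e * D * nrm e') => n; have E1 := nrm_ge0.
have p0 : 0 <= nrm e * D * nrm e' by pos.
case: n => [|n]; first by rewrite expr0; have := @bn1 X; lra.
rewrite h1; have rn : 0 < r ^ n.+1 by pos.
mid (nrm e * D * nrm e' * r ^ n.+1); last nra.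
via (bnM _ _).
have -> : nrm e * D * nrm e' * r ^ n.+1 = nrm e * (D * r ^ n.+1) * nrm e' by lra.
apply: Rmult_le_compat_r => //; apply: bnM_le; mono.
Qed.
End Bracket.

(** * Jacobson's theorem on Lie sets of nilpotent operators *)

Section FdX.
Variable X : CBanach.
Hypothesis fX : fd (fun _ : X => True).
Implicit Types (u v w x y z al be T : BL X) (l : seq (BL X)).
Lemma fd_BL : exists l, forall T, @span (BB X) l T.
Proof.
have c1 : cpt (1 : BL X)%V.
  by apply: tb_mono (fd_tb 1 fX) => y [x [h ->]].
have [||l hl] := @bt_fd (BB X) (fun=> True) => //.
by apply: tb_mono (vala 1 c1 c1) => T []; exists T; rewrite mul1r mulr1.
by exists l => T; apply/hl.
Qed.
Lemma fd_BLsub (L : BL X -> Prop) : @fd (BB X) L.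
Proof. by have [l hl] := fd_BL; exists l. Qed.
Lemma qn_nil T : qn T -> exists k, (T ^+ k)%V = 0%V.
Proof.
move=> q; have [||||k hk] := @nil_of_eig X (fun=> True) T => //.
  by move=> v c _ v0 e; exact: qn_eig e v0.
by exists k; apply: BLext; mono.
Qed.
Fixpoint wordP (P : BL X -> Prop) n w : Prop :=
  if n is m.+1 then exists a w', P a /\ wordP P m w' /\ w = (a * w')%V else w = 1%V.
Variable D : BL X -> Prop.
Hypotheses (bD : forall a b, D a -> D b -> D (br a b)) (qD : forall a, D a -> qn a).
Let vanish l n := forall w, word l n w -> w = 0%V.
Let sp l := @span (BB X) l.
Lemma vanish_ge l n m w : vanish l n -> (n <= m)%N -> word l m w -> w = 0%V.
Proof. by move=> h nm; rewrite -(subnKC nm) => /word_split [u [v [/h -> []]]]; rewrite mul0r. Qed.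
Lemma lsub_l (V : BL X -> Prop) al be : lsub V -> lsub (fun z : BL X => V (al * z * be)%V).
Proof.
move=> lV; split; first by rewrite mulr0 mul0r; exact: lsub0.
split=> [u v|c u]; first by rewrite mulrDr mulrDl; exact: (lsubD lV).
by rewrite -scalerAr -scalerAl; exact: (lsubZ _ lV).
Qed.
Lemma vanish_span l n w : vanish l n -> wordP (sp l) n w -> w = 0%V.
Proof.
move=> hv; have gen j i al : (i + j = n)%N -> word l i al -> forall v, wordP (sp l) j v -> (al * v = 0)%V.
  elim: j i al => [|j IH] i al e hal v; first by move=> ->; rewrite mulr1; apply: hv; rewrite -e addn0.
  move=> [a [v' [ha [hv' ->]]]]; rewrite mulrA; move: a ha.
  apply: (@span_min (BB X)); first exact: (lsub_l al v' (proj1 (@csub0 (BB X)))).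
  by move=> u hu; apply: (IH i.+1) => //; [lia|rewrite -addn1; apply: word_cat => //; exact: word1].
by move=> hw; rewrite -[w]mul1r; apply: (gen n 0%N).
Qed.
Lemma wordP_split P m n w : wordP P (m + n)%N w -> exists u v, wordP P m u /\ wordP P n v /\ w = (u * v)%V.
Proof.
elim: m w => [|m IH] w; first by exists 1%V, w; rewrite mul1r.
move=> [a [w' [ha [/IH [u [v [h1 [h2 ->]]]] ->]]]]; exists (a * u)%V, v; rewrite mulrA.
by split=> //; exists a, u.
Qed.
Section Ext.
Variables (l : seq (BL X)) (w : BL X).
Hypothesis nw : forall u, sp l u -> sp l (br w u).
(* Linear combinations of words [al * w^j] with at least [m] letters of [al] in the span of [l]. *)
Let S m T := forall V, lsub V -> (forall al j k, (m <= k)%N -> wordP (sp l) k al -> V (al * w ^+ j)%V) -> V T.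
Lemma S_l m u T : u \in l -> S m T -> S m.+1 (u * T)%V.
Proof.
move=> hu hT V lV hV; rewrite -[(u * T)%V]mulr1; apply: (hT _ (lsub_l u 1%V lV)) => al j k mk hal.
rewrite mulr1 mulrA; apply: (hV _ _ k.+1) => //; exists u, al; split=> //; exact: (@span_in (BB X)).
Qed.
Lemma w_comm k al V : lsub V -> (forall al', wordP (sp l) k al' -> V al') -> wordP (sp l) k al -> V (br w al).
Proof.
elim: k al V => [|k IH] al V lV hV; first by move=> ->; rewrite brX mulr1 mul1r subrr; exact: lsub0.
move=> [u [al' [hu [hal ->]]]].
have -> : br w (u * al')%V = (br w u * al' + u * br w al')%V by rewrite !brX; bvec.
apply: (lsubD lV); first by apply: hV; exists (br w u), al'; mono.
rewrite -[(u * _)%V]mulr1; apply: (IH al' (fun z => V (u * z * 1)%V) (lsub_l u 1%V lV)) => // be hbe.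
by rewrite mulr1; apply: hV; exists u, be.
Qed.
Lemma S_w m T : S m T -> S m (w * T)%V.
Proof.
move=> hT V lV hV; rewrite -[(w * T)%V]mulr1; apply: (hT _ (lsub_l w 1%V lV)) => al j k mk hal.
have -> : (w * (al * w ^+ j) * 1 = 1 * br w al * w ^+ j + al * w ^+ j.+1)%V by rewrite exprS brX; bvec.
apply: (lsubD lV); last exact: hV hal.
by apply: (w_comm (lsub_l 1%V (w ^+ j)%V lV)) hal => be hbe; rewrite mul1r; exact: hV hbe.
Qed.
(** Cut a word into [n] blocks of length [k]. A block without letters from [l] is [w ^+ k = 0];
    every other block contributes a letter of the span, and [w] can be moved to the right past such
    letters because it normalises the span. *)
Lemma vanish_ext n k : vanish l n -> (w ^+ k)%V = 0%V -> vanish (w :: l) (n * k).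
Proof.
move=> hv wk; have blk i v1 : word (w :: l) i v1 -> v1 = (w ^+ i)%V \/ forall m T, S m T -> S m.+1 (v1 * T)%V.
  elim: i v1 => [|i IH] v1; first mono.
  move=> [a [v' [ha [/IH h ->]]]]; move: ha; rewrite inE => /orP [/eqP ->|].
    case: h => [->|h]; first by left; rewrite exprS.
    by right=> m T /h; rewrite -mulrA; exact: S_w.
  right=> m T hT; rewrite -mulrA; apply: S_l => //.
  case: h => [->|h]; last first.
    by move=> V lV hV; apply: (h m T hT V lV) => al j k0 h1; apply: hV; lia.
  elim: (i) => [|i0 IHi]; first by rewrite mul1r.
  by rewrite exprS -mulrA; exact: S_w.
have main m v : word (w :: l) (m * k)%N v -> v = 0%V \/ S m v.
  elim: m v => [|m IH] v.
    rewrite mul0n => ->; right=> V lV hV; have := hV 1%V 0%N 0%N (leqnn _) erefl; by rewrite mulr1.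
  rewrite mulSn => /word_split [v1 [v2 [h1 [/IH h2 ->]]]].
  case: h2 => [->|]; first by left; rewrite mulr0.
  case: (blk _ _ h1) => [->|]; first by left; rewrite wk mul0r.
  mono.
move=> v /main [//|h]; apply: (h (fun z => z = 0%V) (proj1 (@csub0 (BB X)))) => al j m nm hal.
move: hal; rewrite -(subnKC nm) => /wordP_split [u [u' [/(vanish_span hv) -> [_ ->]]]].
by rewrite !mul0r.
Qed.
End Ext.
(** A largest independent family in [D] whose long words vanish must span [D]. Otherwise some [w] in
    [D] outside the span normalises it, and [vanish_ext] enlarges the family. *)
Lemma jacobson : exists n, forall w, wordP D n w -> w = 0%V.
Proof.
have [N hN] : exists N, @dle (BB X) (fun=> True) N by apply: fd_dle; exact: fd_BLsub.
have [|k [[l [il [lD [[n hn] sk]]]] hmin]] := @nat_min (fun k => exists l, @indep (BB X) l /\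
   (forall u, u \in l -> D u) /\ (exists n, vanish l n) /\ (size l + k = N)%N).
  by exists N, [::]; do 3 (split=> //); exists 1%N => w [a [w' []]].
have [hD|hD] := pselect (forall u, D u -> sp l u).
  exists n => w hw; apply: (vanish_span hn); elim: (n) w hw => [//|m IH] w [a [w' [ha [hw' ->]]]].
  by exists a, w'; split; [exact: hD|split=> //; exact: IH].
exfalso; have [s [hs ns]] : exists s, D s /\ ~ sp l s.
  by apply: contrapT => h; apply: hD => u hu; apply: contrapT => h1; apply: h; exists u.
have [w [hw [nws hu]]] : exists w, D w /\ ~ sp l w /\ forall u, u \in l -> sp l (br w u).
  apply: contrapT => hno.
  (* If no such [w] existed, repeated brackets with letters of [l] would never enter the span. But
     after [n + n] of them every term has [n] letters of [l] on one side of [s], so the bracket is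
     [0]. *)
  have seqz j : exists z, D z /\ ~ sp l z /\ forall a b al be, (n + n <= a + b + j)%N -> word l a al -> word l b be ->
      (al * z * be = 0)%V.
    elim: j => [|j [z [hz [nz h]]]].
      exists s; split=> //; split=> // a b al be h ha hb; case: (leqP n a) => na.
        by rewrite (vanish_ge hn na ha) !mul0r.
      by rewrite (vanish_ge hn (ltac:(lia) : (n <= b)%N) hb) mulr0.
    have [u [hul hu]] : exists u, u \in l /\ ~ sp l (br z u).
      apply: contrapT => h1; apply: hno; exists z; split=> //; split=> // u hul; apply: contrapT => h2.
      by apply: h1; exists u.
    exists (br z u); split; first by apply: bD => //; exact: lD.
    split=> // a b al be hab ha hb.
    have -> : (al * br z u * be = al * z * (u * be) - al * u * z * be)%V by rewrite !brX; bvec.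
    rewrite (h a b.+1) ?(h a.+1 b) ?subrr //; try lia.
      by rewrite -addn1; apply: word_cat => //; exact: word1.
    by exists u, be.
  have [z [_ [nz h]]] := seqz (n + n)%N; apply: nz.
  have := h 0%N 0%N 1%V 1%V (leqnn _) erefl erefl; rewrite mul1r mulr1 => ->; exact: lsub0 (span_lsub _).
have nw u : sp l u -> sp l (br w u).
  move: u; apply: (@span_min (BB X) l (fun u => sp l (br w u))) => //.
  have ls := @span_lsub (BB X) l; split; first by rewrite br0r; exact: lsub0 ls.
  split=> [a b|c a] ha; first by move=> hb; rewrite brDr; exact: (lsubD ls).
  by rewrite brZr; exact: (lsubZ _ ls).
have [m hm] := qn_nil (qD hw).
have iwl : @indep (BB X) (w :: l) by split.
have := hN _ iwl (fun _ _ => I) => /= sN.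
have : (k <= k.-1)%N; last by lia.
apply: hmin; exists (w :: l); split=> //; split.
  by move=> u; rewrite inE => /orP [/eqP ->|/lD].
split; first by exists (n * m)%N; exact: vanish_ext.
by rewrite /=; lia.
Qed.
Lemma engel_kernel (x0 : X) : x0 <> 0%V -> exists x : X, x <> 0%V /\ forall d, D d -> d x = 0%V.
Proof.
move=> h0; have [[|n] [hn hmin]] := nat_min jacobson.
  by case: h0; rewrite -[x0]bl1E (hn 1%V erefl).
have [w [hw w0]] : exists w, wordP D n w /\ w <> 0%V.
  apply: contrapT => h; have : (n.+1 <= n)%N; last by rewrite ltnn.
  by apply: hmin => w hw; apply: contrapT => w0; apply: h; exists w.
have [x hx] : exists x : X, w x <> 0%V.
  by apply: contrapT => hno; apply: w0; apply: BLext => x; apply: contrapT => hx; apply: hno; exists x.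
exists (w x); split=> // d hd; rewrite -blME (hn (d * w)%V) //; by exists d, w.
Qed.
End FdX.
Lemma dbl0 (V : lmodType C) (t : V) : (t + t = 0 -> t = 0)%V.
Proof.
move=> h; have -> : t = (rc (/ 2) *: (t + t))%V.
  by rewrite -{2 3}(scale1r t) -scalerDl scalerA half2 scale1r.
by rewrite h scaler0.
Qed.
Lemma qn_adq (X : CBanach) (a x : BL X) : qn a -> adq a x.
Proof.
move=> q e e0; have [D []] := qn_bound q (ltac:(lra) : 0 < e / 2); exists (D * D * nrm x) => m.
have -> : e = e / 2 + e / 2 by lra.
apply: (@ad_corner X a 1%V); try lra; by rewrite ?mul1r ?mulr1.
Qed.
Lemma adq_eig (X : CBanach) (a x : BL X) (c : C) : adq a x -> br a x = (c *: x)%V -> x <> 0%V -> c = 0%V.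
Proof.
move=> h e x0; apply: contrapT => c0; have cp := Cmod_gt0 c0; have xp := @nrm_gt0 (BB X) x x0.
have [D hD] := h (Cmod c / 2) ltac:(lra).
have hm m : nrm x <= D * (/ 2) ^ m.
  have := hD m; rewrite (@bl_powZ (BB X) _ _ c) -?brE // nrmZ CmodX Rpow_mult_distr.
  have : 0 < Cmod c ^ m by pos.
  move: (Cmod c ^ m) (pos) (pos) => p q r p0 h1; apply: (Rmult_le_reg_l p); lra.
have D0 : 0 <= D by have := hm 0%N; lra.
have [N hN] := @pow_small (/ 2) (nrm x / (D + 1)) ltac:(lra) ltac:(lra) ltac:(pos).
have h1 := hN N (leqnn N); have h2 := hm N.
have e1 : (D + 1) * (nrm x / (D + 1)) = nrm x by rfield; lra.
have p0 : 0 <= (/ 2) ^ N by pos.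
have : (D + 1) * (/ 2) ^ N < (D + 1) * (nrm x / (D + 1)) by apply: Rmult_lt_compat_l; lra.
lra.
Qed.

(** * Elements whose adjoint action has square or cube zero *)

Section LieFd.
Variables (X : CBanach) (L : BL X -> Prop).
Hypotheses (fX : fd (fun _ : X => True)) (lL : lie L) (iL : irred L).
Implicit Types (a b c w x y z t : BL X).
Lemma lie_br a b : L a -> L b -> L (br a b). Proof. by rewrite brX; exact: (proj2 lL). Qed.
Let cL : csub L. Proof. by apply: fd_csub (proj1 lL) _; exact: fd_BLsub. Qed.
(** Quasinilpotent sandwich elements, also called absolute zero divisors, of [L]. *)
Definition sandw w := L w /\ qn w /\ forall x, L x -> br w (br w x) = 0%V.
(** Expanding the bracket of [z] with [br a (br a x) = 0] by the Jacobi identity leaves minus twice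
    the left-hand side. *)
Lemma axa a x z : sandw a -> L x -> L z -> br a (br x (br a z)) = 0%V.
Proof.
move=> [ha [_ h]] hx hz; apply: dbl0.
have e := jac a (br a x) z; have e2 := jac a x z; have e3 := jac a x (br a z).
rewrite e2 e3 (h x hx) !brBr (h z hz) (h _ (lie_br hx hz)) br0r !br0l in e.
by rewrite -[RHS]oppr0 [in RHS]e; vec.
Qed.
Lemma sandw_br a b : sandw a -> sandw b -> sandw (br a b).
Proof.
move=> sa sb; have [ha [qa h1]] := sa; have [hb [qb h2]] := sb.
split; first exact: lie_br.
split=> [|z hz]; first by apply: kleinecke; mono.
rewrite (jac a b z) (jac a b) !brBr (axa sa hb (lie_br hb hz)) (h2 _ (lie_br ha hz)) (h1 _ (lie_br hb hz)) (axa sb ha (lie_br ha hz)).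
by rewrite !br0r !subr0.
Qed.
Lemma sandw_conj c w : L c -> sandw w -> sandw (bexp c * w * bexp (- c))%V.
Proof.
move=> hc [hw [qw h]]; have hNc := lsubN (proj1 lL) hc; split; first by rewrite -bexp_adm; exact: lie_bexp.
split=> [|x hx]; first by apply: qn_conj => //; exact: bexpNl.
have -> : x = (bexp c * (bexp (- c) * x * bexp c) * bexp (- c))%V.
  by rewrite !mulrA bexpNr mul1r -mulrA bexpNr mulr1.
rewrite !br_conj ?bexpNl // h ?mulr0 ?mul0r //.
have := bexp_adm (- c)%V; rewrite opprK => <-; exact: lie_bexp.
Qed.
(* The common kernel of all such elements is [L]-invariant, as they are permuted by conjugation with [exp L]. *)
Lemma sandw0 w : sandw w -> w = 0%V.
Proof.
move=> hw; apply: BLext => x0; apply: contrapT => hx0; have x00 : x0 <> 0%V by move=> e; apply: hx0; rewrite e bl0.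
have [x [xn hx]] := engel_kernel fX sandw_br (fun a h => proj1 (proj2 h)) x00.
pose N (z : X) := forall s, sandw s -> s z = 0%V.
have iN : invs L N.
  split.
    rewrite (_ : N = fun z : X => forall s : {s | sandw s}, sval s z = 0%V).
      by apply: csub_cap => s; exact: csub_preB (csub0 X).
    apply/funext => z; apply/propext; split=> [hz []|hz s hs] //.
    exact: (hz (exist _ s hs)).
  move=> a ha z hz s hs; have ep : ent (fun i => s (ec a i z)).
    move=> r r0; have [K hK] := ec_ent a r0; exists (nrm s * nrm z * K) => n.
    mid (nrm s * nrm z * rsum (fun i => r ^ i * nrm (ec a i)) n); last first.
      mono.
    rewrite -rsumZ; apply: rsum_le => i _.
    have -> : nrm s * nrm z * (r ^ i * nrm (ec a i)) = r ^ i * (nrm s * (nrm (ec a i) * nrm z)) by lra.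
    apply: Rmult_le_compat_l; first pos.
    by apply: bnle_le; [pos|exact: bnle].
  have := @cauchy_est _ _ 1 0 1 Rle_0_1 ep; rewrite pow1 Rmult_1_l /ec invr1 scale1r => h.
  apply: nrm_eq0; apply: Rle_antisym; last pos.
  apply: h => t _; apply: Req_le; rewrite (_ : _ _ = 0%V) ?nrm0 //.
  have hta : L (t *: a)%V by exact: (lsubZ _ (proj1 lL)).
  have := hz _ (sandw_conj (lsubN (proj1 lL) hta) hs); rewrite opprK !blME => e0.
  have e1 : s (bexp (t *: a)%V z) = 0%V.
    have := congr1 (bexp (t *: a)%V) e0; by rewrite bl0 -blME bexpNr.
  rewrite -e1 bexpZ; have [||_ <-] := @bl_ser (BB X) X (fun U => s (U z)) _ (nrm s * nrm z) _ _ (ent_summ t (ec_ent a)).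
  by move=> U V; rewrite blD.
  move=> U; rewrite Rmult_assoc; via (bnle _ _).
    by apply: Rmult_le_compat_l; [pos|rewrite Rmult_comm; exact: bnle].
  by congr ser; apply/funext => i; rewrite [in RHS]blZ.
case: (iL iN) => h; first mono.
by apply: hx0; rewrite (h x0 w hw).
Qed.
(* With [phi_t = exp (t ad y)], of degree [p] in [t], [(ad (phi_t b))^3 = phi_t (ad b)^3 phi_{-t}]
   has degree at most [2 p], so that its coefficient of degree [3 p] vanishes. *)
Lemma cube y b p : (0 < p)%N -> L y -> L b -> (forall x, L x -> (adm y ^+ p.+1)%V x = 0%V) ->
  forall x, L x -> let w := (adm y ^+ p)%V b in br w (br w (br w x)) = 0%V.
Proof.
move=> p0 hy hb hn x hx w; pose Y := adm y.
have exE (t : C) z : L z -> bexp (t *: Y)%V z = (\sum_(k < p.+1) (t ^+ k * (k`!%:R)^-1) *: (Y ^+ k)%V z)%V.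
  move=> hz; apply: (cvg_uniq (bn_cvg z (serP (ec_summ _)))) => e e0; exists p.+1 => n pn.
  rewrite bl_sumE -(subnKC pn) big_split_ord [X in (_ + X - _)%V]big1 => [|i _].
    rewrite addr0 -sumrB big1 ?nrm0 // => i _.
    by rewrite [nat_of_ord _]/= ecZ blZE /ec blZE scalerA subrr.
  rewrite [nat_of_ord _]/= ecZ /ec !blZE (exprD Y).
  have -> : (Y ^+ p.+1 * Y ^+ i = Y ^+ i * Y ^+ p.+1)%V by rewrite -!exprD addnC.
  by rewrite blME hn // bl0 !scaler0.
pose K := rsum (fun k => nrm Y ^ k) p.+1.
have Y0 := nrm_ge0 Y; have K0 : 0 <= K by apply: rsum_ge0 => i; pos.
have fl k : / INR (k`!) <= 1.
  rewrite -[X in _ <= X]Rinv_1; apply: Rinv_le_contravar; first lra.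
  by have -> : 1 = INR 1 by []; apply: le_INR; apply/leP; exact: fact_gt0.
have f0 k : 0 <= / INR (k`!) by left; apply: Rinv_0_lt_compat; exact: fact_gt0R.
have exB (t : C) z : 1 <= Cmod t -> L z -> nrm (bexp (t *: Y)%V z) <= K * Cmod t ^ p * nrm z.
  move=> t1 hz; rewrite exE //; via (nrm_sum (fun k => (t ^+ k * (k`!%:R)^-1) *: (Y ^+ k)%V z)%V p.+1).
  have -> : K * Cmod t ^ p * nrm z = Cmod t ^ p * nrm z * K by rring.
  rewrite /K -rsumZ; apply: rsum_le => k hk; rewrite nrmZ CmodM CmodX Cmod_factV.
  have h1 : Cmod t ^ k <= Cmod t ^ p by apply: Rle_pow => //; lia.
  have h2 : nrm ((Y ^+ k)%V z) <= nrm Y ^ k * nrm z.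
    by apply: bnle_le => //; exact: bnX.
  have tk : 0 <= Cmod t ^ k by pos.
  have -> : Cmod t ^ p * nrm z * nrm Y ^ k = Cmod t ^ p * (nrm Y ^ k * nrm z) by rring.
  apply: Rmult_le_compat => //; [exact: Rmult_le_pos|pos|].
  rewrite -[X in _ <= X]Rmult_1_r; exact: Rmult_le_compat.
have aZ (t : C) : adm (t *: y)%V = (t *: Y)%V.
  by apply: BLext => z; rewrite blZE !admE -scalerAl -scalerAr -scalerBr.
(* Divided by [t ^ p] at [t = n + 1], this tends to [(ad y)^p b] over p!. The threefold bracket is
   divided by [t ^ (3 p)] but bounded by a multiple of [t ^ (2 p)], one factor [t ^ p] coming from
   each of the two conjugations. *)
pose be (n : nat) : BL X := bexp (rc (INR n.+1) *: Y)%V b.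
pose ps n : BL X := (rc (/ INR n.+1 ^ p) *: be n)%V.
pose w' : BL X := ((p`!%:R)^-1 *: w)%V.
have n1 n : 1 <= INR n.+1 by rewrite S_INR; have := pos_INR n; lra.
have cps : cvg ps w'.
  apply: (cvg_dom (r := fun n => K * nrm b * / INR n.+1)) => [n|e e0]; last first.
    have [N hN] := @archi_inv (e / (K * nrm b + 1)) ltac:(by apply: Rdiv_lt_0_compat => //; have := Rmult_le_pos _ _ K0 (nrm_ge0 b); lra).
    exists N => n /hN h; have q0 := Rmult_le_pos _ _ K0 (nrm_ge0 b); have i0 := inv_pos n.
    have e1 : (K * nrm b + 1) * (e / (K * nrm b + 1)) = e by rfield; lra.
    have : (K * nrm b + 1) * / INR n.+1 < (K * nrm b + 1) * (e / (K * nrm b + 1)) by apply: Rmult_lt_compat_l => //; lra.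
    lra.
  have h1 := n1 n; rewrite /ps /be exE // big_ord_recr scalerDr scalerA [nat_of_ord ord_max]/=.
  have -> : (rc (/ INR n.+1 ^ p) * (rc (INR n.+1) ^+ p * (p`!%:R)^-1) = (p`!%:R)^-1)%V.
    by rewrite mulrA -rcX -rcM Rinv_l ?rc1 ?mul1r //; apply: pow_nonzero; lra.
  rewrite -/Y -/w -/w' addrK nrmZ Cmod_rc; last pos.
  have i0 : 0 < / INR n.+1 ^ p by pos.
  mid (/ INR n.+1 ^ p * (INR n.+1 ^ p.-1 * nrm b * rsum (fun k => nrm Y ^ k) p)).
    apply: Rmult_le_compat_l; first pos.
    via (nrm_sum (fun k => (rc (INR n.+1) ^+ k * (k`!%:R)^-1) *: (Y ^+ k)%V b)%V p).
    rewrite -rsumZ; apply: rsum_le => k hk; rewrite nrmZ CmodM CmodX Cmod_factV Cmod_rc; last lra.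
    have h3 : INR n.+1 ^ k <= INR n.+1 ^ p.-1 by apply: Rle_pow => //; lia.
    have h2 : nrm ((Y ^+ k)%V b) <= nrm Y ^ k * nrm b.
      by apply: bnle_le => //; exact: bnX.
    have tk : 0 <= INR n.+1 ^ k by pos.
    have -> : INR n.+1 ^ p.-1 * nrm b * nrm Y ^ k = INR n.+1 ^ p.-1 * (nrm Y ^ k * nrm b) by rring.
    apply: Rmult_le_compat => //; [exact: Rmult_le_pos|pos|].
    rewrite -[X in _ <= X]Rmult_1_r; exact: Rmult_le_compat.
  have -> : / INR n.+1 ^ p * (INR n.+1 ^ p.-1 * nrm b * rsum (fun k => nrm Y ^ k) p) = rsum (fun k => nrm Y ^ k) p * nrm b * / INR n.+1.
    move: (rsum _ p) (nrm b) (INR n.+1) h1 => s0 s1 r h1; case: (p) p0 => [//|q] _ /=; rfield; split; [|apply: pow_nonzero]; lra.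
  apply: Rmult_le_compat_r; first pos.
  apply: Rmult_le_compat_r; first pos.
  by rewrite /K /=; have := pow_le _ p Y0; lra.
have cbr u v (u' v' : nat -> BL X) : cvg u' u -> cvg v' v -> cvg (fun n => br (u' n) (v' n)) (br u v).
  rewrite brX; by move=> h1 h2; apply: cvg_eq (cvgB (bcvgM h1 h2) (bcvgM h2 h1)) => n; rewrite brX.
have c3 := cbr _ _ _ _ cps (cbr _ _ _ _ cps (cbr _ _ _ _ cps (@cvg_cst (BB X) x))).
suff e : br w' (br w' (br w' x)) = 0%V.
  have pf : ((p`!%:R : C)^-1 != 0)%V by rewrite invr_eq0; apply: natC_neq0; exact: fact_gt0.
  move/eqP: e; rewrite /w' !brZl !brZr !scalerA scaler_eq0 !mulf_eq0 (negbTE pf) /= => /eqP //.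
pose Q := K * (8 * (nrm b * nrm b * nrm b)) * K * nrm x.
have b0 := nrm_ge0 b; have Q0 : 0 <= Q.
  by apply: Rmult_le_pos; pos.
apply: (cvg_uniq c3); apply: (cvg_dom (r := fun n => Q * / INR n.+1)) => [n|e e0]; last first.
  have [N hN] := @archi_inv (e / (Q + 1)) ltac:(by apply: Rdiv_lt_0_compat; lra).
  exists N => n /hN h; have i0 := inv_pos n.
  have e1 : (Q + 1) * (e / (Q + 1)) = e by rfield; lra.
  have : (Q + 1) * / INR n.+1 < (Q + 1) * (e / (Q + 1)) by apply: Rmult_lt_compat_l => //; lra.
  lra.
have h1 := n1 n; rewrite subr0 /ps !brZl !brZr !scalerA nrmZ !CmodM Cmod_rc; last pos.
pose t : C := rc (INR n.+1); have ct : Cmod t = INR n.+1 by rewrite Cmod_rc //; lra.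
have hty : L (t *: y)%V by exact: (lsubZ _ (proj1 lL)).
pose x' := bexp (- t *: Y)%V x.
have hx' : L x' by rewrite /x' -aZ scaleNr; apply: lie_bexp => //; exact: (lsubN (proj1 lL)).
have ex : x = bexp (t *: Y)%V x'.
  rewrite -aZ bexp_adm /x' -aZ scaleNr bexp_adm opprK !mulrA bexpNr mul1r -mulrA bexpNr mulr1 //.
have -> : br (be n) (br (be n) (br (be n) x)) = bexp (t *: Y)%V (br b (br b (br b x'))).
  rewrite [in LHS]ex /be -/t -aZ !bexp_adm !br_conj //; exact: bexpNl.
have hB : L (br b (br b (br b x'))) by do !apply: lie_br.
have tN : Cmod (- t)%V = INR n.+1 by rewrite CmodN.
have g1 : nrm (bexp (t *: Y)%V (br b (br b (br b x')))) <= K * INR n.+1 ^ p * (8 * (nrm b * nrm b * nrm b) * (K * INR n.+1 ^ p * nrm x)).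
  via (exB _ _ _ hB); rewrite ct //; apply: Rmult_le_compat_l; first pos.
  have g2 : nrm x' <= K * INR n.+1 ^ p * nrm x by rewrite -tN; apply: exB => //; rewrite tN.
  mid (8 * (nrm b * nrm b * nrm b) * nrm x'); last mono.
  have g3 := nrm_br b x'; have g4 := nrm_br b (br b x'); have g5 := nrm_br b (br b (br b x')).
  have bb : 0 <= 2 * nrm b by lra.
  have g6 := Rmult_le_compat_l _ _ _ bb g3; have g7 := Rmult_le_compat_l _ _ _ bb g4; have g8 := Rmult_le_compat_l _ _ _ bb g6.
  by move: g5 g7 g8; move: (nrm (br b _)) (nrm (br b _)) (nrm (br b _)) => r1 r2 r3; lra.
have p1 : 1 <= INR n.+1 ^ p by apply: pow_R1_Rle.
have ip : 0 < / INR n.+1 ^ p by pos.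
mid (/ INR n.+1 ^ p * / INR n.+1 ^ p * / INR n.+1 ^ p * (K * INR n.+1 ^ p * (8 * (nrm b * nrm b * nrm b) * (K * INR n.+1 ^ p * nrm x)))).
  mono.
have -> : / INR n.+1 ^ p * / INR n.+1 ^ p * / INR n.+1 ^ p * (K * INR n.+1 ^ p * (8 * (nrm b * nrm b * nrm b) * (K * INR n.+1 ^ p * nrm x))) = Q * / INR n.+1 ^ p.
  by rewrite /Q; rfield; lra.
apply: Rmult_le_compat_l => //; apply: Rinv_le_contravar; first lra.
by rewrite -{1}(pow_1 (INR n.+1)); apply: Rle_pow => //; lia.
Qed.
End LieFd.
(** * Graded Lie algebras *)
(** After division by the common divisor of [m], [n] and [N], some [m + j * n] is prime to [N] and
    hence invertible modulo [N]; then [i] exists. *)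
Lemma num_theory N m n : (0 < N)%N -> exists i j, (0 < i)%N /\ (N %| n + i * (m + j * n))%N.
Proof.
wlog m0 : m / (0 < m)%N => [h|] N0.
  have [i [j [i0 hd]]] := h (m + N)%N ltac:(lia) N0; exists i, j; move: hd.
  have -> : (n + i * (m + N + j * n) = i * N + (n + i * (m + j * n)))%N by lia.
  by rewrite dvdn_addr ?dvdn_mull.
pose d := gcdn (gcdn m n) N; have d0 : (0 < d)%N by rewrite gcdn_gt0 N0 orbT.
have /dvdnP [m' em] : (d %| m)%N by apply: dvdn_trans (dvdn_gcdl _ _) (dvdn_gcdl _ _).
have /dvdnP [n' en] : (d %| n)%N by apply: dvdn_trans (dvdn_gcdl _ _) (dvdn_gcdr _ _).
have /dvdnP [N' eN] : (d %| N)%N by apply: dvdn_gcdr.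
have N'0 : (0 < N')%N by move: N0; rewrite eN; case: (N').
have m'0 : (0 < m')%N by move: m0; rewrite em; case: (m').
have g1 : gcdn (gcdn m' n') N' = 1%N.
  apply/eqP; rewrite -(eqn_pmul2r d0) mul1n !muln_gcdl -em -en -eN //.
(* The largest divisor of [N'] prime to [m']: a prime factor of [N'] divides exactly one of [m'] and
   [j * n'], as [m'], [n'], [N'] have no common factor. *)
pose j := N'`_(\pi(m')^'); pose k := (m' + j * n')%N.
have j0 : (0 < j)%N by exact: part_gt0.
have cop : coprime k N'.
  apply/negPn/negP => hc; have [p pp /andP [pk pN]] : exists2 p, prime p & (p %| k)%N && (p %| N')%N.
    have g0 : (1 < gcdn k N')%N.
      by rewrite ltn_neqAle eq_sym hc gcdn_gt0 N'0 orbT.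
    exists (pdiv (gcdn k N')); first exact: pdiv_prime.
    by rewrite !(dvdn_trans (pdiv_dvd _)) ?dvdn_gcdl ?dvdn_gcdr.
  case: (boolP (p %| m')%N) => pm.
    have := pk; rewrite dvdn_addr // Euclid_dvdM // => /orP [pj|pn].
      have := part_pnat (\pi(m')^') N' => /pnatP h; have := h j0 p pp pj.
      by rewrite !inE mem_primes pp m'0 pm.
    by have : (p %| gcdn (gcdn m' n') N')%N; [rewrite !dvdn_gcd pm pn pN|rewrite g1 dvdn1 => /eqP e; rewrite e in pp].
  have pj : (p %| j)%N.
    move: pN; rewrite -{1}(partnC \pi(m') N'0) Euclid_dvdM // => /orP [h|//].
    have := part_pnat \pi(m') N' => /pnatP h1; have := h1 (part_gt0 _ _) p pp h.
    by rewrite mem_primes (negbTE pm) !andbF.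
  by move: pk; rewrite dvdn_addl ?dvdn_mulr // (negbTE pm).
have [a _ ha] := Bezoutl k N'0; rewrite gcdnC (eqP cop) in ha.
(* Adding [N'] makes the first number positive. *)
exists (a * n' + N')%N, j; split; first by lia.
have -> : (n + (a * n' + N') * (m + j * n) = (n' * (1 + a * k) + N' * k) * d)%N by nia.
rewrite eN dvdn_pmul2r; mono.
Qed.

(** * Finite abelian groups as [zmodType] *)

Section GroupInst.
Variable G : FinAbGroup.
HB.instance Definition _ := gen_eqMixin G.
HB.instance Definition _ := gen_choiceMixin G.
Lemma gadd0l : left_id (g0 G) (@gadd G). Proof. by move=> x; rewrite gadd_comm gadd_0. Qed.
Lemma gaddNl : left_inverse (g0 G) (@gopp G) (@gadd G). Proof. by move=> x; rewrite gadd_comm gadd_opp. Qed.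
HB.instance Definition _ := GRing.isZmodule.Build G (@gadd_assoc G) (@gadd_comm G) gadd0l gaddNl.
Lemma gnmulE n (g : G) : gnmul G n g = (g *+ n)%V.
Proof. by elim: n => [|n IH] //; rewrite mulrS -IH. Qed.
Lemma InE (T : eqType) (l : seq T) x : List.In x l <-> x \in l.
Proof.
elim: l => //= y l IH; rewrite inE; split=> [[->|/IH ->]|/orP [/eqP ->|/IH h]]; rewrite ?eqxx ?orbT; mono.
Qed.
Lemma genum_all (g : G) : g \in genum G. Proof. by apply/InE; exact: genum_complete. Qed.
Lemma genum_uniq : uniq (genum G).
Proof. by elim: (genum_nodup G) => //= x l h _ ->; rewrite andbT; apply/negP /InE. Qed.
Lemma genum_sum (f : G -> nat) (c : G) : (\sum_(g <- genum G) f (c + g)%V = \sum_(g <- genum G) f g)%N.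
Proof.
rewrite -(big_map (fun g => (c + g)%V) xpredT f); apply: perm_big; apply: uniq_perm.
by rewrite map_inj_uniq ?genum_uniq // => x y /addrI.
exact: genum_uniq.
move=> g; rewrite genum_all; apply/mapP; exists (g - c)%V; first exact: genum_all.
by rewrite addrC subrK.
Qed.
Lemma gorder (g : G) : exists N, (0 < N)%N /\ (g *+ N = 0)%V.
Proof.
have : ~~ uniq (mkseq (fun k => g *+ k)%V (size (genum G)).+1).
  apply/negP => /uniq_leq_size h; have : (size (genum G) < size (genum G))%N; last by rewrite ltnn.
  by rewrite -{1}(size_mkseq (fun k => g *+ k)%V (size (genum G)).+1) h // => x _; exact: genum_all.
move=> /uniqPn => /(_ 0%V) [i [j [ij]]]; rewrite size_mkseq => hj; rewrite !nth_mkseq //; last lia.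
move=> e; exists (j - i)%N; split; first by rewrite subn_gt0.
by rewrite mulrnBr ?(ltnW ij) // e subrr.
Qed.
Lemma gzmulE z (g : G) : exists n, gzmul G z g = (g *+ n)%V.
Proof.
have [N [N0 hN]] := gorder g; case: z => [|p|p] /=; first by exists 0%N.
  by exists (Pos.to_nat p); rewrite gnmulE.
exists (Pos.to_nat p * N.-1)%N; rewrite gnmulE; apply/eqP; rewrite -subr_eq0 -opprD oppr_eq0 -mulrnDr.
by rewrite -{1}(muln1 (Pos.to_nat p)) -mulnDr add1n prednK // mulnC mulrnA hN mul0rn.
Qed.
(* In a cyclic group some [h + j e] generates a subgroup containing [e]. *)
Lemma cyc_rel (e h : G) : ~ Gsharp G e h -> exists i j, (0 < i)%N /\ (e + (h + e *+ j) *+ i = 0)%V.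
Proof.
move=> /contrapT [g [m [n [-> ->]]]]; have [m' ->] := gzmulE m g; have [n' ->] := gzmulE n g.
have [N [N0 hN]] := gorder g; have [i [j [i0 /dvdnP [q hq]]]] := num_theory n' m' N0.
exists i, j; rewrite -!mulrnA -mulrnDr -mulrnA -mulrnDr.
have -> : (m' + (n' + m' * j) * i = q * N)%N by lia.
by rewrite mulnC mulrnA hN mul0rn.
Qed.
End GroupInst.

Section Graded.
Variables (X : CBanach) (G : FinAbGroup) (Lg : G -> BL X -> Prop).
Implicit Types (g h d e : G) (a b u v w x y z : BL X).
Definition Lsum a := exists f : G -> BL X, (forall g, Lg g (f g)) /\ a = (\sum_(g <- genum G) f g)%V.
Definition graded := (forall g, lsub (Lg g)) /\
  forall g d a b, Lg g a -> Lg d b -> Lg (g + d)%V (a * b - b * a)%V.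
Definition cp g d := (g + d = 0)%V \/ Gsharp G g d.
(** The Engel condition weakened to single vectors [x]; this form is inherited by quotients, see
    [adq_ind]. *)
Definition gcond := forall g d, cp g d -> forall a b, Lg g a -> Lg d b -> forall x, Lsum x -> adq (br a b) x.
Hypothesis gr : graded.
Lemma gr_br g d a b : Lg g a -> Lg d b -> Lg (g + d)%V (br a b).
Proof. by rewrite brX; exact: (proj2 gr). Qed.
Lemma Lg_sum g a : Lg g a -> Lsum a.
Proof.
exists (fun d => if d == g then a else 0%V); split.
  by move=> d; case: eqP => [->|_] //; exact: lsub0 (proj1 gr d).
by rewrite (bigD1_seq g) ?genum_all ?genum_uniq //= eqxx big1 ?addr0 // => d /negbTE ->.
Qed.
Lemma Lsum_lsub : lsub Lsum.
Proof.
split; first by exists (fun=> 0%V); split=> [g|]; [exact: lsub0 (proj1 gr g)|rewrite big1].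
split=> [a b [f [hf ->]] [k [hk ->]]|c a [f [hf ->]]].
  by exists (fun g => f g + k g)%V; rewrite big_split; split=> // g; exact: (lsubD (proj1 gr g)).
by exists (fun g => c *: f g)%V; rewrite scaler_sumr; split=> // g; exact: (lsubZ _ (proj1 gr g)).
Qed.
Lemma Lsum_lie : lie Lsum.
Proof.
have lL := Lsum_lsub; split=> // _ _ [f [hf ->]] [k [hk ->]].
rewrite mulr_suml mulr_sumr -sumrB; apply: (lsub_sum _ lL) => g _.
rewrite mulr_suml mulr_sumr -sumrB; apply: (lsub_sum _ lL) => d _.
exact: Lg_sum (proj2 gr _ _ _ _ (hf g) (hk d)).
Qed.
Lemma Lsum_ind (V : BL X -> Prop) : lsub V -> (forall g a, Lg g a -> V a) -> forall a, Lsum a -> V a.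
Proof. by move=> lV h _ [f [hf ->]]; apply: (lsub_sum _ lV) => g _; exact: h. Qed.
Lemma Lsum_wit (Y : CBanach) (T : BL X -> Y) : (forall a b, T (a + b)%V = T a + T b)%V -> (forall (c : C) a, T (c *: a) = c *: T a)%V ->
  (exists a, Lsum a /\ T a <> 0%V) -> exists g a, Lg g a /\ T a <> 0%V.
Proof.
move=> TD TZ [a [ha h]]; apply: contrapT => hn; apply: h; move: a ha; apply: Lsum_ind.
  split; first by rewrite -(scale0r 0%V) TZ scale0r.
  by split=> [a b ha hb|c a ha]; rewrite ?TD ?TZ ha ?hb ?addr0 ?scaler0.
by move=> g a ha; apply: contrapT => h; apply: hn; exists g, a.
Qed.
Lemma gr_ad g d y b k : Lg g y -> Lg d b -> Lg (g *+ k + d)%V ((adm y ^+ k)%V b).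
Proof.
move=> hy hb; elim: k => [|k IH]; first by rewrite add0r.
by rewrite exprS blME -brE mulrS -addrA; exact: gr_br.
Qed.
Hypotheses (fX : fd (fun _ : X => True)) (iL : irred Lsum) (hc : gcond).
Let lL := Lsum_lie.
Let brL a b : Lsum a -> Lsum b -> Lsum (br a b). Proof. exact: lie_br. Qed.
Let sq w g := fun z => exists x, Lg g x /\ z = br w (br w x).
Let Wc th w := Lg th w /\ w <> 0%V /\ qn w /\ forall z, Lsum z -> br w (br w (br w z)) = 0%V.
Lemma sq_lsub w g : lsub (sq w g).
Proof.
apply: (@img_lsub (BB X) (BB X) (fun x => br w (br w x))); last exact: (proj1 gr g).
  by move=> x y; rewrite !brDr.
by move=> c x; rewrite !brZr.
Qed.
(* If [(ad w)^3 = 0] and [u = (ad w)^2 b] then [(ad u)^2 = (ad w)^2 (ad b)^2 (ad w)^2]; for [w] with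
   [(ad w)^2 L] of minimal dimension this makes [u] a value of [(ad u)^2], in degree minus that of [u]. *)
Lemma descent th w : ~ Wc th w.
Proof.
move=> hw0; have [n [[{hw0}th [{}w [d [hw [hd en]]]]] hmin]] : exists n, (exists th w (d : G -> nat), Wc th w /\
    (forall g, @dle (BB X) (sq w g) (d g)) /\ n = \sum_(g <- genum G) d g)%N /\
    forall m, (exists th w (d : G -> nat), Wc th w /\ (forall g, @dle (BB X) (sq w g) (d g)) /\ m = \sum_(g <- genum G) d g)%N -> (n <= m)%N.
  apply: nat_min; have h g : exists m, @dle (BB X) (sq w g) m by apply: fd_dle; exact: fd_BLsub.
  by exists (\sum_(g <- genum G) sval (cid (h g)))%N, th, w, (fun g => sval (cid (h g))); split=> //; split=> // g; exact: (svalP (cid (h g))).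
have [hwg [w0 [qw w3]]] := hw; have hwL := Lg_sum hwg.
have [ga [b [hb ub]]] : exists g b, Lg g b /\ br w (br w b) <> 0%V.
  apply: (@Lsum_wit (BB X) (fun b => br w (br w b))).
  - by move=> x y; rewrite !brDr.
  - by move=> c x; rewrite !brZr.
  apply: contrapT => h; apply: w0; apply: (sandw0 fX lL iL (w := w)); split=> //; split=> // x hx.
  by apply: contrapT => h1; apply: h; exists x.
have hbL := Lg_sum hb; pose u := br w (br w b).
have hug : Lg (th + (th + ga))%V u by apply: gr_br => //; exact: gr_br.
have huL := Lg_sum hug.
have uE z : br u z = (br w (br w (br b z)) - (br w (br b (br w z)) + br w (br b (br w z))) + br b (br w (br w z)))%V.
  by rewrite /u (jac w) (jac w b z) (jac w b (br w z)) !brBr; vec.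
(* As [[w, u] = (ad w)^3 b = 0], the operators [ad w] and [ad u] commute. Inserting the expansion
   [uE] and cancelling the cubes of [ad w] leaves three times the difference of the two sides. *)
have r1 z : Lsum z -> br w (br w (br b (br w z))) = br w (br b (br w (br w z))).
  move=> hz; have := jac w u z; rewrite {1}/u (w3 b hbL) br0l (uE z) (uE (br w z)) !(brDr, brNr).
  rewrite (w3 (br b z)) ?(w3 z) ?br0r; try by [|exact: brL].
  set p := br w (br w (br b (br w z))); set q := br w (br b (br w (br w z))).
  move=> e; apply: subr0_eq.
  have {}e : ((p - q) + (p - q) + (p - q) = 0)%V by rewrite -[RHS]oppr0 [in RHS]e; vec.
  have -> : (p - q = (3%:R : C)^-1 *: ((p - q) + (p - q) + (p - q)))%V.
    rewrite -{2 3 4}(scale1r (p - q)%V) -!scalerDl scalerA.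
    have h3 : (1 + 1 + 1 = 3%:R :> C)%V by cring.
    by rewrite h3 mulVf ?scale1r //; exact: natC_neq0.
  by rewrite e scaler0.
have r2 z : Lsum z -> br w (br w (br b (br w (br w z)))) = 0%V.
  by move=> hz; rewrite r1 ?w3 ?br0r //; exact: brL.
have uw z : Lsum z -> br w (br w (br u z)) = 0%V.
  by move=> hz; rewrite uE !(brDr, brNr) (r2 z hz) (w3 _ (brL hwL (brL hbL hz))) (w3 _ (brL hbL (brL hwL hz))) ?br0r; vec.
have u2 z : Lsum z -> br u (br u z) = br w (br w (br b (br b (br w (br w z))))).
  move=> hz; rewrite (uE (br u z)) (uw z hz) br0r addr0.
  have wu : br w (br u z) = (- br w (br b (br w (br w z))))%V.
    by rewrite uE !(brDr, brNr) (w3 _ (brL hbL hz)) (r1 z hz); vec.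
  have h1 : br w (br w (br b (br u z))) = (br w (br w (br b (br b (br w (br w z))))) -
      (br w (br b (br w (br b (br w (br w z))))) + br w (br b (br w (br b (br w (br w z)))))))%V.
    by rewrite uE !(brDr, brNr) (r2 _ (brL hbL hz)) (r1 _ (brL hbL (brL hwL hz))) (r1 z hz); vec.
  by rewrite h1 wu !brNr; vec.
have u3 z : Lsum z -> br u (br u (br u z)) = 0%V.
  by move=> hz; rewrite u2 ?uw ?br0r //; exact: brL.
have qu : qn u by apply: kleinecke; exact: w3.
have hu : Wc (th + (th + ga))%V u by split=> //; split.
(* [g0] is opposite to the degree of [u], so the hypothesis applies to [u] and any [f] of degree
   [g0]. [sh] is the shift of degrees under [(ad b)^2 (ad w)^2], the inner part of [(ad u)^2]. *)
pose g0 := (- (th + (th + ga)))%V; pose sh g := ((ga + ga + th + th) + g)%V.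
have subsq g z : sq u g z -> sq w (sh g) z.
  move=> [x [hx ->]]; rewrite u2; last exact: Lg_sum hx.
  exists (br b (br b (br w (br w x)))); split=> //.
  have -> : sh g = (ga + (ga + (th + (th + g))))%V by rewrite !addrA.
  by do !apply: gr_br.
have [[f [hf ef]]|hn] := pselect (sq u g0 u).
  have := hc (or_introl (subrr _)) hug hf huL.
  have h1 : br (br u f) u = ((-1) *: u)%V by rewrite brC -ef scaleN1r.
  move=> h2; have := adq_eig h2 h1 ub; move/eqP; by rewrite oppr_eq0 oner_eq0.
have sh0 : sh g0 = ga.
  rewrite /sh (_ : ga + ga + th + th = ga + (th + (th + ga)))%V ?addrK //; rewrite -!addrA; by rewrite addrC -!addrA.
have sqw : sq w (sh g0) u by rewrite sh0; exists b.
case e0 : (d (sh g0)) => [|m].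
  by apply: ub; apply: (@dle0 (BB X) _ _ _ sqw); rewrite -e0.
(* At [g0] the bound drops by one, because [u] lies in the larger space but not in the smaller;
   [genum_sum] undoes the shift in the total. *)
pose d' g := if g == g0 then m else d (sh g).
have hd' g : @dle (BB X) (sq u g) (d' g).
  rewrite /d'; case: eqP => [->|_]; last exact: dle_mono (subsq g) (hd _).
  apply: (@dle_strict (BB X) (sq w (sh g0)) (sq u g0) m u) => //; [exact: sq_lsub|mono|].
  by rewrite -e0.
have : (n <= \sum_(g <- genum G) d' g)%N by apply: hmin; exists (th + (th + ga))%V, u, d'.
rewrite en -(genum_sum d (ga + ga + th + th)%V) (bigD1_seq g0) ?genum_all ?genum_uniq //=.
rewrite [X in (_ <= X)%N](bigD1_seq g0) ?genum_all ?genum_uniq //= /d' eqxx e0.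
have -> : (\sum_(i <- genum G | i != g0) (if i == g0 then m else d (sh i)) = \sum_(i <- genum G | i != g0) d (sh i))%N.
  by apply: eq_bigr => i /negbTE ->.
by rewrite ltnn.
Qed.
Lemma ad_nil y : Lsum y -> (forall x, Lsum x -> adq y x) -> exists k, forall x, Lsum x -> (adm y ^+ k)%V x = 0%V.
Proof.
move=> hy h; apply: (@nil_of_eig (BB X)); [exact: Lsum_lsub|exact: fd_BLsub| |].
  by move=> v; rewrite -brE; mono.
by move=> v k hv v0 e; apply: (adq_eig (h v hv)) v0; rewrite brE.
Qed.
(** Otherwise take a nonzero value, at a homogeneous vector, of the last nonvanishing power of
    [ad y]: its own adjoint has cube zero by [cube], and Kleinecke's theorem makes it
    quasinilpotent, against [descent]. *)
Lemma hom_central e y : Lg e y -> (forall x, Lsum x -> adq y x) -> forall x, Lsum x -> br y x = 0%V.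
Proof.
move=> hy hq x hx; have hyL := Lg_sum hy.
have [[|[|p]] [hp hmin]] := nat_min (P := fun k => forall x, Lsum x -> (adm y ^+ k)%V x = 0%V) (ad_nil hyL hq).
by have := hp _ (brL hyL hx).
by have := hp x hx; rewrite -brE.
exfalso; have [be [b [hb w0]]] : exists g b, Lg g b /\ (adm y ^+ p.+1)%V b <> 0%V.
  apply: (@Lsum_wit (BB X) (fun b => (adm y ^+ p.+1)%V b)); [exact: blD|exact: blZ|].
  apply: contrapT => h; have : (p.+2 <= p.+1)%N; last by rewrite ltnn.
  by apply: hmin => z hz; apply: contrapT => h1; apply: h; exists z.
have hbL := Lg_sum hb; apply: (@descent (e *+ p.+1 + be)%V ((adm y ^+ p.+1)%V b)); split; first exact: gr_ad.
split=> //; split; last exact: (cube fX lL).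
rewrite exprS blME -brE; apply: kleinecke; have := hp b hbL.
by rewrite exprS blME exprS blME -!brE.
Qed.
Lemma central0 a : Lsum a -> qn a -> (forall x, Lsum x -> br a x = 0%V) -> a = 0%V.
Proof.
move=> ha qa h; apply: BLext => x0; apply: contrapT => hx0.
have x00 : x0 <> 0%V by move=> e; apply: hx0; rewrite e bl0.
have lT : @lsub X (fun _ => True) by [].
have [x [c [_ [xn ex]]]] := @fd_eig X (fun=> True) a x0 lT fX (fun _ _ => I) I x00.
have iN : invs Lsum (fun z : X => a z = 0%V).
  split; first exact: csub_preB (csub0 X).
  move=> b hb z hz; have := congr1 (fun T : BL X => T z) (h b hb).
  by rewrite brX blBE !blME hz bl0 subr0 bl0E.
case: (iL iN) => hN; last by apply: hx0; rewrite hN.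
by apply: (xn); apply: hN; rewrite ex (qn_eig qa ex xn) scale0r.
Qed.
Lemma hom_qn0 e y : Lg e y -> qn y -> y = 0%V.
Proof.
move=> hy qy; apply: central0 => //; first exact: Lg_sum hy.
by apply: (hom_central hy) => x _; exact: qn_adq.
Qed.
(** The hypothesis makes the commutator central. So it commutes with [a], is quasinilpotent by
    Kleinecke's theorem, and vanishes by [hom_qn0]. *)
Lemma cp_comm g d a b : cp g d -> Lg g a -> Lg d b -> br a b = 0%V.
Proof.
move=> gd ha hb; have hab := gr_br ha hb; apply: (hom_qn0 hab); apply: kleinecke.
by rewrite brC (hom_central hab (hc gd ha hb)) ?oppr0 //; exact: Lg_sum ha.
Qed.
(** The last bracket before the vanishing one commutes with [v], so it is quasinilpotent and
    homogeneous, hence zero; this lowers [j]. *)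
Lemma desc_comm j e h v y : Lg e v -> Lg h y -> (adm v ^+ j.+1)%V y = 0%V -> br v y = 0%V.
Proof.
move=> hv hy; elim: j => [|j IH]; first by rewrite -brE.
rewrite exprS blME exprS blME -!brE => h2; apply: IH; rewrite exprS blME -brE.
apply: (hom_qn0 (e := e + (e *+ j + h))%V); first by apply: gr_br => //; exact: gr_ad.
exact: kleinecke.
Qed.
Theorem fd_comm a b : Lsum a -> Lsum b -> br a b = 0%V.
Proof.
have hom e h v y : Lg e v -> Lg h y -> br v y = 0%V.
  move=> hv hy; have [cc|nc] := pselect (cp e h); first exact: cp_comm hv hy.
  have [|i [j [i0 eij]]] := @cyc_rel G e h; first by move=> hs; apply: nc; right.
  (* By the choice of [i] and [j], bracketing [v] with [z] one time less than [i] gives the degree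
     opposite to [z], so the next bracket vanishes. [desc_comm] then yields first [br z v = 0] and
     from this [br v y = 0]. *)
  pose z := (adm v ^+ j)%V y; have hz : Lg (e *+ j + h)%V z by exact: gr_ad.
  have zv : br z v = 0%V.
    apply: (@desc_comm i.-1 _ _ z v hz hv).
    case: i i0 eij => [//|i] _ eij; rewrite exprS blME -brE.
    apply: (cp_comm _ hz (gr_ad i hz hv)); left; rewrite addrA -mulrS [(e *+ j + h)%V]addrC addrC //.
  by apply: (desc_comm (j := j) hv hy); rewrite exprS blME -brE brC zv oppr0.
move=> ha; move: b; apply: Lsum_ind.
  split; first by rewrite br0r.
  by split=> [x y hx hy|c x hx]; rewrite ?brDr ?brZr hx ?hy ?addr0 ?scaler0.
move=> d b hb; move: a ha; apply: Lsum_ind.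
  split; first by rewrite br0l.
  by split=> [x y hx hy|c x hx]; rewrite ?brDl ?brZl hx ?hy ?addr0 ?scaler0.
by move=> g a ha; exact: hom ha hb.
Qed.
End Graded.
(** * Convolution operators *)
Section XG.
Variables (X : CBanach) (G : FinAbGroup).
Notation gs := (genum G).
Let n := size gs.
Let ith i : G := nth 0%V gs i.
Let nx (f : G -> X) := rsum (fun i => nrm (f (ith i))) n.
Lemma gs_ith g : exists i, (i < n)%N /\ ith i = g.
Proof. by exists (index g gs); rewrite index_mem /ith nth_index genum_all. Qed.
Lemma nx_le f g : nrm (f g) <= nx f.
Proof.
have [i [hi <-]] := gs_ith g; rewrite /nx; elim: n hi => [//|m IH] /=.
have p : 0 <= rsum (fun i => nrm (f (ith i))) m by apply: rsum_ge0; pos.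
have p0 := nrm_ge0 (f (ith m)).
by rewrite ltnS leq_eqVlt => /orP [/eqP ->|/IH]; lra.
Qed.
Lemma nx_ub f M : (forall g, nrm (f g) <= M) -> nx f <= INR n * M.
Proof. by move=> h; rewrite -rsum_cst; apply: rsum_le. Qed.
Definition XG : CBanach.
refine (@Build_CBanach (G -> X) (fun f h g => (f g + h g)%V) (fun=> 0%V) (fun f g => (- f g)%V)
  (fun c f g => (c *: f g)%V) nx _ _ _ _ _ _ _ _ _ _ _ _).
- by move=> f h k; apply/funext => g; rewrite addrA.
- by move=> f h; apply/funext => g; rewrite addrC.
- by move=> f; apply/funext => g; rewrite addr0.
- by move=> f; apply/funext => g; rewrite addrN.
- by move=> f; apply/funext => g; exact: scale1r.
- by move=> a b f; apply/funext => g; exact: scalerA.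
- by move=> a f h; apply/funext => g; exact: scalerDr.
- by move=> a b f; apply/funext => g; exact: scalerDl.
- move=> f h; apply/funext => g; apply: nrm_eq0; apply: Rle_antisym; last exact: nrm_ge0.
  by rewrite -h; exact: nx_le.
- by move=> f h; rewrite /nx -rsumD; apply: rsum_le => i _; exact: nrmD.
- by move=> a f; rewrite /nx -rsumZ; congr (rsum _ _); apply/funext => i; exact: nrmZ.
move=> u hu; have hl g : exists l, cvg (fun k => u k g) l.
  apply: cauchy_cvg => e /hu [N hN]; exists N => i j hi hj; apply: Rle_lt_trans (hN i j _ _); try exact/leP.
  exact: (nx_le (fun g => u i g - u j g)%V).
exists (fun g => sval (cid (hl g))) => e e0.
have e1 : 0 < e / (INR n + 1) by apply: Rdiv_lt_0_compat => //; have := pos_INR n; lra.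
have [N hN] : exists N, forall k, (N <= k)%N -> forall g, g \in gs -> nrm (u k g - sval (cid (hl g)))%V < e / (INR n + 1).
  elim: gs => [|g s [N hN]]; first by exists 0%N.
  have [M hM] := svalP (cid (hl g)) _ e1; exists (maxn N M) => k; rewrite geq_max => /andP [h1 h2] d.
  by rewrite inE => /orP [/eqP ->|/hN]; [exact: hM|exact].
exists N => k /leP hk; apply: (Rle_lt_trans _ (INR n * (e / (INR n + 1)))).
  by apply: (nx_ub (f := fun g => u k g - sval (cid (hl g)))%V) => g; left; apply: hN => //; exact: genum_all.
have e2 : (INR n + 1) * (e / (INR n + 1)) = e by rfield; have := pos_INR n; lra.
lra.
Defined.
Implicit Types (xi : XG) (T S A : G -> BL X) (g h d : G).
Lemma ev_le xi g : nrm (xi g) <= nrm xi. Proof. exact: nx_le. Qed.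
Lemma xg_ub xi M : (forall g, nrm (xi g) <= M) -> nrm xi <= INR n * M. Proof. exact: nx_ub. Qed.
Lemma gsum_perm (V : nmodType) (F : G -> V) (f : G -> G) : injective f -> (\sum_(g <- gs) F (f g) = \sum_(g <- gs) F g)%V.
Proof.
move=> hf; rewrite -(big_map f xpredT F); apply: perm_big; apply: uniq_perm.
by rewrite map_inj_uniq ?genum_uniq.
exact: genum_uniq.
have sub : {subset map f gs <= gs} by move=> x _; exact: genum_all.
have um : uniq (map f gs) by rewrite map_inj_uniq ?genum_uniq.
by have [] := uniq_min_size um sub (ltac:(by rewrite size_map)).
Qed.
Lemma gsum1 (V : nmodType) (F : G -> V) g : (forall d, d <> g -> F d = 0%V) -> (\sum_(d <- gs) F d = F g)%V.
Proof. by move=> h; rewrite (bigD1_seq g) ?genum_all ?genum_uniq //= big1 ?addr0 // => d /eqP /h. Qed.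
Lemma nrm_gsum (Y : CBanach) (F : G -> Y) M : (forall g, nrm (F g) <= M) -> nrm (\sum_(g <- gs) F g)%V <= INR n * M.
Proof.
move=> h; rewrite (big_nth 0%V) big_mkord; via (nrm_sum (fun i => F (ith i)) n).
by rewrite -rsum_cst; apply: rsum_le.
Qed.
Lemma xg_sumE I (r : seq I) (F : I -> XG) g : (\sum_(i <- r) F i)%V g = (\sum_(i <- r) F i g)%V.
Proof. by elim: r => [|i r IH]; rewrite ?big_nil // !big_cons -IH. Qed.
Definition inj h (x : X) : XG := fun g => if g == h then x else 0%V.
Lemma inj_le h x : nrm (inj h x) <= INR n * nrm x.
Proof. by apply: xg_ub => g; rewrite /inj; case: eqP; [lra|rewrite nrm0; pos]. Qed.
Lemma injD h x y : inj h (x + y)%V = (inj h x + inj h y)%V.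
Proof. by apply/funext => g; rewrite /inj -[RHS]/((if _ then _ else _) + (if _ then _ else _))%V; case: eqP; rewrite ?addr0. Qed.
Lemma injZ h (c : C) x : inj h (c *: x)%V = (c *: inj h x)%V.
Proof. by apply/funext => g; rewrite /inj -[RHS]/(c *: (if _ then _ else _))%V; case: eqP; rewrite ?scaler0. Qed.
Lemma inj_dec xi : xi = (\sum_(h <- gs) inj h (xi h))%V.
Proof.
apply/funext => g; rewrite xg_sumE (gsum1 (g := g)) /inj ?eqxx // => d.
by case: eqP => [->|].
Qed.
(** Convolution with an operator-valued function on [G]. The function is recovered by [cop_inj], so
    that a graded sum becomes direct. *)
Definition copf T xi : XG := fun h => (\sum_(g <- gs) T g (xi (h - g)%V))%V.
Lemma copP T : linear (copf T) /\ bounded (copf T).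
Proof.
have tb0 : exists M, 0 <= M /\ forall g, nrm (T g) <= M.
  exists (rsum (fun i => nrm (T (ith i))) n); split; first by apply: rsum_ge0; pos.
  move=> g; have [i [hi <-]] := gs_ith g.
  apply: Rle_trans (rsum_mono (fun i => nrm_ge0 (T (ith i) : BB X)) hi) => /=.
  by have := rsum_ge0 i (fun i => nrm_ge0 (T (ith i) : BB X)); lra.
split; first split.
move=> x y; apply/funext => h; rewrite -[RHS]/(copf T x h + copf T y h)%V -big_split.
  by apply: eq_bigr => g _; exact: blD.
move=> c x; apply/funext => h; rewrite -[RHS]/(c *: copf T x h)%V scaler_sumr.
  by apply: eq_bigr => g _; exact: blZ.
have [M []] := tb0; exists (INR n * (INR n * M)) => x.
rewrite Rmult_assoc; apply: (xg_ub (xi := copf T x)) => h; rewrite Rmult_assoc; apply: nrm_gsum => g.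
by via (bnle _ _); apply: Rmult_le_compat (ev_le _ _); pos.
Qed.
Definition cop T : BL XG := BLmk (copP T).
Lemma copE T xi h : cop T xi h = (\sum_(g <- gs) T g (xi (h - g)%V))%V. Proof. by []. Qed.
Lemma cop_inj T x g : cop T (inj 0%V x) g = T g x.
Proof.
rewrite copE (gsum1 (g := g)) /inj ?subrr ?eqxx // => d hd.
by case: eqP => [/eqP|_]; [rewrite subr_eq0 => /eqP e; case: hd|exact: bl0].
Qed.
Lemma cop_eq T S : (forall g, T g = S g) -> cop T = cop S. Proof. by move=> h; congr cop; apply/funext. Qed.
Lemma copD T S : cop (fun g => T g + S g)%V = (cop T + cop S)%V.
Proof.
apply: BLext => xi; apply/funext => h; rewrite -[RHS]/(cop T xi h + cop S xi h)%V -big_split.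
pos.
Qed.
Lemma copZ (c : C) T : cop (fun g => c *: T g)%V = (c *: cop T)%V.
Proof.
apply: BLext => xi; apply/funext => h; rewrite -[RHS]/(c *: cop T xi h)%V scaler_sumr.
pos.
Qed.
Lemma copM T S : (cop T * cop S)%V = cop (fun k => \sum_(g <- gs) T g * S (k - g)%V)%V.
Proof.
apply: BLext => xi; apply/funext => h; rewrite blME !copE.
under eq_bigr do rewrite bl_sum.
under [RHS]eq_bigr do rewrite bl_sumE.
rewrite [RHS]exchange_big; apply: eq_bigr => g _.
rewrite -[RHS](gsum_perm _ (addrI g)); apply: eq_bigr => d.
by rewrite [(g + d)%V]addrC addrK opprD addrA (addrAC h).
Qed.
(** Reindexing the second product by [g |-> k - g] pairs the same degrees in both products; hence
    families adapted to a grading give a Lie algebra of convolutions. *)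
Lemma cop_br T S : br (cop T) (cop S) = cop (fun k => \sum_(g <- gs) br (T g) (S (k - g)%V))%V.
Proof.
rewrite brX !copM.
have -> : cop (fun k => \sum_(g <- gs) S g * T (k - g)%V)%V = cop (fun k => \sum_(g <- gs) S (k - g)%V * T g)%V.
  apply: cop_eq => k; rewrite -[RHS](gsum_perm _ (f := fun g => (k - g)%V)); last by move=> x y /addrI /oppr_inj.
  by apply: eq_bigr => g; have -> : (k - (k - g) = g)%V by rewrite opprB addrC subrK.
rewrite -scaleN1r -copZ -copD; apply: cop_eq => k; rewrite scaleN1r -sumrB.
by apply: eq_bigr => g; rewrite brX.
Qed.
Definition sg T : BL X := (\sum_(g <- gs) T g)%V.
(** Summation intertwines [cop T] with the sum [sg T] of the family, by [Sm_cop]; this carries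
    results from [X^G] back to [X]. *)
Definition Sm xi : X := (\sum_(h <- gs) xi h)%V.
Lemma Sm_cop T xi : Sm (cop T xi) = sg T (Sm xi).
Proof.
rewrite /Sm.
rewrite exchange_big bl_sumE; apply: eq_bigr => g.
by rewrite bl_sum -[RHS](gsum_perm _ (f := fun h => (h - g)%V)) // => x y /addIr.
Qed.
Lemma Sm_inj x : Sm (inj 0%V x) = x.
Proof. by rewrite /Sm (gsum1 (g := 0%V)) /inj ?eqxx // => d /eqP /negbTE ->. Qed.
Lemma Sm_le xi : nrm (Sm xi) <= INR n * nrm xi. Proof. by apply: nrm_gsum; exact: ev_le. Qed.
Lemma SmD x y : Sm (x + y)%V = (Sm x + Sm y)%V. Proof. by rewrite -big_split. Qed.
Lemma SmZ (c : C) x : Sm (c *: x)%V = (c *: Sm x)%V. Proof. by rewrite scaler_sumr. Qed.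
Lemma Sm_bexp T xi : Sm (bexp (cop T) xi) = bexp (sg T) (Sm xi).
Proof.
have Sm_B x y : Sm (x - y)%V = (Sm x - Sm y)%V by rewrite -scaleN1r SmD SmZ scaleN1r.
have h1 := bn_cvg xi (serP (ec_summ (cop T))); have h2 := bn_cvg (Sm xi) (serP (ec_summ (sg T))).
apply: (cvg_uniq _ h2); have := cvg_lip (f := Sm) (M := INR n) _ h1.
have lp x y : nrm (Sm x - Sm y)%V <= INR n * nrm (x - y)%V by rewrite -Sm_B; exact: Sm_le.
move=> /(_ lp) h3 e e0; have [N hN] := h3 e e0; exists N => m hm; have := hN m hm.
rewrite !bl_sumE (_ : Sm _ = \sum_(i < m) ec (sg T) i (Sm xi))%V //.
elim: m {hm} => [|m IH]; first by rewrite !big_ord0 /Sm big1.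
rewrite !big_ord_recr SmD IH; congr (_ _)%V; rewrite SmZ; congr (_ _)%V.
by elim: m {IH} => [|m IH]; rewrite // !exprS Sm_cop IH.
Qed.
Lemma sg_cop T x : sg T x = Sm (cop T (inj 0%V x)). Proof. by rewrite Sm_cop Sm_inj. Qed.
Lemma cop_le T g : nrm (T g) <= INR n * nrm (cop T).
Proof.
apply: bn_bound => [|x]; first pos.
rewrite -cop_inj; via (ev_le _ _); via (bnle _ _).
via (Rmult_le_compat_l _ _ _ (nrm_ge0 (cop T)) (inj_le 0%V x)); lra.
Qed.
Lemma cop_dec T xi : cop T xi = (\sum_(h <- gs) \sum_(g <- gs) inj h (T g (xi (h - g)%V)))%V.
Proof.
rewrite {1}(inj_dec (cop T xi)); apply: eq_bigr => h; rewrite copE.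
elim: gs => [|g s IH]; last by rewrite !big_cons injD IH.
by rewrite !big_nil -(scale0r 0%V) injZ !scale0r.
Qed.
Lemma tb_bigsum (Y : CBanach) I (s : seq I) (A : I -> Y -> Prop) : (forall i, tb (A i)) ->
  tb (fun z => exists f : I -> Y, (forall i, A i (f i)) /\ z = (\sum_(i <- s) f i)%V).
Proof.
move=> h; elim: s => [|i s IH].
  by apply: tb_mono (@tb1 Y 0%V) => z [f []]; rewrite big_nil.
apply: tb_mono (tb_add (h i) IH) => z [f [hf ->]]; exists (f i), (\sum_(j <- s) f j)%V.
by rewrite big_cons; do 2 (split=> //); exists f.
Qed.
Lemma cop_cpt T : (forall g, cpt (T g)) -> cpt (cop T).
Proof.
move=> hT; pose A h g := fun z => exists y, (exists x, nrm x <= 1 /\ y = T g x) /\ z = inj h y.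
have tA h g : tb (A h g).
  apply: tb_lip (hT g) => x y.
  by have -> : (inj h x - inj h y = inj h (x - y))%V; [rewrite -!scaleN1r injD injZ|exact: inj_le].
apply: tb_mono (tb_bigsum gs (fun h => tb_bigsum gs (tA h))) => z [xi [h1 ->]].
exists (fun h => \sum_(g <- gs) inj h (T g (xi (h - g)%V)))%V; split; last exact: cop_dec.
move=> h; exists (fun g => inj h (T g (xi (h - g)%V))); split=> // g.
by exists (T g (xi (h - g)%V)); split=> //; exists (xi (h - g)%V); split=> //; apply: Rle_trans (ev_le _ _) h1.
Qed.
Lemma cop_frk T : (forall g, frk (T g)) -> frk (cop T).
Proof.
move=> hT; have hl g : exists l, forall x, span l (T g x) by exact: frkE.
pose l g := sval (cid (hl g)); have lP g := svalP (cid (hl g)).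
apply: (frkP (l := flatten [seq flatten [seq map (inj h) (l g) | g <- gs] | h <- gs])) => xi.
rewrite cop_dec; apply: lsub_sum (span_lsub _) _ => h _; apply: lsub_sum (span_lsub _) _ => g _.
apply: (span_sub (l := map (inj h) (l g))); last by apply: span_map (lP g _); [exact: injD|exact: injZ].
move=> x hx; apply/flattenP; exists (flatten [seq map (inj h) (l g) | g <- gs]).
  by apply: map_f; exact: genum_all.
by apply/flattenP; exists (map (inj h) (l g)) => //; apply: (map_f (fun g => map (inj h) (l g))); exact: genum_all.
Qed.
Lemma frk_cop T g : frk (cop T) -> frk (T g).
Proof.
move=> /frkE [l hl]; apply: (frkP (l := map (fun xi => xi g) l)) => x.
by rewrite -cop_inj; apply: (span_map (f := fun xi => xi g)).
Qed.
End XG.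
(** * Irreducible graded Lie algebras of compact operators *)
Lemma alg_comm (X : CBanach) (M : BL X -> Prop) u v : (forall a b, M a -> M b -> br a b = 0%V) ->
  alg M u -> alg M v -> br u v = 0%V.
Proof.
move=> h hu hv; have comb (w : BL X) : (forall a, M a -> br w a = 0%V) -> forall u, alg M u -> br w u = 0%V.
  move=> hw u'; elim=> [//||p q _ h1 _ h2|c p _ h1|p q _ h1 _ h2].
  by rewrite br0r.
  by rewrite brDr h2 addr0.
  by rewrite brZr h1 scaler0.
  have -> : br w (p * q)%V = (br w p * q + p * br w q)%V by rewrite !brX; bvec.
    by rewrite h1 h2 mul0r mulr0 addr0.
apply: (comb u _ v hv) => b hb; rewrite brC; apply/eqP; rewrite oppr_eq0; apply/eqP.
by mono.
Qed.
Lemma irred_mono (X : CBanach) (M M' : BL X -> Prop) : (forall a, M a -> M' a) -> irred M -> irred M'.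
Proof. by move=> h iM S [cS hS]; apply: iM; split=> //; mono. Qed.
(** A spanning list of the range of [T] may leave [hi], where [pi] is not linear; it is replaced by
    one of the range inside [hi]. *)
Lemma frk_ind (X : CBanach) (p : spair X) (T : BL X) : stab p T -> frk T -> frk (ind p T).
Proof.
move=> sT [l hl]; have hh := proj1 (hiP p).
pose W y := hi p y /\ exists x, y = T x.
have lW : lsub W.
  split; first by split; [exact: lsub0 hh|exists 0%V; rewrite bl0].
  split=> [x y [h1 [x' e1]] [h2 [y' e2]]|c x [h1 [x' e1]]].
    by split; [exact: lsubD h2|exists (x' + y')%V; rewrite e1 e2 blD].
  by split; [exact: lsubZ h1|exists (c *: x')%V; rewrite e1 blZ].
have [k hk] : exists k, dle W k by apply: fd_dle; exists l => y []; mono.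
have [l' [_ hl']] := dle_span lW hk.
apply: (frkP (l := map (pi p) l')) => q; have [x [hx <-]] := pi_ex q; rewrite indE //.
have : span l' (T x) by apply/hl'; split; [exact: (proj1 sT)|exists x].
have : forall v, v \in l' -> hi p v.
  by move=> v hv; have /hl' [] : span l' v by exact: span_in.
move: (T x); elim: l' {hl'} => [|v l' IH] y hv; first move=> -> //.
move=> [a [z [hz ->]]]; have hvv : hi p v by apply: hv; rewrite inE eqxx.
have hv' w : w \in l' -> hi p w by move=> hw; apply: hv; rewrite inE hw orbT.
exists a, (pi p z); split; first mono.
rewrite piD ?piZ //; first exact: lsubZ.
by apply: (span_min hh hv').
Qed.
Lemma br_ind (X : CBanach) (p : spair X) a b : stab p a -> stab p b ->
  stab p (br a b) /\ ind p (br a b) = br (ind p a) (ind p b).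
Proof.
rewrite !brX; split; [apply: stabB|rewrite indB ?indM //]; exact: stabM.
Qed.
Lemma adq_ind (X : CBanach) (p : spair X) a x : stab p a -> stab p x -> adq a x -> adq (ind p a) (ind p x).
Proof.
move=> sa sx h e /h [D hD]; exists D => m; apply: Rle_trans (hD m).
suff [_ <-] : stab p ((adm a ^+ m)%V x) /\ ind p ((adm a ^+ m)%V x) = (adm (ind p a) ^+ m)%V (ind p x).
  exact: nrm_ind.
elim: m => [|m [s e']] //.
by rewrite !exprS !blME -!brE -e'; exact: br_ind.
Qed.
Lemma graded_ind (X : CBanach) (G : FinAbGroup) (Lg : G -> BL X -> Prop) p : graded Lg ->
  graded (fun g => imf p (fun x => Lg g x /\ stab p x)).
Proof.
move=> [l1 l2]; split=> [|g d _ _ [x [[hx sx] ->]] [y [[hy sy] ->]]]; last first.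
  exists (x * y - y * x)%V; rewrite indB ?indM //; try exact: stabM.
  by split=> //; split; [mono|apply: stabB; exact: stabM].
split; first by exists 0%V; rewrite ind0; split=> //; split; [exact: lsub0 (l1 g)|exact: stab0].
split=> [_ _ [x [[hx sx] ->]] [y [[hy sy] ->]]|c _ [x [[hx sx] ->]]].
  by exists (x + y)%V; rewrite indD //; split=> //; split; [exact: (lsubD (l1 g))|exact: stabD].
by exists (c *: x)%V; rewrite indZ //; split=> //; split; [exact: (lsubZ _ (l1 g))|exact: stabZ].
Qed.
Section Irr.
Variables (X : CBanach) (G : FinAbGroup) (Lg : G -> BL X -> Prop).
Hypotheses (gr : graded Lg) (kL : forall a, Lsum Lg a -> cpt a) (iL : irred (Lsum Lg)) (hc : gcond Lg).
Implicit Types (g h d e : G) (a b c x y z : BL X) (T : G -> BL X).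
Notation gs := (genum G).
Definition cLg g := cl (Lg g).
Definition Fg g x := cLg g x /\ frk x.
Lemma gr_cl : graded cLg.
Proof.
split=> [g|g d a b /cl_seq [u [hu cu]] /cl_seq [v [hv cv]]]; first exact: (proj1 (@cl_csub (BB X) _ (proj1 gr g))).
have := cvgB (bcvgM cu cv) (bcvgM cv cu); apply: cvg_cl => n.
by apply: cl_incl; exact: (proj2 gr).
Qed.
Lemma cLg_csub g : csub (cLg g). Proof. exact: cl_csub (proj1 gr g). Qed.
Lemma gr_F : graded Fg.
Proof.
have [l1 l2] := gr_cl; split=> [|g d a b [a1 a2] []]; last first.
  by split; [mono|apply: frkB; exact: frkMl].
split; first by split; [exact: lsub0 (l1 g)|exact: frk0].
split=> [a b [a1 a2] []|c a []]; split.
exact: (lsubD (l1 g)).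
exact: frkD.
exact: (lsubZ _ (l1 g)).
exact: frkZ.
Qed.
(** The range of [P] is closed, invariant and nonzero. *)
Lemma comm_fd P : frk P -> P <> 0%V -> (forall x, Lsum Lg x -> (P * x = x * P)%V) -> fd (fun _ : X => True).
Proof.
move=> fP P0 h; have iN : invs (Lsum Lg) (fun y : X => exists x : X, y = P x).
  split; first exact: fd_csub (range_lsub P) fP.
  by move=> a ha y [x ->]; exists (a x); rewrite -!blME h.
case: (iL iN) => hN; last by have [l hl] := fP; exists l; mono.
by case: P0; apply: BLext => x; apply: hN; exists x.
Qed.
(** A closed space of operators on [X^G], because [cop_le] bounds each component by the whole; [t8]
    requires such closedness. *)
Let V W := exists T, (forall g, cLg g (T g)) /\ W = cop T.
Lemma V_lie : lie V.
Proof.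
have [l1 l2] := gr_cl; split; first split.
exists (fun=> 0%V); split=> [g|]; first exact: lsub0.
  by rewrite -(scale0r (cop (fun=> 0%V : BL X))) -copZ; rewrite scaler0.
split=> [_ _ [T [hT ->]] [S [hS ->]]|c _ [T [hT ->]]].
    by exists (fun g => T g + S g)%V; rewrite copD; split=> // g; exact: (lsubD (l1 g)).
  by exists (fun g => c *: T g)%V; rewrite copZ; split=> // g; exact: (lsubZ _ (l1 g)).
move=> _ _ [T [hT ->]] [S [hS ->]]; rewrite -brX cop_br.
exists (fun k => \sum_(g <- gs) br (T g) (S (k - g)%V))%V; split=> // k.
apply: (lsub_sum _ (l1 k)) => g; rewrite brX.
by have := l2 g (k - g)%V _ _ (hT g) (hS (k - g)%V); rewrite addrC subrK.
Qed.
Lemma V_csub : @csub (BB (XG X G)) V.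
Proof.
split; first exact: (proj1 V_lie).
move=> u W hu cu; pose N := INR (size gs).
have [T hT] := choice hu.
have hl g : exists l, cvg (fun k => T k g) l.
  apply: cauchy_cvg => e e0; have n0 : 0 <= N := pos_INR _.
  have [M hM] := cvg_cauchy cu (ltac:(pos) : 0 < e / (N + 1)).
  exists M => i j hi hj; have := hM i j; rewrite (proj2 (hT i)) (proj2 (hT j)) => h.
  have e1 : (cop (T i) - cop (T j) = cop (fun g => T i g - T j g))%V.
    by rewrite -scaleN1r -copZ -copD; apply: cop_eq => d; rewrite scaleN1r.
  rewrite e1 in h; apply: Rle_lt_trans (cop_le (fun g => T i g - T j g)%V g) _.
  have e2 : (N + 1) * (e / (N + 1)) = e by rfield; lra.
  have e3 : N * nrm (cop (fun g => T i g - T j g)%V) <= N * (e / (N + 1)) by mono.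
  have : 0 < e / (N + 1) by pos.
  rewrite -/N; lra.
pose T' g := sval (cid (hl g)); have cT g : cvg (fun k => T k g) (T' g) := svalP (cid (hl g)).
exists T'; split=> [g|]; first by apply: (csub_cvg (cLg_csub g)) (cT g) => k; exact: (proj1 (hT k)).
apply: BLext => xi; apply/funext => h.
have c1 : cvg (fun k => u k xi h) (W xi h).
  move=> e /(bn_cvg xi cu) [M hM]; exists M => k hk; apply: Rle_lt_trans (hM k hk).
  exact: (ev_le (u k xi - W xi)%V).
apply: (cvg_uniq c1).
have cs (s : seq G) : cvg (fun k => \sum_(g <- s) T k g (xi (h - g)%V))%V (\sum_(g <- s) T' g (xi (h - g)%V))%V.
  elim: s => [|g s IH]; first by rewrite big_nil; apply: cvg_eq (cvg_cst _) => k; rewrite big_nil.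
  rewrite big_cons; apply: cvg_eq (cvgD (bn_cvg _ (cT g)) IH) => k; by rewrite big_cons.
by apply: cvg_eq (cs gs) => k; rewrite (proj2 (hT k)).
Qed.
Lemma sg_br T S : sg (fun k => \sum_(g <- gs) br (T g) (S (k - g)%V))%V = br (sg T) (sg S).
Proof.
apply: BLext => x; rewrite sg_cop -cop_br !brX -scaleN1r SmD SmZ scaleN1r !Sm_cop Sm_inj //.
Qed.
Lemma ad_sym A T m : (forall g, Lg g (A g)) -> (forall g, cLg g (T g)) -> exists S, (forall g, cLg g (S g)) /\
  (adm (cop A) ^+ m)%V (cop T) = cop S /\ (adm (sg A) ^+ m)%V (sg T) = sg S.
Proof.
move=> hA hT; elim: m => [|m [S [h1 [h2 h3]]]]; first by exists T.
exists (fun k => \sum_(g <- gs) br (A g) (S (k - g)%V))%V; split=> [k|].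
  apply: (lsub_sum _ (proj1 gr_cl k)) => g; rewrite brX.
  by have := proj2 gr_cl g (k - g)%V _ _ (cl_incl (hA g)) (h1 (k - g)%V); rewrite addrC subrK.
by rewrite !exprS !blME h2 h3 -!brE cop_br sg_br.
Qed.
(** Without nonzero finite-rank operators in the closures there would be none in [V], since
    components of a finite-rank convolution have finite rank. By [t8] the adjoint of [cop A] would
    then be quasinilpotent on [V], and summing components would give the same for [ad a] at every
    [y]. *)
Lemma fin_hom a : Lsum Lg a -> ~ (forall y, Lsum Lg y -> adq a y) -> exists g F, Fg g F /\ F <> 0%V.
Proof.
move=> [A [hA ea]] hn; apply: contrapT => hno; apply: hn => y [Y [hY ->]] e e0.
have cA : cpt (cop A) by apply: cop_cpt => g; apply: kL; exact: (Lg_sum gr (hA g)).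
have adV v : V v -> V (cop A * v - v * cop A)%V.
  apply: (proj2 V_lie); exists A; split=> // g; exact: cl_incl.
have nV v : V v -> frk v -> v = 0%V.
  move=> [T [hT ->]] fv; rewrite -(scale0r (cop T)) -copZ; apply: cop_eq => g; rewrite scale0r.
  apply: contrapT => h; apply: hno; exists g, (T g); split=> //; split; [pos|exact: frk_cop fv].
have [D hD] := t8 cA V_csub adV nV e0; pose N := INR (size gs); have N0 : 0 <= N := pos_INR _.
exists (N * (N * (D * nrm (cop Y)))) => m; have hcY g : cLg g (Y g) by exact: cl_incl.
have [S [_ [h2 h3]]] := ad_sym m hA hcY.
rewrite ea h3; mid (N * (N * nrm (cop S))).
  by apply: nrm_gsum; exact: cop_le.
have := hD m (cop Y) (ex_intro _ Y (conj hcY erefl)); rewrite h2 => h4.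
mid (N * (N * (D * e ^ m * nrm (cop Y)))); last lra.
by mono.
Qed.
(** The conjugation is performed on [X^G], where it keeps the closed Lie algebra [V] and finite
    rank, and is then brought back by [Sm]. On [X] itself finite rank of the sum would say nothing
    about its summands. *)
Lemma conj_sym b T : Lsum Lg b -> (forall g, cLg g (T g)) -> exists S, (forall g, cLg g (S g)) /\
  ((forall g, frk (T g)) -> forall g, frk (S g)) /\ (bexp b * sg T * bexp (- b))%V = sg S.
Proof.
move=> [B [hB ->]] hT; have vB : V (cop B) by exists B; split=> // g; exact: cl_incl.
have [S [hS eS]] := lie_bexp V_csub V_lie vB (ex_intro _ T (conj hT erefl)).
exists S; split=> //; rewrite bexp_adm in eS; split=> [fT g|].
  by apply: frk_cop; rewrite -eS; apply: frkMr; apply: frkMl; exact: cop_frk.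
apply: BLext => x; rewrite [RHS]sg_cop -eS Sm_bexp Sm_cop.
have -> : (- cop B = cop (fun g => - B g))%V.
  by rewrite -scaleN1r -copZ; apply: cop_eq => g; rewrite scaleN1r.
by rewrite Sm_bexp Sm_inj /sg sumrN.
Qed.
Hypothesis nfd : ~ fd (fun _ : X => True).
(** A commutator in [L] that is not quasinilpotent would have, by [p6], a finite-rank projection
    commuting with all of [L], which forces finite dimension. [qn_lim] extends this to the
    closures. *)
Lemma qn_cp g d x y : cp g d -> cLg g x -> cLg d y -> qn (br x y).
Proof.
have kc g' z : Lg g' z -> cpt z by move=> hz; apply: kL; exact: (Lg_sum gr hz).
have qLg x' y' : cp g d -> Lg g x' -> Lg d y' -> qn (br x' y').
  move=> gd hx hy; apply: contrapT => hq; apply: nfd.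
  have kb : cpt (br x' y') by apply: kL; exact: (Lg_sum gr (gr_br gr hx hy)).
  have [P [P0 [cP [PP hP]]]] := p6 kb hq.
  apply: (comm_fd (cpt_idem_frk cP PP) P0) => z hz; apply: hP; exact: hc hx hy _ hz.
move=> gd /cl_seq [u [hu cu]] /cl_seq [v [hv cv]]; rewrite brX.
have cw := cvgB (bcvgM cu cv) (bcvgM cv cu).
apply: (qn_lim _ cw) => [|e e0].
  by apply: cpt_lim cw => k; apply: cptB; apply: cptMl; [exact: kc (hv k)|exact: kc (hu k)].
exists 0%N => k; have := qLg _ _ gd (hu k) (hv k); rewrite brX => q.
by have [D []] := qn_bound q e0; exists D.
Qed.
Let I := Lsum Fg.
Let D1 (d : BL X) := exists x y, I x /\ I y /\ d = br x y.
Lemma I_frk x : I x -> frk x.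
Proof.
apply: Lsum_ind; last by move=> g a [].
by split; [exact: frk0|split=> []; [exact: frkD|exact: frkZ]].
Qed.
Lemma I_alg x : I x -> alg (fun a => exists g, Fg g a) x.
Proof.
apply: Lsum_ind; last by move=> g a ha; apply: alg_in; exists g.
by split; [exact: alg0|split=> []; [exact: algD|exact: algZ]].
Qed.
(** Only finitely many homogeneous finite-rank letters enter [s]; a gap for these letters alone is
    finite-dimensional unless they act as zero on it. *)
Lemma sgp_letters s : sgp D1 s -> exists Ml : seq (BL X), (forall a, a \in Ml -> exists g, Fg g a) /\
  alg (fun a => a \in Ml) s /\ forall p, (forall a, a \in Ml -> stab p a) ->
  (forall a b, a \in Ml -> b \in Ml -> br (ind p a) (ind p b) = 0%V) -> ind p s = 0%V.
Proof.
elim=> [d [x [y [hx [hy ->]]]]|a b _ [l1 [h1 [h2 h3]]] _ [l2 [h4 [h5 _]]]].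
  have [|Ml [h1 h2]] := alg_fins (M := fun a => exists g, Fg g a) (us := [:: x; y]).
    by move=> u; rewrite !inE => /orP [/eqP ->|/eqP ->]; exact: I_alg.
  have ax := h2 x ltac:(by rewrite inE eqxx); have ay := h2 y ltac:(by rewrite !inE eqxx orbT).
  exists Ml; split=> //; split.
    rewrite brX -scaleN1r; apply: algD; first exact: algM.
    by apply: algZ; exact: algM.
  move=> p sp cm; have [sx ix] := alg_imf sp ax; have [sy iy] := alg_imf sp ay.
  rewrite brX indB ?indM //; try exact: stabM.
  rewrite -brX; apply: (alg_comm _ ix iy) => _ _ [a [ha ->]] [b [hb ->]]; mono.
exists (l1 ++ l2); split=> [u|]; first by rewrite mem_cat => /orP [/h1|/h4].
have m1 u : u \in l1 -> u \in l1 ++ l2 by move=> hu; rewrite mem_cat hu.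
have m2 u : u \in l2 -> u \in l1 ++ l2 by move=> hu; rewrite mem_cat hu orbT.
split; first by apply: algM; [exact: alg_mono h2|exact: alg_mono h5].
move=> p sp cm; have [sa _] := alg_imf (fun u hu => sp u (m1 u hu)) h2.
have [sb _] := alg_imf (fun u hu => sp u (m2 u hu)) h5.
rewrite indM // h3 ?mul0r; mono.
Qed.
Lemma sgp_qn s : sgp D1 s -> qn s.
Proof.
move=> hs; have [Ml [h1 [h2 h3]]] := sgp_letters hs.
have fs : frk s by elim: hs => [d [x [y [hx [hy ->]]]]|a b _ fa _ _]; [rewrite brX; apply: frkB; apply: frkMl; exact: I_frk|exact: frkMr].
apply: qn_of_bound => e e0; apply: (gap_pow (frk_cpt fs) h2 e0) => p gp; have [sM _] := gp.
suff -> : ind p s = 0%V by rewrite nrm0; lra.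
have iQ := irred_ind gp.
have hl a : exists l, a \in Ml -> forall q, span l (ind p a q).
  have [ha|] := pselect (a \in Ml); last by exists [::].
  have [g [_ fa]] := h1 a ha; have [l hl] := frkE (frk_ind (sM a ha) fa); by exists l.
pose ls := flatten [seq sval (cid (hl a)) | a <- Ml].
have hls a q : a \in Ml -> span ls (ind p a q).
  move=> ha; apply: span_sub (svalP (cid (hl a)) ha q) => x hx; apply/flattenP.
  by exists (sval (cid (hl a))) => //; apply: (map_f (fun a => sval (cid (hl a)))).
(* The ranges of the letters span an invariant subspace, so by irreducibility either the letters
   vanish on the gap or the gap has finite dimension. *)
have iS : invs (imf p (fun a => a \in Ml)) (span ls).
  by split=> [|_ [a [ha ->]] q _]; [exact: span_csub|mono].
have [hz|hT] := iQ _ iS.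
  have [_ hi] := alg_imf sM h2; apply: (alg_triv _ hi) => _ [a [ha ->]]; apply: BLext.
  mono.
have gq := graded_ind p gr_F; set Lq := (fun => _) in gq.
have Ml_q a : a \in Ml -> Lsum Lq (ind p a).
  by move=> ha; have [g hg] := h1 a ha; apply: (Lg_sum gq (g := g)); exists a; mono.
apply: h3 => // a b' ha hb'; apply: (fd_comm gq); [by exists ls| | |exact: Ml_q|exact: Ml_q].
  by apply: irred_mono iQ => _ [a' [ha' ->]]; mono.
move=> g d gd _ _ [x [[[hx _] sx] ->]] [y [[[hy _] sy] ->]] z _; apply: qn_adq.
have [sb <-] := br_ind sx sy; apply: qn_ind sb _; exact: qn_cp hx hy.
Qed.
(** [nil_theorem] is applied twice. With brackets of finite-rank elements it shows that these
    elements commute. With brackets of them against the closures it shows that they are central: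
    here [[x, [x, c]] = 0] by the first application, so Kleinecke's theorem applies, and the
    brackets commute with each other. A nonzero central finite-rank element contradicts infinite
    dimension. *)
Lemma nfd_qn a : Lsum Lg a -> qn a.
Proof.
move=> ha; apply: contrapT => hq; have a0 : a <> 0%V by move=> e; apply: hq; rewrite e; exact: qn0.
have lL := Lsum_lsub gr; have [l1 l2] := gr_cl.
have [|g0 [F [hF F0]]] := fin_hom ha.
  move=> had; have [P [P0 [cP [PP hP]]]] := p6 (kL ha) hq; apply: nfd.
  by apply: (comm_fd (cpt_idem_frk cP PP) P0) => z hz; apply: hP; exact: had.
pose Cs := Lsum cLg.
have Cc b x : Lsum Lg b -> Cs x -> Cs (bexp b * x * bexp (- b))%V.
  by move=> hb [T [hT ->]]; have [S [hS [_ e]]] := conj_sym hb hT; exists S; split=> //; rewrite -/(sg T) e.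
have Ic b x : Lsum Lg b -> I x -> I (bexp b * x * bexp (- b))%V.
  move=> hb [T [hT ->]]; have [S [hS [fS e]]] := conj_sym hb (fun g => proj1 (hT g)); exists S; split.
    by move=> g; split=> //; apply: fS => d; exact: (proj2 (hT d)).
  by rewrite -/(sg T) e.
have I0 x y : I x -> I y -> br x y = 0%V.
  move=> hx hy; apply: (nil_theorem lL iL ha a0 (D := D1)); last by exists x, y.
  - by move=> d [x' [y' [hx' [hy' ->]]]]; rewrite brX; apply: frkB; apply: frkMl; exact: I_frk.
  - move=> b d hb [x' [y' [hx' [hy' ->]]]]; exists (bexp b * x' * bexp (- b))%V, (bexp b * y' * bexp (- b))%V.
    by split; [exact: Ic|split; [exact: Ic|rewrite br_conj // bexpNl]].
  - exact: sgp_qn.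
have CI c x : Cs c -> I x -> I (br c x).
  move=> [T [hT ->]] [S [hS ->]]; rewrite brX mulr_suml mulr_sumr -sumrB.
  apply: (lsub_sum _ (Lsum_lsub gr_F)) => g _; rewrite mulr_suml mulr_sumr -sumrB.
  apply: (lsub_sum _ (Lsum_lsub gr_F)) => d _; apply: (Lg_sum gr_F (g := g + d)%V); split.
    by apply: l2 => //; exact: (proj1 (hS d)).
  by apply: frkB; [apply: frkMl|apply: frkMr]; exact: (proj2 (hS d)).
pose D2 (d : BL X) := exists c x, Cs c /\ I x /\ d = br c x.
have D2I (d : BL X) : D2 d -> I d by move=> [c [x [hcc [hx ->]]]]; exact: CI.
have sc b s : (forall z, I z -> br b z = 0%V) -> sgp D2 s -> br b s = 0%V.
  move=> hb; elim=> [d /D2I /hb //|p q _ h1 _ h2].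
  have -> : br b (p * q)%V = (br b p * q + p * br b q)%V by rewrite !brX; bvec.
  by rewrite h1 h2 mul0r mulr0 addr0.
have C0 c x : Cs c -> I x -> br c x = 0%V.
  move=> hcc hx; apply: (nil_theorem lL iL ha a0 (D := D2)); last by exists c, x.
  - by move=> d /D2I; exact: I_frk.
  - move=> b d hb [c' [x' [hc' [hx' ->]]]]; exists (bexp b * c' * bexp (- b))%V, (bexp b * x' * bexp (- b))%V.
    by split; [exact: Cc|split; [exact: Ic|rewrite br_conj // bexpNl]].
  move=> s hs; have [] : qn s /\ forall z, I z -> br s z = 0%V; last by [].
  elim: hs => [d hd|p q hp [q1 c1] hq' [q2 c2]].
    split; last by move=> z hz; apply: I0 => //; exact: D2I.
    have [c' [x' [hc' [hx' ->]]]] := hd; rewrite brC -scaleN1r; apply: qnZ; apply: kleinecke.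
    by rewrite (brC x' c') brNr I0 ?oppr0 //; exact: CI.
  split=> [|z hz].
    apply: qn_comm => //; apply/eqP; rewrite -subr_eq0 -brX; apply/eqP; exact: sc.
  have -> : br (p * q)%V z = (p * br q z + br p z * q)%V by rewrite !brX; bvec.
  by rewrite c1 // c2 // mul0r mulr0 addr0.
apply: nfd; apply: (comm_fd (proj2 hF) F0) => x hx; apply/eqP; rewrite eq_sym -subr_eq0 -brX; apply/eqP.
apply: C0; last exact: (Lg_sum gr_F hF).
by move: hx => [T [hT ->]]; exists T; split=> // g; exact: cl_incl.
Qed.
End Irr.
Theorem irr_comm (X : CBanach) (G : FinAbGroup) (Lg : G -> BL X -> Prop) : graded Lg ->
  (forall a, Lsum Lg a -> cpt a) -> irred (Lsum Lg) -> gcond Lg ->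
  forall a b, Lsum Lg a -> Lsum Lg b -> br a b = 0%V.
Proof.
move=> gr kL iL hc a b ha; have [fX|nfd] := pselect (fd (fun _ : X => True)); first exact: (fd_comm gr fX iL hc).
by rewrite (shulman_turovskii (Lsum_lie gr) kL (nfd_qn gr kL iL hc nfd) iL ha) br0l.
Qed.
(** * Gaps of maximal chains of invariant subspaces *)
(** Eigenspaces are invariant, so an operator of [L] with an eigenvalue is scalar. Either all
    operators are quasinilpotent and vanish by [shulman_turovskii], or one is a nonzero compact
    scalar; then the dimension is finite and every operator has an eigenvalue. *)
Lemma comm_dim1 (X : CBanach) (L : BL X -> Prop) : lie L -> (forall a, L a -> cpt a) -> irred L ->
  (forall a b, L a -> L b -> br a b = 0%V) -> forall x y : X, x <> 0%V -> exists c : C, y = (c *: x)%V.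
Proof.
move=> lL kL iL cL.
have eig a (c : C) x : L a -> x <> 0%V -> a x = (c *: x)%V -> forall y, a y = (c *: y)%V.
  move=> ha x0 hx; have [||h] := iL (fun y => a y = (c *: y)%V); last by [].
  - split=> [|b hb y hy].
      have := csub_preB (a - c *: Id)%V (csub0 X); congr csub; apply/funext => y.
      by rewrite !blE; apply/propext; split=> [/eqP|->]; [rewrite subr_eq0 => /eqP|rewrite subrr].
    have := congr1 (fun T : BL X => T y) (cL a b ha hb).
    by rewrite brX !blE => /subr0_eq ->; rewrite hy blZ.
  by move=> h; case: x0; exact: h.
have sc a : L a -> exists c : C, forall y, a y = (c *: y)%V.
  move=> ha; have [hq|[b [hb nb]]] : (forall b, L b -> qn b) \/ exists b, L b /\ ~ qn b.
    by have [|h] := EM (exists b, L b /\ ~ qn b); [mono|left=> b hb; apply: contrapT => hn; apply: h; exists b].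
    by exists 0%V => y; rewrite (shulman_turovskii lL kL hq iL ha) scale0r.
  have [c [x [c0 [x0 hx]]]] : exists c x, c <> 0%V /\ x <> 0%V /\ b x = (c *: x)%V.
    apply: contrapT => hn; apply: nb; apply: cpt_qn (kL b hb) _ => z x e z0; apply: contrapT => x0.
    by apply: hn; exists z, x.
  have hb' := eig b c x hb x0 hx; have fX : fd (fun _ : X => True).
    have [||l hl] := @cpt_idem_frk X 1%V; [|exact: mul1r|by exists l => y _; apply: hl; exists y].
    have -> : Id = (c^-1 *: b)%V; last exact: cptZ (kL b hb).
    by apply: BLext => y; rewrite !blE hb' scalerA mulVf ?scale1r; apply/eqP.
  have [y [k [_ [y0 hy]]]] := fd_eig (csubT X).1 fX (T := a) (fun _ _ => I) I x0.
  by exists k; exact: eig hy.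
move=> x y x0; have [||h] := iL (span [:: x]).
split; first exact: span_csub.
  move=> a ha z hz; have [c ->] := sc a ha; exact: lsubZ (span_lsub _) hz.
by move=> h; case: x0; apply: h; apply: span_in; rewrite inE.
by have [c [z [-> ->]]] := h y; exists c; rewrite addr0.
Qed.
Section Gap.
Variables (X : CBanach) (G : FinAbGroup) (Lg : G -> BL X -> Prop).
Hypotheses (gr : graded Lg) (kL : forall a, Lsum Lg a -> cpt a) (hc : gcond Lg).
Lemma gap_irr p : gap (Lsum Lg) p -> irred (imf p (Lsum Lg)) /\ forall a b, Lsum Lg a -> Lsum Lg b -> ind p (br a b) = 0%V.
Proof.
move=> hp; have [sL hL] := hp; have iQ := irred_ind hp; split=> // a b ha hb.
rewrite (proj2 (br_ind (sL a ha) (sL b hb))); have gq := graded_ind p gr.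
set Lq := (fun g => _) in gq; have inq x : Lsum Lg x -> Lsum Lq (ind p x).
  move=> hx; suff [] : stab p x /\ Lsum Lq (ind p x) by [].
  have l := Lsum_lsub gq; move: x hx; apply: Lsum_ind => [|g x hx].
    split; first by rewrite ind0; split; [exact: stab0|exact: lsub0 l].
    split=> [x y [h1 h2] [h3 h4]|c x [h1 h2]].
      by rewrite indD //; split; [exact: stabD|exact: (lsubD l)].
    by rewrite indZ //; split; [exact: stabZ|exact: (lsubZ _ l)].
  have sx := sL x (Lg_sum gr hx); split=> //; apply: (Lg_sum gq (g := g)); by exists x.
have outq q : Lsum Lq q -> imf p (Lsum Lg) q.
  apply: Lsum_ind => [|g _ [x [[hx _] ->]]]; last by exists x; split=> //; exact: Lg_sum hx.
  exact: proj1 (lie_ind (Lsum_lie gr) sL).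
apply: (irr_comm gq) => [q /outq [x [hx ->]]||||]; try mono.
apply: cpt_ind; mono.
apply: irred_mono iQ => _ [x [hx ->]]; mono.
move=> g d gd _ _ [x [[hx sx] ->]] [y [[hy sy] ->]] _ /outq [z [hz ->]].
have [s1 <-] := br_ind sx sy; apply: adq_ind (hc gd hx hy hz); mono.
Qed.
Lemma gap_dim1 p x y : gap (Lsum Lg) p -> hi p x -> ~ lo p x -> hi p y -> exists c : C, lo p (y - c *: x)%V.
Proof.
move=> hp hx nx hy; have [iQ cQ] := gap_irr hp; have [sL _] := hp.
have kQ b : imf p (Lsum Lg) b -> cpt b by move=> [a [ha ->]]; apply: cpt_ind; exact: kL.
have bQ u v : imf p (Lsum Lg) u -> imf p (Lsum Lg) v -> br u v = 0%V.
  by move=> [a [ha ->]] [b [hb ->]]; rewrite -(proj2 (br_ind (sL a ha) (sL b hb))); exact: cQ.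
have n0 : pi p x <> 0%V by move/pi_eq0; auto.
have [c e] := comm_dim1 (lie_ind (Lsum_lie gr) sL) kQ iQ bQ (pi p y) n0.
have hh := proj1 (hiP p); exists c; apply/pi_eq0; first by apply: lsubB => //; exact: lsubZ.
by rewrite piB ?piZ ?e ?subrr //; exact: lsubZ.
Qed.
(** [S] lies between the closed union of the members below it and the intersection of those above
    it. These bound a gap, of dimension at most one by [gap_dim1], so [S] is one of the two. *)
Lemma mchain_max Ch S : mchain (Lsum Lg) Ch -> csub S -> (forall S', Ch S' -> le_s S S' \/ le_s S' S) -> Ch S.
Proof.
move=> hC cS hS; have [c1 [c2 c3]] := hC.
pose F1 S' := Ch S' /\ le_s S' S; pose F2 S' := Ch S' /\ le_s S S'.
have cY : Ch (Fcup F1).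
  apply: (mchain_cup hC) => [S' []//|]; exists (fun x => x = 0%V); split; first exact: mchain0 hC.
  by move=> x ->; exact: lsub0 (proj1 cS).
have cZ : Ch (Fcap F2) by apply: (mchain_cap hC) => S' [].
have YS : le_s (Fcup F1) S by apply: cl_sub cS _ => x [S' [[_ h] /h]].
have SZ : le_s S (Fcap F2) by move=> x hx S' [_ h]; exact: h.
pose p := SPair (c1 _ cZ).1 (c1 _ cY).1 (fun x hx => SZ x (YS x hx)).
have gp : gap (Lsum Lg) p.
  apply: (mchain_gap (p := p) hC cY cZ) => S' h; have [h'|h'] := hS S' h; [right|left] => x hx; first exact: hx.
  by apply: cl_incl; exists S'.
have [h|h] := EM (le_s S (Fcup F1)).
  by have -> : S = Fcup F1 by apply/funext => x; apply/propext; split; auto.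
have [s [sS nY]] : exists s, S s /\ ~ Fcup F1 s.
  by apply: contrapT => hn; apply: h => s hs; apply: contrapT => n; apply: hn; exists s.
have -> : S = Fcap F2; last by [].
apply/funext => x; apply/propext; split=> [|hx]; first exact: SZ.
have [c /YS hl] := gap_dim1 gp (SZ s sS) nY hx.
by rewrite -(subrK (c *: s)%V x); apply: (lsubD (proj1 cS)) => //; exact: lsubZ (proj1 cS) sS.
Qed.
(** Elements of [L] with this property form a subspace that contains all commutators. *)
Definition ann v := forall p, gap (Lsum Lg) p -> ind p v = 0%V.
(** On every gap only [y] survives, and [gap_pow] turns the bound [d] there into the rate [2 * d] on
    [X]. *)
Lemma ann_pow v y d : Lsum Lg v -> Lsum Lg y -> ann v -> 0 < d -> nrm y <= d ->
  exists D, forall m, nrm ((v + y) ^+ m)%V <= D * (2 * d) ^ m.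
Proof.
move=> hv hy av d0 yd; have h : Lsum Lg (v + y)%V by exact: (lsubD (Lsum_lsub gr)).
apply: (gap_pow (M := Lsum Lg)); [exact: kL|exact: alg_in|lra|move=> p gp].
by rewrite indD ?av ?add0r //; [have := nrm_ind p y; lra|exact: gp.1|exact: gp.1].
Qed.
End Gap.

(** * Translation to the notions of the theorem *)

Section Bridge.
Variables (X : CBanach) (G : FinAbGroup) (L : op X -> Prop) (Lg : G -> op X -> Prop).
Hypotheses (aL : opLieAlg L) (kL : forall a, L a -> compact_op a) (gL : @subgraded X G L Lg).
Hypothesis eL : forall g d : G, (gadd G g d = g0 G \/ Gsharp G g d) ->
  forall a b, Lg g a -> Lg d b -> Engel L (bracket a b).
Let LB (T : BL X) := L T.
Let LgB g (T : BL X) := Lg g T.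
Lemma bl_lift a : L a -> exists T : BL X, a = T.
Proof. by have [_ [h _]] := aL => /h ha; exists (BLmk ha). Qed.
Lemma br_bf (S T : BL X) : bracket S T = br S T.
Proof. by rewrite brX. Qed.
Lemma ad_bf (S T : BL X) n : Nat.iter n (ad S) T = (adm S ^+ n)%V T.
Proof. by elim: n => [|n IH]; rewrite ?expr0 //= IH exprS blME -brE -br_bf. Qed.
Lemma op_lsub (V : op X -> Prop) : op_subspace V -> lsub (fun T : BL X => V T).
Proof. by move=> [h0 [hD hZ]]; split=> //; split=> [S T|c T] *; [exact: hD|exact: hZ]. Qed.
Lemma bridge_lie : lie LB.
Proof. by have [h [_ hb]] := aL; split; [exact: op_lsub|move=> a b ha hb'; exact: hb]. Qed.
Lemma bridge_gr : graded LgB.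
Proof. by have [h [_ hb]] := gL; split=> [g|g d a b]; [exact: op_lsub (h g).1|exact: hb]. Qed.
Lemma bridge_Lsum T : Lsum LgB T <-> LB T.
Proof.
have [h [hs _]] := gL; split=> [|/hs [f [hf e]]].
  by move: T; apply: (Lsum_ind (proj1 bridge_lie)) => g a; exact: (h g).2.
have [F hF] := choice (fun g => bl_lift ((h g).2 _ (hf g))).
exists F; split=> [g|]; first by rewrite /LgB -hF.
apply: BLext => x; rewrite e /osum; elim: (genum G) => [|g s IH] /=; first by rewrite big_nil.
by rewrite big_cons blDE -IH /oadd hF.
Qed.
Lemma bridge_cpt T : LB T -> cpt T.
Proof.
move=> /kL [_ [_ hT]]; apply: tb_of_sep => u e hu e0.
have [x hx] := choice hu; have [phi [hphi [y hy]]] := hT x (fun n => (hx n).1).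
have [N hN] := cvg_cauchy (proj2 (cvgE _ _) hy) e0.
exists (phi N), (phi N.+1); split; first by apply/ltP; exact: hphi.
by rewrite !(hx _).2; exact: hN.
Qed.
Lemma bridge_cond : gcond LgB.
Proof.
move=> g d gd a b ha hb x /bridge_Lsum hx e e0.
have [_ he] := eL gd ha hb; have [N hN] := he e e0.
have [D [D0 hD]] := fin_bound (fun m => nrm ((adm (br a b) ^+ m)%V x)) N e0.
exists (D + nrm x) => m; have em := pow_lt e m e0; have x0 := nrm_ge0 (x : BB X).
have := Rmult_le_pos D (e ^ m); have := Rmult_le_pos (nrm x) (e ^ m).
have [hm|/hD] := leqP N m; last by lra.
have : nrm ((adm (br a b) ^+ m)%V x) <= e ^ m * nrm x; last by lra.
by have := hN m (elimT leP hm) x hx; rewrite br_bf ad_bf.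
Qed.
Let kB a : Lsum LgB a -> cpt a := fun h => bridge_cpt (proj1 (bridge_Lsum a) h).
Lemma csubE (S : X -> Prop) : csub S <-> @closed_vsubspace X S.
Proof.
split=> [[[h0 [hD hZ]] hc]|[h0 [hD [hZ hc]]]]; last by split=> // u l hu /cvgE; exact: hc.
by do 3 (split=> //); move=> u l hu /cvgE; exact: hc.
Qed.
Lemma bridge_triang : triangularizable L.
Proof.
have [Ch hC] := mchain_ex (Lsum LgB); have [c1 [c2 c3]] := hC; exists Ch; split; first split.
- by split=> [S /c1 [/csubE]|].
- move=> Ch' [h1 h2] h3 S hS; apply: (mchain_max bridge_gr kB bridge_cond hC); first exact/csubE/h1.
  by move=> S' /h3; exact: h2.
move=> S hS a La x Sx; have [T e] := bl_lift La; rewrite e; apply: (c1 S hS).2 Sx.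
by apply/bridge_Lsum; rewrite /LB -e.
Qed.
Variable I : op X -> Prop.
Hypothesis cI : closed_ideal L I.
Let IB (T : BL X) := I T.
Let lI : lsub IB. Proof. by have [[h _] _] := cI; exact: op_lsub. Qed.
Let IL T : IB T -> LB T. Proof. by have [[_ [h _]] _] := cI; exact: h. Qed.
Lemma qnorm_glb (T : BL X) : is_glb (fun r => exists y : BL X, IB y /\ r = nrm (T + y)%V) (@qnorm X I T).
Proof.
have e r : (exists y, I y /\ r = opnorm (oadd T y)) <-> exists y : BL X, IB y /\ r = nrm (T + y)%V.
  split=> [[y [hy ->]]|[y [hy ->]]]; last by exists y.
  by have [[_ [h _]] _] := cI; have [y' ey] := bl_lift (h y hy); rewrite ey in hy *; exists y'.
suff : is_glb (fun r => exists y, I y /\ r = opnorm (oadd T y)) (@qnorm X I T).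
  by move=> [h1 h2]; split=> [r /e /h1|b hb] //; apply: h2 => r /e /hb.
apply: ClassicalEpsilon.epsilon_spec; apply: glb_ex.
  by exists (opnorm (oadd T (0 : BL X)%V)), (0 : BL X)%V; split=> //; exact: lsub0 lI.
by move=> r /e [y [_ ->]]; exact: nrm_ge0.
Qed.
Let adI a z : LB a -> IB z -> IB (br a z).
Proof. by have [[_ [_ h]] _] := cI; move=> ha hz; rewrite /IB -br_bf; exact: h. Qed.
Let Lb := proj1 bridge_lie.
Lemma ad_mod b i x z n : LB b -> IB i -> LB x -> IB z ->
  IB ((adm b ^+ n)%V (x + z)%V - (adm (b + i) ^+ n)%V x)%V.
Proof.
move=> hb hi hx hz; elim: n => [|n IH]; first by rewrite !expr0 !bl1E addrC addKr.
rewrite !exprS !blME -!brE; set P := bf _ (x + z)%V in IH *; set Q := bf _ x in IH *.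
have -> : (br b P - br (b + i) Q = br b (P - Q) + br Q i)%V.
  by rewrite brDl brBr (brC Q) opprD addrA.
apply: (lsubD lI); first exact: adI.
apply: adI => //; apply: adm_lsub bridge_lie _ hx; apply: (lsubD Lb) => //; exact: IL.
Qed.
Lemma engel_mod (a : BL X) : LB a -> (forall d, 0 < d -> exists v y i : BL X, LB v /\ LB y /\ IB i /\
  ann LgB v /\ nrm y <= d /\ a = (v + y + i)%V) -> Engel_wrt L (@qnorm X I) a.
Proof.
move=> ha h e e0; have [v [y [i [hv [hy [hi [av [yd ->]]]]]]]] := h (e / 8) ltac:(lra).
have d0 : 0 < e / 8 by lra.
have [D hD] := ann_pow bridge_gr kB (proj2 (bridge_Lsum v) hv) (proj2 (bridge_Lsum y) hy) av d0 yd.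
have D0 : 0 <= D by have := hD 0%N; have := nrm_ge0 ((v + y) ^+ 0 : BB X)%V; rewrite /=; lra.
have [N hN] := @pow_dom (D * D) (2 * (e / 8) + 2 * (e / 8)) e ltac:(lra) ltac:(lra).
exists N => n /leP /hN {}hN _ /[dup] /bl_lift [x ->] hx.
have en := pow_lt e n e0; rewrite ad_bf; have [g1 _] := qnorm_glb ((adm (v + y + i) ^+ n)%V x).
have [_ g2] := qnorm_glb x; have hb : LB (v + y)%V by exact: (lsubD Lb).
suff : qnorm I ((adm (v + y + i) ^+ n)%V x) / e ^ n <= qnorm I x.
  move=> h1; apply: (Rmult_le_reg_r (/ e ^ n)); first pos.
  by rewrite (Rmult_comm (e ^ n)) Rmult_assoc Rinv_r; lra.
apply: g2 => r [z [hz ->]]; apply: (Rmult_le_reg_r (e ^ n)) => //.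
rewrite /Rdiv Rmult_assoc Rinv_l; last lra.
rewrite Rmult_1_r; via (g1 _ _).
  by exists ((adm (v + y) ^+ n)%V (x + z)%V - (adm (v + y + i) ^+ n)%V x)%V; split; [exact: ad_mod|].
rewrite addrC subrK; mid (D * D * nrm (x + z : BL X)%V * (2 * (e / 8) + 2 * (e / 8)) ^ n).
  apply: (ad_corner (E := 1%V)); rewrite ?mulr1 ?mul1r //; lra.
have := nrm_ge0 (x + z : BB X)%V; nra.
Qed.
Let annM a b : LB a -> LB b -> ann LgB (br a b).
Proof.
move=> ha hb p gp; have [_ h] := gap_irr bridge_gr kB bridge_cond gp.
by apply: h; exact/bridge_Lsum.
Qed.
(** It contains all commutators, so its closure in [L] is automatically an ideal. *)
Let NB (T : BL X) := exists v i : BL X, LB v /\ ann LgB v /\ IB i /\ T = (v + i)%V.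
Let NBl v : LB v -> ann LgB v -> NB v.
Proof. by move=> hv av; exists v, 0%V; rewrite addr0; do 3 (split=> //); exact: lsub0 lI. Qed.
Let NBr i : IB i -> NB i.
Proof.
move=> hi; exists 0%V, i; rewrite add0r; split; first exact: lsub0 Lb.
by split=> // p _; exact: ind0.
Qed.
Lemma NB_lsub : lsub NB.
Proof.
have sv p v : gap (Lsum LgB) p -> LB v -> stab p v by move=> [sL _] /bridge_Lsum; exact: sL.
split; first by apply: NBr; exact: lsub0 lI.
split=> [_ _ [v [i [hv [av [hi ->]]]]] [w [j [hw [aw [hj ->]]]]]|c _ [v [i [hv [av [hi ->]]]]]].
  exists (v + w)%V, (i + j)%V; split; first exact: (lsubD Lb).
  split; last by split; [exact: (lsubD lI)|exact: addrACA].
  by move=> p gp; rewrite indD ?av ?aw ?addr0 //; exact: sv.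
exists (c *: v)%V, (c *: i)%V; split; first exact: (lsubZ _ Lb).
split; last by split; [exact: (lsubZ _ lI)|exact: scalerDr].
by move=> p gp; rewrite indZ ?av ?scaler0 //; exact: sv.
Qed.
Lemma bridge_solv : (exists a, L a /\ ~ I a) -> exists J, closed_ideal L J /\ subset I J /\
  (exists a, J a /\ ~ I a) /\ forall a, J a -> Engel_wrt L (@qnorm X I) a.
Proof.
(* If the quotient is commutative, all of [L] serves as [J]. Otherwise some commutator lies outside
   [I], and it shows that the closure of [NB] is strictly larger than [I]. *)
move=> hL; have [h|hn] := EM (forall a b, LB a -> LB b -> IB (br a b)).
  exists L; have [hs [_ hb]] := aL; split; first by split=> [|u T _ //]; do 2 (split=> //).
  split; first by have [[_ [h' _]] _] := cI.
  (* From the first power on the values lie in [I], so their quotient norm is at most [0]. *)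
  split=> // _ /[dup] /bl_lift [a ->] ha e e0; exists 1%N => -[/leP //|n] _ _ /[dup] /bl_lift [x ->] hx.
  rewrite ad_bf exprS blME -brE; set T := br _ _; have [g1 _] := qnorm_glb T; have [_ g2] := qnorm_glb x.
  apply: (Rle_trans _ 0).
    apply: g1; exists (- T)%V; rewrite addrN nrm0; split=> //; apply: (lsubN lI).
    by apply: h => //; exact: adm_lsub bridge_lie ha hx.
  apply: Rmult_le_pos; first pos.
  by apply: g2 => r [y [_ ->]]; pos.
have cJ := cl_csub NB_lsub; have lJ := proj1 cJ.
exists (fun a : op X => exists T : BL X, a = T /\ LB T /\ cl NB T); split.
  split; first split.
  - split; first by exists (0 : BL X)%V; split=> //; split; [exact: lsub0 Lb|exact: lsub0 lJ].
    split=> [_ _ [S [-> [hS cS]]] [T [-> [hT cT]]]|c _ [S [-> [hS cS]]]].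
      by exists (S + T)%V; split=> //; split; [exact: (lsubD Lb)|exact: (lsubD lJ)].
    by exists (c *: S)%V; split=> //; split; [exact: (lsubZ _ Lb)|exact: (lsubZ _ lJ)].
  - split=> [_ [T [-> [hT _]]]//|_ _ /[dup] /bl_lift [a ->] ha [T [-> [hT _]]]].
    have hb : LB (br a T) by rewrite brX; exact: (proj2 bridge_lie).
    exists (br a T); split; first exact: br_bf.
    by split=> //; apply: cl_incl; apply: NBl => //; exact: annM.
  move=> u _ hu /[dup] /bl_lift [T ->] hT hc; exists T; do 2 (split=> //).
  have [U hU] := choice hu; apply: (csub_cvg cJ (u := U)) => [n|]; first exact: (hU n).2.2.
  move=> e e0; have [N hN] := hc e e0; exists N => n /leP /hN; by rewrite (hU n).1.
split.
  move=> a Ia; have [T e] := bl_lift (proj1 (proj2 (proj1 cI)) _ Ia); rewrite e in Ia *; exists T; split=> //.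
  split; first exact: IL.
  by apply: cl_incl; exact: NBr.
split.
  apply: contrapT => hno; apply: hn => a b ha hb; apply: contrapT => hi; apply: hno.
  have hab : LB (br a b) by rewrite brX; exact: (proj2 bridge_lie).
  exists (br a b); split=> //; exists (br a b); do 2 (split=> //); apply: cl_incl.
  by apply: NBl => //; exact: annM.
move=> _ [a [-> [ha ca]]]; apply: engel_mod => // d /ca [_ [[v [i [hv [av [hi ->]]]]] yd]].
exists v, (a - (v + i))%V, i; split=> //; split.
  by apply: (lsubB Lb) => //; apply: (lsubD Lb) => //; exact: IL.
do 2 (split=> //); split; first by left.
by rewrite addrAC [RHS]addrC subrK.
Qed.
End Bridge.
Theorem mainTheorem9 (X : CBanach) (G : FinAbGroup)
    (L : op X -> Prop) (Lg : G -> op X -> Prop) :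
  opLieAlg L ->
  (forall a, L a -> compact_op a) ->
  @subgraded X G L Lg ->
  (forall g d : G, (gadd G g d = g0 G \/ @Gsharp G g d) ->
     forall a b, Lg g a -> Lg d b -> Engel L (bracket a b)) ->
  E_solvable L /\ triangularizable L.
Proof.
move=> aL kL gL eL; split; last exact: bridge_triang aL kL gL eL.
by move=> I cI; exact: bridge_solv aL kL gL eL I cI.
Qed.
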